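(* Let $n\ge2$, let $1\le p,q\le\infty$, let $\alpha\in\mathbb{C}$ and $\alpha_0=\mathrm{Re}\,\alpha$. The operator $R_+^\alpha$, initially defined on functions $f\in S(\mathbb{R}^n)$ by analytic continuation, extends as a linear bounded operator $\mathcal{R}_+^\alpha$ from $L^p(\mathbb{R}^n)$ to $L^q(Z_n)$ if $$\frac{1-n}{2}\le\alpha_0\le1,\qquad p=\frac{n+1}{n+\alpha_0},\qquad q=\frac{n+1}{1-\alpha_0}.$$
   Context: $Z_n=S^{n-1}\times\mathbb{R}$ is equipped with the product measure $d\theta\,dt$, where $d\theta$ is the surface area measure on the unit sphere $S^{n-1}\subset\mathbb{R}^n$. $S(\mathbb{R}^n)$ is the Schwartz space. For real $X$ and complex $\lambda$, $(X)_+^\lambda=|X|^\lambda$ if $X>0$ and $0$ otherwise. The Radon transform is $(Rf)(\theta,t)=\int_{\theta^\perp}f(t\theta+y)\,d_\theta y$, where $\theta^\perp=\{x: x\cdot\theta=0\}$ and $d_\theta y$ is the Euclidean measure on $\theta^\perp$. For $\mathrm{Re}\,\alpha>0$, $$(R_+^\alpha f)(\theta,t)=\frac1{\Gamma(\alpha)}\int_{\mathbb{R}^n}(t-x\cdot\theta)_+^{\alpha-1}f(x)\,dx=\frac1{\Gamma(\alpha)}\int_0^\infty\tau^{\alpha-1}(Rf)(\theta,t-\tau)\,d\tau .$$ For $f\in S(\mathbb{R}^n)$ and fixed $(\theta,t)\in Z_n$, $\alpha\mapsto(R_+^\alpha f)(\theta,t)$ extends to an entire function of $\alpha\in\mathbb{C}$;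 this extension defines $R_+^\alpha f$ for all $\alpha\in\mathbb{C}$ and $f\in S(\mathbb{R}^n)$. *)

(* Defs.v *)
From HB Require Import structures.
From mathcomp Require Import all_boot all_order all_algebra.
From mathcomp Require Import all_classical all_reals all_analysis measurable_realfun.
From mathcomp Require Import complex.

Set Implicit Arguments.
Unset Strict Implicit.
Unset Printing Implicit Defensive.
Import Order.TTheory GRing.Theory Num.Theory.
Import numFieldNormedType.Exports.

Local Open Scope classical_set_scope.
Local Open Scope ring_scope.

Definition Rn (R : realType) (n : nat) : Type := 'rV[R]_n.

HB.instance Definition _ (R : realType) (n : nat) :=
  NormedModule.copy (Rn R n) 'rV[R]_n.

Section Rn_measurable.
Context {R : realType} (n : nat).

Definition coord (i : 'I_n) (x : Rn R n) : measurableTypeR R := x ord0 i.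

Let Rn_set0 : g_sigma_preimage coord set0.
Proof. exact: sigma_algebra0. Qed.

Let Rn_setC A : g_sigma_preimage coord A -> g_sigma_preimage coord (~` A).
Proof. exact: sigma_algebraC. Qed.

Let Rn_bigcup (F : (set (Rn R n))^nat) :
  (forall i, g_sigma_preimage coord (F i)) ->
  g_sigma_preimage coord (\bigcup_i (F i)).
Proof. exact: sigma_algebra_bigcup. Qed.

(* The sigma-algebra generated by the coordinates, i.e. the Borel one; this is
   the analogue for row vectors of the library's instance on n.-tuple. *)
HB.instance Definition _ := @isMeasurable.Build default_measure_display
  (Rn R n) (g_sigma_preimage coord) Rn_set0 Rn_setC Rn_bigcup.

End Rn_measurable.

Lemma measurable_coord (R : realType) n (i : 'I_n) :
  measurable_fun [set: Rn R n] (coord i).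
Proof.
move=> _ Y mY; rewrite setTI; apply: sub_sigma_algebra => /=.
rewrite -bigcup_seq/=; exists i => /=; first by rewrite mem_index_enum.
by exists Y => //; rewrite setTI.
Qed.

Lemma measurable_fun_coord d (T : measurableType d) (R : realType) n
    (f : T -> Rn R n) :
  (forall i, measurable_fun [set: T] (coord i \o f)) ->
  measurable_fun [set: T] f.
Proof.
move=> mf mT Y mY; rewrite setTI.
suff : (@measurable _ (Rn R n)) `<=` [set Y | measurable (f @^-1` Y)].
  by move=> /(_ _ mY).
apply: smallest_sub; last first.
  move=> A; rewrite -bigcup_seq/= => -[i _ [B mB <-]] /=.
  by rewrite setTI -comp_preimage -[X in measurable X]setTI; exact: mf.
split => /=.
- by rewrite preimage_set0.
- by move=> A mA; rewrite setTD -preimage_setC; exact: measurableC.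
- by move=> F mF; rewrite preimage_bigcup; exact: bigcup_measurable.
Qed.

Section lebesgue_Rn.
Context {R : realType}.
Local Open Scope ereal_scope.

Definition Rn_cons n (xt : Rn R n * measurableTypeR R) : Rn R n.+1 :=
  \row_i (if unlift ord0 i is Some j then xt.1 ord0 j else xt.2).

Lemma measurable_Rn_cons n : measurable_fun setT (@Rn_cons n).
Proof.
apply: measurable_fun_coord => i.
case: (unliftP ord0 i) => [j|] iE.
- rewrite (_ : _ \o _ = coord j \o fst).
    by apply: measurableT_comp => //; exact: measurable_coord.
  by apply/funext => -[x t]; rewrite /coord /= mxE iE liftK.
- rewrite (_ : _ \o _ = snd) //.
  by apply/funext => -[x t]; rewrite /coord /= mxE iE unlift_none.
Qed.

Section step.
Context n (m : {measure set (Rn R n) -> \bar R}).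

Definition lebesgue_Rn_step : set (Rn R n.+1) -> \bar R :=
  pushforward (m \x @lebesgue_measure R) (@Rn_cons n).

Let step0 : lebesgue_Rn_step set0 = 0.
Proof. by rewrite /lebesgue_Rn_step /pushforward preimage_set0 measure0. Qed.

Let step_ge0 A : 0 <= lebesgue_Rn_step A.
Proof. by apply: integral_ge0 => x _; exact: measure_ge0. Qed.

Let step_sigma_additive : semi_sigma_additive lebesgue_Rn_step.
Proof.
move=> F mF tF mUF; rewrite /lebesgue_Rn_step /pushforward preimage_bigcup.
apply: measure_semi_sigma_additive.
- by move=> k; rewrite -[X in measurable X]setTI; exact: measurable_Rn_cons.
- apply/trivIsetP => /= i j _ _ ij; rewrite -preimage_setI.
  by move/trivIsetP : tF => /(_ _ _ _ _ ij) ->//; rewrite preimage_set0.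
- by rewrite -preimage_bigcup -[X in measurable X]setTI;
     exact: measurable_Rn_cons.
Qed.

HB.instance Definition _ := isMeasure.Build _ _ _
  lebesgue_Rn_step step0 step_ge0 step_sigma_additive.

End step.

Fixpoint lebesgue_Rn n : {measure set (Rn R n) -> \bar R} :=
  if n is n'.+1 then lebesgue_Rn_step (lebesgue_Rn n')
  else dirac (0%R : Rn R 0).

End lebesgue_Rn.

Section sphere.
Context {R : realType}.

Definition dot n (x y : Rn R n) : R := \sum_i x ord0 i * y ord0 i.
(* The norm of the normed module Rn is the sup norm. *)
Definition enorm n (x : Rn R n) : R := Num.sqrt (dot x x).

(* For n > 0 the radius (n != 0)%:R is 1. For n = 0, where the unit sphere is
   empty, it is 0, because the library's measurable types are inhabited. *)
Definition sphere n : Type := {x : Rn R n | enorm x == (n != 0%N)%:R}.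

HB.instance Definition _ n := Choice.on (sphere n).

Definition sphere_point n : Rn R n := \row_i (i == 0%N :> nat)%:R.

Lemma sphere_pointP n : enorm (sphere_point n) == (n != 0%N)%:R.
Proof.
case: n => [|n]; first by rewrite /enorm /dot big_ord0 sqrtr0.
rewrite /enorm /dot big_ord_recl !mxE /= mulr1 big1 ?addr0 ?sqrtr1 //.
by move=> i _; rewrite !mxE /= mulr0.
Qed.

HB.instance Definition _ n := isPointed.Build (sphere n)
  (exist _ (sphere_point n) (sphere_pointP n)).

Section sphere_measurable.
Variable n : nat.
Local Notation S := (preimage_set_system setT (@sval _ _ : sphere n -> Rn R n)
  measurable).

Let sphere_sigma_algebra : sigma_algebra setT S.
Proof.
by apply: sigma_algebra_preimage; exact: sigma_algebra_measurable.
Qed.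

Let sphere0 : S set0. Proof. by case: sphere_sigma_algebra. Qed.

Let sphereC A : S A -> S (~` A).
Proof. by move=> mA; rewrite -setTD; case: sphere_sigma_algebra => _ + _; exact. Qed.

Let sphere_bigcup (F : (set (sphere n))^nat) :
  (forall i, S (F i)) -> S (\bigcup_i (F i)).
Proof. by case: sphere_sigma_algebra => _ _; exact. Qed.

HB.instance Definition _ := @isMeasurable.Build default_measure_display
  (sphere n) S sphere0 sphereC sphere_bigcup.

End sphere_measurable.

Definition cone n (A : set (sphere n)) : set (Rn R n) :=
  [set x | exists r : R, exists2 theta, A theta &
     0 < r <= 1 /\ x = r *: sval theta].

Lemma enormZ n r (x : Rn R n) : 0 <= r -> enorm (r *: x) = r * enorm x.
Proof.
move=> r0; rewrite /enorm /dot.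
under eq_bigr do rewrite !mxE mulrACA -expr2.
by rewrite -mulr_sumr sqrtrM ?sqr_ge0// sqrtr_sqr ger0_norm.
Qed.

Lemma cone_inj n (theta eta : sphere n) (r s : R) : 0 < r -> 0 < s ->
  r *: sval theta = s *: sval eta -> theta = eta.
Proof.
case: n theta eta => [|n] [x /= px] [y /= py] r0 s0 /= rs; apply/val_inj => /=.
  by apply/rowP => -[].
have := congr1 (@enorm _) rs.
rewrite !enormZ ?ltW// (eqP px) (eqP py) !mulr1 => rsE.
by move: rs; rewrite rsE => /scalerI; apply; rewrite gt_eqF.
Qed.

Lemma measurable_enorm n : measurable_fun setT (@enorm n).
Proof.
apply: (@measurableT_comp _ _ _ _ _ _ (@Num.sqrt R)).
  by apply: continuous_measurable_fun; exact: sqrt_continuous.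
apply: measurable_sum => i.
by apply: measurable_funM; exact: measurable_coord.
Qed.

Definition ndir n (x : Rn R n) : Rn R n := (enorm x)^-1 *: x.

Lemma measurable_ndir n : measurable_fun setT (@ndir n).
Proof.
apply: measurable_fun_coord => i.
rewrite (_ : _ \o _ = (fun x => enorm x `^ (-1)) \* coord i); last first.
  by apply/funext => x; rewrite /coord /= mxE powR_inv1 // sqrtr_ge0.
apply: measurable_funM; last exact: measurable_coord.
by apply: (measurableT_comp (@measurable_powR R (-1))); exact: measurable_enorm.
Qed.

Lemma coneE n (B : set (Rn R n.+1)) :
  cone (@sval _ _ @^-1` B) =
  (@enorm n.+1 @^-1` `]0, 1]) `&` (@ndir n.+1 @^-1` B).
Proof.
apply/seteqP; split => x /=.
- move=> [r [[y /= py] /= By [/andP[r0 r1] ->]]].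
  have rE : enorm (r *: y) = r by rewrite enormZ ?(ltW r0)// (eqP py) mulr1.
  rewrite in_itv /= /ndir rE r0 r1; split => //.
  by rewrite scalerA mulVf ?gt_eqF// scale1r.
- rewrite in_itv /= => -[/andP[x0 x1] Bx].
  have py : enorm (ndir x) == (n.+1 != 0%N)%:R.
    by rewrite /ndir enormZ ?invr_ge0 ?(ltW x0)// mulVf // gt_eqF.
  exists (enorm x), (exist _ (ndir x) py) => //=; split; first by rewrite x0 x1.
  by rewrite /ndir scalerA divff ?gt_eqF// scale1r.
Qed.

Lemma Rn0_measurable (A : set (Rn R 0)) : measurable A.
Proof.
have [->|/set0P[x Ax]] := eqVneq A set0; first exact: measurable0.
rewrite (_ : A = setT); first exact: measurableT.
by apply/seteqP; split => // y _; rewrite (_ : y = x) //; apply/rowP => -[].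
Qed.

Lemma measurable_cone n (A : set (sphere n)) :
  measurable A -> measurable (cone A).
Proof.
case: n A => [|n] A; first by move=> _; exact: Rn0_measurable.
move=> [B mB <-]; rewrite setTI coneE; apply: measurableI.
- by rewrite -[X in measurable X]setTI; apply: measurable_enorm.
- by rewrite -[X in measurable X]setTI; apply: measurable_ndir.
Qed.

Section surface.
Variable n : nat.
Local Open Scope ereal_scope.

(* Surface area: n times the volume of the cone over A in the unit ball, as
   obtained from integration in polar coordinates. *)
Definition sphere_measure (A : set (sphere n)) : \bar R :=
  mscale (NngNum (ler0n R n)) (lebesgue_Rn n) (cone A).

Let sphere_measure0 : sphere_measure set0 = 0.
Proof.
rewrite /sphere_measure (_ : cone set0 = set0) ?measure0//.
by apply/seteqP; split => // x [r [? []]].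
Qed.

Let sphere_measure_ge0 A : 0 <= sphere_measure A.
Proof. exact: measure_ge0. Qed.

Let sphere_measure_sigma_additive : semi_sigma_additive sphere_measure.
Proof.
move=> F mF tF mUF; rewrite /sphere_measure.
have -> : cone (\bigcup_k F k) = \bigcup_k cone (F k).
  apply/seteqP; split => x.
    by move=> [r [theta [k _ Fk] rx]]; exists k => //; exists r, theta.
  by move=> [k _ [r [theta Fk rx]]]; exists r, theta => //; exists k.
apply: measure_semi_sigma_additive.
- by move=> k; exact: measurable_cone.
- apply/trivIsetP => /= i j _ _ ij; apply/seteqP; split => // x.
  move=> [[r [theta Fi [/andP[r0 _] xr]]] [s [eta Fj [/andP[s0 _] xs]]]].
  have te : theta = eta.
    move: xs; rewrite xr => /(@cone_inj _ _ _ _ _ r0 s0); exact.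
  move/trivIsetP : tF => /(_ _ _ I I ij) /seteqP[+ _] => /(_ theta); apply.
  by split => //; rewrite te.
- by apply: bigcupT_measurable => k; exact: measurable_cone.
Qed.

HB.instance Definition _ := isMeasure.Build _ _ _ sphere_measure
  sphere_measure0 sphere_measure_ge0 sphere_measure_sigma_additive.

End surface.
End sphere.

Local Open Scope complex_scope.
Notation cabs := ComplexField.Normc.normc.

Section schwartz.
Context {R : realType} (n : nat).

Definition partial (i : 'I_n) (g : Rn R n -> R) : Rn R n -> R :=
  fun x => 'D_(delta_mx ord0 i) g x.

Definition partials (s : seq 'I_n) (g : Rn R n -> R) : Rn R n -> R :=
  foldr partial g s.

Definition smooth (g : Rn R n -> R) : Prop := forall s : seq 'I_n,
  continuous (partials s g) /\
  forall i x, derivable (partials s g) x (delta_mx ord0 i).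

Definition rapidly_decreasing (g : Rn R n -> R) : Prop :=
  forall (s : seq 'I_n) (k : nat), exists C : R, forall x : Rn R n,
    (1 + enorm x) ^+ k * `|partials s g x| <= C.

(* R[i] is not a normed module over R, so differentiation in the real variables
   is done on the real and imaginary parts. *)
Definition schwartz (f : Rn R n -> R[i]) : Prop :=
  [/\ smooth (fun x => complex.Re (f x)), smooth (fun x => complex.Im (f x)),
      rapidly_decreasing (fun x => complex.Re (f x))
    & rapidly_decreasing (fun x => complex.Im (f x))].

End schwartz.

Section complex_integral.
Context d (T : measurableType d) (R : realType).
Variable mu : {measure set T -> \bar R}.

Definition cintegral (D : set T) (f : T -> R[i]) : R[i] :=
  (\int[mu]_(x in D) complex.Re (f x)) +i* (\int[mu]_(x in D) complex.Im (f x)).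

End complex_integral.

Section Lp.
Context d (T : measurableType d) (R : realType).
Variable mu : {measure set T -> \bar R}.

Definition cmeasurable (f : T -> R[i]) : Prop :=
  measurable_fun setT (fun x => complex.Re (f x)) /\
  measurable_fun setT (fun x => complex.Im (f x)).

Definition Lpnorm (p : \bar R) (f : T -> R[i]) : \bar R :=
  Lnorm mu p (fun x => (cabs (f x))%:E).

Definition in_Lp (p : \bar R) (f : T -> R[i]) : Prop :=
  cmeasurable f /\ (Lpnorm p f < +oo)%E.

End Lp.

(* L^p is handled through representatives: a map between the L-spaces of
   almost-everywhere classes is a map on functions that respects
   almost-everywhere equality. *)
Definition bounded_linear_Lp d1 d2 (T1 : measurableType d1)
    (T2 : measurableType d2) (R : realType)
    (mu : {measure set T1 -> \bar R}) (nu : {measure set T2 -> \bar R})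
    (p q : \bar R) (A : (T1 -> R[i]) -> (T2 -> R[i])) : Prop :=
  [/\ forall f, in_Lp mu p f -> in_Lp nu q (A f),
      forall f g, in_Lp mu p f -> in_Lp mu p g ->
        {ae mu, forall x, f x = g x} -> {ae nu, forall z, A f z = A g z},
      forall (a : R[i]) f g, in_Lp mu p f -> in_Lp mu p g ->
        {ae nu, forall z, A (fun x => a * f x + g x) z = a * A f z + A g z}
    & exists C : R, 0 <= C /\ forall f, in_Lp mu p f ->
        (Lpnorm nu q (A f) <= C%:E * Lpnorm mu p f)%E].

Notation Zn R n := (@sphere R n * measurableTypeR R)%type.

Section radon_fractional.
Context {R : realType}.

(* (X)_+^lambda, where |X|^lambda = exp (lambda ln |X|) *)
Definition pospow (X : R) (lambda : R[i]) : R[i] :=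
  if 0 < X then
    (`|X| `^ complex.Re lambda)%:C *
    (cos (complex.Im lambda * ln `|X|) +i* sin (complex.Im lambda * ln `|X|))
  else 0.

(* Euler's integral, used only for 0 < Re alpha. *)
Definition Gamma (alpha : R[i]) : R[i] :=
  cintegral lebesgue_measure `]0, +oo[
    (fun s : measurableTypeR R => pospow s (alpha - 1) * (expR (- s))%:C).

Definition entire (F : R[i] -> R[i]) : Prop :=
  forall z : R[i], derivable (F : R[i]^o -> R[i]^o) z 1.

Variable n : nat.

Definition radon_plus_int (f : Rn R n -> R[i]) (theta : sphere n) (t : R)
    (alpha : R[i]) : R[i] :=
  (Gamma alpha)^-1 *
  cintegral (lebesgue_Rn n) setT
    (fun x => pospow (t - dot x (sval theta)) (alpha - 1) * f x).

Definition entire_extension (f : Rn R n -> R[i]) (theta : sphere n) (t : R) :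
    set (R[i] -> R[i]) :=
  [set F | entire F /\
    forall alpha, 0 < complex.Re alpha -> F alpha = radon_plus_int f theta t alpha].

(* For f Schwartz the entire extension exists and is unique; the default value
   is irrelevant. *)
Definition radon_plus (alpha : R[i]) (f : Rn R n -> R[i])
    (theta : sphere n) (t : R) : R[i] :=
  xget (fun=> 0) (entire_extension f theta t) alpha.

Definition Zn_measure : {measure set (Zn R n) -> \bar R} :=
  (@sphere_measure R n \x @lebesgue_measure R)%E.

End radon_fractional.

(* Main.v *)
(** Write [a = Re alpha]. For [a < 1] the operator is, for each direction, a
    Fourier multiplier in the variable [t]: it multiplies the Fourier transform
    of [f] at [s theta] by a symbol [m s] of modulus at most [B |s|^(-a)].
    The bound is proved by the real method. In the layer cake formula for the
    q-th power of the norm, at height [1/y], the function is split, separately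
    for every frequency [s], according to whether [|s|^(1-a) y] exceeds a multiple
    of [|f x|^(p-1)]. The frequencies below this threshold contribute pointwise
    at most [1/(2y)], because [|s|^(-a)] is integrable at [0]; those above it are
    estimated in [L^2] by Plancherel and polar coordinates, where the weight
    [|xi|^(-(2a+n-1))] appears. Since [(1-a)(q-2) = 2a+n-1], the substitution
    [v = |xi|^(1-a) y] removes the weight, and what remains is the integral of
    [|f|^p]. Density then gives an operator on all of [L^p].

    To identify it with the analytic continuation, note that the Laplace integral
    of [s_+^(alpha-1)] at [e + i sigma] is [Gamma alpha (e + i sigma)^(-alpha)].
    Fourier inversion turns this into the multiplier formula, damped by [e], for
    [Re alpha > 2]; both sides are analytic, so it holds for [Re alpha > 0], and
    [e -> 0] gives the formula for [0 < Re alpha < 1]. Its right-hand side is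
    analytic on [Re alpha < 1] and hence is the continuation there.
    For [a = 1] the kernel is bounded and the estimate is immediate. *)

From HB Require Import structures.
Require Import Defs.
From mathcomp Require Import all_boot all_order all_algebra.
From mathcomp Require Import all_classical all_reals all_analysis.
From mathcomp Require Import measurable_realfun.
From mathcomp Require Import complex ring lra.

Set Implicit Arguments.
Unset Strict Implicit.
Unset Printing Implicit Defensive.
Import Order.TTheory GRing.Theory Num.Theory.
Import numFieldNormedType.Exports.

Local Open Scope ring_scope.
Local Open Scope complex_scope.
Local Open Scope classical_set_scope.

Local Notation coord := Defs.coord.

(** * Complex-valued functions and their integrals *)

(** The exponents are conjugate, [(p - 1) * (q - 1) = 1], and this fixes the threshold
    [kap * |f| ^ (p - 1)]: multiplied by [|f|] it gives a multiple of [|f| ^ p] in the low-frequency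
    estimate, and its power [2 - q] turns [|f| ^ 2] into [|f| ^ p] in the high-frequency one. The
    factor [kap] is tied to the bound [S] for the integral of [|f| ^ p], which makes the final
    estimate homogeneous. At [q = 2] the integral over heights diverges, but there the weight is
    trivial and Plancherel alone suffices. The symbol need not make the frequency integral converge
    for a general [f], so all estimates are made with a cutoff [|s| <= M] and constants free of [M];
    the cutoff is removed in L^2, and only then is the operator extended. Plancherel and polar
    coordinates enter only as upper bounds and are proved as inequalities. Complex analysis enters
    through one tool, the identity theorem on half-planes. It is reached from Goursat's lemma by a
    maximum principle; taking two primitives first supplies the second derivatives that this
    principle asks for. *)

Section cabs_theory.
Context {R : realType}.
Implicit Types z w : R[i].

Lemma cabsM z w : cabs (z * w) = cabs z * cabs w.
Proof. exact: ComplexField.Normc.normcM. Qed.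

Lemma cabsD z w : cabs (z + w) <= cabs z + cabs w.
Proof. exact: le_normcD. Qed.

Lemma cabsN z : cabs (- z) = cabs z. Proof. exact: normcN. Qed.

Lemma cabsB z w : cabs (z - w) <= cabs z + cabs w.
Proof. by rewrite -(cabsN w); exact: cabsD. Qed.

Lemma cabsE z : cabs z = Num.sqrt (complex.Re z ^+ 2 + complex.Im z ^+ 2).
Proof. by case: z. Qed.

Lemma cabs_ge0 z : 0 <= cabs z.
Proof. by rewrite cabsE sqrtr_ge0. Qed.

Lemma sqr_cabs z : cabs z ^+ 2 = complex.Re z ^+ 2 + complex.Im z ^+ 2.
Proof. by rewrite cabsE sqr_sqrtr// addr_ge0 ?sqr_ge0. Qed.

Lemma cabs0 : cabs (0 : R[i]) = 0. Proof. exact: ComplexField.Normc.normc0. Qed.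

Lemma cabs1 : cabs (1 : R[i]) = 1. Proof. exact: ComplexField.Normc.normc1. Qed.

Lemma cabs_eq0 z : cabs z = 0 -> z = 0.
Proof. exact: ComplexField.Normc.eq0_normc. Qed.

Lemma cabsV z : cabs z^-1 = (cabs z)^-1.
Proof. exact: ComplexField.Normc.normcV. Qed.

Lemma cabsX z k : cabs (z ^+ k) = cabs z ^+ k.
Proof. by elim: k => [|k IH]; rewrite ?expr0 ?cabs1// !exprS cabsM IH. Qed.

Lemma cabsC (x : R) : cabs x%:C = `|x|.
Proof. by rewrite cabsE /= expr0n addr0 sqrtr_sqr. Qed.

Lemma normr_cabs z : `|z| = (cabs z)%:C.
Proof. by rewrite normc_def cabsE. Qed.

Lemma normRe_cabs z : `|complex.Re z| <= cabs z.
Proof.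
by rewrite -(ler_pXn2r (n:=2))// ?nnegrE ?cabs_ge0// sqr_cabs real_normK ?num_real// lerDl sqr_ge0.
Qed.

Lemma normIm_cabs z : `|complex.Im z| <= cabs z.
Proof.
by rewrite -(ler_pXn2r (n:=2))// ?nnegrE ?cabs_ge0// sqr_cabs real_normK ?num_real// lerDr sqr_ge0.
Qed.

Lemma cabs_ReIm z : cabs z <= `|complex.Re z| + `|complex.Im z|.
Proof.
rewrite -(ler_pXn2r (n:=2))// ?nnegrE ?cabs_ge0 ?addr_ge0// sqr_cabs.
rewrite sqrrD !real_normK ?num_real// -addrA lerD2l lerDr.
by rewrite mulrn_wge0// mulr_ge0.
Qed.

Lemma cabs_conj z : cabs z^* = cabs z.
Proof. by case: z => a b /=; rewrite sqrrN. Qed.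

Lemma ReD z w : complex.Re (z + w) = complex.Re z + complex.Re w.
Proof. by case: z; case: w. Qed.
Lemma ImD z w : complex.Im (z + w) = complex.Im z + complex.Im w.
Proof. by case: z; case: w. Qed.
Lemma ReN z : complex.Re (- z) = - complex.Re z. Proof. by case: z. Qed.
Lemma ImN z : complex.Im (- z) = - complex.Im z. Proof. by case: z. Qed.
Lemma ReM z w : complex.Re (z * w) =
  complex.Re z * complex.Re w - complex.Im z * complex.Im w.
Proof. by case: z; case: w. Qed.
Lemma ImM z w : complex.Im (z * w) =
  complex.Re z * complex.Im w + complex.Im z * complex.Re w.
Proof. by case: z => a b; case: w => c d /=. Qed.

Lemma complex_ext z w :
  complex.Re z = complex.Re w -> complex.Im z = complex.Im w -> z = w.
Proof. by case: z => a b; case: w => c d /= -> ->. Qed.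

Lemma cabsB_ge z w : cabs z - cabs w <= cabs (z - w).
Proof. by rewrite lerBlDr -{1}(subrK w z) cabsD. Qed.

Lemma cabsBC z w : cabs (z - w) = cabs (w - z).
Proof. by rewrite -cabsN opprB. Qed.

Definition expi (s : R) : R[i] := cos s +i* sin s.

Lemma expiD s t : expi (s + t) = expi s * expi t.
Proof. by apply: complex_ext; rewrite ?ReM ?ImM /= ?cosD ?sinD//; ring. Qed.

Lemma expi0 : expi 0 = 1.
Proof. by rewrite /expi cos0 sin0. Qed.

Lemma cabs_expi s : cabs (expi s) = 1.
Proof. by rewrite cabsE /= cos2Dsin2 sqrtr1. Qed.

Lemma conj_expi s : (expi s)^* = expi (- s).
Proof. by rewrite /expi cosN sinN. Qed.

Definition cexp z : R[i] := (expR (complex.Re z))%:C * expi (complex.Im z).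

Lemma cexpD z w : cexp (z + w) = cexp z * cexp w.
Proof.
by rewrite /cexp ReD ImD expRD expiD rmorphM/=; ring.
Qed.

Lemma cexp0 : cexp 0 = 1.
Proof. by rewrite /cexp /= expR0 expi0 mulr1. Qed.

Lemma cabs_cexp z : cabs (cexp z) = expR (complex.Re z).
Proof. by rewrite /cexp cabsM cabs_expi mulr1 cabsC ger0_norm// expR_ge0. Qed.

Lemma cexpC (x : R) : cexp x%:C = (expR x)%:C.
Proof. by rewrite /cexp /= expi0 mulr1. Qed.

Lemma pospowE (X : R) l : 0 < X -> pospow X l = cexp (l * (ln X)%:C).
Proof.
move=> X0; rewrite /pospow X0 /cexp ReM ImM /= !mulr0 subr0 add0r.
by rewrite gtr0_norm// /powR gt_eqF.
Qed.

End cabs_theory.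

Section cmeasurable_theory.
Context d (T : measurableType d) (R : realType).
Implicit Types f g : T -> R[i].

Lemma cmeasurable_cst (c : R[i]) : cmeasurable (fun _ : T => c).
Proof. by split; exact: measurable_cst. Qed.

Lemma cmeasurableD f g : cmeasurable f -> cmeasurable g ->
  cmeasurable (fun x => f x + g x).
Proof.
move=> [f1 f2] [g1 g2]; split.
- under eq_fun do rewrite ReD; exact: measurable_funD.
- under eq_fun do rewrite ImD; exact: measurable_funD.
Qed.

Lemma cmeasurableN f : cmeasurable f -> cmeasurable (fun x => - f x).
Proof.
move=> [f1 f2]; split.
- under eq_fun do rewrite ReN; exact: measurable_funN.
- under eq_fun do rewrite ImN; exact: measurable_funN.
Qed.

Lemma cmeasurableB f g : cmeasurable f -> cmeasurable g ->
  cmeasurable (fun x => f x - g x).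
Proof. by move=> mf mg; apply: cmeasurableD => //; exact: cmeasurableN. Qed.

Lemma cmeasurableM f g : cmeasurable f -> cmeasurable g ->
  cmeasurable (fun x => f x * g x).
Proof.
move=> [f1 f2] [g1 g2]; split.
- by under eq_fun do rewrite ReM; apply: measurable_funB; exact: measurable_funM.
- by under eq_fun do rewrite ImM; apply: measurable_funD; exact: measurable_funM.
Qed.

Lemma cmeasurableC (h : T -> R) : measurable_fun setT h ->
  cmeasurable (fun x => (h x)%:C).
Proof. by move=> mh; split => //=; exact: measurable_cst. Qed.

Lemma cmeasurable_conj f : cmeasurable f -> cmeasurable (fun x => (f x)^*).
Proof.
move=> [f1 f2]; split.
- by rewrite (_ : (fun x => _) = fun x => complex.Re (f x))//;
    apply/funext => x; case: (f x).
- rewrite (_ : (fun x => _) = fun x => - complex.Im (f x)).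
    exact: measurable_funN.
  by apply/funext => x; case: (f x).
Qed.

Lemma measurable_cos : measurable_fun [set: R] (@cos R).
Proof. by apply: continuous_measurable_fun; exact: continuous_cos. Qed.

Lemma measurable_sin : measurable_fun [set: R] (@sin R).
Proof. by apply: continuous_measurable_fun; exact: continuous_sin. Qed.

Lemma cmeasurable_expi (h : T -> R) : measurable_fun setT h ->
  cmeasurable (fun x => expi (h x)).
Proof.
by move=> mh; split => /=; apply: measurableT_comp => //;
  [exact: measurable_cos|exact: measurable_sin].
Qed.

Lemma cmeasurable_cexp f : cmeasurable f -> cmeasurable (fun x => cexp (f x)).
Proof.
move=> [f1 f2]; apply: cmeasurableM; last exact: cmeasurable_expi.
by apply: cmeasurableC; apply: measurableT_comp.
Qed.

Lemma measurable_cabs f : cmeasurable f -> measurable_fun setT (fun x => cabs (f x)).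
Proof.
move=> [f1 f2]; under eq_fun do rewrite cabsE.
apply: measurableT_comp.
  by apply: continuous_measurable_fun; exact: sqrt_continuous.
by apply: measurable_funD; exact: measurable_funX.
Qed.

Lemma measurable_ecabs f : cmeasurable f ->
  measurable_fun setT (fun x => (cabs (f x))%:E).
Proof. by move=> /measurable_cabs mf; apply/measurable_EFinP. Qed.

Lemma cmeasurable_if (b : T -> bool) f g : measurable_fun setT b ->
  cmeasurable f -> cmeasurable g -> cmeasurable (fun x => if b x then f x else g x).
Proof.
move=> mb [f1 f2] [g1 g2]; split.
- rewrite (_ : (fun x => _) = fun x => if b x then complex.Re (f x) else complex.Re (g x)).
    exact: measurable_fun_ifT.
  by apply/funext => x; case: ifP.
- rewrite (_ : (fun x => _) = fun x => if b x then complex.Im (f x) else complex.Im (g x)).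
    exact: measurable_fun_ifT.
  by apply/funext => x; case: ifP.
Qed.

Lemma cmeasurable_comp d' (T' : measurableType d') (f : T -> R[i]) (h : T' -> T) :
  measurable_fun setT h -> cmeasurable f -> cmeasurable (fun x => f (h x)).
Proof. by move=> mh [f1 f2]; split; apply: (measurableT_comp (f:=fun x => _ (f x))). Qed.

End cmeasurable_theory.

Section cintegral_theory.
Context d (T : measurableType d) (R : realType).
Variable mu : {measure set T -> \bar R}.
Implicit Types f g : T -> R[i].

Definition cintegrable f : Prop :=
  cmeasurable f /\ (\int[mu]_x (cabs (f x))%:E < +oo)%E.

Lemma cintegrable_abs f : cintegrable f ->
  mu.-integrable setT (fun x => (cabs (f x))%:E).
Proof.
move=> [mf foo]; apply/integrableP; split; first exact: measurable_ecabs.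
by under eq_integral do rewrite gee0_abs ?lee_fin ?cabs_ge0//.
Qed.

Lemma cintegrableP f : cintegrable f <->
  mu.-integrable setT (fun x => (complex.Re (f x))%:E) /\
  mu.-integrable setT (fun x => (complex.Im (f x))%:E).
Proof.
split.
- move=> [[mf1 mf2] foo]; have fi := cintegrable_abs (conj (conj mf1 mf2) foo).
  split.
  + apply: le_integrable fi => //; first exact/measurable_EFinP.
    by move=> x _ /=; rewrite lee_fin (ger0_norm (cabs_ge0 _)) normRe_cabs.
  + apply: le_integrable fi => //; first exact/measurable_EFinP.
    by move=> x _ /=; rewrite lee_fin (ger0_norm (cabs_ge0 _)) normIm_cabs.
- move=> [if1 if2].
  have mf : cmeasurable f.
    by split; apply/measurable_EFinP; exact: measurable_int if1 || exact: measurable_int if2.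
  split=> //.
  have : mu.-integrable setT (fun x => (`|complex.Re (f x)| + `|complex.Im (f x)|)%:E).
    rewrite (_ : (fun _ => _) = (fun x => `|(complex.Re (f x))%:E| + `|(complex.Im (f x))%:E|)%E)//.
    by apply: integrableD => //; exact: integrable_abse.
  move=> /integrableP[ms]; apply: le_lt_trans.
  apply: ge0_le_integral => //; first by move=> x _; rewrite lee_fin cabs_ge0.
  - exact: measurable_ecabs.
  - exact: measurableT_comp.
  - by move=> x _; rewrite lee_fin ger0_norm ?addr_ge0// cabs_ReIm.
Qed.

Lemma cintegrable_le f (h : T -> R) : cmeasurable f ->
  mu.-integrable setT (fun x => (h x)%:E) -> (forall x, cabs (f x) <= h x) ->
  cintegrable f.
Proof.
move=> mf /integrableP[mh ih] fh; split => //; apply: le_lt_trans ih.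
apply: ge0_le_integral => //; first by move=> x _; rewrite lee_fin cabs_ge0.
- exact: measurable_ecabs.
- exact: measurableT_comp.
- by move=> x _; rewrite lee_fin (le_trans (fh x))// ler_norm.
Qed.

Lemma cintegrable_lec f g (c : R) : cmeasurable f -> cintegrable g ->
  (forall x, cabs (f x) <= c * cabs (g x)) -> cintegrable f.
Proof.
move=> mf ig fg; apply: (cintegrable_le (h := fun x => c * cabs (g x))) => //.
by under eq_fun do rewrite EFinM; apply: integrableZl => //; exact: cintegrable_abs.
Qed.

Lemma cintegrableD f g : cintegrable f -> cintegrable g ->
  cintegrable (fun x => f x + g x).
Proof.
move=> /cintegrableP[f1 f2] /cintegrableP[g1 g2]; apply/cintegrableP; split.
- under eq_fun do rewrite ReD EFinD; exact: integrableD.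
- under eq_fun do rewrite ImD EFinD; exact: integrableD.
Qed.

Lemma cintegrableZ (a : R[i]) f : cintegrable f -> cintegrable (fun x => a * f x).
Proof.
move=> fi; apply: (cintegrable_lec (c := cabs a) (g := f)) => //.
  by apply: cmeasurableM; [exact: cmeasurable_cst|case: fi].
by move=> x; rewrite cabsM.
Qed.

Lemma cintegrableN f : cintegrable f -> cintegrable (fun x => - f x).
Proof. by move=> /(cintegrableZ (-1)); under eq_fun do rewrite mulN1r. Qed.

Lemma cintegrableB f g : cintegrable f -> cintegrable g ->
  cintegrable (fun x => f x - g x).
Proof. by move=> fi gi; apply: cintegrableD => //; exact: cintegrableN. Qed.

Lemma cintegralD f g : cintegrable f -> cintegrable g ->
  cintegral mu setT (fun x => f x + g x) = cintegral mu setT f + cintegral mu setT g.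
Proof.
move=> /cintegrableP[f1 f2] /cintegrableP[g1 g2].
apply: complex_ext; rewrite /cintegral ?ReD ?ImD /=.
- by under eq_Rintegral do rewrite ReD; exact: RintegralD.
- by under eq_Rintegral do rewrite ImD; exact: RintegralD.
Qed.

Lemma cintegralZ (a : R[i]) f : cintegrable f ->
  cintegral mu setT (fun x => a * f x) = a * cintegral mu setT f.
Proof.
move=> /cintegrableP[f1 f2].
have Z1 (c : R) : mu.-integrable setT (EFin \o (fun x => c * complex.Re (f x))).
  by rewrite (_ : _ \o _ = (fun x => c%:E * (complex.Re (f x))%:E)%E)//; exact: integrableZl.
have Z2 (c : R) : mu.-integrable setT (EFin \o (fun x => c * complex.Im (f x))).
  by rewrite (_ : _ \o _ = (fun x => c%:E * (complex.Im (f x))%:E)%E)//; exact: integrableZl.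
apply: complex_ext; rewrite /cintegral ?ReM ?ImM /=.
- by under eq_Rintegral do rewrite ReM; rewrite RintegralB// !RintegralZl.
- by under eq_Rintegral do rewrite ImM; rewrite RintegralD// !RintegralZl.
Qed.

Lemma cintegralN f : cintegrable f ->
  cintegral mu setT (fun x => - f x) = - cintegral mu setT f.
Proof.
move=> fi; rewrite -mulN1r -cintegralZ//.
by congr cintegral; apply/funext => x; rewrite mulN1r.
Qed.

Lemma cintegralB f g : cintegrable f -> cintegrable g ->
  cintegral mu setT (fun x => f x - g x) = cintegral mu setT f - cintegral mu setT g.
Proof.
by move=> fi gi; rewrite cintegralD ?cintegralN//; exact: cintegrableN.
Qed.

Lemma cintegral0 : cintegral mu setT (fun _ => 0) = 0.
Proof. by rewrite /cintegral /= Rintegral_cst//= mul0r. Qed.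

Lemma eq_cintegral f g : f =1 g -> cintegral mu setT f = cintegral mu setT g.
Proof. by move=> fg; congr cintegral; exact/funext. Qed.

Lemma cintegralC (h : T -> R) :
  cintegral mu setT (fun x => (h x)%:C) = (\int[mu]_x h x)%:C.
Proof. by rewrite /cintegral /= Rintegral_cst//= mul0r. Qed.

(** A rotation by the unimodular [u = |I| / I] makes the integral real and nonnegative; it is then
    the integral of a real part, which the modulus dominates. An infinite right-hand side is treated
    apart. *)
Lemma cabs_cintegral f : cmeasurable f ->
  ((cabs (cintegral mu setT f))%:E <= \int[mu]_x (cabs (f x))%:E)%E.
Proof.
move=> mf; have [foo|] := ltP (\int[mu]_x (cabs (f x))%:E)%E +oo%E; last first.
  by rewrite leye_eq => /eqP ->; rewrite leey.
have fi : cintegrable f by [].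
set I := cintegral mu setT f.
have [->|I0] := eqVneq I 0.
  by rewrite cabs0 integral_ge0// => x _; rewrite lee_fin cabs_ge0.
have aI0 : cabs I != 0 by apply/eqP => /cabs_eq0/eqP; rewrite (negbTE I0).
pose u : R[i] := (cabs I)%:C / I.
have au : cabs u = 1 by rewrite /u cabsM cabsV cabsC ger0_norm ?cabs_ge0// divff.
have uI : u * I = (cabs I)%:C by rewrite /u divfK.
have fu := cintegrableZ u fi.
have -> : cabs I = \int[mu]_x complex.Re (u * f x).
  by have /(congr1 (@complex.Re R)) := cintegralZ u fi; rewrite -/I uI /= => ->.
have fRe := (cintegrableP (fun x => u * f x)).1 fu.
rewrite /Rintegral fineK; last exact: integrable_fin_num fRe.1.
apply: le_integral => //; [exact: fRe.1|exact: cintegrable_abs|].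
by move=> x _; rewrite lee_fin (le_trans (ler_norm _))// (le_trans (normRe_cabs _))// cabsM au mul1r.
Qed.

Lemma cabs_cintegral_le f (h : T -> R) : cmeasurable f ->
  mu.-integrable setT (fun x => (h x)%:E) -> (forall x, cabs (f x) <= h x) ->
  cabs (cintegral mu setT f) <= \int[mu]_x h x.
Proof.
move=> mf ih fh; rewrite -lee_fin /Rintegral fineK; last exact: integrable_fin_num.
apply: le_trans (cabs_cintegral mf) _; apply: le_integral => //.
- exact: cintegrable_abs (cintegrable_le mf ih fh).
- by move=> x _; rewrite lee_fin.
Qed.

Lemma ae_eq_cintegral f g : cmeasurable f -> cmeasurable g ->
  {ae mu, forall x, f x = g x} -> cintegral mu setT f = cintegral mu setT g.
Proof.
move=> [f1 f2] [g1 g2] fg; apply: complex_ext; rewrite /cintegral /= /Rintegral; congr fine.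
- apply: ae_eq_integral => //; try exact/measurable_EFinP.
  by apply: filterS fg => x ->.
- apply: ae_eq_integral => //; try exact/measurable_EFinP.
  by apply: filterS fg => x ->.
Qed.

(** Dominated convergence for [cabs (f_ k x - f x)] with majorant [2 * h], the limit inheriting the
    bound [h]. Convergence of complex values is expressed through the real sequence of distances. *)
Lemma cvg_cintegral (f_ : (T -> R[i])^nat) f (h : T -> R) :
  (forall k, cmeasurable (f_ k)) -> cmeasurable f ->
  (forall x, (fun k => cabs (f_ k x - f x)) @ \oo --> 0) ->
  mu.-integrable setT (fun x => (h x)%:E) -> (forall k x, cabs (f_ k x) <= h x) ->
  (fun k => cabs (cintegral mu setT (f_ k) - cintegral mu setT f)) @ \oo --> 0.
Proof.
move=> mf_ mf f_f ih f_h.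
have fh x : cabs (f x) <= h x.
  have c : (fun k => h x + cabs (f_ k x - f x)) @ \oo --> h x.
    by rewrite -[X in _ --> X]addr0; apply: cvgD => //; exact: cvg_cst.
  rewrite -(cvg_lim _ c)//; apply: limr_ge; first by apply/cvg_ex; exists (h x).
  near=> k; apply: (@le_trans _ _ (cabs (f_ k x) + cabs (f_ k x - f x))); last by rewrite lerD.
  by rewrite (le_trans _ (cabsB _ _))// opprB addrC subrK.
have fi_ k := cintegrable_le (mf_ k) ih (f_h k).
have fi := cintegrable_le mf ih fh.
have i2 : mu.-integrable setT (fun x => (2 * h x)%:E).
  by under eq_fun do rewrite EFinM; exact: integrableZl.
have mfd k : cmeasurable (fun x => f_ k x - f x) by exact: cmeasurableB.
have : (fun k => \int[mu]_x (cabs (f_ k x - f x))%:E)%E @ \oo --> (\int[mu]_x (cst 0 x))%E.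
  apply: (@dominated_cvg _ _ _ _ _ _ _ _ (fun x => (2 * h x)%:E)) => //.
  - by move=> k; exact: measurable_ecabs.
  - by move=> x _; apply: cvg_EFin; [near=> k|exact: f_f].
  - move=> k x _; rewrite gee0_abs ?lee_fin ?cabs_ge0//.
    by rewrite (le_trans (cabsB _ _))// mulrDl mul1r lerD.
rewrite integral0 => /fine_cvg c0.
apply: (@squeeze_cvgr _ _ _ _ (fun=> 0) (fun k => fine (\int[mu]_x (cabs (f_ k x - f x))%:E)%E)) => //.
  near=> k; rewrite cabs_ge0 andTb -cintegralB//.
  rewrite -lee_fin fineK; first exact: cabs_cintegral.
  apply: integrable_fin_num => //; apply: cintegrable_abs; exact: cintegrableB.
exact: cvg_cst.
Unshelve. all: by end_near. Qed.

End cintegral_theory.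

Section measurable_integral.
Context d1 d2 (X : measurableType d1) (Y : measurableType d2) (R : realType).
Variable (nu : {sigma_finite_measure set Y -> \bar R}).

(** The integrals of the positive and negative parts are measurable by Tonelli, and so is [fine] of
    their difference; parameters with an infinite inner integral simply receive the value [0]. *)
Lemma measurable_fun_Rintegral (f : X * Y -> R) : measurable_fun setT f ->
  measurable_fun setT (fun x => \int[nu]_y f (x, y)).
Proof.
move=> mf; apply: measurableT_comp => //.
have mEf : measurable_fun setT (EFin \o f) by exact/measurable_EFinP.
pose F1 := (fun x => \int[nu]_y (EFin \o f)^\+ (x, y))%E.
pose F2 := (fun x => \int[nu]_y (EFin \o f)^\- (x, y))%E.
rewrite (_ : (fun x => _) = (F1 \- F2)%E); last first.
  apply/funext => x; rewrite /= integralE /F1 /F2.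
  by congr (_ - _)%E; apply: eq_integral => y _; rewrite unlock.
apply: emeasurable_funB; apply: measurable_fun_fubini_tonelli_F => //.
- exact: measurable_funepos.
- exact: measurable_funeneg.
Qed.

Lemma cmeasurable_cintegral (f : X * Y -> R[i]) : cmeasurable f ->
  cmeasurable (fun x => cintegral nu setT (fun y => f (x, y))).
Proof.
move=> [f1 f2]; split; rewrite /cintegral /=.
- exact: (measurable_fun_Rintegral (f:=fun z => complex.Re (f z))).
- exact: (measurable_fun_Rintegral (f:=fun z => complex.Im (f z))).
Qed.

End measurable_integral.

Section cfubini.
Context d1 d2 (X : measurableType d1) (Y : measurableType d2) (R : realType).
Variables (mu : {sigma_finite_measure set X -> \bar R})
  (nu : {sigma_finite_measure set Y -> \bar R}).

(** The real-valued integral replaces an infinite inner integral by [0]. For integrable [f] this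
    happens only on a null set, so the real iterated integrals agree with the extended ones, to
    which Fubini applies. *)
Lemma RFubini (f : X * Y -> R) : (mu \x nu)%E.-integrable setT (EFin \o f) ->
  \int[mu]_x \int[nu]_y f (x, y) = \int[nu]_y \int[mu]_x f (x, y).
Proof.
move=> fi; have mf : measurable_fun setT f.
  by apply/measurable_EFinP; exact: measurable_int fi.
have mf' : measurable_fun setT (fun z : Y * X => f (z.2, z.1)).
  by apply: (measurableT_comp mf); exact: measurable_fun_pair.
rewrite /Rintegral; congr fine.
transitivity (\int[mu]_x \int[nu]_y (EFin \o f) (x, y))%E.
  apply: ae_eq_integral => //.
  - by apply/measurable_EFinP; exact: measurable_fun_Rintegral.
  - exact: (measurable_fubini_F fi).
  - have := ae_integrable1 fi; apply: filterS => x /= ix _.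
    by rewrite fineK//; exact: integrable_fin_num.
rewrite Fubini//; apply: ae_eq_integral => //.
- exact: (measurable_fubini_G fi).
- apply/measurable_EFinP.
  exact: (@measurable_fun_Rintegral _ _ Y X R mu (fun z : Y * X => f (z.2, z.1)) mf').
- have := ae_integrable2 fi; apply: filterS => x /= ix _.
  by rewrite fineK//; exact: integrable_fin_num.
Qed.

End cfubini.

Lemma cfubini d1 d2 (X : measurableType d1) (Y : measurableType d2) (R : realType)
  (mu : {sigma_finite_measure set X -> \bar R})
  (nu : {sigma_finite_measure set Y -> \bar R}) (f : X * Y -> R[i]) :
  cintegrable (mu \x nu)%E f ->
  cintegral mu setT (fun x => cintegral nu setT (fun y => f (x, y))) =
  cintegral nu setT (fun y => cintegral mu setT (fun x => f (x, y))).
Proof.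
move=> /cintegrableP[f1 f2]; apply: complex_ext; rewrite /cintegral /=.
- exact: (RFubini (f := fun z => complex.Re (f z))).
- exact: (RFubini (f := fun z => complex.Im (f z))).
Qed.

Local Opaque integral.

(** * Lebesgue measure on R^n and polar coordinates *)

Section pushforward_integral.
Context d1 d2 (X : measurableType d1) (Y : measurableType d2) (R : realType).

Definition pushm (mu : {measure set X -> \bar R}) (phi : X -> Y)
    (mphi : measurable_fun setT phi) : {measure set Y -> \bar R} :=
  measure_function_pushforward__canonical__measure_function_Measure mu mphi.

Lemma ge0_integral_push (mu : {measure set X -> \bar R}) (nu : {measure set Y -> \bar R})
    (phi : X -> Y) (g : Y -> \bar R) :
  measurable_fun setT phi -> (forall A, measurable A -> nu A = mu (phi @^-1` A)) ->
  measurable_fun setT g -> (forall y, (0 <= g y)%E) ->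
  (\int[nu]_y g y = \int[mu]_x g (phi x))%E.
Proof.
move=> mphi E mg g0; transitivity (\int[pushm mu mphi]_y g y)%E.
  by apply: eq_measure_integral => A mA _; exact: E.
by rewrite ge0_integral_pushforward.
Qed.

End pushforward_integral.

Section sigma_finite_of.
Context d (T : measurableType d) (R : realType).
Variables (mu : {measure set T -> \bar R}) (mu_sigma_finite : sigma_finite setT mu).

(** The proof of sigma-finiteness is a phantom argument, so that structure inference on this synonym
    of [mu] recovers it. *)
Definition sigma_finite_of of sigma_finite setT mu : set T -> \bar R := mu.

HB.instance Definition _ := Measure.copy (sigma_finite_of mu_sigma_finite) mu.
HB.instance Definition _ := Measure_isSigmaFinite.Build _ _ _
  (sigma_finite_of mu_sigma_finite) mu_sigma_finite.

End sigma_finite_of.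

Section product_sigma_finite.
Context d1 d2 (X : measurableType d1) (Y : measurableType d2) (R : realType).
Variables (mu : {sigma_finite_measure set X -> \bar R})
  (nu : {sigma_finite_measure set Y -> \bar R}).

Lemma sigma_finite_prod : sigma_finite setT (mu \x nu)%E.
Proof.
have /sigma_finiteP[F [TF ndF Foo]] := sigma_finiteT mu.
have /sigma_finiteP[G [TG ndG Goo]] := sigma_finiteT nu.
exists (fun k => F k `*` G k).
  rewrite -setXTT TF TG predeqE => -[x y]; split.
    move=> [/= [k _ Fkx] [l _ Gly]]; exists (maxn k l) => //; split.
    - by move: x Fkx; exact/subsetPset/ndF/leq_maxl.
    - by move: y Gly; exact/subsetPset/ndG/leq_maxr.
  by move=> [k _ []/= ? ?]; split; exists k.
move=> k; have [? ?] := Foo k; have [? ?] := Goo k.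
split; first exact: measurableX.
by rewrite product_measure1E// lte_mul_pinfty// ge0_fin_numE.
Qed.

(* The canonical structure of [SigmaFiniteMeasure] on [mu \x nu] is shadowed in
   the library by the one on products of subprobabilities. *)
Definition prodm : {sigma_finite_measure set (X * Y)%type -> \bar R} :=
  sigma_finite_of sigma_finite_prod.

End product_sigma_finite.

(** * Affine substitutions on the line *)

Section change_of_variables_R.
Context {R : realType}.
Local Notation leb := (@lebesgue_measure R).

Lemma measurable_affine (c a : R) :
  measurable_fun [set: measurableTypeR R] (fun x : measurableTypeR R => c * x + a : measurableTypeR R).
Proof. by apply: measurable_funD => //; exact: measurable_funM. Qed.

(** By uniqueness, Lebesgue measure is [c] times its image under the affine map, since both agree on
    half-open intervals. The formula for integrals follows by pushing forward. *)
Lemma ge0_integral_affine (c a : R) (g : R -> \bar R) : 0 < c ->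
  measurable_fun [set: R] g -> (forall x, (0 <= g x)%E) ->
  (\int[leb]_x g (c * x + a)%R = (c^-1)%:E * \int[leb]_x g x)%E.
Proof.
move=> c0 mg g0; pose phi := fun x : measurableTypeR R => c * x + a : measurableTypeR R.
have mphi : measurable_fun setT phi by exact: measurable_affine.
pose m' := mscale (NngNum (ltW c0)) (pushm leb mphi).
have E A : measurable A -> leb A = m' A.
  move=> mA; apply: lebesgue_measure_unique => // _ [[u v] _ <-] /=.
  rewrite /m' /mscale /= /pushforward.
  have -> : phi @^-1` `]u, v]%classic = `](u - a) / c, (v - a) / c]%classic.
    apply/seteqP; split => x /=; rewrite !in_itv /= /phi ltr_pdivrMr// ler_pdivlMr// ltrBlDr lerBrDr mulrC//.
  rewrite !lebesgue_measure_itv/= !lte_fin ltr_pM2r ?invr_gt0// ltrD2r.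
  case: ifP => uv; last by rewrite mule0.
  by rewrite -!EFinD -EFinM; congr EFin; field; rewrite gt_eqF.
have -> : (\int[leb]_x g x = \int[m']_x g x)%E.
  by apply: eq_measure_integral => A mA _; exact: E.
rewrite ge0_integral_mscale//= ge0_integral_pushforward//.
by rewrite muleA -EFinM mulVf ?gt_eqF// mul1e.
Qed.

Lemma ge0_integral_opp (g : R -> \bar R) :
  measurable_fun [set: R] g -> (forall x, (0 <= g x)%E) ->
  (\int[leb]_x g (- x)%R = \int[leb]_x g x)%E.
Proof.
move=> mg g0; apply/esym.
apply: (@ge0_integral_push _ _ (measurableTypeR R) (measurableTypeR R) R leb leb (-%R : R -> R)) => //.
by move=> A mA; apply/esym/lebesgue_measureN.
Qed.

Lemma ge0_integral_affineN (c a : R) (g : R -> \bar R) : c != 0 ->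
  measurable_fun [set: R] g -> (forall x, (0 <= g x)%E) ->
  (\int[leb]_x g (c * x + a)%R = (`|c|^-1)%:E * \int[leb]_x g x)%E.
Proof.
move=> c0 mg g0; have [cp|cn|/eqP] := ltrgt0P c; last by rewrite (negbTE c0).
  exact: ge0_integral_affine.
have ncp : 0 < - c by rewrite oppr_gt0.
rewrite -(ge0_integral_affine a ncp mg g0) -[LHS]ge0_integral_opp//.
  by apply: eq_integral => x _; rewrite mulrN mulNr.
by apply: (measurableT_comp mg); exact: measurable_affine.
Qed.

End change_of_variables_R.

Section Rn_product.
Context {R : realType}.
Local Notation leb := (@lebesgue_measure R).

Definition Rn_uncons n (x : Rn R n.+1) : Rn R n * measurableTypeR R :=
  ((\row_j x ord0 (lift ord0 j)) : Rn R n, x ord0 ord0).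

Lemma Rn_unconsK n : cancel (@Rn_uncons n) (@Rn_cons R n).
Proof.
move=> x; apply/rowP => i; rewrite mxE; case: unliftP => [j|] ->//=.
by rewrite mxE.
Qed.

Lemma Rn_consK n : cancel (@Rn_cons R n) (@Rn_uncons n).
Proof.
move=> [x t]; rewrite /Rn_uncons mxE unlift_none; congr pair.
by apply/rowP => j; rewrite !mxE liftK.
Qed.

Lemma measurable_Rn_uncons n : measurable_fun setT (@Rn_uncons n).
Proof.
apply: measurable_fun_pair; last exact: (measurable_coord ord0).
apply: measurable_fun_coord => i.
rewrite (_ : _ \o _ = coord (lift ord0 i)); first exact: measurable_coord.
by apply/funext => x; rewrite /coord/= mxE.
Qed.

Lemma sigma_finite_Rn n : sigma_finite setT (@lebesgue_Rn R n).
Proof.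
elim: n => [|n IH].
  exists (fun=> setT); first by rewrite bigcup_const.
  by move=> k; split => //=; rewrite diracT ltry.
pose m : {sigma_finite_measure set (Rn R n) -> \bar R} :=
  sigma_finite_of IH.
have [F FT Foo] := sigma_finite_prod m leb.
exists (fun k => @Rn_uncons n @^-1` F k).
  by rewrite -preimage_bigcup -FT preimage_setT.
move=> k; have [mF Fk] := Foo k; split.
  by rewrite -[X in measurable X]setTI; exact: measurable_Rn_uncons.
rewrite /= /lebesgue_Rn_step /pushforward /=.
rewrite (_ : _ @^-1` _ = F k)//.
by apply/seteqP; split => z /=; rewrite Rn_consK.
Qed.

Definition lebRn n : {sigma_finite_measure set (Rn R n) -> \bar R} :=
  sigma_finite_of (@sigma_finite_Rn n).

Lemma ge0_integral_RnS n (g : Rn R n.+1 -> \bar R) :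
  measurable_fun setT g -> (forall x, (0 <= g x)%E) ->
  (\int[lebRn n.+1]_x g x = \int[lebRn n]_x \int[leb]_t g (Rn_cons (x, t)))%E.
Proof.
move=> mg g0.
rewrite (ge0_integral_push (mu := (lebRn n \x leb)%E) (@measurable_Rn_cons R n))//.
rewrite fubini_tonelli1//.
by apply: measurableT_comp => //; exact: measurable_Rn_cons.
Qed.

Lemma ge0_integral_RnS2 n (g : Rn R n.+1 -> \bar R) :
  measurable_fun setT g -> (forall x, (0 <= g x)%E) ->
  (\int[lebRn n.+1]_x g x = \int[leb]_t \int[lebRn n]_x g (Rn_cons (x, t)))%E.
Proof.
move=> mg g0; rewrite ge0_integral_RnS//.
rewrite -(fubini_tonelli (fun z => g (Rn_cons z)))//.
by apply: measurableT_comp => //; exact: measurable_Rn_cons.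
Qed.

Lemma Rn_consZ n (s t : R) (x : Rn R n) : s *: Rn_cons (x, t) = Rn_cons (s *: x, s * t).
Proof. by apply/rowP => i; rewrite !mxE; case: unliftP => [j|] _ /=; rewrite ?mxE. Qed.

Lemma Rn_consD n (s t : R) (x y : Rn R n) :
  Rn_cons (x, s) + Rn_cons (y, t) = Rn_cons (x + y, s + t).
Proof. by apply/rowP => i; rewrite !mxE; case: unliftP => [j|] _ /=; rewrite ?mxE. Qed.

Lemma measurable_RnZ n (s : R) : measurable_fun setT (fun x : Rn R n => s *: x : Rn R n).
Proof.
apply: measurable_fun_coord => i.
rewrite (_ : _ \o _ = fun x => s * coord i x); last by apply/funext => x; rewrite /coord/= mxE.
by apply: measurable_funM => //; exact: measurable_coord.
Qed.

Lemma measurable_RnD n (v : Rn R n) : measurable_fun setT (fun x : Rn R n => x + v : Rn R n).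
Proof.
apply: measurable_fun_coord => i.
rewrite (_ : _ \o _ = fun x => coord i x + v ord0 i); last by apply/funext => x; rewrite /coord/= mxE.
by apply: measurable_funD => //; exact: measurable_coord.
Qed.

Lemma ge0_integral_RnZ n (s : R) (g : Rn R n -> \bar R) : 0 < s ->
  measurable_fun setT g -> (forall x, (0 <= g x)%E) ->
  (\int[lebRn n]_x g (s *: x)%R = (s ^- n)%:E * \int[lebRn n]_x g x)%E.
Proof.
move=> s0; elim: n g => [|n IH] g mg g0.
  rewrite expr0 invr1 mul1e; apply: eq_integral => x _; congr g.
  by apply/rowP => -[].
have mgc x : measurable_fun [set: R] (fun t => g (Rn_cons (x, t))).
  have mc := measurableT_comp mg (@measurable_Rn_cons R n).
  exact: measurableT_comp mc (pair1_measurable _).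
have mgi : measurable_fun setT (fun x => \int[leb]_t g (Rn_cons (x, t)))%E.
  apply: (measurable_fun_fubini_tonelli_F (fun z => g (Rn_cons z))) => //.
  by apply: measurableT_comp => //; exact: measurable_Rn_cons.
rewrite !ge0_integral_RnS//; last first.
  by apply: measurableT_comp => //; exact: measurable_RnZ.
transitivity (\int[lebRn n]_x ((s^-1)%:E * \int[leb]_t g (Rn_cons (s *: x, t)%R)))%E.
  apply: eq_integral => x _.
  under eq_integral do rewrite Rn_consZ.
  rewrite -(@ge0_integral_affine _ s 0 (fun t => g (Rn_cons (s *: x, t))))//.
  by apply: eq_integral => t _; rewrite addr0.
rewrite ge0_integralZl//; last 3 first.
- by apply: (measurableT_comp (f := fun x => \int[leb]_t g (Rn_cons (x, t)))%E) => //; exact: measurable_RnZ.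
- by move=> x _; exact: integral_ge0.
- by rewrite lee_fin invr_ge0 ltW.
rewrite (IH (fun x => \int[leb]_t g (Rn_cons (x, t)))%E)//; last by move=> x; exact: integral_ge0.
by rewrite muleA -EFinM exprS invfM.
Qed.

Lemma ge0_integral_RnD n (v : Rn R n) (g : Rn R n -> \bar R) :
  measurable_fun setT g -> (forall x, (0 <= g x)%E) ->
  (\int[lebRn n]_x g (x + v)%R = \int[lebRn n]_x g x)%E.
Proof.
elim: n v g => [|n IH] v g mg g0.
  apply: eq_integral => x _; congr g; by apply/rowP => -[].
have mgc x : measurable_fun [set: R] (fun t => g (Rn_cons (x, t))).
  have mc := measurableT_comp mg (@measurable_Rn_cons R n).
  exact: measurableT_comp mc (pair1_measurable _).
have mgi : measurable_fun setT (fun x => \int[leb]_t g (Rn_cons (x, t)))%E.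
  apply: (measurable_fun_fubini_tonelli_F (fun z => g (Rn_cons z))) => //.
  by apply: measurableT_comp => //; exact: measurable_Rn_cons.
rewrite !ge0_integral_RnS//; last first.
  by apply: measurableT_comp => //; exact: measurable_RnD.
rewrite -[RHS](IH (Rn_uncons v).1)//; last by move=> x; exact: integral_ge0.
apply: eq_integral => x _.
rewrite -{1}(Rn_unconsK v); case: (Rn_uncons v) => v1 v2 /=.
under eq_integral do rewrite Rn_consD.
have := @ge0_integral_affine _ 1 v2 (fun t => g (Rn_cons (x + v1, t))) ltr01 (mgc _) (fun=> g0 _).
by rewrite invr1 mul1e => <-; apply: eq_integral => t _; rewrite mul1r.
Qed.

End Rn_product.

Section restricted_measure.
Context d (T : measurableType d) (R : realType).
Variables (mu : {measure set T -> \bar R}) (D : set T) (mD : measurable D).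

Lemma ge0_integral_mrestr (f : T -> \bar R) : measurable_fun setT f ->
  (forall x, (0 <= f x)%E) -> (\int[mrestr mu mD]_x f x = \int[mu]_(x in D) f x)%E.
Proof.
move=> mf f0.
have mC : measurable (~` D) by exact: measurableC.
rewrite -(setUv D) ge0_integral_setU//; last 2 first.
- by rewrite setUv.
- by apply/disj_setPS; rewrite setICr.
rewrite [X in (_ + X)%E](_ : _ = 0%E) ?adde0.
  apply: eq_measure_integral => A mA AD; rewrite /mrestr /=; congr (mu _).
  exact: setIidl.
apply: null_set_integral => //; first exact: measurable_funS mf.
by rewrite /= /mrestr setICl measure0.
Qed.

End restricted_measure.

Section powR_integrals.
Context {R : realType}.
Local Notation leb := (@lebesgue_measure R).

Lemma is_derive_powR_scale (k c s : R) : 0 < s ->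
  is_derive s 1 (fun s : R => k * s `^ c) (k * (c * s `^ (c - 1))).
Proof. by move=> s0; exact: (is_deriveZ k (is_derive1_powR c s0)). Qed.

Lemma continuous_powR_pos (c s : R) : 0 < s -> {for s, continuous (fun s => s `^ c)}.
Proof.
move=> s0; have := is_derive1_powR c s0 => D.
by have /derivable1_diffP/differentiable_continuous := @ex_derive _ _ _ _ _ _ _ D.
Qed.

Lemma powRN_cvg0 (c : R) : 0 < c -> (s `^ (- c)) @[s --> +oo] --> (0 : R).
Proof.
move=> c0; apply/cvgr0Pnorm_le => e e0; near=> s.
have es : e `^ (- c^-1) <= s by near: s; apply: nbhs_pinfty_ge; rewrite num_real.
have s0 : 0 < s by rewrite (lt_le_trans _ es)// powR_gt0.
rewrite ger0_norm ?powR_ge0// powRN -[leRHS]invrK lef_pV2 ?posrE ?invr_gt0 ?powR_gt0//.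
rewrite (le_trans _ (ge0_ler_powR (ltW c0) _ _ es)) ?nnegrE ?powR_ge0 ?(ltW s0)//.
rewrite -powRrM mulNr mulVf ?gt_eqF// powRN.
by rewrite powRr1 // ltW.
Unshelve. all: by end_near. Qed.

Lemma integral_powR_tail (c rho : R) : 0 < c -> 0 < rho ->
  (\int[leb]_(s in `[rho, +oo[) (s `^ (- c - 1))%:E)%E = (rho `^ (- c) / c)%:E.
Proof.
move=> c0 r0; pose F := fun s : R => - c^-1 * s `^ (- c).
have dF (s : R) : 0 < s -> is_derive s 1 F (s `^ (- c - 1)).
  move=> s0; have := is_derive_powR_scale (- c^-1) (- c) s0.
  by rewrite mulrA mulrNN mulVf ?gt_eqF// mul1r.
have cF : {within `[rho, +oo[, continuous (fun s => s `^ (- c - 1))}.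
  apply: continuous_in_subspaceT => s; rewrite inE /= in_itv /= andbT => rs.
  exact/continuous_powR_pos/(lt_le_trans r0 rs).
rewrite (@ge0_continuous_FTC2y _ _ F _ 0 _ cF)//.
- by rewrite sub0e /F -EFinN mulNr opprK mulrC.
- by move=> x _; exact: powR_ge0.
- rewrite -[X in _ --> X](mulr0 (- c^-1)).
  by apply: cvgMr; exact: powRN_cvg0.
- by move=> x rx; case: (dF x (lt_trans r0 rx)).
- apply: cvg_at_right_filter.
  by have /derivable1_diffP/differentiable_continuous := @ex_derive _ _ _ _ _ _ _ (dF rho r0).
- by move=> x; rewrite in_itv /= andbT => rx; rewrite derive1E; case: (dF x (lt_trans r0 rx)).
Qed.

(** For [c < 1] the integrand is singular at [0], so the fundamental theorem is applied on
    [[1/(k+1), r]] and monotone convergence exhausts []0, r]]. The nonnegative value of the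
    primitive at the lower end is dropped, whence the inequality. *)
Lemma integral_powR_head (c r : R) : 0 < c -> 0 < r ->
  (\int[leb]_(s in `]0%R, r]) (s `^ (c - 1))%:E <= (r `^ c / c)%:E)%E.
Proof.
move=> c0 r0; pose F := fun s : R => c^-1 * s `^ c.
have dF (s : R) : 0 < s -> is_derive s 1 F (s `^ (c - 1)).
  move=> s0; have := is_derive_powR_scale (c^-1) c s0.
  by rewrite mulrA mulVf ?gt_eqF// mul1r.
pose A (k : nat) : set R := `[k.+1%:R^-1, r]%classic.
have AU : `]0%R, r]%classic = \bigcup_k A k.
  apply/seteqP; split => x /=; rewrite in_itv /=.
    move=> /andP[x0 xr]; have [k _ /(_ k (leqnn k)) kx] := near_infty_natSinv_lt (PosNum x0).
    by exists k => //; rewrite /A /= in_itv /= xr andbT ltW.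
  by move=> [k _]; rewrite /A /= in_itv /= => /andP[kx ->]; rewrite andbT (lt_le_trans _ kx)// invr_gt0.
rewrite AU.
have mp : measurable_fun setT (fun s : R => (s `^ (c - 1))%:E).
  by apply/measurable_EFinP; exact: measurable_powR.
have cv : (\int[leb]_(x in A k) (x `^ (c - 1))%:E)%E @[k --> \oo] -->
    (\int[leb]_(x in \bigcup_k A k) (x `^ (c - 1))%:E)%E.
  apply: ge0_nondecreasing_set_cvg_integral.
  - move=> k l kl; apply/subsetPset => x; rewrite /A /= !in_itv /= => /andP[kx ->].
    by rewrite andbT (le_trans _ kx)// lef_pV2 ?posrE// ler_nat ltnS.
  - by move=> k; exact: measurable_itv.
  - by move=> k; exact: measurable_funS mp.
  - by move=> k x _; rewrite lee_fin powR_ge0.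
rewrite -(cvg_lim _ cv)//; apply: lime_le; first by apply/cvg_ex; eexists; exact: cv.
near=> k; rewrite /A.
have kr : k.+1%:R^-1 < r by near: k; exact: (near_infty_natSinv_lt (PosNum r0)).
have k0 : 0 < k.+1%:R^-1 :> R by rewrite invr_gt0.
have dc s : 0 < s -> {for s, continuous F}.
  by move=> s0; have /derivable1_diffP/differentiable_continuous := @ex_derive _ _ _ _ _ _ _ (dF s s0).
rewrite (@continuous_FTC2 _ _ F)//.
- by rewrite -EFinB lee_fin /F lerBlDr mulrC lerDl mulr_ge0 ?invr_ge0 ?powR_ge0 ?(ltW c0).
- apply: continuous_in_subspaceT => s; rewrite inE /= in_itv /= => /andP[ks _].
  exact/continuous_powR_pos/(lt_le_trans k0 ks).
- split.
  + by move=> s; rewrite in_itv /= => /andP[ks _]; case: (dF s (lt_trans k0 ks)).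
  + by apply: cvg_at_right_filter; exact: dc.
  + by apply: cvg_at_left_filter; exact: dc.
- by move=> s; rewrite in_itv /= => /andP[ks _]; rewrite derive1E; case: (dF s (lt_trans k0 ks)).
Unshelve. all: by end_near. Qed.

End powR_integrals.

(** * Polar coordinates from the scaling of volume *)

Section polar_coordinates.
Context {R : realType} (n : nat).
Local Notation leb := (@lebesgue_measure R).
Local Notation sphm := (@sphere_measure R n.+1).

(** The test fails only at the origin, which has no direction and receives the default point of the
    sphere. *)
Definition unit_dir (x : Rn R n.+1) : sphere n.+1 :=
  match pselect (enorm (ndir x) == (n.+1 != 0%N)%:R) with
  | left H => exist _ (ndir x) H
  | right _ => point
  end.

Lemma unit_dirE (x : Rn R n.+1) : 0 < enorm x -> sval (unit_dir x) = ndir x.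
Proof.
move=> x0; rewrite /unit_dir; case: pselect => //= H; exfalso; apply: H.
by rewrite /ndir enormZ ?invr_ge0 ?(ltW x0)// mulVf // gt_eqF.
Qed.

Lemma enorm_ge0 m (x : Rn R m) : 0 <= enorm x. Proof. exact: sqrtr_ge0. Qed.

Lemma enorm_sphere m (th : @sphere R m.+1) : enorm (sval th) = 1.
Proof. by case: th => x /= /eqP. Qed.

Lemma measurable_sval m : measurable_fun setT (fun th : @sphere R m => sval th : Rn R m).
Proof. by move=> _ Y mY; rewrite setTI; exists Y => //; rewrite setTI. Qed.

Lemma measurable_to_sphere d (T : measurableType d) m (f : T -> @sphere R m) :
  measurable_fun setT (fun x => sval (f x) : Rn R m) -> measurable_fun setT f.
Proof. by move=> mf _ Y [B mB <-]; rewrite !setTI; rewrite -[X in measurable X]setTI; exact: mf. Qed.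

Lemma measurable_unit_dir : measurable_fun setT unit_dir.
Proof.
apply: measurable_to_sphere.
rewrite (_ : (fun x => _) = fun x => if 0 < enorm x then ndir x else (sval (unit_dir 0) : Rn R n.+1)).
  apply: measurable_fun_ifT.
  - by apply: measurable_fun_ltr => //; exact: measurable_enorm.
  - exact: measurable_ndir.
  - exact: measurable_cst.
apply/funext => x; case: ifP => [/unit_dirE//|/negbT].
rewrite -leNgt => x0; have {x0}x0 : enorm x = 0 by apply/eqP; rewrite eq_le x0 enorm_ge0.
rewrite (_ : x = 0)//; apply/rowP => i; rewrite mxE.
move/eqP: x0; rewrite sqrtr_eq0 /dot => x0.
have sq0 j : 0 <= x ord0 j * x ord0 j by rewrite -expr2 sqr_ge0.
have s0 : \sum_i x ord0 i * x ord0 i = 0 by apply/eqP; rewrite eq_le x0 sumr_ge0.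
have := psumr_eq0P (fun j _ => sq0 j) s0 (i:=i) isT.
by move/eqP; rewrite mulf_eq0 orbb => /eqP.
Qed.

(** The surface measure is defined by cones, and the cone over [A] is the part of the punctured unit
    ball whose direction lies in [A]. So the measure is [n.+1] times the image under [unit_dir] of
    volume on that ball. *)
Lemma ge0_integral_sphere (g : @sphere R n.+1 -> \bar R) :
  measurable_fun setT g -> (forall th, (0 <= g th)%E) ->
  (\int[sphm]_th g th = n.+1%:R%:E *
    \int[lebRn n.+1]_(x in @enorm R n.+1 @^-1` `]0%R, 1%R]) g (unit_dir x))%E.
Proof.
move=> mg g0.
have mB : measurable (@enorm R n.+1 @^-1` `]0%R, 1%R]).
  by rewrite -[X in measurable X]setTI; apply: measurable_enorm.
have mgu : measurable_fun setT (fun x => g (unit_dir x)).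
  by apply: (measurableT_comp mg); exact: measurable_unit_dir.
rewrite (ge0_integral_push (mu := mscale (NngNum (ler0n R n.+1)) (mrestr (lebRn n.+1) mB))
  measurable_unit_dir _ mg g0); last first.
  move=> A [B mB' <-]; rewrite /sphere_measure /mscale /= /mrestr; congr (_ * _)%E.
  rewrite setTI coneE; congr (lebesgue_Rn _ _).
  apply/seteqP; split => x /=; rewrite !in_itv /=.
  + by move=> [/[dup] H /andP[x0 x1] Bx]; split => //; rewrite unit_dirE.
  + by move=> [Bx /[dup] H /andP[x0 x1]]; split => //; rewrite -unit_dirE.
rewrite (ge0_integral_mscale (mrestr (lebRn n.+1) mB) measurableT (NngNum (ler0n R n.+1)) mgu (fun x _ => g0 _)).
by rewrite (ge0_integral_mrestr (lebRn n.+1) mB mgu (fun x => g0 _)).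
Qed.

Lemma measurable_bool_natr d (T : measurableType d) (b : T -> bool) :
  measurable_fun setT b -> measurable_fun setT (fun x => (b x)%:R : R).
Proof.
move=> mb; rewrite (_ : (fun x => _) = fun x => if b x then 1 else 0 : R).
  by apply: measurable_fun_ifT.
by apply/funext => x; case: (b x).
Qed.

Lemma integral_bool_natr d (T : measurableType d) (mu : {measure set T -> \bar R})
  (b : T -> bool) (f : T -> \bar R) :
  (\int[mu]_(x in [set x | b x]) f x = \int[mu]_x ((b x)%:R%:E * f x))%E.
Proof.
rewrite [LHS]integral_mkcond; apply: eq_integral => x _; rewrite patchE.
case: (boolP (b x)) => bx; first by rewrite ifT ?mul1e// inE.
by rewrite ifF ?mul0e//; apply/negbTE; rewrite notin_setE /=; exact/negP.
Qed.

(** No Jacobian is computed. The sphere integral becomes one over the unit ball; a scaling of [r], a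
    scaling of [x] and two exchanges of integration leave for each [x] the integral of
    [s ^ (- n - 2)] over [s >= |x|]. Its value [|x| ^ (- n - 1) / (n + 1)] cancels the factors
    collected on the way. *)
Lemma polar_le (G : Rn R n.+1 -> \bar R) : measurable_fun setT G ->
  (forall x, (0 <= G x)%E) ->
  (\int[sphm]_th \int[leb]_r ((0 < r)%R%:R%:E * (r ^+ n)%:E * G (r *: sval th))
   <= \int[lebRn n.+1]_x G x)%E.
Proof.
move=> mG G0.
have mpr (f : R -> R) : measurable_fun setT f -> measurable_fun setT (fun z : Rn R n.+1 * measurableTypeR R => f z.2).
  by move=> mf; exact: measurableT_comp.
have msv d (T : measurableType d) (f : T -> Rn R n.+1) (r : T -> R) : measurable_fun setT f -> measurable_fun setT r ->
    measurable_fun setT (fun z => r z *: f z : Rn R n.+1).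
  move=> mf mr; apply: measurable_fun_coord => i.
  rewrite (_ : _ \o _ = fun z => r z * coord i (f z)); last by apply/funext => z; rewrite /coord/= mxE.
  apply: measurable_funM => //; exact: (measurableT_comp (measurable_coord i)).
pose h (z : Rn R n.+1 * measurableTypeR R) := ((0 < z.2)%R%:R%:E * (z.2 ^+ n)%:E * G (z.2 *: z.1))%E.
have h0 z : (0 <= h z)%E.
  rewrite /h; case: (ltP 0 z.2) => z0; last by rewrite !mul0e.
  by rewrite mul1e mule_ge0// lee_fin exprn_ge0// ltW.
have mh : measurable_fun setT h.
  apply: emeasurable_funM; first apply: emeasurable_funM; last 1 first.
  - by apply: (measurableT_comp mG); exact: msv.
  - apply/measurable_EFinP/measurable_bool_natr.
    by apply: measurable_fun_ltr.
  - by apply/measurable_EFinP; exact: measurable_funX.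
have mhs : measurable_fun setT (fun th : @sphere R n.+1 => \int[leb]_r h (sval th, r))%E.
  apply: (measurableT_comp (f := fun x => \int[leb]_r h (x, r))%E); last exact: measurable_sval.
  exact: (measurable_fun_fubini_tonelli_F h).
have mh2 (x : Rn R n.+1) : measurable_fun [set: R] (fun r => h (x, r)).
  exact: (measurableT_comp mh (pair1_measurable x)).
rewrite (ge0_integral_sphere mhs); last by move=> th; exact: integral_ge0.
pose b (x : Rn R n.+1) := 0 < enorm x <= 1.
pose k (z : Rn R n.+1 * measurableTypeR R) :=
  ((b z.1)%:R%:E * ((0 < z.2)%R%:R%:E * (enorm z.1 ^+ n.+1 * z.2 ^+ n)%:E * G (z.2 *: z.1)))%E.
have menorm d (T : measurableType d) (f : T -> Rn R n.+1) : measurable_fun setT f ->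
    measurable_fun setT (fun z => enorm (f z)).
  by move=> mf; apply: (measurableT_comp (@measurable_enorm R n.+1)).
have k0 z : (0 <= k z)%E.
  rewrite /k; apply: mule_ge0; first by rewrite lee_fin.
  case: (ltP 0 z.2) => z0; last by rewrite !mul0e.
  by rewrite mul1e mule_ge0// lee_fin mulr_ge0// exprn_ge0 ?enorm_ge0// ltW.
have mk : measurable_fun setT k.
  apply: emeasurable_funM.
    apply/measurable_EFinP/measurable_bool_natr; apply: measurable_and.
    + by apply: measurable_fun_ltr => //; exact: menorm.
    + by apply: measurable_fun_ler => //; exact: menorm.
  apply: emeasurable_funM; first apply: emeasurable_funM; last 1 first.
  - by apply: (measurableT_comp mG); exact: msv.
  - apply/measurable_EFinP/measurable_bool_natr.
    by apply: measurable_fun_ltr.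
  - apply/measurable_EFinP; apply: measurable_funM; last exact: measurable_funX.
    by apply: measurable_funX; exact: menorm.
(* Substitution [r = |x| s]: then [r] times the direction of [x] is [s x], and [r ^ n] with the
   factor [|x|] of the substitution gives [|x| ^ n.+1] in [k]. *)
have E1 : (\int[lebRn n.+1]_(x in @enorm R n.+1 @^-1` `]0%R, 1%R]) \int[leb]_r h (sval (unit_dir x), r) =
    \int[lebRn n.+1]_x \int[leb]_r k (x, r))%E.
  rewrite (_ : _ @^-1` _ = [set x | b x]); last by apply/seteqP; split => x /=; rewrite in_itv.
  rewrite integral_bool_natr; apply: eq_integral => x _.
  case: (boolP (b x)) => bx; last first.
    rewrite mul0e; apply/esym; under eq_integral do rewrite /k /= (negbTE bx) mul0e.
    exact: integral0.
  have /andP[x0 x1] := bx.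
  have := ge0_integral_affine 0 x0 (mh2 (sval (unit_dir x))) (fun r => h0 _).
  move=> /(congr1 (fun y => (enorm x)%:E * y)%E).
  rewrite muleA -EFinM divff ?gt_eqF// !mul1e => <-.
  rewrite -ge0_integralZl//; last 2 first.
  - apply: (measurableT_comp (mh2 _)); exact: measurable_affine.
  - by rewrite lee_fin ltW.
  apply: eq_integral => r _; rewrite /k /h /= bx mul1e addr0 (unit_dirE x0) /ndir scalerA.
  rewrite mulrAC divff ?gt_eqF// mul1r pmulr_rgt0// exprMn exprS.
  rewrite !muleA [((enorm x)%:E * _)%E]muleC -!muleA; congr (_ * _)%E.
  by rewrite !muleA -!EFinM !mulrA.
rewrite E1 (fubini_tonelli k)//.
pose L (z : measurableTypeR R * Rn R n.+1) := ((0 < z.1)%R%:R%:E * (((0 < enorm z.2) && (enorm z.2 <= z.1))%:R%:E *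
   (enorm z.2 ^+ n.+1 * z.1 `^ (- n.+1%:R - 1))%:E * G z.2))%E.
have L0 z : (0 <= L z)%E.
  by rewrite /L !mule_ge0 ?lee_fin// mulr_ge0 ?powR_ge0 ?exprn_ge0 ?enorm_ge0.
have mL : measurable_fun setT L.
  apply: emeasurable_funM.
    by apply/measurable_EFinP/measurable_bool_natr; apply: measurable_fun_ltr.
  apply: emeasurable_funM; first apply: emeasurable_funM; last 1 first.
  - exact: (measurableT_comp mG).
  - apply/measurable_EFinP/measurable_bool_natr; apply: measurable_and.
    + by apply: measurable_fun_ltr => //; exact: menorm.
    + by apply: measurable_fun_ler => //; exact: menorm.
  - apply/measurable_EFinP; apply: measurable_funM; last exact: (measurableT_comp (measurable_powR _)).
    by apply: measurable_funX; exact: menorm.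
(* For fixed [s > 0], [x] is replaced by [x / s]: the ball condition becomes [|x| <= s], and the
   powers of [s] add up to [s ^ (- n - 2)]. *)
have E2 s : (\int[lebRn n.+1]_x k (x, s) = \int[lebRn n.+1]_x L (s, x))%E.
  have [s0|s0] := ltP 0 s; last first.
    by rewrite !integral0_eq// => x _; rewrite /k /L /= ltNge s0 !(mul0e,mule0).
  have mLs : measurable_fun setT (fun x => L (s, x)) by exact: (measurableT_comp mL (pair1_measurable s)).
  have := ge0_integral_RnZ s0 mLs (fun x => L0 _).
  move=> /(congr1 (fun y => (s ^+ n.+1)%:E * y)%E).
  rewrite muleA -EFinM divff ?expf_neq0 ?gt_eqF// mul1e => <-.
  rewrite -ge0_integralZl//; last 2 first.
  - apply: (measurableT_comp mLs); exact: measurable_RnZ.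
  - by rewrite lee_fin exprn_ge0// ltW.
  apply: eq_integral => x _; rewrite /k /L /= s0 !mul1e (enormZ _ (ltW s0)).
  have -> : (s * enorm x <= s) = (enorm x <= 1) by rewrite -[leRHS]mulr1 ler_pM2l.
  rewrite pmulr_rgt0// /b.
  have pw : s `^ (- n.+1%:R - 1) = (s ^+ n.+2)^-1.
    by rewrite -opprD natr1 powRN powR_mulrn// ltW.
  rewrite !muleA -!EFinM; congr (_%:E * _)%E.
  by rewrite pw exprMn !exprS; field; rewrite expf_neq0 gt_eqF.
under eq_integral do rewrite E2.
rewrite (fubini_tonelli L mL L0).
have E3 x : (\int[leb]_s L (s, x) <= (n.+1%:R^-1)%:E * G x)%E.
  have [x0|x0] := ltP 0 (enorm x); last first.
    rewrite integral0_eq; first by rewrite mule_ge0.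
    by move=> s _; rewrite /L /= [(0 < enorm x)%R]ltNge x0 /= !(mul0e, mule0).
  have -> : (\int[leb]_s L (s, x) = \int[leb]_s (((enorm x <= s)%R%:R)%:E * ((enorm x ^+ n.+1)%:E * G x * (s `^ (- n.+1%:R - 1))%:E)))%E.
    apply: eq_integral => s _; rewrite /L /= x0 /=; case: (leP (enorm x) s) => xs; last by rewrite !(mul0e, mule0).
    by rewrite (lt_le_trans x0 xs) !mul1e EFinM muleAC.
  rewrite -(@integral_bool_natr _ _ leb (fun s => enorm x <= s)).
  rewrite (_ : [set s | enorm x <= s] = `[enorm x, +oo[%classic); last first.
    by apply/seteqP; split => s /=; rewrite in_itv /= andbT.
  rewrite ge0_integralZl//; last 3 first.
  - by apply/measurable_EFinP; apply: measurable_funTS; exact: measurable_powR.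
  - by move=> s _; rewrite lee_fin powR_ge0.
  - by rewrite mule_ge0// lee_fin exprn_ge0// enorm_ge0.
  rewrite integral_powR_tail// powRN powR_mulrn ?enorm_ge0// muleAC -EFinM.
  by rewrite mulrA divff ?expf_neq0 ?gt_eqF// mul1r.
have mG' : measurable_fun setT (fun x => (n.+1%:R^-1)%:E * G x)%E by exact: emeasurable_funM.
apply: (@le_trans _ _ (n.+1%:R%:E * \int[lebRn n.+1]_x ((n.+1%:R^-1)%:E * G x))%E).
  apply: lee_wpmul2l => //; apply: ge0_le_integral => //.
  - by move=> x _; exact: integral_ge0.
  - exact: (measurable_fun_fubini_tonelli_G L).
rewrite ge0_integralZl// muleA -EFinM divff// mul1e; exact: lexx.
Qed.

End polar_coordinates.

(** * Plancherel inequality *)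

Section poisson_kernel.
Context {R : realType}.
Local Notation leb := (@lebesgue_measure R).

Lemma is_derive_mulrl (c s : R) : is_derive s 1 (fun s => c * s) c.
Proof. by have := is_deriveZ c (is_derive_id s (1 : R)); rewrite scaler1. Qed.

Lemma is_derive_comp_mulrl (f : R -> R) (f' c s : R) :
  is_derive (c * s) 1 f f' -> is_derive s 1 (fun s => f (c * s)) (c * f').
Proof. by move=> D; rewrite mulrC; exact: (is_derive1_comp D (is_derive_mulrl c s)). Qed.

Lemma expR_cvg0 (e : R) : 0 < e -> expR (- e * s) @[s --> +oo] --> 0.
Proof.
move=> e0; apply/cvgr0Pnorm_le => d d0; near=> s.
have es : e^-1 * d^-1 <= s by near: s; apply: nbhs_pinfty_ge; rewrite num_real.
have s0 : 0 < s by rewrite (lt_le_trans _ es)// mulr_gt0 ?invr_gt0.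
rewrite ger0_norm ?expR_ge0// mulNr expRN -[leRHS]invrK lef_pV2 ?posrE ?invr_gt0 ?expR_gt0//.
rewrite (@le_trans _ _ (e * s))//; first by rewrite mulrC -ler_pdivrMr// mulrC.
by rewrite (le_trans _ (expR_ge1Dx _))// lerDr.
Unshelve. all: by end_near. Qed.

(** An antiderivative in [s] of [exp (- e s) (1 + cos (x s))]. The summand [1] makes the integrand
    nonnegative, as the fundamental theorem on a half-line requires; its contribution is subtracted
    again in [cintegral_wexp]. *)
Let F (e x s : R) := - e^-1 * expR (- e * s) +
  expR (- e * s) * ((e ^+ 2 + x ^+ 2)^-1 * (x * sin (x * s) - e * cos (x * s))).

Let is_derive_F (e x s : R) : 0 < e ->
  is_derive s 1 (F e x) (expR (- e * s) * (1 + cos (x * s))).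
Proof.
move=> e0.
have D1 := is_derive_comp_mulrl (is_derive_expR (- e * s)).
have D2 := is_derive_comp_mulrl (is_derive_sin (x * s)).
have D3 := is_derive_comp_mulrl (is_derive_cos (x * s)).
have D4 := is_deriveB (is_deriveZ x D2) (is_deriveZ e D3).
have D5 := is_deriveM D1 (is_deriveZ ((e ^+ 2 + x ^+ 2)^-1) D4).
have D6 := is_deriveD (is_deriveZ (- e^-1) D1) D5.
apply: (is_derive_eq D6).
set E := expR (- e * s); set c := cos (x * s); set sn := sin (x * s).
set k := (e ^+ 2 + x ^+ 2)^-1.
change (- e^-1 * (- e * E) + (E * (k * (x * (x * c) - e * (x * - sn))) +
  (k * (x * sn - e * c)) * (- e * E)) = E * (1 + c)); rewrite /k.
have ? : e ^+ 2 + x ^+ 2 != 0 by rewrite gt_eqF// ltr_wpDr ?sqr_ge0// exprn_gt0.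
by field; apply/andP; split => //; rewrite gt_eqF.
Qed.

Let F_cvg e x : 0 < e -> F e x s @[s --> +oo] --> (0 : R).
Proof.
move=> e0; rewrite -[X in _ --> X]addr0; apply: cvgD.
  by rewrite -[X in _ --> X](mulr0 (- e^-1)); apply: cvgMr; exact: expR_cvg0.
pose C := (e ^+ 2 + x ^+ 2)^-1 * (`|x| + e).
apply/cvgr0Pnorm_le => d d0.
have C0 : 0 <= C.
  by rewrite mulr_ge0 ?invr_ge0 ?addr_ge0 ?sqr_ge0// ltW.
have C1 : 0 < C + 1 by rewrite ltr_wpDl.
have := expR_cvg0 e0 => /cvgr0Pnorm_le /(_ (d / (C + 1))).
rewrite divr_gt0// => /(_ isT); apply: filterS => s.
rewrite normrM => H; rewrite -[leRHS](divfK (lt0r_neq0 C1) d).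
rewrite ler_pM// normrM ger0_norm ?invr_ge0 ?addr_ge0 ?sqr_ge0//.
rewrite (@le_trans _ _ C) ?lerDl// /C ler_wpM2l ?invr_ge0 ?addr_ge0 ?sqr_ge0//.
rewrite (le_trans (ler_normB _ _))// lerD//.
- by rewrite normrM ler_piMr// ler_norml sin_geN1 sin_le1.
- by rewrite normrM (gtr0_norm e0) ler_piMr ?(ltW e0)// ler_norml cos_geN1 cos_le1.
Qed.

Lemma continuous_is_derive (f f' : R -> R) (s : R) : is_derive s 1 f (f' s) -> {for s, continuous f}.
Proof. by move=> D; have /derivable1_diffP/differentiable_continuous := @ex_derive _ _ _ _ _ _ _ D. Qed.

Let continuous_integrand (e x : R) : continuous (fun s : R => expR (- e * s) * (1 + cos (x * s))).
Proof.
move=> s; apply: (@continuousM R R (fun s => expR (- e * s)) (fun s => 1 + cos (x * s))).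
  exact: (continuous_is_derive (f' := fun s => - e * expR (- e * s)) (is_derive_comp_mulrl (is_derive_expR _))).
apply: continuousD; first exact: cst_continuous.
exact: (continuous_is_derive (f' := fun s => x * (- sin (x * s))) (is_derive_comp_mulrl (is_derive_cos _))).
Qed.

Let integral_half (e x : R) : 0 < e ->
  (\int[leb]_(s in `[0%R, +oo[) (expR (- e * s) * (1 + cos (x * s)))%:E =
   (e^-1 + e / (e ^+ 2 + x ^+ 2))%:E)%E.
Proof.
move=> e0; rewrite (@ge0_continuous_FTC2y _ _ (F e x) _ 0).
- rewrite sub0e -EFinN /F !mulr0 sin0 cos0 expR0; congr EFin; ring.
- by move=> s _; rewrite mulr_ge0 ?expR_ge0// -lerBlDl sub0r cos_geN1.
- by apply: continuous_subspaceT; exact: continuous_integrand.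
- exact: F_cvg.
- by move=> s _; case: (is_derive_F x s e0).
- apply: cvg_at_right_filter; exact: (continuous_is_derive (f' := fun s => (expR (- e * s) * (1 + cos (x * s)))) (is_derive_F x 0 e0)).
- by move=> s _; rewrite derive1E; case: (is_derive_F x s e0).
Qed.

Definition wexp (e s : R) := expR (- e * `|s|).

Lemma wexp_ge0 e s : 0 <= wexp e s. Proof. exact: expR_ge0. Qed.

Lemma continuous_wexp e : continuous (wexp e).
Proof.
move=> s; apply: (continuous_comp (f := fun s => - e * `|s|) (g := expR)); last exact: continuous_expR.
apply: continuousM; first exact: cst_continuous.
exact: norm_continuous.
Qed.

Lemma measurable_wexp e : measurable_fun [set: R] (wexp e).
Proof. apply: continuous_measurable_fun; exact: continuous_wexp. Qed.

Let integral_whole (e x : R) : 0 < e ->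
  (\int[leb]_s (wexp e s * (1 + cos (x * s)))%:E =
   (2 * (e^-1 + e / (e ^+ 2 + x ^+ 2)))%:E)%E.
Proof.
move=> e0; rewrite ge0_symfun_integralT.
- rewrite (_ : [set x | _] = `[0%R, +oo[%classic); last first.
    by apply/seteqP; split => s /=; rewrite in_itv /= andbT.
  rewrite EFinM -(integral_half x e0); congr (_ * _)%E; apply: eq_integral => s.
  by rewrite inE /= in_itv /= andbT => s0; rewrite /wexp ger0_norm.
- by move=> s; rewrite mulr_ge0 ?wexp_ge0// -lerBlDl sub0r cos_geN1.
- move=> s; apply: continuousM; first exact: continuous_wexp.
  apply: continuousD; first exact: cst_continuous.
  exact: (continuous_is_derive (f' := fun s => x * (- sin (x * s))) (is_derive_comp_mulrl (is_derive_cos _))).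
- by move=> s /=; rewrite /wexp normrN mulrN cosN.
Qed.

Lemma integral_wexp (e : R) : 0 < e -> (\int[leb]_s (wexp e s)%:E = (2 / e)%:E)%E.
Proof.
move=> e0; have := integral_whole 0 e0.
rewrite expr0n addr0.
rewrite (_ : 2 * (e^-1 + e / e ^+ 2) = 2 * (2 / e)); last by field; rewrite gt_eqF.
under eq_integral do rewrite mul0r cos0 mulrC EFinM.
rewrite ge0_integralZl//; last by move=> s _; rewrite lee_fin wexp_ge0.
- rewrite EFinM => /(congr1 (fun y => (2^-1)%:E * y)%E).
  by rewrite !muleA -!EFinM mulVf// !mul1r !mul1e.
- by apply/measurable_EFinP; exact: measurable_wexp.
Qed.

Lemma integrable_wexp (e : R) : 0 < e -> leb.-integrable setT (fun s => (wexp e s)%:E).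
Proof.
move=> e0; apply/integrableP; split; first by apply/measurable_EFinP; exact: measurable_wexp.
under eq_integral do rewrite gee0_abs ?lee_fin ?wexp_ge0//.
by rewrite integral_wexp// ltry.
Qed.

(** This is [2 * pi] times the Poisson kernel of the half-plane at height [e]; hence its integral
    does not depend on [e]. *)
Definition poisson (e x : R) := 2 * e / (e ^+ 2 + x ^+ 2).

Lemma cintegral_wexp (e x : R) : 0 < e ->
  cintegral leb setT (fun s : measurableTypeR R => (wexp e s)%:C * expi (x * s)) = (poisson e x)%:C.
Proof.
move=> e0.
have iw := integrable_wexp e0.
have mcos : measurable_fun [set: R] (fun s => cos (x * s)).
  by apply: (measurableT_comp (@measurable_cos R)); exact: mulrl_measurable.
have msin : measurable_fun [set: R] (fun s => sin (x * s)).
  by apply: (measurableT_comp (@measurable_sin R)); exact: mulrl_measurable.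
have ib (f : R -> R) : measurable_fun [set: R] f -> (forall s, `|f s| <= 1) ->
    leb.-integrable setT (fun s => (wexp e s * f s)%:E).
  move=> mf f1; apply: le_integrable iw => //.
    by apply/measurable_EFinP; apply: measurable_funM => //; exact: measurable_wexp.
  by move=> s _ /=; rewrite lee_fin normrM ler_piMr.
have c1 s : `|cos (x * s)| <= 1 by rewrite ler_norml cos_geN1 cos_le1.
have s1 s : `|sin (x * s)| <= 1 by rewrite ler_norml sin_geN1 sin_le1.
apply: complex_ext; rewrite /cintegral /=.
- under eq_Rintegral do rewrite mul0r subr0.
  have := congr1 fine (integral_whole x e0); rewrite /=.
  rewrite -/(Rintegral leb setT (fun s => wexp e s * (1 + cos (x * s)))).
  under eq_Rintegral do rewrite mulrDr mulr1.
  rewrite RintegralD//; last exact: ib.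
  rewrite {1}/Rintegral integral_wexp//= => H.
  apply: (addrI (2 / e)); rewrite H /poisson; field.
  have ? : e ^+ 2 + x ^+ 2 != 0 by rewrite gt_eqF// ltr_wpDr ?sqr_ge0// exprn_gt0.
  by apply/andP; split => //; rewrite gt_eqF.
- under eq_Rintegral do rewrite mul0r addr0.
  (* Reflection [s -> - s] between two nonnegative integrands; after subtracting the common part it
     says that the sine integral equals its opposite. *)
  have H : (\int[leb]_s (wexp e s * (1 + sin (x * s)))%:E = \int[leb]_s (wexp e s * (1 - sin (x * s)))%:E)%E.
    rewrite -[LHS]ge0_integral_opp.
    + by apply: eq_integral => s _; rewrite /wexp normrN mulrN sinN.
    + apply/measurable_EFinP; apply: measurable_funM; first exact: measurable_wexp.
      exact: measurable_funD.
    + by move=> s; rewrite lee_fin mulr_ge0 ?wexp_ge0// -lerBlDl sub0r sin_geN1.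
  have := congr1 fine H.
  rewrite -/(Rintegral leb setT (fun s => wexp e s * (1 + sin (x * s)))).
  rewrite -/(Rintegral leb setT (fun s => wexp e s * (1 - sin (x * s)))).
  under eq_Rintegral do rewrite mulrDr mulr1.
  under [in RHS]eq_Rintegral do rewrite mulrBr mulr1.
  rewrite RintegralD// ?RintegralB//; try exact: ib.
  by move=> /addrI/eqP; rewrite eq_sym -subr_eq0 -opprD oppr_eq0 -mulr2n mulrn_eq0 /= => /eqP.
Qed.

Lemma poisson_ge0 e x : 0 <= e -> 0 <= poisson e x.
Proof. by move=> e0; rewrite /poisson divr_ge0 ?mulr_ge0// addr_ge0 ?sqr_ge0. Qed.

Lemma continuous_poisson e : 0 < e -> continuous (poisson e).
Proof.
move=> e0 x; apply: (@continuousM _ _ (fun=> 2 * e) (fun x : R => (e ^+ 2 + x ^+ 2)^-1)); first exact: cst_continuous.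
apply: continuousV; first by rewrite gt_eqF// ltr_wpDr ?sqr_ge0// exprn_gt0.
apply: continuousD; first exact: cst_continuous.
exact: exprn_continuous.
Qed.

Lemma integral_poisson e : 0 < e -> (\int[leb]_x (poisson e x)%:E = (2 * pi)%:E)%E.
Proof.
move=> e0; rewrite ge0_symfun_integralT//; last 3 first.
- by move=> x; rewrite poisson_ge0 ?ltW.
- exact: continuous_poisson.
- by move=> x /=; rewrite /poisson sqrrN.
rewrite (_ : [set x | _] = `[0%R, +oo[%classic); last first.
  by apply/seteqP; split => s /=; rewrite in_itv /= andbT.
pose G (x : R) := 2 * atan (e^-1 * x).
have DG (x : R) : is_derive x 1 G (poisson e x).
  have D : is_derive (e^-1 * x) 1 atan ((1 + (e^-1 * x) ^+ 2)^-1).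
    apply: DeriveDef; first exact: derivable_atan.
    by rewrite -derive1E derive1_atan.
  apply: (is_derive_eq (is_deriveZ 2 (is_derive_comp_mulrl D))).
  rewrite /poisson /GRing.scale /=.
  have ? : e ^+ 2 + x ^+ 2 != 0 by rewrite gt_eqF// ltr_wpDr ?sqr_ge0// exprn_gt0.
  have ? : 1 + (e^-1 * x) ^+ 2 != 0 by rewrite gt_eqF// ltr_wpDr ?sqr_ge0.
  by field; do ?[apply/andP; split]; rewrite gt_eqF//; rewrite ?ltr_wpDr ?sqr_ge0 ?exprn_gt0.
rewrite (@ge0_continuous_FTC2y _ _ G _ pi).
- by rewrite /G mulr0 atan0 mulr0 sube0 -EFinM.
- by move=> x _; rewrite poisson_ge0 ?ltW.
- apply: continuous_subspaceT => s; exact: continuous_poisson.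
- rewrite (_ : pi = 2 * (pi / 2)); last by rewrite mulrC divfK.
  apply: cvgMr.
  have cx : e^-1 * x @[x --> +oo] --> +oo.
    by apply: gt0_cvgMry; [rewrite invr_gt0|exact: cvg_id].
  exact: (fun A HA => cx _ (cvgy_atan HA)).
- by move=> x _; case: (DG x).
- by apply: cvg_at_right_filter; exact: (continuous_is_derive (DG 0)).
- by move=> x _; rewrite derive1E; case: (DG x).
Qed.

End poisson_kernel.

Lemma fatou_le d (T : measurableType d) (R : realType) (mu : {measure set T -> \bar R})
    (f_ : nat -> T -> \bar R) (f : T -> \bar R) (c : \bar R) :
  (forall k, measurable_fun setT (f_ k)) -> (forall k x, (0 <= f_ k x)%E) ->
  (forall x, f_ ^~ x @ \oo --> f x) ->
  (\forall k \near \oo, (\int[mu]_x f_ k x <= c)%E) -> (\int[mu]_x f x <= c)%E.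
Proof.
move=> mf f0 f_f f_c; have := fatou mu measurableT mf (fun k x _ => f0 k x).
have -> : (\int[mu]_x limn_einf (f_ ^~ x) = \int[mu]_x f x)%E.
  by apply: eq_integral => x _; have [-> _] := cvg_limn_einf_sup (f_f x).
move=> /le_trans; apply; rewrite limn_einf_lim; apply: lime_le; first exact: is_cvg_einfs.
near=> k; apply: (@le_trans _ _ (\int[mu]_x f_ k x)%E); last by near: k.
by apply: ereal_inf_lbound; exists k => /=.
Unshelve. all: by end_near. Qed.

Section cintegral_more.
Context d (T : measurableType d) (R : realType).
Variable mu : {measure set T -> \bar R}.

Lemma cintegral_conj (f : T -> R[i]) : cintegrable mu f ->
  cintegral mu setT (fun x => (f x)^*) = (cintegral mu setT f)^*.
Proof.
move=> /cintegrableP[f1 f2]; apply: complex_ext; rewrite /cintegral /=.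
- by apply: eq_Rintegral => x _; case: (f x).
- rewrite -mulN1r -RintegralZl//; apply: eq_Rintegral => x _.
  by case: (f x) => a b /=; rewrite mulN1r.
Qed.

Lemma cintegrable_conj (f : T -> R[i]) : cintegrable mu f -> cintegrable mu (fun x => (f x)^*).
Proof.
move=> fi; apply: (cintegrable_lec (c := 1) (g := f)) => //.
  by apply: cmeasurable_conj; case: fi.
by move=> x; rewrite cabs_conj mul1r.
Qed.

Lemma mulcJ_cabs (z : R[i]) : z * z^* = (cabs z ^+ 2)%:C.
Proof. by apply: complex_ext; rewrite ?sqr_cabs; case: z => a b /=; ring. Qed.

End cintegral_more.

Section product_integrable.
Context d1 d2 (X : measurableType d1) (Y : measurableType d2) (R : realType).
Variables (mu : {sigma_finite_measure set X -> \bar R})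
  (nu : {sigma_finite_measure set Y -> \bar R}).

Lemma cintegrable_prod (u : X -> R[i]) (v : Y -> R[i]) :
  cintegrable mu u -> cintegrable nu v ->
  cintegrable (mu \x nu)%E (fun z => u z.1 * v z.2).
Proof.
move=> ui vi; have [mu_ _] := ui; have [mv _] := vi.
have mm : cmeasurable (fun z : X * Y => u z.1 * v z.2).
  apply: cmeasurableM; first exact: (cmeasurable_comp measurable_fst mu_).
  exact: (cmeasurable_comp measurable_snd mv).
split => //; rewrite fubini_tonelli1/fubini_F; last 2 first.
- exact: measurable_ecabs.
- by move=> z; rewrite lee_fin cabs_ge0.
have fv := integrable_fin_num measurableT (cintegrable_abs vi).
have -> : (\int[mu]_x \int[nu]_y (cabs (u x * v y))%:E =
   \int[mu]_x ((cabs (u x))%:E * \int[nu]_y (cabs (v y))%:E))%E.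
  apply: eq_integral => x _; rewrite -ge0_integralZl//.
  - by apply: eq_integral => y _; rewrite cabsM.
  - exact: measurable_ecabs.
  - by move=> y _; rewrite lee_fin cabs_ge0.
  - by rewrite lee_fin cabs_ge0.
rewrite -(fineK fv) ge0_integralZr//; last 3 first.
- exact: measurable_ecabs.
- by move=> x _; rewrite lee_fin cabs_ge0.
- by rewrite lee_fin fine_ge0// integral_ge0// => y _; rewrite lee_fin cabs_ge0.
by rewrite -(fineK (integrable_fin_num measurableT (cintegrable_abs ui))) -EFinM ltry.
Qed.

End product_integrable.

(** * Plancherel's inequality for an abstract phase, by regularisation *)

Section plancherel_abstract.
Context d1 d2 (X : measurableType d1) (Y : measurableType d2) (R : realType).
Variables (mu : {sigma_finite_measure set X -> \bar R})
  (nu : {sigma_finite_measure set Y -> \bar R}).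
Variables (phi : X * Y -> R) (mphi : measurable_fun setT phi).
Variables (w : nat -> Y -> R) (g : nat -> X * X -> R) (C : R).
Hypothesis iw : forall k, nu.-integrable setT (fun y => (w k y)%:E).
Hypothesis w0 : forall k y, 0 <= w k y.
Hypothesis w1 : forall y, (w k y) @[k --> \oo] --> (1 : R).
Hypothesis mg : forall k, measurable_fun setT (g k).
Hypothesis g0 : forall k z, 0 <= g k z.
Hypothesis gE : forall k x x', cintegral nu setT (fun y => (w k y)%:C * expi (phi (x, y) - phi (x', y))) = (g k (x, x'))%:C.
Hypothesis gC1 : forall k x, (\int[mu]_x' (g k (x, x'))%:E <= C%:E)%E.
Hypothesis gC2 : forall k x', (\int[mu]_x (g k (x, x'))%:E <= C%:E)%E.

Definition fourier (f : X -> R[i]) (y : Y) : R[i] :=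
  cintegral mu setT (fun x => f x * expi (phi (x, y))).

Variables (f : X -> R[i]) (fi : cintegrable mu f).

Let mf : cmeasurable f. Proof. by case: fi. Qed.

Let mE : cmeasurable (fun z : X * Y => f z.1 * expi (phi z)).
Proof.
apply: cmeasurableM; first exact: (cmeasurable_comp measurable_fst mf).
exact: cmeasurable_expi.
Qed.

Let ifE y : cintegrable mu (fun x => f x * expi (phi (x, y))).
Proof.
apply: (cintegrable_lec (c := 1) (g := f)) => //.
  exact: (cmeasurable_comp (pair2_measurable y) mE).
by move=> x; rewrite cabsM cabs_expi mulr1 mul1r.
Qed.

Lemma cmeasurable_fourier : cmeasurable (fourier f).
Proof.
apply: (@cmeasurable_cintegral _ _ Y X R mu (fun z => f z.2 * expi (phi (z.2, z.1)))).
exact: (cmeasurable_comp (h := fun z : Y * X => (z.2, z.1)) (measurable_fun_pair measurable_snd measurable_fst) mE).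
Qed.

Let B := fine (\int[mu]_x (cabs (f x))%:E).

Lemma cabs_fourier y : cabs (fourier f y) <= B.
Proof.
rewrite -lee_fin /B fineK; last exact: integrable_fin_num (cintegrable_abs fi).
have mEy : cmeasurable (fun x => f x * expi (phi (x, y))) by case: (ifE y).
apply: le_trans (cabs_cintegral mu mEy) _.
by under eq_integral do rewrite cabsM cabs_expi mulr1.
Qed.

Let B_ge0 : 0 <= B.
Proof. by rewrite fine_ge0// integral_ge0// => x _; rewrite lee_fin cabs_ge0. Qed.

(** The two factors of the square are opened one after the other, each by Fubini on [Y * X]. The
    first exchange is justified by the bound [B] on [fourier f] and the integrability of [w k];
    after the second, the integral in [y] of the weighted phase difference is [g k]. *)
Let weighted_eq k : cintegral nu setT (fun y => (w k y * cabs (fourier f y) ^+ 2)%:C) =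
  cintegral mu setT (fun x => f x * cintegral mu setT (fun x' => (f x')^* * (g k (x, x'))%:C)).
Proof.
have mw : cmeasurable (fun y => (w k y)%:C).
  by apply: cmeasurableC; apply/measurable_EFinP; exact: measurable_int (iw k).
have mF := cmeasurable_fourier.
have wi : cintegrable nu (fun y => (w k y)%:C).
  by apply: (cintegrable_le (h := w k)) => // y; rewrite cabsC ger0_norm.
have wc y : cabs (w k y)%:C = w k y by rewrite cabsC ger0_norm.
pose h1 (z : Y * X) := (w k z.1)%:C * (fourier f z.1)^* * (f z.2 * expi (phi (z.2, z.1))).
have mphi' : measurable_fun setT (fun z : Y * X => phi (z.2, z.1)).
  exact: (measurableT_comp mphi (measurable_fun_pair measurable_snd measurable_fst)).
have mfE : cmeasurable (fun z : Y * X => f z.2 * expi (phi (z.2, z.1))).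
  apply: cmeasurableM; first exact: (cmeasurable_comp measurable_snd mf).
  exact: cmeasurable_expi.
have mw1 : cmeasurable (fun z : Y * X => (w k z.1)%:C).
  exact: (cmeasurable_comp measurable_fst mw).
have mh1 : cmeasurable h1.
  apply: cmeasurableM => //; apply: cmeasurableM => //.
  exact: (cmeasurable_comp measurable_fst (cmeasurable_conj mF)).
have ip := cintegrable_prod wi fi.
transitivity (cintegral nu setT (fun y => cintegral mu setT (fun x => h1 (y, x)))).
  apply: eq_cintegral => y; rewrite /h1 /= cintegralZ; last exact: ifE.
  by rewrite -/(fourier f y) -mulrA [_^* * _]mulrC mulcJ_cabs -rmorphM.
rewrite cfubini; last first.
  apply: (cintegrable_lec (c := B) mh1 ip) => z; rewrite /h1 !cabsM cabs_expi mulr1 cabs_conj wc.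
  by rewrite mulrAC [leRHS]mulrC ler_wpM2l ?mulr_ge0 ?cabs_ge0// cabs_fourier.
apply: eq_cintegral => x.
have mphix : cmeasurable (fun z : Y => expi (phi (x, z))).
  apply: cmeasurable_expi; exact: (measurableT_comp mphi (pair1_measurable x)).
pose h2 (z : Y * X) := (w k z.1)%:C * expi (phi (x, z.1)) * (f z.2 * expi (phi (z.2, z.1)))^*.
have mh2 : cmeasurable h2.
  apply: cmeasurableM; last exact: cmeasurable_conj.
  by apply: cmeasurableM => //; exact: (cmeasurable_comp measurable_fst mphix).
transitivity (f x * cintegral nu setT (fun y => (w k y)%:C * expi (phi (x, y)) * (fourier f y)^*)).
  rewrite -cintegralZ.
    by apply: eq_cintegral => y; rewrite /h1 /=; ring.
  apply: (cintegrable_lec (c := B) _ wi).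
    by apply: cmeasurableM; [exact: cmeasurableM|exact: cmeasurable_conj].
  move=> y; rewrite !cabsM cabs_expi mulr1 cabs_conj wc mulrC.
  by rewrite ler_wpM2r ?cabs_fourier.
congr (_ * _).
transitivity (cintegral nu setT (fun y => cintegral mu setT (fun x' => h2 (y, x')))).
  apply: eq_cintegral => y; rewrite /h2 /= cintegralZ; last exact/cintegrable_conj/ifE.
  by rewrite cintegral_conj.
rewrite cfubini; last first.
  apply: (cintegrable_lec (c := 1) mh2 ip) => z; rewrite /h2 !cabsM cabs_expi mulr1 cabs_conj wc.
  by rewrite mul1r cabsM cabs_expi mulr1.
apply: eq_cintegral => x'; rewrite -gE -cintegralZ; last first.
  apply: (cintegrable_lec (c := 1) _ wi).
    apply: cmeasurableM => //; apply: cmeasurable_expi; apply: measurable_funB.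
      exact: (measurableT_comp mphi (pair1_measurable x)).
    exact: (measurableT_comp mphi (pair1_measurable x')).
  by move=> y; rewrite cabsM cabs_expi mulr1 mul1r.
apply: eq_cintegral => y; rewrite expiD -conj_expi.
have -> : h2 (y, x') = (w k y)%:C * expi (phi (x, y)) * ((f x')^* * (expi (phi (x', y)))^*).
  by rewrite /h2 /fst /snd; congr (_ * _); exact: rmorphM.
by ring.
Qed.

Hypothesis f2 : (\int[mu]_x (cabs (f x) ^+ 2)%:E < +oo)%E.

(** Schur's test: with [|f x| |f x'| <= (|f x| ^ 2 + |f x'| ^ 2) / 2] each half of the double
    integral sees the kernel [g k] integrated in one variable, which costs [C]. *)
Let le_weighted k :
  (\int[nu]_y (w k y * cabs (fourier f y) ^+ 2)%:E <= C%:E * \int[mu]_x (cabs (f x) ^+ 2)%:E)%E.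
Proof.
have iwF : nu.-integrable setT (fun y => (w k y * cabs (fourier f y) ^+ 2)%:E).
  apply: (@le_integrable _ _ _ _ _ _ _ (fun y => (B ^+ 2)%:E * (w k y)%:E)%E) => //.
  - apply/measurable_EFinP; apply: measurable_funM.
      by apply/measurable_EFinP; exact: measurable_int (iw k).
    by apply: measurable_funX; apply: measurable_cabs; exact: cmeasurable_fourier.
  - move=> y _; rewrite /= lee_fin !ger0_norm ?mulr_ge0 ?exprn_ge0 ?sqr_ge0 ?cabs_ge0//.
    by rewrite mulrC ler_wpM2r// lerXn2r ?nnegrE ?cabs_ge0 ?cabs_fourier.
  - exact: (integrableZl measurableT (B ^+ 2) (iw k)).
have mwF : measurable_fun setT (fun y => w k y * cabs (fourier f y) ^+ 2).
  by apply/measurable_EFinP; exact: measurable_int iwF.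
have e1 : (\int[nu]_y (w k y * cabs (fourier f y) ^+ 2)%:E)%E =
   (complex.Re (cintegral nu setT (fun y => (w k y * cabs (fourier f y) ^+ 2)%:C)))%:E.
  by rewrite /cintegral /= /Rintegral fineK//; exact: integrable_fin_num.
rewrite e1 weighted_eq.
have mgc : cmeasurable (fun z : X * X => (f z.2)^* * (g k z)%:C).
  apply: cmeasurableM; last exact: cmeasurableC.
  exact: (cmeasurable_comp measurable_snd (cmeasurable_conj mf)).
have mgx : cmeasurable (fun x => cintegral mu setT (fun x' => (f x')^* * (g k (x, x'))%:C)).
  exact: (cmeasurable_cintegral mu mgc).
have mff : cmeasurable (fun x => f x * cintegral mu setT (fun x' => (f x')^* * (g k (x, x'))%:C)).
  exact: cmeasurableM.
apply: (@le_trans _ _ (cabs (cintegral mu setT (fun x => f x * cintegral mu setT (fun x' => (f x')^* * (g k (x, x'))%:C))))%:E).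
  by rewrite lee_fin (le_trans (ler_norm _))// normRe_cabs.
apply: (le_trans (cabs_cintegral mu mff)).
have gcE x x' : cabs ((f x')^* * (g k (x, x'))%:C) = cabs (f x') * g k (x, x').
  by rewrite cabsM cabs_conj cabsC ger0_norm.
pose F1 (z : X * X) := ((cabs (f z.1) ^+ 2)%:E * (g k z)%:E)%E.
pose F2 (z : X * X) := ((cabs (f z.2) ^+ 2)%:E * (g k z)%:E)%E.
have mc2 : measurable_fun setT (fun x => (cabs (f x) ^+ 2)%:E).
  by apply/measurable_EFinP; apply: measurable_funX; exact: measurable_cabs.
have mgE : measurable_fun setT (fun z => (g k z)%:E) by exact/measurable_EFinP.
have mF1 : measurable_fun setT F1.
  apply: emeasurable_funM => //; exact: (measurableT_comp mc2 measurable_fst).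
have mF2 : measurable_fun setT F2.
  apply: emeasurable_funM => //; exact: (measurableT_comp mc2 measurable_snd).
have F10 z : (0 <= F1 z)%E by rewrite /F1 -EFinM lee_fin mulr_ge0 ?sqr_ge0.
have F20 z : (0 <= F2 z)%E by rewrite /F2 -EFinM lee_fin mulr_ge0 ?sqr_ge0.
pose F3 (z : X * X) := ((cabs (f z.1))%:E * ((cabs (f z.2))%:E * (g k z)%:E))%E.
have mF3 : measurable_fun setT F3.
  apply: emeasurable_funM.
    exact: (measurableT_comp (measurable_ecabs mf) measurable_fst).
  apply: emeasurable_funM => //; exact: (measurableT_comp (measurable_ecabs mf) measurable_snd).
have F30 z : (0 <= F3 z)%E by rewrite /F3 -!EFinM lee_fin !mulr_ge0 ?cabs_ge0.
apply: (@le_trans _ _ (\int[mu]_x \int[mu]_x' F3 (x, x'))%E).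
  apply: ge0_le_integral => //.
  - by move=> x _; rewrite lee_fin cabs_ge0.
  - exact: measurable_ecabs.
  - exact: (measurable_fun_fubini_tonelli_F F3).
  - move=> x _; rewrite /F3 /= cabsM EFinM ge0_integralZl//.
    + apply: lee_wpmul2l; first by rewrite lee_fin cabs_ge0.
      apply: (le_trans (cabs_cintegral mu (cmeasurable_comp (pair1_measurable x) mgc))).
      by under eq_integral do rewrite /= gcE EFinM.
    + apply: emeasurable_funM; first exact: measurable_ecabs.
      exact: (measurableT_comp mgE (pair1_measurable x)).
    + by move=> x' _; rewrite -EFinM lee_fin mulr_ge0 ?cabs_ge0.
    + by rewrite lee_fin cabs_ge0.
pose F4 z := ((2^-1)%:E * F1 z + (2^-1)%:E * F2 z)%E.
have H20 : (0 <= (2^-1)%:E :> \bar R)%E by rewrite lee_fin.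
apply: (@le_trans _ _ (\int[mu]_x \int[mu]_x' F4 (x, x'))%E).
  apply: ge0_le_integral => //.
  - by move=> x _; apply: integral_ge0.
  - exact: (measurable_fun_fubini_tonelli_F F3).
  - apply: (measurable_fun_fubini_tonelli_F F4).
      by apply: emeasurable_funD; exact: emeasurable_funM.
    by move=> z; rewrite adde_ge0// mule_ge0.
  - move=> x _; apply: ge0_le_integral => //.
    + exact: (measurableT_comp mF3 (pair1_measurable x)).
    + by apply: emeasurable_funD; apply: emeasurable_funM => //;
        [exact: (measurableT_comp mF1 (pair1_measurable x))|exact: (measurableT_comp mF2 (pair1_measurable x))].
    + move=> x' _; rewrite /F3 /F4 /F1 /F2 -!EFinM -EFinD lee_fin /=.
      set a := cabs (f x); set b := cabs (f x'); set G := g k _.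
      rewrite -subr_ge0 (_ : _ - _ = 2^-1 * (a - b) ^+ 2 * G); last by field.
      by apply: mulr_ge0; [apply: mulr_ge0; [rewrite invr_ge0|exact: sqr_ge0]|exact: g0].
have E4 : (\int[mu]_x \int[mu]_x' F4 (x, x') =
   (2^-1)%:E * (\int[mu]_x \int[mu]_x' F1 (x, x')) + (2^-1)%:E * (\int[mu]_x \int[mu]_x' F2 (x, x')))%E.
  have fF1 : measurable_fun setT (fun x => \int[mu]_x' F1 (x, x'))%E.
    exact: (measurable_fun_fubini_tonelli_F F1 mF1 F10).
  have fF2 : measurable_fun setT (fun x => \int[mu]_x' F2 (x, x'))%E.
    exact: (measurable_fun_fubini_tonelli_F F2 mF2 F20).
  rewrite -!ge0_integralZl//; try by move=> x _; apply: integral_ge0.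
  rewrite -ge0_integralD//; try by move=> x _; rewrite mule_ge0// integral_ge0.
  - apply: eq_integral => x _.
    have mF1x := measurableT_comp mF1 (pair1_measurable x).
    have mF2x := measurableT_comp mF2 (pair1_measurable x).
    rewrite -!ge0_integralZl// -ge0_integralD//.
    + by move=> x' _; rewrite mule_ge0.
    + exact: emeasurable_funM.
    + by move=> x' _; rewrite mule_ge0.
    + exact: emeasurable_funM.
  - exact: emeasurable_funM.
  - exact: emeasurable_funM.
pose I2 := (\int[mu]_x (cabs (f x) ^+ 2)%:E)%E.
have C0 : 0 <= C.
  by rewrite -lee_fin (le_trans _ (gC1 k point))// integral_ge0// => x' _; rewrite lee_fin.
have I1 : (\int[mu]_x \int[mu]_x' F1 (x, x') <= C%:E * I2)%E.
  rewrite /I2 -ge0_integralZl//; last by move=> x _; rewrite lee_fin sqr_ge0.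
  apply: ge0_le_integral => //.
  - by move=> x _; exact: integral_ge0.
  - exact: (measurable_fun_fubini_tonelli_F F1).
  - exact: emeasurable_funM.
  - move=> x _; rewrite /F1 /= ge0_integralZl//.
    + by rewrite muleC; apply: lee_wpmul2r => //; rewrite lee_fin sqr_ge0.
    + exact: (measurableT_comp mgE (pair1_measurable x)).
    + by move=> x' _; rewrite lee_fin.
    + by rewrite lee_fin sqr_ge0.
have I2' : (\int[mu]_x \int[mu]_x' F2 (x, x') <= C%:E * I2)%E.
  rewrite (fubini_tonelli F2)// /I2 -ge0_integralZl//; last by move=> x _; rewrite lee_fin sqr_ge0.
  apply: ge0_le_integral => //.
  - by move=> x _; exact: integral_ge0.
  - exact: (measurable_fun_fubini_tonelli_G F2).
  - exact: emeasurable_funM.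
  - move=> x _; rewrite /F2 /= ge0_integralZl//.
    + by rewrite muleC; apply: lee_wpmul2r => //; rewrite lee_fin sqr_ge0.
    + exact: (measurableT_comp mgE (pair2_measurable x)).
    + by move=> x' _; rewrite lee_fin.
    + by rewrite lee_fin sqr_ge0.
rewrite E4 -/I2; apply: (@le_trans _ _ ((2^-1)%:E * (C%:E * I2) + (2^-1)%:E * (C%:E * I2))%E).
  by apply: leeD; apply: lee_wpmul2l.
have h1 : 2^-1 + 2^-1 = 1 :> R by field.
by rewrite -ge0_muleDl// -EFinD h1 mul1e.
Qed.

(** The weighted bounds are uniform in [k], and Fatou's lemma removes the weights, which tend to
    [1]. Keeping phase and kernel abstract lets one proof serve the line and [Rn]. *)
Lemma plancherel_le :
  (\int[nu]_y (cabs (fourier f y) ^+ 2)%:E <= C%:E * \int[mu]_x (cabs (f x) ^+ 2)%:E)%E.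
Proof.
have mF : measurable_fun setT (fun y => cabs (fourier f y) ^+ 2).
  by apply: measurable_funX; apply: measurable_cabs; exact: cmeasurable_fourier.
have mwF k : measurable_fun setT (fun y => (w k y * cabs (fourier f y) ^+ 2)%:E).
  apply/measurable_EFinP; apply: measurable_funM => //.
  by apply/measurable_EFinP; exact: measurable_int (iw k).
have wF0 k y : (0 <= (w k y * cabs (fourier f y) ^+ 2)%:E)%E by rewrite lee_fin mulr_ge0 ?sqr_ge0.
apply: (fatou_le mwF wF0); last by near=> k; exact: le_weighted.
move=> y; apply: cvg_EFin; first by near=> k.
by rewrite -[X in _ --> X]mul1r; apply: cvgMl; exact: w1.
Unshelve. all: by end_near. Qed.

End plancherel_abstract.

Section product_cintegral.
Context d1 d2 (X : measurableType d1) (Y : measurableType d2) (R : realType).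
Variables (mu : {sigma_finite_measure set X -> \bar R})
  (nu : {sigma_finite_measure set Y -> \bar R}).

Lemma Rintegral_prod (f : X * Y -> R) : (mu \x nu)%E.-integrable setT (EFin \o f) ->
  \int[mu]_x \int[nu]_y f (x, y) = \int[(mu \x nu)%E]_z f z.
Proof.
move=> fi; have mf : measurable_fun setT f.
  by apply/measurable_EFinP; exact: measurable_int fi.
rewrite /Rintegral; congr fine; rewrite -(integral12_prod_meas1 fi).
apply: ae_eq_integral => //.
- by apply/measurable_EFinP; exact: measurable_fun_Rintegral.
- exact: (measurable_fubini_F fi).
- have := ae_integrable1 fi; apply: filterS => x /= ix _.
  by rewrite fineK//; exact: integrable_fin_num.
Qed.

Lemma cintegral_prod (f : X * Y -> R[i]) : cintegrable (mu \x nu)%E f ->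
  cintegral (mu \x nu)%E setT f = cintegral mu setT (fun x => cintegral nu setT (fun y => f (x, y))).
Proof.
move=> /cintegrableP[f1 f2]; apply: complex_ext; rewrite /cintegral /=; apply/esym.
- exact: (Rintegral_prod (f := fun z => complex.Re (f z))).
- exact: (Rintegral_prod (f := fun z => complex.Im (f z))).
Qed.

End product_cintegral.

Lemma cintegrable_push d1 d2 (X : measurableType d1) (Y : measurableType d2) (R : realType)
    (mu : {measure set X -> \bar R}) (nu : {measure set Y -> \bar R}) (phi : X -> Y) (g : Y -> R[i]) :
  measurable_fun setT phi -> (forall A, measurable A -> nu A = mu (phi @^-1` A)) ->
  cmeasurable g -> cintegrable mu (fun x => g (phi x)) ->
  cintegrable nu g /\ cintegral nu setT g = cintegral mu setT (fun x => g (phi x)).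
Proof.
move=> mphi E mg gi.
have ige (h : Y -> R) : measurable_fun setT h -> mu.-integrable setT (EFin \o (h \o phi)) ->
    nu.-integrable setT (EFin \o h) /\ \int[nu]_y h y = \int[mu]_x h (phi x).
  move=> mh hi.
  have ih : nu.-integrable setT (EFin \o h).
    apply/integrableP; split; first exact/measurable_EFinP.
    rewrite (ge0_integral_push mphi E)//; last first.
      by apply: measurableT_comp => //; exact/measurable_EFinP.
    by have /integrableP[] := hi.
  split => //; rewrite /Rintegral; congr fine.
  rewrite integralE [RHS]integralE; congr (_ - _)%E.
  - rewrite (ge0_integral_push mphi E)//; last by apply: measurable_funepos; exact/measurable_EFinP.
    by apply: eq_integral => x _; rewrite unlock.
  - rewrite (ge0_integral_push mphi E)//; last by apply: measurable_funeneg; exact/measurable_EFinP.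
    by apply: eq_integral => x _; rewrite unlock.
have [g1 g2] := mg; have /cintegrableP[gi1 gi2] := gi.
have [h1 e1] := ige _ g1 gi1; have [h2 e2] := ige _ g2 gi2.
by split; [apply/cintegrableP|rewrite /cintegral e1 e2].
Qed.

Section product_Rn.
Context {R : realType}.
Local Notation leb := (@lebesgue_measure R).

Lemma cmeasurable_prod_coord n (u : 'I_n -> R -> R[i]) : (forall i, cmeasurable (u i : measurableTypeR R -> _)) ->
  cmeasurable (fun x : Rn R n => \prod_i u i (x ord0 i)).
Proof.
elim: n u => [|n IH] u mu_; first by under eq_fun do rewrite big_ord0; exact: cmeasurable_cst.
under eq_fun do rewrite big_ord_recl.
apply: cmeasurableM; first exact: (cmeasurable_comp (measurable_coord ord0) (mu_ ord0)).
have := cmeasurable_comp (measurableT_comp measurable_fst (@measurable_Rn_uncons R n)) (IH (fun i => u (lift ord0 i)) (fun i => mu_ _)).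
by under eq_fun do under eq_bigr do rewrite /Rn_uncons /= mxE.
Qed.

Lemma cintegral_prod_coord n (u : 'I_n -> R -> R[i]) : (forall i, cintegrable leb (u i)) ->
  cintegrable (lebRn n) (fun x : Rn R n => \prod_i u i (x ord0 i)) /\
  cintegral (lebRn n) setT (fun x : Rn R n => \prod_i u i (x ord0 i)) = \prod_i cintegral leb setT (u i).
Proof.
elim: n u => [|n IH] u iu.
  rewrite big_ord0; under eq_fun do rewrite big_ord0.
  split.
    split; first exact: cmeasurable_cst.
    by rewrite cabs1 integral_cst// mul1e /= diracT ltry.
  apply: complex_ext; rewrite /cintegral /= Rintegral_cst//= ?mul0r//.
  by rewrite indicT mul1r.
have [i1 e1] := IH (fun i => u (lift ord0 i)) (fun i => iu _).
have mp : cmeasurable (fun x : Rn R n.+1 => \prod_i u i (x ord0 i)).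
  by apply: cmeasurable_prod_coord => i; case: (iu i).
have ip := cintegrable_prod i1 (iu ord0).
have E z : \prod_i u i (Rn_cons z ord0 i) = (\prod_i u (lift ord0 i) (z.1 ord0 i)) * u ord0 z.2.
  rewrite big_ord_recl mulrC mxE unlift_none; congr (_ * _).
  by apply: eq_bigr => i _; rewrite mxE liftK.
have ic : cintegrable (lebRn n \x leb)%E (fun z => \prod_i u i (Rn_cons z ord0 i)).
  by under eq_fun do rewrite E.
have [i2 e2] := cintegrable_push (nu := lebRn n.+1) (@measurable_Rn_cons R n) (fun A _ => erefl) mp ic.
split; first exact: i2.
etransitivity; first exact: e2.
etransitivity; first exact: (cintegral_prod ic).
rewrite big_ord_recl -e1.
transitivity (cintegral (lebRn n) setT (fun x => cintegral leb setT (u ord0) * \prod_i u (lift ord0 i) (x ord0 i))).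
  apply: eq_cintegral => x; under eq_cintegral do rewrite E /=.
  by rewrite (cintegralZ _ (iu ord0)) mulrC.
by rewrite (cintegralZ _ i1).
Qed.

End product_Rn.

Section plancherel.
Context {R : realType}.
Local Notation leb := (@lebesgue_measure R).

Lemma poissonBC (d x y : R) : poisson d (x - y) = poisson d (y - x).
Proof. by rewrite /poisson -(opprB y x) sqrrN. Qed.

Let e (k : nat) : R := k.+1%:R^-1.
Let e0 k : 0 < e k. Proof. by rewrite invr_gt0. Qed.

Let wexp_cvg1 (s : R) : wexp (e k) s @[k --> \oo] --> (1 : R).
Proof.
have c : - e k * `|s| @[k --> \oo] --> (0 : R).
  rewrite -[X in _ --> X](mul0r `|s|); apply: cvgMl; rewrite -oppr0; apply: cvgN.
  exact: cvg_harmonic.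
rewrite -(@expR0 R); exact: (fun A HA => c _ (@continuous_expR R 0 A HA)).
Qed.

Let iwexp k : leb.-integrable setT (fun s => (wexp (e k) s)%:E).
Proof. exact: integrable_wexp. Qed.

Let cwexp k (x : R) : cintegrable leb (fun s : measurableTypeR R => (wexp (e k) s)%:C * expi (x * s)).
Proof.
apply: (cintegrable_le (h := wexp (e k) : measurableTypeR R -> R)) => //.
  apply: cmeasurableM; first by apply: cmeasurableC; exact: measurable_wexp.
  by apply: cmeasurable_expi; exact: mulrl_measurable.
by move=> s; rewrite cabsM cabs_expi mulr1 cabsC ger0_norm// wexp_ge0.
Qed.

Let mpois k : measurable_fun [set: R] (poisson (e k)).
Proof. by apply: continuous_measurable_fun; exact: continuous_poisson. Qed.

Let cpoisson k (x : R) : cintegrable leb (fun s : measurableTypeR R => (poisson (e k) (x - s))%:C) /\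
  cintegral leb setT (fun s : measurableTypeR R => (poisson (e k) (x - s))%:C) = (2 * pi)%:C.
Proof.
have mp : measurable_fun [set: R] (fun s => poisson (e k) (x - s)).
  by apply: (measurableT_comp (mpois k)); exact: measurable_funB.
have E : (\int[leb]_s (poisson (e k) (x - s))%:E = (2 * pi)%:E)%E.
  rewrite -(integral_poisson (e0 k)).
  have := @ge0_integral_affineN R (-1) x (fun s => (poisson (e k) s)%:E).
  rewrite normrN normr1 invr1 mul1e => <-//.
  - by apply: eq_integral => s _; rewrite mulN1r addrC.
  - exact/measurable_EFinP.
  - by move=> s; rewrite lee_fin poisson_ge0// ltW.
split.
  split; first exact: cmeasurableC.
  under eq_integral do rewrite cabsC ger0_norm ?poisson_ge0 ?(ltW (e0 k))//.
  by rewrite E ltry.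
by rewrite cintegralC /Rintegral E.
Qed.

Definition fourierR (h : R -> R[i]) (t : R) : R[i] :=
  cintegral leb setT (fun s : measurableTypeR R => h s * expi (s * t)).

Lemma plancherel_R (h : R -> R[i]) : cintegrable leb h ->
  (\int[leb]_t (cabs (fourierR h t) ^+ 2)%:E <= (2 * pi)%:E * \int[leb]_s (cabs (h s) ^+ 2)%:E)%E.
Proof.
move=> hi; have [h2|] := ltP (\int[leb]_s (cabs (h s) ^+ 2)%:E)%E +oo%E; last first.
  by rewrite leye_eq => /eqP ->; rewrite gt0_muley ?leey// lte_fin mulr_gt0// pi_gt0.
have mphi : measurable_fun [set: measurableTypeR R * measurableTypeR R] (fun z => z.1 * z.2 : R).
  by apply: measurable_funM; [exact: measurable_fst|exact: measurable_snd].
apply: (@plancherel_le _ _ _ _ _ leb leb _ mphi (fun k => wexp (e k))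
  (fun k z => poisson (e k) (z.1 - z.2)) (2 * pi)) => //.
- move=> k y; exact: wexp_ge0.
- move=> k; apply: (measurableT_comp (mpois k)).
  by apply: measurable_funB; [exact: measurable_fst|exact: measurable_snd].
- by move=> k z; rewrite poisson_ge0// ltW.
- by move=> k x x' /=; rewrite -cintegral_wexp//; apply: eq_cintegral => s; rewrite -mulrBl.
- move=> k x /=; have [/cintegrableP[i1 _] /(congr1 (@complex.Re R))] := cpoisson k x.
  by rewrite /cintegral /= => <-; rewrite /Rintegral fineK//; exact: integrable_fin_num.
- move=> k x /=; have [/cintegrableP[i1 _] /(congr1 (@complex.Re R))] := cpoisson k x.
  rewrite /cintegral /= => <-; rewrite /Rintegral fineK; last exact: integrable_fin_num i1.
  rewrite le_eqVlt; apply/orP; left; apply/eqP; apply: eq_integral => s _.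
  by rewrite poissonBC.
Qed.

Definition fourierRn n (f : Rn R n -> R[i]) (xi : Rn R n) : R[i] :=
  cintegral (lebRn n) setT (fun x => f x * expi (- dot x xi)).

Lemma expi_sum n (a : 'I_n -> R) : expi (\sum_i a i) = \prod_i expi (a i).
Proof. by elim/big_ind2 : _ => //; [exact: expi0|move=> ? ? ? ? <- <-; exact: expiD]. Qed.

Lemma measurable_dot n d (T : measurableType d) (u v : T -> Rn R n) :
  measurable_fun setT u -> measurable_fun setT v -> measurable_fun setT (fun z => dot (u z) (v z)).
Proof.
move=> mu_ mv; apply: measurable_sum => i.
by apply: measurable_funM; [exact: (measurableT_comp (measurable_coord i) mu_)|exact: (measurableT_comp (measurable_coord i) mv)].
Qed.

(** Weights and kernels are products over the coordinates of the one-dimensional ones, so the row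
    integrals, and with them the constant, are [n]-th powers. *)
Lemma plancherel_Rn n (f : Rn R n -> R[i]) : cintegrable (lebRn n) f ->
  (\int[lebRn n]_xi (cabs (fourierRn f xi) ^+ 2)%:E <=
   ((2 * pi) ^+ n)%:E * \int[lebRn n]_x (cabs (f x) ^+ 2)%:E)%E.
Proof.
move=> fi; have [f2|] := ltP (\int[lebRn n]_s (cabs (f s) ^+ 2)%:E)%E +oo%E; last first.
  by rewrite leye_eq => /eqP ->; rewrite gt0_muley ?leey// lte_fin exprn_gt0// mulr_gt0// pi_gt0.
have mphi : measurable_fun [set: Rn R n * Rn R n] (fun z => - dot z.1 z.2 : R).
  by apply: measurable_funN; apply: measurable_dot; [exact: measurable_fst|exact: measurable_snd].
have iwn k : (lebRn n).-integrable setT (fun y : Rn R n => (\prod_i wexp (e k) (y ord0 i))%:E).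
  have [|/cintegrableP[+ _] _] := @cintegral_prod_coord R n (fun _ s => (wexp (e k) s)%:C * expi (0 * s)).
    by move=> i; exact: cwexp.
  apply: eq_integrable => // y _; congr EFin.
  under eq_bigr do rewrite mul0r expi0 mulr1.
  by rewrite -rmorph_prod.
have pois k (x : Rn R n) : (\int[lebRn n]_x' (\prod_i poisson (e k) (x ord0 i - x' ord0 i))%:E = ((2 * pi) ^+ n)%:E)%E.
  have [|i0 E0] := @cintegral_prod_coord R n (fun i s => (poisson (e k) (x ord0 i - s))%:C).
    by move=> i; case: (cpoisson k (x ord0 i)).
  have [i1 _] := (cintegrableP _ _).1 i0.
  have : \prod_(i < n) cintegral leb setT (fun s : measurableTypeR R => (poisson (e k) (x ord0 i - s))%:C) = ((2 * pi) ^+ n)%:C.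
    rewrite (eq_bigr (fun=> (2 * pi)%:C)); last by move=> i _; exact: (cpoisson k _).2.
    by rewrite prodr_const card_ord -rmorphXn.
  rewrite -E0 => /(congr1 (@complex.Re R)); rewrite /cintegral /=.
  move=> E1; rewrite -E1 /Rintegral fineK; last exact: integrable_fin_num i1.
  by apply: eq_integral => y _; rewrite -rmorph_prod.
apply: (@plancherel_le _ _ _ _ _ (lebRn n) (lebRn n) _ mphi (fun k y => \prod_i wexp (e k) (y ord0 i))
  (fun k z => \prod_i poisson (e k) (z.1 ord0 i - z.2 ord0 i)) ((2 * pi) ^+ n)) => //.
- by move=> k y; apply: prodr_ge0 => i _; exact: wexp_ge0.
- move=> y; rewrite [X in _ --> X](_ : 1 = \prod_(i < n) 1 :> R); last by rewrite big1.
  by apply: cvg_big => [|i _]; [exact: (@mul_continuous R)|exact: wexp_cvg1].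
- move=> k; apply: measurable_prod => i _.
  apply: (measurableT_comp (mpois k)).
  by apply: measurable_funB; [exact: (measurableT_comp (measurable_coord i) measurable_fst)|exact: (measurableT_comp (measurable_coord i) measurable_snd)].
- by move=> k z; apply: prodr_ge0 => i _; rewrite poisson_ge0// ltW.
- move=> k x x' /=.
  rewrite rmorph_prod.
  have [|_ H] := @cintegral_prod_coord R n (fun i s => (wexp (e k) s)%:C * expi ((x' ord0 i - x ord0 i) * s)).
    by move=> i; exact: cwexp.
  transitivity (\prod_i cintegral leb setT (fun s : measurableTypeR R => (wexp (e k) s)%:C * expi ((x' ord0 i - x ord0 i) * s))).
    rewrite -H; apply: eq_cintegral => y; rewrite big_split /=; congr (_ * _).
      by rewrite rmorph_prod.
    rewrite -expi_sum; congr expi; rewrite /dot opprK addrC -sumrB.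
    by apply: eq_bigr => i _; rewrite mulrBl.
  apply: eq_bigr => i _; rewrite cintegral_wexp//; congr (_%:C).
  by rewrite poissonBC.
- by move=> k x /=; rewrite pois.
- move=> k x /=; rewrite -(pois k x) le_eqVlt; apply/orP; left; apply/eqP; apply: eq_integral => y _.
  by congr EFin; apply: eq_bigr => i _; rewrite poissonBC.
Qed.

End plancherel.

(** * The frequency operator and its L^q bound *)

Section integral_R_halves.
Context {R : realType}.
Local Notation leb := (@lebesgue_measure R).

Lemma measurable_pos : measurable_fun [set: R] (fun s : R => 0 < s).
Proof. exact: measurable_fun_ltr. Qed.

Lemma ge0_integral_halves (g : R -> \bar R) : measurable_fun [set: R] g -> (forall s, (0 <= g s)%E) ->
  (\int[leb]_s g s = \int[leb]_s ((0 < s)%R%:R%:E * g s) + \int[leb]_s ((0 < s)%R%:R%:E * g (- s)%R))%E.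
Proof.
move=> mg g0.
have mgN : measurable_fun [set: R] (fun s => g (- s)).
  by apply: (measurableT_comp mg).
have mi : measurable_fun [set: R] (fun s : R => (0 < s)%R%:R%:E : \bar R).
  by apply/measurable_EFinP/measurable_bool_natr; exact: measurable_pos.
have i0 (b : bool) : (0 <= (b%:R%:E : \bar R))%E by rewrite lee_fin.
have mp : measurable_fun [set: R] (fun s => (0 < s)%R%:R%:E * g s)%E by exact: emeasurable_funM.
have mpN : measurable_fun [set: R] (fun s => (0 < s)%R%:R%:E * g (- s)%R)%E by exact: emeasurable_funM.
have mn : measurable_fun [set: R] (fun s => (0 < - s)%R%:R%:E * g (- - s)%R)%E.
  by apply: (measurableT_comp mpN).
rewrite -[X in (_ + X)%E](ge0_integral_opp mpN); last by move=> s; rewrite mule_ge0.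
rewrite -ge0_integralD//; try by move=> s _; rewrite mule_ge0.
have m0 : measurable [set (0 : R)] by [].
apply: ae_eq_integral => //; first exact: emeasurable_funD.
exists [set 0]; split => //; first exact: lebesgue_measure_set1.
move=> s /= ; apply: contra_notP => s0 _; rewrite opprK.
have [sp|sn|s00] := ltrgt0P s.
- by rewrite oppr_gt0 ltNge (ltW sp) /= mul1e mul0e adde0.
- by rewrite oppr_gt0 sn mul1e mul0e add0e.
- by exfalso; apply: s0.
Qed.

Lemma integral_abs_powR_head (a rho : R) : 0 < a -> 0 < rho ->
  (\int[leb]_s ((`|s| <= rho)%R%:R * `|s| `^ (a - 1))%:E <= (2 * (rho `^ a / a))%:E)%E.
Proof.
move=> a0 r0.
have mi (r : R) : measurable_fun [set: R] (fun s : R => (`|s| <= r)%R%:R * `|s| `^ (a - 1)).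
  apply: measurable_funM.
    by apply: measurable_bool_natr; apply: measurable_fun_ler => //; exact: measurableT_comp.
  by apply: (measurableT_comp (measurable_powR _)); exact: normr_measurable.
rewrite ge0_integral_halves; last 2 first.
- exact/measurable_EFinP.
- by move=> s; rewrite lee_fin mulr_ge0 ?powR_ge0.
have E : (\int[leb]_s ((0 < s)%R%:R%:E * ((`|s| <= rho)%R%:R * `|s| `^ (a - 1))%:E) <= (rho `^ a / a)%:E)%E.
  apply: le_trans (integral_powR_head a0 r0).
  rewrite (_ : `]0%R, rho]%classic = [set s : R | 0 < s <= rho]); last first.
    by apply/seteqP; split => s /=; rewrite in_itv.
  rewrite integral_bool_natr le_eqVlt; apply/orP; left; apply/eqP; apply: eq_integral => s _.
  case: (ltP 0 s) => s0; last by rewrite !mul0e.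
  by rewrite mul1e gtr0_norm //= EFinM.
apply: (@le_trans _ _ ((rho `^ a / a)%:E + (rho `^ a / a)%:E)%E).
  by under [X in (_ + X)%E]eq_integral do rewrite normrN; exact: (leeD E E).
by rewrite -EFinD lee_fin mulr_natl mulr2n.
Qed.

End integral_R_halves.

Section sphere_finite.
Context {R : realType} (n : nat).
Local Notation leb := (@lebesgue_measure R).

Lemma normr_coord_enorm m (x : Rn R m) (i : 'I_m) : `|x ord0 i| <= enorm x.
Proof.
rewrite /enorm -sqrtr_sqr ler_wsqrtr// /dot (bigD1 i)//= -expr2 lerDl sumr_ge0// => j _.
by rewrite -expr2 sqr_ge0.
Qed.

(** The cone over the whole sphere lies in the cube of points with coordinates in [[-1, 1]], whose
    indicator is a product of integrable functions of one variable. *)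
Lemma sphere_measure_finite : (@sphere_measure R n.+1 setT < +oo)%E.
Proof.
pose u (i : 'I_n.+1) (s : R) : R[i] := (`|s| <= 1)%R%:R%:C.
have iu i : cintegrable leb (u i).
  apply: (cintegrable_le (h := (fun s => (`|s| <= 1)%R%:R : R) : measurableTypeR R -> R)).
  - apply: cmeasurableC; apply: measurable_bool_natr.
    by apply: measurable_fun_ler => //; exact: normr_measurable.
  - apply/integrableP; split.
      apply/measurable_EFinP/measurable_bool_natr.
      by apply: measurable_fun_ler => //; exact: normr_measurable.
    under eq_integral do rewrite gee0_abs ?lee_fin//.
    apply: le_lt_trans (ltry (2 * (1 `^ 1 / 1))).
    apply: le_trans (integral_abs_powR_head ltr01 ltr01).
    rewrite le_eqVlt; apply/orP; left; apply/eqP; apply: eq_integral => s _.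
    by rewrite subrr powRr0 mulr1.
  - by move=> s; rewrite /u cabsC ger0_norm.
have [[_ +] _] := cintegral_prod_coord iu.
move=> H; have mc := measurable_cone (@measurableT _ (@sphere R n.+1)).
rewrite /sphere_measure /mscale /= lte_mul_pinfty//; apply: le_lt_trans H.
rewrite -(setIT (cone setT)) -[leLHS]/(lebRn n.+1 (cone setT `&` setT)) -integral_indic//.
apply: ge0_le_integral => //.
- by apply/measurable_EFinP; exact: measurable_indic.
- by apply: measurable_ecabs; apply: cmeasurable_prod_coord => i; case: (iu i).
- move=> x _; rewrite lee_fin indicE; case: (boolP (x \in _)) => xc; last exact: cabs_ge0.
  move/set_mem: xc => [r [th _ [/andP[r0 r1] ->]]].
  rewrite big1 ?cabs1// => i _; rewrite /u (_ : `|_| <= 1)//.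
  rewrite (le_trans (normr_coord_enorm _ _))// enormZ ?(ltW r0)//.
  by rewrite enorm_sphere mulr1.
Qed.

Lemma sigma_finite_sphere : sigma_finite setT (@sphere_measure R n.+1).
Proof.
exists (fun=> setT); first by rewrite bigcup_const.
by move=> k; split => //; exact: sphere_measure_finite.
Qed.

Definition sphm : {sigma_finite_measure set (@sphere R n.+1) -> \bar R} :=
  sigma_finite_of sigma_finite_sphere.

End sphere_finite.

Lemma ge0_le_integralT d (T : measurableType d) (R : realType) (mu : {measure set T -> \bar R})
    (f g : T -> \bar R) : measurable_fun setT f -> measurable_fun setT g ->
  (forall x, (0 <= f x)%E) -> (forall x, (f x <= g x)%E) ->
  (\int[mu]_x f x <= \int[mu]_x g x)%E.
Proof. by move=> mf mg f0 fg; apply: ge0_le_integral. Qed.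

(** * The multiplier with cutoff and its L^2 estimate *)

Section frequency_operator.
Context {R : realType} (n : nat).
Local Notation leb := (@lebesgue_measure R).
Local Notation mu := (@lebRn R n.+1).
Local Notation sm := (@sphm R n).
Implicit Types (f : Rn R n.+1 -> R[i]) (F : R -> Rn R n.+1 -> R[i]).

Variables (m : R -> R[i]) (al0 B : R).
Hypothesis mm : cmeasurable (m : measurableTypeR R -> R[i]).
Hypothesis B0 : 0 <= B.
Hypothesis mB : forall s, cabs (m s) <= B * `|s| `^ (- al0).
Hypothesis al1 : al0 < 1.

(** The function to be transformed may depend on the frequency [s], since the splitting used later
    cuts [f] differently at each frequency. The cutoff [|s| <= M] makes the symbol integrable in [s]
    for every integrable [f]. *)
Definition freq_symbol (M : R) F (th : sphere n.+1) (s : R) : R[i] :=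
  (`|s| <= M)%R%:R%:C * m s * fourierRn (F s) (s *: sval th).

Definition freq_op (M : R) F (th : sphere n.+1) (t : R) : R[i] :=
  fourierR (freq_symbol M F th) t.

Lemma cmeasurable_fourier_family d (T : measurableType d) (F : T -> Rn R n.+1 -> R[i]) (xi : T -> Rn R n.+1) :
  cmeasurable (fun z : T * Rn R n.+1 => F z.1 z.2) -> measurable_fun setT xi ->
  cmeasurable (fun y => fourierRn (F y) (xi y)).
Proof.
move=> mF mxi; apply: (@cmeasurable_cintegral _ _ T _ R mu (fun z => F z.1 z.2 * expi (- dot z.2 (xi z.1)))).
apply: cmeasurableM => //; apply: cmeasurable_expi; apply: measurable_funN.
by apply: measurable_dot => //; exact: (measurableT_comp mxi).
Qed.

Lemma measurable_scale_Rn d (T : measurableType d) k (r : T -> R) (f : T -> Rn R k) :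
  measurable_fun setT r -> measurable_fun setT f -> measurable_fun setT (fun z => r z *: f z : Rn R k).
Proof.
move=> mr mf; apply: measurable_fun_coord => i.
rewrite (_ : _ \o _ = fun z => r z * coord i (f z)); last by apply/funext => z; rewrite /coord/= mxE.
apply: measurable_funM => //; exact: (measurableT_comp (measurable_coord i)).
Qed.

Lemma measurable_abs_le d (T : measurableType d) (r : T -> R) (M : R) :
  measurable_fun setT r -> measurable_fun setT (fun z => `|r z| <= M).
Proof. by move=> mr; apply: measurable_fun_ler => //; exact: measurableT_comp. Qed.

Lemma cmeasurable_freq_symbol M F : cmeasurable (fun z : measurableTypeR R * Rn R n.+1 => F z.1 z.2) ->
  cmeasurable (fun z : sphere n.+1 * measurableTypeR R => freq_symbol M F z.1 z.2).
Proof.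
move=> mF; apply: cmeasurableM; first apply: cmeasurableM.
- by apply: cmeasurableC; apply: measurable_bool_natr; exact: measurable_abs_le.
- exact: (cmeasurable_comp measurable_snd mm).
- apply: (@cmeasurable_fourier_family _ _ (fun z => F z.2)).
  + apply: (cmeasurable_comp (f := fun w : measurableTypeR R * Rn R n.+1 => F w.1 w.2)
      (h := fun w : (sphere n.+1 * measurableTypeR R) * Rn R n.+1 => (w.1.2, w.2))) => //.
    by apply: measurable_fun_pair => //; exact: measurableT_comp.
  + apply: measurable_scale_Rn => //.
    by apply: (measurableT_comp (@measurable_sval R n.+1)).
Qed.

Variables (f : Rn R n.+1 -> R[i]) (fi : cintegrable mu f).
Let Sf := fine (\int[mu]_x (cabs (f x))%:E).

Lemma cabs_fourierRn_le (g : Rn R n.+1 -> R[i]) xi : cmeasurable g ->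
  (forall x, cabs (g x) <= cabs (f x)) -> cabs (fourierRn g xi) <= Sf.
Proof.
move=> mg gf; rewrite -lee_fin /Sf fineK; last exact: integrable_fin_num (cintegrable_abs fi).
have mge : cmeasurable (fun x => g x * expi (- dot x xi)).
  apply: cmeasurableM => //; apply: cmeasurable_expi; apply: measurable_funN.
  by apply: measurable_dot.
apply: le_trans (cabs_cintegral mu mge) _; apply: ge0_le_integral => //.
- by move=> x _; rewrite lee_fin cabs_ge0.
- exact: measurable_ecabs.
- by apply: measurable_ecabs; case: fi.
- by move=> x _; rewrite lee_fin cabsM cabs_expi mulr1.
Qed.

Section family.
Variables (M : R) (F : R -> Rn R n.+1 -> R[i]).
Hypothesis M0 : 0 < M.
Hypothesis mF : cmeasurable (fun z : measurableTypeR R * Rn R n.+1 => F z.1 z.2).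
Hypothesis Ff : forall s x, cabs (F s x) <= cabs (f x).

Lemma cmeasurable_F s : cmeasurable (F s).
Proof. exact: (cmeasurable_comp (pair1_measurable (s : measurableTypeR R)) mF). Qed.

Lemma cintegrable_freq_symbol th : cintegrable leb (freq_symbol M F th).
Proof.
apply: (cintegrable_le (h := (fun s => Sf * B * ((`|s| <= M)%R%:R * `|s| `^ (1 - al0 - 1))) : measurableTypeR R -> R)).
- exact: (cmeasurable_comp (pair1_measurable th) (cmeasurable_freq_symbol M mF)).
- under eq_fun do rewrite EFinM.
  apply: integrableZl => //; apply/integrableP; split.
    apply/measurable_EFinP; apply: measurable_funM.
      by apply: measurable_bool_natr; exact: measurable_abs_le.
    by apply: (measurableT_comp (measurable_powR _)); exact: normr_measurable.
  under eq_integral do rewrite gee0_abs ?lee_fin ?mulr_ge0 ?powR_ge0//.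
  apply: le_lt_trans (integral_abs_powR_head _ M0) (ltry _).
  by rewrite subr_gt0.
- move=> s; rewrite /freq_symbol !cabsM cabsC ger0_norm//.
  rewrite (_ : 1 - al0 - 1 = - al0); last by ring.
  rewrite (_ : Sf * B * _ = (`|s| <= M)%R%:R * (B * `|s| `^ (- al0)) * Sf); last by ring.
  apply: ler_pM; rewrite ?mulr_ge0 ?cabs_ge0//.
  + by apply: ler_pM; rewrite ?cabs_ge0.
  + exact: (cabs_fourierRn_le _ (cmeasurable_F s)).
Qed.

Lemma cmeasurable_freq_op : cmeasurable (fun z : Zn R n.+1 => freq_op M F z.1 z.2).
Proof.
apply: (@cmeasurable_cintegral _ _ (Zn R n.+1) (measurableTypeR R) R leb
  (fun w => freq_symbol M F w.1.1 w.2 * expi (w.2 * w.1.2))).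
apply: cmeasurableM.
- apply: (cmeasurable_comp (f := fun z : sphere n.+1 * measurableTypeR R => freq_symbol M F z.1 z.2)
    (h := fun w : Zn R n.+1 * measurableTypeR R => (w.1.1, w.2))); last exact: cmeasurable_freq_symbol.
  by apply: measurable_fun_pair => //; exact: measurableT_comp.
- apply: cmeasurable_expi; apply: measurable_funM => //.
  exact: measurableT_comp.
Qed.

(** In dimension [n.+1] polar coordinates supply [s ^ n], and the multiplier contributes
    [s ^ (- 2 al0)]; the weight is what remains when volume is used instead of [d th ds]. The sign
    [sg] separates positive from negative frequencies. *)
Definition freq_weight (sg : R) (xi : Rn R n.+1) : R :=
  enorm xi `^ (- (2 * al0 + n%:R)) * cabs (fourierRn (F (enorm xi)) (sg *: xi)) ^+ 2.

Lemma freq_weight_ge0 sg xi : 0 <= freq_weight sg xi.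
Proof. by rewrite mulr_ge0 ?powR_ge0 ?sqr_ge0. Qed.

Lemma measurable_freq_weight sg : measurable_fun setT (freq_weight sg).
Proof.
apply: measurable_funM.
  by apply: (measurableT_comp (measurable_powR _)); exact: measurable_enorm.
apply: measurable_funX; apply: measurable_cabs.
apply: (@cmeasurable_fourier_family _ _ (fun xi => F (enorm xi))).
- apply: (cmeasurable_comp (f := fun w : measurableTypeR R * Rn R n.+1 => F w.1 w.2)
      (h := fun w : Rn R n.+1 * Rn R n.+1 => (enorm w.1, w.2))) => //.
  by apply: measurable_fun_pair => //; apply: (measurableT_comp (@measurable_enorm R n.+1)).
- exact: measurable_RnZ.
Qed.

Hypothesis F_even : forall s, F (- s) = F s.

(** Plancherel in [t] for each direction, then a split of the frequency line into two half-lines.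
    [F_even] lets the negative half be written with the positive radius and [sg = - 1], after which
    [polar_le] applies. The indicator of [|s| <= M] is bounded by [1], so [M] disappears. *)
Lemma freq_op_L2 :
  (\int[Zn_measure n.+1]_z (cabs (freq_op M F z.1 z.2) ^+ 2)%:E <=
   (2 * pi * B ^+ 2)%:E * (\int[mu]_xi (freq_weight 1 xi)%:E + \int[mu]_xi (freq_weight (- 1) xi)%:E))%E.
Proof.
have mH := cmeasurable_freq_symbol M mF.
have mop := cmeasurable_freq_op.
pose K (z : Zn R n.+1) := (cabs (freq_op M F z.1 z.2) ^+ 2)%:E.
have mK : measurable_fun setT K.
  by apply/measurable_EFinP; apply: measurable_funX; exact: measurable_cabs.
have K0 z : (0 <= K z)%E by rewrite lee_fin sqr_ge0.
have -> : (\int[Zn_measure n.+1]_z (cabs (freq_op M F z.1 z.2) ^+ 2)%:E =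
   \int[sm]_th \int[leb]_t K (th, t))%E.
  exact: (fubini_tonelli1 (m1 := sm) (m2 := leb) K mK K0).
pose H2 (z : sphere n.+1 * measurableTypeR R) := (cabs (freq_symbol M F z.1 z.2) ^+ 2)%:E.
have mH2 : measurable_fun setT H2.
  by apply/measurable_EFinP; apply: measurable_funX; exact: measurable_cabs.
have H20 z : (0 <= H2 z)%E by rewrite lee_fin sqr_ge0.
have pi20 : (0 <= (2 * pi)%:E :> \bar R)%E by rewrite lee_fin mulr_ge0// pi_ge0.
have PL th : (\int[leb]_t K (th, t) <= (2 * pi)%:E * \int[leb]_s H2 (th, s))%E.
  have ci : cintegrable leb (freq_symbol M F th) by exact: cintegrable_freq_symbol.
  have pl := plancherel_R ci.
  exact: pl.
apply: (@le_trans _ _ (\int[sm]_th ((2 * pi)%:E * \int[leb]_s H2 (th, s)))%E).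
  apply: ge0_le_integral => //.
  - by move=> th _; exact: integral_ge0.
  - exact: (measurable_fun_fubini_tonelli_F K).
  - apply: emeasurable_funM => //; exact: (measurable_fun_fubini_tonelli_F H2).
rewrite ge0_integralZl//; last 2 first.
- exact: (measurable_fun_fubini_tonelli_F H2).
- by move=> th _; exact: integral_ge0.
rewrite (EFinM (2 * pi)%R (B ^+ 2)%R) -muleA; apply: (lee_wpmul2l pi20).
pose P (sg : R) (z : sphere n.+1 * measurableTypeR R) := ((0 < z.2)%R%:R%:E * H2 (z.1, (sg * z.2)%R))%E.
have mP sg : measurable_fun setT (P sg).
  apply: emeasurable_funM.
    by apply/measurable_EFinP/measurable_bool_natr; exact: measurable_fun_ltr.
  apply: (measurableT_comp mH2); apply: measurable_fun_pair => //.
  by apply: measurable_funM.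
have P0 sg z : (0 <= P sg z)%E by apply: mule_ge0; [rewrite lee_fin ler0n|exact: H20].
have HH th : (\int[leb]_s H2 (th, s) = \int[leb]_s P 1%R (th, s) + \int[leb]_s P (- 1)%R (th, s))%E.
  have mg : measurable_fun setT (fun s : measurableTypeR R => H2 (th, s)).
    exact: (measurableT_comp mH2 (pair1_measurable th)).
  have g0 (s : measurableTypeR R) : (0 <= H2 (th, s))%E by exact: H20.
  have hh := ge0_integral_halves mg g0.
  have E1 (s : measurableTypeR R) : ((0 < s)%R%:R%:E * H2 (th, s) = P 1%R (th, s))%E.
    by rewrite -[in H2 (th, s)](mul1r s).
  have E2 (s : measurableTypeR R) : ((0 < s)%R%:R%:E * H2 (th, (- s)%R) = P (- 1)%R (th, s))%E.
    by rewrite -(mulN1r s); reflexivity.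
  have I1 : (\int[leb]_s ((0 < s)%R%:R%:E * H2 (th, s)) = \int[leb]_s P 1%R (th, s))%E.
    by apply: eq_integral => s _; exact: E1.
  have I2 : (\int[leb]_s ((0 < s)%R%:R%:E * H2 (th, (- s)%R)) = \int[leb]_s P (- 1)%R (th, s))%E.
    by apply: eq_integral => s _; exact: E2.
  exact: (etrans hh (f_equal2 (fun a b : \bar R => (a + b)%E) I1 I2)).
have -> : (\int[sm]_th \int[leb]_s H2 (th, s) =
   \int[sm]_th \int[leb]_s P 1%R (th, s) + \int[sm]_th \int[leb]_s P (- 1)%R (th, s))%E.
  rewrite -ge0_integralD//; try by move=> th _; exact: integral_ge0.
  - by apply: eq_integral => th _; exact: HH.
  - exact: (measurable_fun_fubini_tonelli_F (P 1%R)).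
  - exact: (measurable_fun_fubini_tonelli_F (P (-1)%R)).
have L (sg : R) : sg = 1 \/ sg = - 1 ->
    (\int[sm]_th \int[leb]_s P sg (th, s) <= (B ^+ 2)%:E * \int[mu]_xi (freq_weight sg xi)%:E)%E.
  move=> sg1; have mw : measurable_fun setT (fun xi => (freq_weight sg xi)%:E).
    by apply/measurable_EFinP; exact: measurable_freq_weight.
  have mG : measurable_fun setT (fun xi => (B ^+ 2)%:E * (freq_weight sg xi)%:E)%E by exact: emeasurable_funM.
  rewrite -ge0_integralZl//; last 2 first.
  - by move=> xi _; rewrite lee_fin freq_weight_ge0.
  - by rewrite lee_fin sqr_ge0.
  have G0 xi : (0 <= (B ^+ 2)%:E * (freq_weight sg xi)%:E)%E.
    by rewrite mule_ge0 ?lee_fin ?sqr_ge0 ?freq_weight_ge0.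
  apply: le_trans (polar_le mG G0).
  pose Q (z : sphere n.+1 * measurableTypeR R) :=
    ((0 < z.2)%R%:R%:E * (z.2 ^+ n)%:E * ((B ^+ 2)%:E * (freq_weight sg (z.2 *: sval z.1))%:E))%E.
  have mQ : measurable_fun setT Q.
    apply: emeasurable_funM; first apply: emeasurable_funM.
    - by apply/measurable_EFinP/measurable_bool_natr; exact: measurable_fun_ltr.
    - by apply/measurable_EFinP; exact: measurable_funX.
    - apply: (measurableT_comp mG); apply: measurable_scale_Rn => //.
      by apply: (measurableT_comp (@measurable_sval R n.+1)).
  have PQ z : (P sg z <= Q z)%E.
    rewrite /P /Q; case: (ltP 0 z.2) => [s0|]; last by rewrite !mul0e.
    rewrite !mul1e /H2 -!EFinM lee_fin /= /freq_symbol /freq_weight.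
    have es : enorm (z.2 *: sval z.1) = z.2 by rewrite enormZ ?(ltW s0)// enorm_sphere mulr1.
    have Fsg : F (sg * z.2) = F z.2 by case: sg1 => ->; rewrite ?mul1r// mulN1r F_even.
    have asg : `|sg * z.2| = z.2 by case: sg1 => ->; rewrite ?mul1r ?mulN1r ?normrN gtr0_norm.
    rewrite es Fsg asg scalerA !cabsM cabsC !exprMn.
    set X := cabs (fourierRn _ _); have X0 : 0 <= X ^+ 2 by exact: sqr_ge0.
    have -> : z.2 ^+ n * (B ^+ 2 * (z.2 `^ (- (2 * al0 + n%:R)) * X ^+ 2)) = (B * z.2 `^ (- al0)) ^+ 2 * X ^+ 2.
      rewrite exprMn; have <- : z.2 ^+ n * z.2 `^ (- (2 * al0 + n%:R)) = (z.2 `^ (- al0)) ^+ 2.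
        rewrite -(powR_mulrn n (ltW s0)) -(powR_mulrn 2 (powR_ge0 _ _)) -powRrM -powRD; last first.
          by rewrite (gt_eqF s0) implybT.
        by congr (_ `^ _); ring.
      by ring.
    rewrite ler_wpM2r// -[leRHS]mul1r; apply: ler_pM; rewrite ?sqr_ge0//.
      by rewrite normr_nat -natrX lern1; case: (_ <= _).
    by rewrite lerXn2r ?nnegrE ?cabs_ge0 ?mulr_ge0 ?powR_ge0// -{2}asg.
  have PQI th : (\int[leb]_s P sg (th, s) <= \int[leb]_s Q (th, s))%E.
    have m1 : measurable_fun setT (fun s : measurableTypeR R => P sg (th, s)).
      exact: (measurableT_comp (mP sg) (pair1_measurable th)).
    have m2 : measurable_fun setT (fun s : measurableTypeR R => Q (th, s)).
      exact: (measurableT_comp mQ (pair1_measurable th)).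
    exact: (ge0_le_integralT leb m1 m2 (fun s => P0 sg (th, s)) (fun s => PQ (th, s))).
  have m1 := @measurable_fun_fubini_tonelli_F _ _ _ _ R leb (P sg) (mP sg) (P0 sg).
  have m2 := @measurable_fun_fubini_tonelli_F _ _ _ _ R leb Q mQ (fun z => le_trans (P0 sg z) (PQ z)).
  apply: (ge0_le_integralT sm m1 m2 _ PQI) => th.
  by apply: integral_ge0 => s _; exact: P0.
have w0 sg : (0 <= \int[mu]_xi (freq_weight sg xi)%:E)%E by apply: integral_ge0 => xi _; rewrite lee_fin freq_weight_ge0.
rewrite (ge0_muleDr _ (w0 1) (w0 (-1))).
by apply: leeD; apply: L; [left|right].
Qed.

End family.
End frequency_operator.

Section tonelli.
Context d1 d2 (X : measurableType d1) (Y : measurableType d2) (R : realType).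
Implicit Types f : X -> Y -> \bar R.

Lemma tonelliC (m1 : {sigma_finite_measure set X -> \bar R}) (m2 : {sigma_finite_measure set Y -> \bar R}) f :
  measurable_fun setT (fun z : X * Y => f z.1 z.2) -> (forall x y, (0 <= f x y)%E) ->
  (\int[m1]_x \int[m2]_y f x y = \int[m2]_y \int[m1]_x f x y)%E.
Proof.
move=> mf f0.
exact: (@fubini_tonelli _ _ _ _ R m1 m2 (fun z => f z.1 z.2) mf (fun z => f0 z.1 z.2)).
Qed.

Lemma measurable_integral_snd (m2 : {sigma_finite_measure set Y -> \bar R}) f :
  measurable_fun setT (fun z : X * Y => f z.1 z.2) ->
  (forall x y, (0 <= f x y)%E) -> measurable_fun setT (fun x => \int[m2]_y f x y)%E.
Proof.
move=> mf f0.
exact: (@measurable_fun_fubini_tonelli_F _ _ _ _ R m2 (fun z => f z.1 z.2) mf (fun z => f0 z.1 z.2)).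
Qed.

Lemma measurable_integral_fst (m1 : {sigma_finite_measure set X -> \bar R}) f :
  measurable_fun setT (fun z : X * Y => f z.1 z.2) ->
  (forall x y, (0 <= f x y)%E) -> measurable_fun setT (fun y => \int[m1]_x f x y)%E.
Proof.
move=> mf f0.
exact: (@measurable_fun_fubini_tonelli_G _ _ _ _ R m1 (fun z => f z.1 z.2) mf (fun z => f0 z.1 z.2)).
Qed.

End tonelli.

Section layer_cake.
Context {R : realType}.
Local Notation leb := (@lebesgue_measure R).

Lemma mulr_bool_le (b : bool) (x : R) : 0 <= x -> b%:R * x <= x.
Proof. by case: b => x0; rewrite ?mul1r ?mul0r. Qed.

Lemma ge0_integralZlT d (T : measurableType d) (mu : {measure set T -> \bar R}) (k : R) (f : T -> \bar R) :
  measurable_fun setT f -> (forall x, (0 <= f x)%E) -> 0 <= k ->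
  (\int[mu]_x (k%:E * f x) = k%:E * \int[mu]_x f x)%E.
Proof. by move=> mf f0 k0; apply: ge0_integralZl. Qed.

Lemma integral_powR_tail_ind (c rho : R) : 0 < c -> 0 < rho ->
  (\int[leb]_y ((rho <= y)%R%:R * y `^ (- c - 1))%:E = (rho `^ (- c) / c)%:E)%E.
Proof.
move=> c0 r0; rewrite -integral_powR_tail//.
rewrite (_ : `[rho, +oo[%classic = [set y : R | rho <= y]); last first.
  by apply/seteqP; split => y /=; rewrite in_itv /= andbT.
by rewrite integral_bool_natr; apply: eq_integral => y _; rewrite EFinM.
Qed.

Lemma measurable_le_natr d (T : measurableType d) (u v : T -> R) : measurable_fun setT u ->
  measurable_fun setT v -> measurable_fun setT (fun x => (u x <= v x)%R%:R : R).
Proof. by move=> mu mv; apply: measurable_bool_natr; exact: measurable_fun_ler. Qed.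

Lemma measurable_lt_natr d (T : measurableType d) (u v : T -> R) : measurable_fun setT u ->
  measurable_fun setT v -> measurable_fun setT (fun x => (u x < v x)%R%:R : R).
Proof. by move=> mu mv; apply: measurable_bool_natr; exact: measurable_fun_ltr. Qed.

Lemma measurable_powR_comp d (T : measurableType d) (u : T -> R) (c : R) : measurable_fun setT u ->
  measurable_fun setT (fun x => u x `^ c).
Proof. by move=> mu; exact: (measurableT_comp (measurable_powR c) mu). Qed.

(* The layer cake formula, with the weak type information [1 <= 4 y^2 h^2] inserted. *)
Lemma powR_layer_cake (q u : R) (h : R -> R) : 0 < q -> 0 <= u ->
  measurable_fun [set: R] h ->
  (forall y, 0 < y -> y^-1 <= u -> (2 * y)^-1 <= `|h y|) ->
  ((u `^ q)%:E <= (4 * q)%:E * \int[leb]_y ((0 < y)%R%:R * y `^ (1 - q) * h y ^+ 2)%:E)%E.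
Proof.
move=> q0 u0 mh hu.
have mg : measurable_fun [set: R] (fun y => (0 < y)%R%:R * y `^ (1 - q) * h y ^+ 2).
  apply: measurable_funM; last exact: measurable_funX.
  by apply: measurable_funM; [exact: measurable_lt_natr|exact: measurable_powR_comp].
have g0 y : (0 <= ((0 < y)%R%:R * y `^ (1 - q) * h y ^+ 2)%:E)%E.
  by rewrite lee_fin mulr_ge0 ?sqr_ge0// mulr_ge0 ?powR_ge0.
have [->|un0] := eqVneq u 0.
  by rewrite powR0 ?gt_eqF// mule_ge0 ?lee_fin ?mulr_ge0 ?(ltW q0)//; exact: integral_ge0.
have up : 0 < u by rewrite lt_neqAle eq_sym un0.
have uV : 0 < u^-1 by rewrite invr_gt0.
have uq : (u^-1) `^ (- q) = u `^ q by rewrite -(powR_inv1 (ltW up)) -powRrM mulN1r opprK.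
have := integral_powR_tail_ind q0 uV; rewrite uq => E.
have -> : (u `^ q)%:E = (q%:E * (u `^ q / q)%:E)%E by rewrite -EFinM mulrC divfK ?gt_eqF.
rewrite -E mulrC EFinM -muleA; apply: lee_wpmul2l; first by rewrite lee_fin ltW.
have mg1 : measurable_fun [set: R] (fun y => ((0 < y)%R%:R * y `^ (1 - q) * h y ^+ 2)%:E).
  exact/measurable_EFinP.
rewrite -ge0_integralZlT//; apply: ge0_le_integralT.
- apply/measurable_EFinP; apply: measurable_funM; last exact: measurable_powR_comp.
  exact: measurable_le_natr.
- exact: emeasurable_funM.
- by move=> y; rewrite lee_fin mulr_ge0 ?powR_ge0.
move=> y; rewrite -EFinM lee_fin; case: (leP u^-1 y) => uy; last first.
  by rewrite mul0r mulr_ge0// -lee_fin g0.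
have y0 : 0 < y by exact: lt_le_trans uy.
have yu : y^-1 <= u by rewrite -[leRHS]invrK lef_pV2 ?posrE.
have hy := hu _ y0 yu.
rewrite mul1r y0 mul1r mulrCA -[leLHS]mulr1.
have -> : y `^ (- q - 1) = y `^ (1 - q) * y ^- 2.
  rewrite -(powR_invn 2 (ltW y0)) -powRD; last by rewrite (gt_eqF y0) implybT.
  by congr (_ `^ _); ring.
rewrite -mulrA ler_wpM2l ?powR_ge0// mulr1.
have : ((2 * y)^-1) ^+ 2 <= `|h y| ^+ 2.
  by rewrite lerXn2r ?nnegrE// invr_ge0 mulr_ge0// ltW.
rewrite real_normK ?num_real// exprVn exprMn invfM => h2.
by rewrite -(ler_pM2l (ltr0n _ 4)) in h2; apply: le_trans h2; rewrite mulrA (_ : 4 * (2 ^+ 2)^-1 = 1) ?mul1r//; field.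
Qed.

End layer_cake.

(** * Splitting the function at each frequency *)

Section frequency_splitting.
Context {R : realType} (n : nat).
Local Notation leb := (@lebesgue_measure R).
Local Notation mu := (@lebRn R n.+1).
Local Notation sm := (@sphm R n).
Local Notation zm := (prodm sm leb).

Variables (m : R -> R[i]) (al0 B : R).
Hypothesis mm : cmeasurable (m : measurableTypeR R -> R[i]).
Hypothesis B0 : 0 < B.
Hypothesis mB : forall s, cabs (m s) <= B * `|s| `^ (- al0).
Hypothesis al1 : al0 < 1.
Let a := 1 - al0.

Variables (f : Rn R n.+1 -> R[i]) (fi : cintegrable mu f).
Variable (M : R).
Hypothesis M0 : 0 < M.

Let a0 : 0 < a. Proof. by rewrite subr_gt0. Qed.

(** With [v = |s| ^ a * y], the point [x] belongs to the high part at frequency [s] when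
    [|s| ^ a * y] reaches [tau x]. High and low thus refer to the size of [s] relative to [x], not
    to the size of [f x]. *)
Definition high (tau : Rn R n.+1 -> R) (v : R) (x : Rn R n.+1) : R[i] := (tau x <= v)%R%:R%:C * f x.
Definition low (tau : Rn R n.+1 -> R) (v : R) (x : Rn R n.+1) : R[i] := (v < tau x)%R%:R%:C * f x.

Lemma cabs_high tau v x : cabs (high tau v x) <= cabs (f x).
Proof. by rewrite /high cabsM cabsC normr_nat mulr_bool_le ?cabs_ge0. Qed.

Lemma cabs_low tau v x : cabs (low tau v x) <= cabs (f x).
Proof. by rewrite /low cabsM cabsC normr_nat mulr_bool_le ?cabs_ge0. Qed.

Section threshold.
Variable tau : Rn R n.+1 -> R.
Hypothesis mtau : measurable_fun setT tau.
Hypothesis tau0 : forall x, 0 <= tau x.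

Lemma cmeasurable_high d (T : measurableType d) (v : T -> R) (g : T -> Rn R n.+1) :
  measurable_fun setT v -> measurable_fun setT g -> cmeasurable (fun z => high tau (v z) (g z)).
Proof.
move=> mv mg; apply: cmeasurableM.
  by apply: cmeasurableC; apply: measurable_le_natr => //; exact: measurableT_comp.
by apply: (cmeasurable_comp mg); case: fi.
Qed.

Lemma cmeasurable_low d (T : measurableType d) (v : T -> R) (g : T -> Rn R n.+1) :
  measurable_fun setT v -> measurable_fun setT g -> cmeasurable (fun z => low tau (v z) (g z)).
Proof.
move=> mv mg; apply: cmeasurableM.
  by apply: cmeasurableC; apply: measurable_lt_natr => //; exact: measurableT_comp.
by apply: (cmeasurable_comp mg); case: fi.
Qed.

Let highf (y s : R) := high tau (`|s| `^ a * y).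
Let lowf (y s : R) := low tau (`|s| `^ a * y).

Lemma measurable_absa d (T : measurableType d) (s y : T -> R) : measurable_fun setT s ->
  measurable_fun setT y -> measurable_fun setT (fun z => `|s z| `^ a * y z).
Proof.
move=> ms my; apply: measurable_funM => //; apply: measurable_powR_comp.
exact: measurableT_comp.
Qed.

Let mhighf y : cmeasurable (fun z : measurableTypeR R * Rn R n.+1 => highf y z.1 z.2).
Proof. by apply: cmeasurable_high => //; exact: measurable_absa. Qed.

Let mlowf y : cmeasurable (fun z : measurableTypeR R * Rn R n.+1 => lowf y z.1 z.2).
Proof. by apply: cmeasurable_low => //; exact: measurable_absa. Qed.

Lemma fourierRn_split v xi : fourierRn f xi = fourierRn (high tau v) xi + fourierRn (low tau v) xi.
Proof.
have ie (g : Rn R n.+1 -> R[i]) : cmeasurable g -> (forall x, cabs (g x) <= cabs (f x)) ->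
    cintegrable mu (fun x => g x * expi (- dot x xi)).
  move=> mg gf; apply: (cintegrable_lec (c := 1) (g := f)) => //.
    apply: cmeasurableM => //; apply: cmeasurable_expi; apply: measurable_funN.
    exact: measurable_dot.
  by move=> x; rewrite mul1r cabsM cabs_expi mulr1.
rewrite /fourierRn -cintegralD; last 2 first.
- by apply: ie; [exact: cmeasurable_high|exact: cabs_high].
- by apply: ie; [exact: cmeasurable_low|exact: cabs_low].
apply: eq_cintegral => x; rewrite -mulrDl -mulrDl /high /low; congr (_ * _).
by case: (leP (tau x) v) => _; rewrite ?addr0 ?add0r mul1r.
Qed.

Lemma freq_op_split y th t :
  freq_op m M (fun=> f) th t = freq_op m M (highf y) th t + freq_op m M (lowf y) th t.
Proof.
have ie (F : R -> Rn R n.+1 -> R[i]) :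
    cmeasurable (fun z : measurableTypeR R * Rn R n.+1 => F z.1 z.2) ->
    (forall s x, cabs (F s x) <= cabs (f x)) ->
    cintegrable leb (fun s : measurableTypeR R => freq_symbol m M F th s * expi (s * t)).
  move=> mF Ff; apply: (cintegrable_lec (c := 1) (g := (freq_symbol m M F th : measurableTypeR R -> R[i]))).
  - apply: cmeasurableM; last by apply: cmeasurable_expi; exact: measurable_funM.
    exact: (cmeasurable_comp (pair1_measurable th) (cmeasurable_freq_symbol mm M mF)).
  - exact: (cintegrable_freq_symbol mm mB al1 fi M0 mF Ff th).
  - by move=> s; rewrite mul1r cabsM cabs_expi mulr1.
rewrite /freq_op /fourierR -cintegralD; last 2 first.
- by apply: ie => // s x; exact: cabs_high.
- by apply: ie => // s x; exact: cabs_low.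
apply: eq_cintegral => s; rewrite -mulrDl /freq_symbol; congr (_ * _).
by rewrite -mulrDr (fourierRn_split (`|s| `^ a * y)).
Qed.

(** After Tonelli the integral over [s] comes first. At a given [x] only [|s| <= rho] with
    [rho ^ a = tau x / y] contributes, and [|s| ^ (- al0)] has integral at most [2 * rho ^ a / a]
    there. The bound is pointwise in [(th, t)] and free of [M]. *)
Lemma freq_op_low_le y th t : 0 < y ->
  ((cabs (freq_op m M (lowf y) th t))%:E <= (2 * B / (a * y))%:E * \int[mu]_x (tau x * cabs (f x))%:E)%E.
Proof.
move=> y0.
have ci : cintegrable leb (freq_symbol m M (lowf y) th).
  exact: (cintegrable_freq_symbol mm mB al1 fi M0 (mlowf y) (fun s x => cabs_low tau _ x) th).
pose K (s : measurableTypeR R) (x : Rn R n.+1) := (B * `|s| `^ (- al0) * ((`|s| `^ a * y < tau x)%R%:R * cabs (f x)))%:E.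
have mK : measurable_fun setT (fun z : measurableTypeR R * Rn R n.+1 => K z.1 z.2).
  apply/measurable_EFinP; apply: measurable_funM; first apply: measurable_funM => //.
    by apply: measurable_powR_comp; exact: measurableT_comp.
  apply: measurable_funM; last by apply: (measurableT_comp (measurable_cabs (proj1 fi))).
  by apply: measurable_lt_natr; [exact: measurable_absa|exact: measurableT_comp].
have K0 s x : (0 <= K s x)%E.
  by rewrite lee_fin !mulr_ge0 ?powR_ge0 ?cabs_ge0// ltW.
apply: (@le_trans _ _ (\int[leb]_s \int[mu]_x K s x)%E).
  have mse : cmeasurable (fun s : measurableTypeR R => freq_symbol m M (lowf y) th s * expi (s * t)).
    apply: cmeasurableM; last by apply: cmeasurable_expi; exact: measurable_funM.
    by case: ci.
  apply: le_trans (cabs_cintegral leb mse) _.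
  apply: ge0_le_integralT.
  - exact: measurable_ecabs.
  - exact: (measurable_integral_snd mu mK K0).
  - by move=> s; rewrite lee_fin cabs_ge0.
  move=> s; rewrite cabsM cabs_expi mulr1 /freq_symbol !cabsM cabsC normr_nat.
  have mle : cmeasurable (fun x => lowf y s x * expi (- dot x (s *: sval th))).
    apply: cmeasurableM; first by apply: cmeasurable_low.
    by apply: cmeasurable_expi; apply: measurable_funN; exact: measurable_dot.
  apply: (@le_trans _ _ ((B * `|s| `^ (- al0))%:E * (cabs (fourierRn (lowf y s) (s *: sval th)))%:E)%E).
    rewrite -EFinM lee_fin ler_wpM2r ?cabs_ge0//.
    by apply: le_trans (mB s); rewrite mulr_bool_le ?cabs_ge0.
  have -> : (\int[mu]_x K s x = (B * `|s| `^ (- al0))%:E * \int[mu]_x (cabs (lowf y s x))%:E)%E.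
    rewrite -ge0_integralZlT//.
    - by apply: eq_integral => x _; rewrite /K EFinM /lowf /low cabsM cabsC normr_nat.
    - by apply: measurable_ecabs; exact: cmeasurable_low.
    - by move=> x; rewrite lee_fin cabs_ge0.
    - by rewrite mulr_ge0 ?powR_ge0 ?(ltW B0).
  apply: lee_wpmul2l; first by rewrite lee_fin mulr_ge0 ?powR_ge0 ?(ltW B0).
  apply: le_trans (cabs_cintegral mu mle) _.
  rewrite le_eqVlt; apply/orP; left; apply/eqP; apply: eq_integral => x _.
  by rewrite cabsM cabs_expi mulr1.
rewrite (tonelliC _ _ mK K0) -ge0_integralZlT; last 3 first.
- by apply/measurable_EFinP; apply: measurable_funM => //; apply: measurable_cabs; case: fi.
- by move=> x; rewrite lee_fin mulr_ge0 ?cabs_ge0.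
- by rewrite divr_ge0 ?mulr_ge0 ?(ltW B0) ?(ltW a0) ?(ltW y0).
apply: ge0_le_integralT.
- exact: (measurable_integral_fst leb mK K0).
- apply/measurable_EFinP; apply: measurable_funM => //; apply: measurable_funM => //.
  by apply: measurable_cabs; case: fi.
- by move=> x; apply: integral_ge0 => s _; exact: K0.
(* If [tau x = 0] the low part is empty at [x], as [|s| ^ a * y] is never negative. *)
move=> x; have [tx0|tx0] := ltP 0 (tau x); last first.
  have tx : tau x = 0 by apply/eqP; rewrite eq_le tx0 tau0.
  rewrite tx mul0r mule0 integral0_eq// => s _; rewrite /K tx.
  by rewrite ltNge mulr_ge0 ?powR_ge0 ?(ltW y0)//= mul0r mulr0.
pose rho := (tau x / y) `^ a^-1.
have ty : 0 < tau x / y by rewrite divr_gt0.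
have rho0 : 0 < rho by exact: powR_gt0.
have rhoa : rho `^ a = tau x / y.
  by rewrite /rho -powRrM mulVf ?(gt_eqF a0)// powRr1 ?(ltW ty).
have Kle (s : measurableTypeR R) : (K s x <= (B * cabs (f x))%:E * ((`|s| <= rho)%R%:R * `|s| `^ (a - 1))%:E)%E.
  rewrite /K -EFinM lee_fin.
  have -> : a - 1 = - al0 by rewrite /a; ring.
  rewrite [leRHS](_ : _ = B * `|s| `^ (- al0) * ((`|s| <= rho)%R%:R * cabs (f x))); last by ring.
  rewrite ler_wpM2l ?mulr_ge0 ?powR_ge0 ?(ltW B0)// ler_wpM2r ?cabs_ge0//.
  have [sy|_] := ltP (`|s| `^ a * y) (tau x); last exact: ler0n.
  suff -> : `|s| <= rho by [].
  rewrite leNgt; apply/negP => rs; move: sy; rewrite -ltr_pdivlMr// -rhoa; apply/negP; rewrite -leNgt.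
  by apply: ge0_ler_powR; rewrite ?nnegrE ?(ltW a0) ?(ltW rho0)// ltW.
have mT : measurable_fun setT (fun s : measurableTypeR R => ((`|s| <= rho)%R%:R * `|s| `^ (a - 1))%:E).
  apply/measurable_EFinP; apply: measurable_funM.
    by apply: measurable_le_natr => //; exact: normr_measurable.
  by apply: measurable_powR_comp; exact: normr_measurable.
have T0 (s : measurableTypeR R) : (0 <= ((`|s| <= rho)%R%:R * `|s| `^ (a - 1))%:E)%E.
  by rewrite lee_fin mulr_ge0 ?powR_ge0.
have Bf0 : 0 <= B * cabs (f x) by rewrite mulr_ge0 ?cabs_ge0 ?(ltW B0).
apply: (@le_trans _ _ (\int[leb]_s ((B * cabs (f x))%:E * ((`|s| <= rho)%R%:R * `|s| `^ (a - 1))%:E))%E).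
  apply: ge0_le_integralT.
  - exact: (measurableT_comp mK (pair2_measurable x)).
  - exact: emeasurable_funM.
  - by move=> s; exact: K0.
  - exact: Kle.
rewrite (ge0_integralZlT _ mT T0 Bf0).
apply: (@le_trans _ _ ((B * cabs (f x))%:E * (2 * (rho `^ a / a))%:E)%E).
  by apply: lee_wpmul2l; [rewrite lee_fin|exact: (integral_abs_powR_head a0 rho0)].
rewrite rhoa -!EFinM lee_fin le_eqVlt; apply/orP; left; apply/eqP.
by field; rewrite (gt_eqF a0) (gt_eqF y0).
Qed.

End threshold.

End frequency_splitting.

Lemma eq_integralT d (T : measurableType d) (R : realType) (mu : {measure set T -> \bar R})
  (f g : T -> \bar R) : f =1 g -> (\int[mu]_x f x = \int[mu]_x g x)%E.
Proof. by move=> fg; apply: eq_integral => x _. Qed.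

Lemma conjcM (R : realType) (z w : R[i]) : conjc z * conjc w = conjc (z * w).
Proof. by case: z w => [a b] [c d]; apply: complex_ext => /=; ring. Qed.

(** The transform of [f] at [- xi] is the conjugate of the transform of the conjugate of [f] at
    [xi], so the case [sg = - 1] is Plancherel for the conjugate function. *)
Lemma plancherel_Rn_sign (R : realType) n (f : Rn R n -> R[i]) (sg : R) : cintegrable (lebRn n) f ->
  sg = 1 \/ sg = - 1 ->
  (\int[lebRn n]_xi (cabs (fourierRn f (sg *: xi)) ^+ 2)%:E <=
   ((2 * pi) ^+ n)%:E * \int[lebRn n]_x (cabs (f x) ^+ 2)%:E)%E.
Proof.
move=> fi; case=> ->.
  have E xi : (cabs (fourierRn f xi) ^+ 2)%:E = (cabs (fourierRn f (1 *: xi)) ^+ 2)%:E by rewrite scale1r.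
  by have := plancherel_Rn fi; rewrite (eq_integralT (lebRn n) E).
have E xi : (cabs (fourierRn (fun x => (f x)^*) xi) ^+ 2)%:E = (cabs (fourierRn f (- 1 *: xi)) ^+ 2)%:E.
  have hei : cintegrable (lebRn n) (fun x => f x * expi (- dot x (- 1 *: xi))).
    apply: (cintegrable_lec (c := 1) (g := f)) => //.
      apply: cmeasurableM; first by case: fi.
      by apply: cmeasurable_expi; apply: measurable_funN; exact: measurable_dot.
    by move=> x; rewrite mul1r cabsM cabs_expi mulr1.
  rewrite -[in RHS]cabs_conj -(cintegral_conj hei) /fourierRn.
  congr ((cabs _ ^+ 2)%:E); apply: eq_cintegral => x.
  have -> : expi (- dot x xi) = (expi (- dot x (- 1 *: xi)))^*.
    rewrite conj_expi opprK; congr (expi _).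
    by rewrite /dot -sumrN; apply: eq_bigr => i _; rewrite !mxE; ring.
  exact: conjcM.
have E2 x : (cabs (f x)^* ^+ 2)%:E = (cabs (f x) ^+ 2)%:E by rewrite cabs_conj.
by have := plancherel_Rn (cintegrable_conj fi); rewrite (eq_integralT (lebRn n) E) (eq_integralT (lebRn n) E2).
Qed.

(** * The L^q bound for [q > 2] *)

Section interpolation.
Context {R : realType} (n : nat).
Local Notation leb := (@lebesgue_measure R).
Local Notation mu := (@lebRn R n.+1).
Local Notation sm := (@sphm R n).
Local Notation zm := (prodm sm leb).

Variables (m : R -> R[i]) (al0 B : R).
Hypothesis mm : cmeasurable (m : measurableTypeR R -> R[i]).
Hypothesis B0 : 0 < B.
Hypothesis mB : forall s, cabs (m s) <= B * `|s| `^ (- al0).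
Hypothesis al1 : al0 < 1.
Let a := 1 - al0.

Variables (f : Rn R n.+1 -> R[i]) (fi : cintegrable mu f).
Variable (M : R).
Hypothesis M0 : 0 < M.

Let a0 : 0 < a. Proof. by rewrite subr_gt0. Qed.

Local Notation high := (high f).
Local Notation low := (low f).
Local Opaque freq_op.
Variables (p q : R).
Hypothesis p1 : 1 < p.
Hypothesis q2 : 2 < q.
Hypothesis pq : (p - 1) * (q - 1) = 1.
Hypothesis aq : a * (q - 2) = 2 * al0 + n%:R.
Variable S : R.
Hypothesis S0 : 0 < S.
Hypothesis fS : (\int[mu]_x (cabs (f x) `^ p)%:E <= S%:E)%E.

(** With this value the low-frequency bound [2 * B / (a * y) * kap * S] is exactly [1 / (2 y)], half
    of the height [1 / y]. The exponent [p - 1] in [tau] makes [tau x * |f x|] equal to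
    [kap * |f x| ^ p]. *)
Let kap := a / (4 * B * S).
Let tau (x : Rn R n.+1) : R := kap * cabs (f x) `^ (p - 1).

Let kap0 : 0 < kap. Proof. by rewrite /kap divr_gt0 ?mulr_gt0 ?ltr0n. Qed.

Let mtau : measurable_fun setT tau.
Proof.
apply: measurable_funM => //; apply: measurable_powR_comp.
by apply: measurable_cabs; case: fi.
Qed.

Let tau0 x : 0 <= tau x. Proof. by rewrite mulr_ge0 ?powR_ge0 ?(ltW kap0). Qed.

Let F (y s : R) := high tau (`|s| `^ a * y).
Let G (y s : R) := low tau (`|s| `^ a * y).

Lemma freq_op_low_half y th t : 0 < y -> cabs (freq_op m M (G y) th t) <= (2 * y)^-1.
Proof.
move=> y0; rewrite -lee_fin; apply: le_trans (freq_op_low_le mm B0 mB al1 fi M0 mtau tau0 th t y0) _.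
have E : (\int[mu]_x (tau x * cabs (f x))%:E = kap%:E * \int[mu]_x (cabs (f x) `^ p)%:E)%E.
  rewrite -ge0_integralZlT ?(ltW kap0)//.
  - apply: eq_integral => x _; rewrite -EFinM; congr (_%:E); rewrite /tau -mulrA; congr (_ * _).
    by rewrite mulrC mulr_powRB1 ?cabs_ge0// (lt_trans _ p1).
  - by apply/measurable_EFinP; apply: measurable_powR_comp; apply: measurable_cabs; case: fi.
  - by move=> x; rewrite lee_fin powR_ge0.
have c0 : 0 <= 2 * B / (a * y) by rewrite divr_ge0 ?mulr_ge0 ?(ltW B0) ?(ltW a0) ?(ltW y0).
rewrite E; apply: (@le_trans _ _ ((2 * B / (a * y))%:E * (kap%:E * S%:E))%E).
  have k0 : (0 <= kap%:E)%E by rewrite lee_fin (ltW kap0).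
  have c0' : (0 <= (2 * B / (a * y))%:E)%E by rewrite lee_fin.
  exact: (lee_wpmul2l c0' (lee_wpmul2l k0 fS)).
rewrite -!EFinM lee_fin le_eqVlt; apply/orP; left; apply/eqP; rewrite /kap.
by field; rewrite (gt_eqF a0) (gt_eqF y0) (gt_eqF B0) (gt_eqF S0).
Qed.

(** The low part accounts for at most half of the height, so the high part has to supply the other
    half; this is the input that [powR_layer_cake] asks for. *)
Lemma freq_op_high_large y th t : 0 < y -> y^-1 <= cabs (freq_op m M (fun=> f) th t) ->
  (2 * y)^-1 <= `|cabs (freq_op m M (F y) th t)|.
Proof.
move=> y0 hu; rewrite (ger0_norm (cabs_ge0 _)).
have := freq_op_low_half th t y0.
have := cabsD (freq_op m M (F y) th t) (freq_op m M (G y) th t).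
rewrite -(freq_op_split mm mB al1 fi M0 mtau) => h1 h2.
have E : y^-1 = (2 * y)^-1 + (2 * y)^-1 by field; rewrite gt_eqF.
move: hu; rewrite E => hu; rewrite -(lerD2r ((2 * y)^-1)).
by apply: le_trans hu (le_trans h1 _); rewrite lerD2l.
Qed.

Let cmeasurable_F_joint : cmeasurable (fun w : (sphere n.+1 * measurableTypeR R) * measurableTypeR R =>
  freq_op m M (F w.2) w.1.1 w.1.2).
Proof.
apply: (@cmeasurable_cintegral _ _ ((sphere n.+1 * measurableTypeR R) * measurableTypeR R)%type (measurableTypeR R) R leb
  (fun w => freq_symbol m M (F w.1.2) w.1.1.1 w.2 * expi (w.2 * w.1.1.2))).
apply: cmeasurableM; last first.
  apply: cmeasurable_expi; apply: measurable_funM => //.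
  by apply: (measurableT_comp measurable_snd); exact: measurableT_comp.
apply: cmeasurableM; first apply: cmeasurableM.
- by apply: cmeasurableC; apply: measurable_bool_natr; exact: measurable_abs_le.
- exact: (cmeasurable_comp measurable_snd mm).
apply: (@cmeasurable_fourier_family _ _ _ _ (fun z => F z.1.2 z.2)).
- apply: (cmeasurable_high fi mtau) => //; apply: measurable_absa.
    exact: (measurableT_comp measurable_snd measurable_fst).
  apply: (measurableT_comp measurable_snd); apply: (measurableT_comp measurable_fst).
  exact: measurable_fst.
- apply: measurable_scale_Rn => //.
  apply: (measurableT_comp (@measurable_sval R n.+1)).
  apply: (measurableT_comp measurable_fst); apply: (measurableT_comp measurable_fst).
  exact: measurable_fst.
Qed.

(** The weight of the layer cake formula in the variable [y], the inverse of the height, once the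
    factor [y ^ 2] from Chebyshev's inequality has been included. *)
Let wt (y : R) : R := (0 < y)%R%:R * y `^ (1 - q).

Let wt0 y : 0 <= wt y. Proof. by rewrite mulr_ge0 ?powR_ge0. Qed.

Let mwt d (T : measurableType d) (y : T -> R) : measurable_fun setT y ->
  measurable_fun setT (fun z => wt (y z)).
Proof.
by move=> my; apply: measurable_funM; [exact: measurable_lt_natr|exact: measurable_powR_comp].
Qed.

(* Only the frequencies above the threshold matter: the others contribute at most half the height. *)
Lemma freq_op_layer_cake :
  (\int[Zn_measure n.+1]_z (cabs (freq_op m M (fun=> f) z.1 z.2) `^ q)%:E <=
   (4 * q)%:E * \int[leb]_y ((wt y)%:E * \int[Zn_measure n.+1]_z (cabs (freq_op m M (F y) z.1 z.2) ^+ 2)%:E))%E.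
Proof.
have q0 : 0 < q by apply: lt_trans q2.
pose K (z : sphere n.+1 * measurableTypeR R) (y : measurableTypeR R) :=
  (wt y * cabs (freq_op m M (F y) z.1 z.2) ^+ 2)%:E.
have mK : measurable_fun setT (fun w : (sphere n.+1 * measurableTypeR R) * measurableTypeR R => K w.1 w.2).
  apply/measurable_EFinP; apply: measurable_funM; first exact: mwt.
  by apply: measurable_funX; exact: (measurable_cabs cmeasurable_F_joint).
have K0 z y : (0 <= K z y)%E by rewrite lee_fin mulr_ge0 ?sqr_ge0.
have mKi := measurable_integral_snd leb mK K0.
have Ki0 z : (0 <= \int[leb]_y K z y)%E by apply: integral_ge0 => y _; exact: K0.
have q40 : 0 <= 4 * q by rewrite mulr_ge0// ltW.
apply: (@le_trans _ _ (\int[zm]_z ((4 * q)%:E * \int[leb]_y K z y))%E).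
  apply: (ge0_le_integralT zm).
  - apply/measurable_EFinP; apply: measurable_powR_comp; apply: measurable_cabs.
    apply: (cmeasurable_freq_op mm M (F := fun=> f)).
    by apply: (cmeasurable_comp measurable_snd); case: fi.
  - exact: emeasurable_funM.
  - by move=> z; rewrite lee_fin; exact: powR_ge0.
  move=> z; apply: powR_layer_cake; [exact: q0|exact: cabs_ge0| |].
  - have mz := measurableT_comp (measurable_cabs cmeasurable_F_joint) (pair1_measurable z).
    exact: mz.
  - by move=> y y0 hu; exact: freq_op_high_large.
rewrite (ge0_integralZlT _ mKi Ki0 q40); apply: lee_wpmul2l; first by rewrite lee_fin.
rewrite (tonelliC zm leb mK K0) le_eqVlt; apply/orP; left; apply/eqP.
apply: eq_integral => y _; rewrite -[RHS](ge0_integralZlT zm) //.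
- by apply/measurable_EFinP; apply: measurable_funX; apply: measurable_cabs;
    exact: (cmeasurable_comp (pair2_measurable (y : measurableTypeR R)) cmeasurable_F_joint).
- by move=> z; rewrite lee_fin sqr_ge0.
Qed.

Let Phi (sg : R) (xi : Rn R n.+1) (v : R) : R := cabs (fourierRn (high tau v) (sg *: xi)) ^+ 2.

Let Phi0 sg xi v : 0 <= Phi sg xi v. Proof. exact: sqr_ge0. Qed.

Let mPhi sg d (T : measurableType d) (xi : T -> Rn R n.+1) (v : T -> R) : measurable_fun setT xi ->
  measurable_fun setT v -> measurable_fun setT (fun z => Phi sg (xi z) (v z)).
Proof.
move=> mxi mv; apply: measurable_funX; apply: measurable_cabs.
apply: (@cmeasurable_fourier_family _ _ _ _ (fun z => high tau (v z))).
  apply: (cmeasurable_high fi mtau) => //; exact: (measurableT_comp mv measurable_fst).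
exact: (measurableT_comp (measurable_RnZ sg) mxi).
Qed.

Lemma freq_weight_scaling sg xi :
  (\int[leb]_y (wt y * freq_weight al0 (F y) sg xi)%:E <= \int[leb]_v (wt v * Phi sg xi v)%:E)%E.
Proof.
have c0 : 0 < 2 * al0 + n%:R by rewrite -aq mulr_gt0// subr_gt0.
(* At the origin the weight is [0], because [0] to a nonzero exponent is [0]; the exponent is
   nonzero since [q > 2]. *)
have e0 := enorm_ge0 xi; have [e00|en0] := eqVneq (enorm xi) 0.
  rewrite integral0_eq; first by apply: integral_ge0 => v _; rewrite lee_fin mulr_ge0.
  by move=> y _; rewrite /freq_weight e00 powR0 ?mul0r ?mulr0// oppr_eq0 gt_eqF.
have ep : 0 < enorm xi by rewrite lt_neqAle eq_sym en0.
pose c := enorm xi `^ a; have cp : 0 < c by exact: powR_gt0.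
pose w := enorm xi `^ (- (2 * al0 + n%:R)).
pose g (v : R) := (c * (wt v * Phi sg xi v))%:E.
have mg : measurable_fun [set: R] g.
  apply/measurable_EFinP; apply: measurable_funM => //; apply: measurable_funM; first exact: mwt.
  exact: mPhi.
have g0 v : (0 <= g v)%E by rewrite lee_fin mulr_ge0 ?(ltW cp)// mulr_ge0.
have fw y : freq_weight al0 (F y) sg xi = w * Phi sg xi (c * y).
  by rewrite /freq_weight /F (ger0_norm e0).
have ER y : wt y * freq_weight al0 (F y) sg xi = c * (wt (c * y) * Phi sg xi (c * y)).
  rewrite fw; set X := Phi _ _ _.
  rewrite /wt pmulr_rgt0//; case: ltP => y0; last by rewrite !mul0r mulr0.
  rewrite !mul1r mulrA [RHS]mulrA; congr (_ * _).
  rewrite powRM ?(ltW cp) ?(ltW y0)// mulrA mulrC; congr (_ * _).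
  (* One [c] compensates the Jacobian of [v = c * y], the other power comes from [wt]. As
     [c = |xi| ^ a], the result is [|xi| ^ (- a (q - 2))], which [aq] identifies with the polar
     weight. *)
  have -> : c * c `^ (1 - q) = c `^ (2 - q).
    rewrite -{1}(powRr1 (ltW cp)) -powRD; last by rewrite (gt_eqF cp) implybT.
    by congr (_ `^ _); ring.
  rewrite /c -powRrM (_ : a * (2 - q) = - (a * (q - 2))); last by ring.
  by rewrite aq.
have E y : (wt y * freq_weight al0 (F y) sg xi)%:E = g (c * y + 0).
  by rewrite /g addr0 ER.
rewrite (eq_integralT leb E).
rewrite (ge0_integral_affine 0 cp mg g0).
have mP : measurable_fun [set: R] (fun v => (wt v * Phi sg xi v)%:E).
  apply/measurable_EFinP; apply: measurable_funM; [exact: mwt|exact: mPhi].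
have P0 v : (0 <= (wt v * Phi sg xi v)%:E)%E by rewrite lee_fin mulr_ge0.
rewrite /g; under eq_integral => v _ do rewrite EFinM.
by rewrite (ge0_integralZlT leb mP P0 (ltW cp)) muleA -EFinM mulVf ?mul1e// gt_eqF.
Qed.

Lemma measurable_freq_weight_joint sg :
  measurable_fun setT (fun z : Rn R n.+1 * measurableTypeR R => freq_weight al0 (F z.2) sg z.1).
Proof.
apply: measurable_funM.
  by apply: measurable_powR_comp; exact: (measurableT_comp (@measurable_enorm R n.+1) measurable_fst).
apply: (mPhi sg (v := fun z => `|enorm z.1| `^ a * z.2)) => //; apply: measurable_absa => //.
exact: (measurableT_comp (@measurable_enorm R n.+1) measurable_fst).
Qed.

Lemma layer_fourier sg :
  (\int[leb]_y ((wt y)%:E * \int[mu]_xi (freq_weight al0 (F y) sg xi)%:E) <=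
   \int[leb]_y ((wt y)%:E * \int[mu]_xi (Phi sg xi y)%:E))%E.
Proof.
pose K1 (xi : Rn R n.+1) (y : measurableTypeR R) := (wt y * freq_weight al0 (F y) sg xi)%:E.
pose K2 (xi : Rn R n.+1) (y : measurableTypeR R) := (wt y * Phi sg xi y)%:E.
have mw := measurable_freq_weight_joint sg.
have mK1 : measurable_fun setT (fun z : Rn R n.+1 * measurableTypeR R => K1 z.1 z.2).
  apply/measurable_EFinP; apply: measurable_funM => //; exact: mwt.
have mK2 : measurable_fun setT (fun z : Rn R n.+1 * measurableTypeR R => K2 z.1 z.2).
  by apply/measurable_EFinP; apply: measurable_funM => //; [exact: mwt|exact: mPhi].
have K10 xi y : (0 <= K1 xi y)%E by rewrite lee_fin mulr_ge0 ?freq_weight_ge0.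
have K20 xi y : (0 <= K2 xi y)%E by rewrite lee_fin mulr_ge0.
have E1 y : ((wt y)%:E * \int[mu]_xi (freq_weight al0 (F y) sg xi)%:E = \int[mu]_xi K1 xi y)%E.
  rewrite -ge0_integralZlT//.
    by apply/measurable_EFinP; exact: (measurableT_comp mw (pair2_measurable (y : measurableTypeR R))).
  by move=> xi; rewrite lee_fin freq_weight_ge0.
have E2 y : ((wt y)%:E * \int[mu]_xi (Phi sg xi y)%:E = \int[mu]_xi K2 xi y)%E.
  have mPy : measurable_fun setT (fun xi => (Phi sg xi y)%:E).
    by apply/measurable_EFinP; exact: mPhi.
  exact: (esym (ge0_integralZlT mu mPy (fun xi => Phi0 sg xi y) (wt0 y))).
rewrite (eq_integralT leb E1) (eq_integralT leb E2).
rewrite -(tonelliC mu leb mK1 K10) -(tonelliC mu leb mK2 K20).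
apply: ge0_le_integralT.
- exact: measurable_integral_snd.
- exact: measurable_integral_snd.
- by move=> xi; apply: integral_ge0 => y _; exact: K10.
- by move=> xi; exact: freq_weight_scaling.
Qed.

Lemma layer_plancherel sg y : sg = 1 \/ sg = - 1 ->
  (\int[mu]_xi (Phi sg xi y)%:E <= ((2 * pi) ^+ n.+1)%:E * \int[mu]_x (cabs (high tau y x) ^+ 2)%:E)%E.
Proof.
apply: plancherel_Rn_sign.
apply: (cintegrable_lec (c := 1) (g := f)) => //; first exact: (cmeasurable_high fi mtau).
by move=> x; rewrite mul1r cabs_high.
Qed.

(** For fixed [x] the heights with [tau x <= y] contribute the integral of [y ^ (1 - q)] from
    [tau x] on, that is [tau x ^ (2 - q) / (q - 2)]; it converges because [q > 2]. The two powers of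
    [|f x|] then combine to [|f x| ^ p]. *)
Lemma layer_threshold :
  (\int[leb]_y ((wt y)%:E * \int[mu]_x (cabs (high tau y x) ^+ 2)%:E) <= (kap `^ (2 - q) / (q - 2) * S)%:E)%E.
Proof.
have q20 : 0 < q - 2 by rewrite subr_gt0.
pose K (x : Rn R n.+1) (y : measurableTypeR R) := (wt y * cabs (high tau y x) ^+ 2)%:E.
have mK : measurable_fun setT (fun z : Rn R n.+1 * measurableTypeR R => K z.1 z.2).
  apply/measurable_EFinP; apply: measurable_funM; first exact: mwt.
  apply: measurable_funX; apply: measurable_cabs; exact: (cmeasurable_high fi mtau).
have K0 x y : (0 <= K x y)%E by rewrite lee_fin mulr_ge0 ?sqr_ge0.
have E y : ((wt y)%:E * \int[mu]_x (cabs (high tau y x) ^+ 2)%:E = \int[mu]_x K x y)%E.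
  rewrite -ge0_integralZlT//.
    apply/measurable_EFinP; apply: measurable_funX; apply: measurable_cabs.
    exact: (cmeasurable_high fi mtau).
  by move=> x; rewrite lee_fin sqr_ge0.
rewrite (eq_integralT leb E) -(tonelliC mu leb mK K0).
have k0 : 0 <= kap `^ (2 - q) / (q - 2) by rewrite divr_ge0 ?powR_ge0 ?(ltW q20).
rewrite EFinM; have k0' : (0 <= (kap `^ (2 - q) / (q - 2))%:E)%E by rewrite lee_fin.
apply: le_trans (lee_wpmul2l k0' fS).
have mfp : measurable_fun setT (fun x => (cabs (f x) `^ p)%:E).
  by apply/measurable_EFinP; apply: measurable_powR_comp; apply: measurable_cabs; case: fi.
rewrite -ge0_integralZlT//; last by move=> x; rewrite lee_fin powR_ge0.
apply: ge0_le_integralT.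
- exact: measurable_integral_snd.
- exact: emeasurable_funM.
- by move=> x; apply: integral_ge0 => y _; exact: K0.
move=> x; have [f0|f0] := eqVneq (cabs (f x)) 0.
  rewrite integral0_eq; first by rewrite mule_ge0// lee_fin powR_ge0.
  by move=> y _; rewrite /K /high cabsM f0 mulr0 expr0n mulr0.
have fp : 0 < cabs (f x) by rewrite lt_neqAle eq_sym f0 cabs_ge0.
have tp : 0 < tau x by rewrite mulr_gt0 ?powR_gt0.
have KE (y : measurableTypeR R) : K x y = ((cabs (f x) ^+ 2)%:E * ((tau x <= y)%R%:R * y `^ (- (q - 2) - 1))%:E)%E.
  rewrite /K /high cabsM cabsC normr_nat -EFinM /wt; congr (_%:E).
  case: (leP (tau x) y) => ty; last by rewrite !mul0r expr0n !mulr0.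
  rewrite (lt_le_trans tp ty) !mul1r mulrC; congr (_ * _ `^ _); ring.
under eq_integral => y _ do rewrite KE.
have mT : measurable_fun [set: R] (fun y => ((tau x <= y)%R%:R * y `^ (- (q - 2) - 1))%:E).
  by apply/measurable_EFinP; apply: measurable_funM; [exact: measurable_le_natr|exact: measurable_powR_comp].
have T0 y : (0 <= ((tau x <= y)%R%:R * y `^ (- (q - 2) - 1))%:E)%E by rewrite lee_fin mulr_ge0 ?powR_ge0.
rewrite (ge0_integralZlT leb mT T0 (sqr_ge0 _)) (integral_powR_tail_ind q20 tp) -!EFinM lee_fin le_eqVlt.
apply/orP; left; apply/eqP; rewrite mulrA [RHS]mulrAC; congr (_ / _).
rewrite /tau powRM ?powR_ge0 ?(ltW kap0)// opprB mulrCA; congr (_ * _).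
rewrite -powRrM -(powR_mulrn 2 (cabs_ge0 _)) -powRD; last by rewrite (gt_eqF fp) implybT.
(* The exponent is [2 + (p - 1) (2 - q)], and conjugacy of the exponents makes it [p]. *)
congr (_ `^ _); have : (p - 1) * (2 - q) = (p - 1) - (p - 1) * (q - 1) by ring.
by rewrite pq => ->; ring.
Qed.

(** The factors are, in order: the layer cake formula, Plancherel in [t], Plancherel on [Rn] for
    both signs, and the integral over heights. Inserting [kap] leaves [S ^ (q - 1)], the power that
    makes the estimate homogeneous in [f]. *)
Lemma freq_op_Lq :
  (\int[Zn_measure n.+1]_z (cabs (freq_op m M (fun=> f) z.1 z.2) `^ q)%:E <=
   (4 * q * (2 * pi * B ^+ 2) * (2 * (2 * pi) ^+ n.+1) * ((4 * B / a) `^ (q - 2) / (q - 2)) * S `^ (q - 1))%:E)%E.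
Proof.
have q0 : 0 < q by apply: lt_trans q2.
have pi0 : 0 <= pi :> R by exact: pi_ge0.
have q20 : 0 < q - 2 by rewrite subr_gt0.
have -> : 4 * q * (2 * pi * B ^+ 2) * (2 * (2 * pi) ^+ n.+1) * ((4 * B / a) `^ (q - 2) / (q - 2)) * S `^ (q - 1)
   = 4 * q * ((2 * pi * B ^+ 2) * (2 * (((2 * pi) ^+ n.+1) * (kap `^ (2 - q) / (q - 2) * S)))).
  have -> : kap `^ (2 - q) = (4 * B / a) `^ (q - 2) * S `^ (q - 2).
    rewrite -powRM ?(ltW S0)//; last by rewrite divr_ge0 ?(ltW a0)// mulr_ge0// ltW.
    rewrite (_ : 4 * B / a * S = kap^-1); last by rewrite /kap; field; rewrite (gt_eqF a0) (gt_eqF B0) (gt_eqF S0).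
    by rewrite -(powR_inv1 (ltW kap0)) -powRrM; congr (_ `^ _); ring.
  have -> : S `^ (q - 1) = S `^ (q - 2) * S.
    rewrite -{3}(powRr1 (ltW S0)) -powRD; last by rewrite (gt_eqF S0) implybT.
    by congr (_ `^ _); ring.
  by ring.
apply: le_trans freq_op_layer_cake _; rewrite [leRHS]EFinM; apply: lee_wpmul2l; first by rewrite lee_fin mulr_ge0// ltW.
have W0 sg y : (0 <= \int[mu]_xi (freq_weight al0 (F y) sg xi)%:E)%E.
  by apply: integral_ge0 => xi _; rewrite lee_fin freq_weight_ge0.
have P0 sg y : (0 <= \int[mu]_xi (Phi sg xi y)%:E)%E.
  by apply: integral_ge0 => xi _; rewrite lee_fin Phi0.
have mW sg : measurable_fun [set: R] (fun y => (wt y)%:E * \int[mu]_xi (Phi sg xi y)%:E)%E.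
  apply: emeasurable_funM; first by apply/measurable_EFinP; exact: mwt.
  apply: (@measurable_integral_fst _ _ _ (measurableTypeR R) _ mu (fun xi y => (Phi sg xi y)%:E)) => [|xi y]; last by rewrite lee_fin Phi0.
  by apply/measurable_EFinP; exact: mPhi.
have mV sg : measurable_fun [set: R] (fun y => (wt y)%:E * \int[mu]_xi (freq_weight al0 (F y) sg xi)%:E)%E.
  apply: emeasurable_funM; first by apply/measurable_EFinP; exact: mwt.
  apply: (@measurable_integral_fst _ _ _ (measurableTypeR R) _ mu
    (fun xi y => (freq_weight al0 (F y) sg xi)%:E)) => [|xi y]; last by rewrite lee_fin freq_weight_ge0.
  by apply/measurable_EFinP; exact: (measurable_freq_weight_joint sg).
have V0 sg y : (0 <= (wt y)%:E * \int[mu]_xi (freq_weight al0 (F y) sg xi)%:E)%E.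
  by apply: mule_ge0 => //; rewrite lee_fin.
pose D := (kap `^ (2 - q) / (q - 2) * S).
have V_le sg : sg = 1 \/ sg = - 1 ->
    (\int[leb]_y ((wt y)%:E * \int[mu]_xi (freq_weight al0 (F y) sg xi)%:E) <= ((2 * pi) ^+ n.+1 * D)%:E)%E.
  move=> sg1; apply: le_trans (layer_fourier sg) _.
  have pin : 0 <= (2 * pi : R) ^+ n.+1 by rewrite exprn_ge0// mulr_ge0.
  have mH : measurable_fun [set: R] (fun y => (wt y)%:E * \int[mu]_x (cabs (high tau y x) ^+ 2)%:E)%E.
    apply: emeasurable_funM; first by apply/measurable_EFinP; exact: mwt.
    apply: (@measurable_integral_fst _ _ _ (measurableTypeR R) _ mu
      (fun x y => (cabs (high tau y x) ^+ 2)%:E)) => [|x y]; last by rewrite lee_fin sqr_ge0.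
    apply/measurable_EFinP; apply: measurable_funX; apply: measurable_cabs.
    exact: (cmeasurable_high fi mtau).
  have H0 y : (0 <= (wt y)%:E * \int[mu]_x (cabs (high tau y x) ^+ 2)%:E)%E.
    by apply: mule_ge0; [rewrite lee_fin|apply: integral_ge0 => x _; rewrite lee_fin sqr_ge0].
  rewrite EFinM; have pin' : (0 <= ((2 * pi : R) ^+ n.+1)%:E)%E by rewrite lee_fin.
  apply: le_trans (lee_wpmul2l pin' layer_threshold).
  rewrite -(ge0_integralZlT leb mH H0 pin); apply: ge0_le_integralT.
  - exact: mW.
  - exact: emeasurable_funM.
  - by move=> y; apply: mule_ge0 => //; rewrite lee_fin.
  move=> y; rewrite muleCA; apply: lee_wpmul2l; first by rewrite lee_fin.
  exact: layer_plancherel.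
have Bpi : 0 <= 2 * pi * B ^+ 2 by rewrite mulr_ge0 ?sqr_ge0// mulr_ge0.
pose U y := ((2 * pi * B ^+ 2)%:E * ((wt y)%:E * \int[mu]_xi (freq_weight al0 (F y) 1 xi)%:E
  + (wt y)%:E * \int[mu]_xi (freq_weight al0 (F y) (- 1) xi)%:E))%E.
have mUs : measurable_fun [set: R] (fun y => (wt y)%:E * \int[mu]_xi (freq_weight al0 (F y) 1 xi)%:E
  + (wt y)%:E * \int[mu]_xi (freq_weight al0 (F y) (- 1)%R xi)%:E)%E by exact: emeasurable_funD.
have Us0 y : (0 <= (wt y)%:E * \int[mu]_xi (freq_weight al0 (F y) 1 xi)%:E
  + (wt y)%:E * \int[mu]_xi (freq_weight al0 (F y) (- 1)%R xi)%:E)%E by exact: adde_ge0.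
apply: (@le_trans _ _ (\int[leb]_y U y)%E).
  apply: ge0_le_integralT.
  - apply: emeasurable_funM; first by apply/measurable_EFinP; exact: mwt.
    apply: (@measurable_integral_fst _ _ _ (measurableTypeR R) _ zm
      (fun z y => (cabs (freq_op m M (F y) z.1 z.2) ^+ 2)%:E)) => [|z y]; last by rewrite lee_fin sqr_ge0.
    by apply/measurable_EFinP; apply: measurable_funX; exact: (measurable_cabs cmeasurable_F_joint).
  - exact: emeasurable_funM.
  - by move=> y; apply: mule_ge0; [rewrite lee_fin|apply: integral_ge0 => z _; rewrite lee_fin sqr_ge0].
  move=> y; rewrite /U -ge0_muleDr// muleCA; apply: lee_wpmul2l; first by rewrite lee_fin.
  apply: (freq_op_L2 mm (ltW B0) mB al1 fi M0).
  + by apply: (cmeasurable_high fi mtau) => //; exact: measurable_absa.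
  + by move=> s x; exact: cabs_high.
  + by move=> s; rewrite /F normrN.
rewrite /U (ge0_integralZlT leb mUs Us0 Bpi) [leRHS]EFinM; apply: lee_wpmul2l; first by rewrite lee_fin.
rewrite (ge0_integralD leb measurableT (fun y _ => V0 1 y) (mV 1) (fun y _ => V0 (- 1) y) (mV (- 1))).
apply: (@le_trans _ _ (((2 * pi) ^+ n.+1 * D)%:E + ((2 * pi) ^+ n.+1 * D)%:E)%E).
  by apply: leeD; apply: V_le; [left|right].
rewrite -EFinD lee_fin -/D le_eqVlt; apply/orP; left; apply/eqP; set X := _ ^+ _; ring.
Qed.

End interpolation.

(** * Extension to L^p *)

Section ae_limits.
Context d (T : measurableType d) (R : realType).
Variable mu : {measure set T -> \bar R}.

Lemma fatou_ae (f_ : nat -> T -> \bar R) (f : T -> \bar R) (c : \bar R) :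
  (forall k, measurable_fun setT (f_ k)) -> measurable_fun setT f ->
  (forall k x, (0 <= f_ k x)%E) -> (forall x, (0 <= f x)%E) ->
  {ae mu, forall x, f_ ^~ x @ \oo --> f x} ->
  (forall k, (\int[mu]_x f_ k x <= c)%E) -> (\int[mu]_x f x <= c)%E.
Proof.
move=> mf_ mf f_0 f0 f_f f_c; have := fatou mu measurableT mf_ (fun k x _ => f_0 k x).
have ml : measurable_fun setT (fun x => limn_einf (f_ ^~ x)).
  under eq_fun do rewrite -[limn_einf _]oppeK -limn_esupN.
  apply: measurableT_comp => //; apply: (measurable_fun_limn_esup (f := fun k x => - f_ k x)%E) => k.
  exact: measurableT_comp.
have l0 x : (0 <= limn_einf (f_ ^~ x))%E.
  rewrite limn_einf_lim; apply: lime_ge; first exact: is_cvg_einfs.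
  by apply: nearW => k; apply: le_ereal_inf_tmp => _ [j _ <-].
rewrite (ge0_ae_eq_integral (f := fun x => limn_einf (f_ ^~ x)) (g := f) measurableT ml mf) //; last first.
  apply: filterS f_f => x fx _.
  by have [-> _] := cvg_limn_einf_sup fx.
move=> /le_trans; apply; rewrite limn_einf_lim; apply: lime_le; first exact: is_cvg_einfs.
apply: nearW => k; apply: (@le_trans _ _ (\int[mu]_x f_ k x)%E) => //.
by apply: ereal_inf_lbound; exists k => /=.
Qed.

(** The sum of the [w i] has integral at most [2], hence is finite almost everywhere, and it bounds
    every term. This takes the place of a Borel-Cantelli argument in the extraction of
    subsequences. *)
Lemma ae_bounded_of_summable (w : nat -> T -> R) : (forall i, measurable_fun setT (w i)) ->
  (forall i x, 0 <= w i x) -> (forall i, (\int[mu]_x (w i x)%:E <= ((2^-1) ^+ i)%:E)%E) ->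
  {ae mu, forall x, exists C, forall i, w i x <= C}.
Proof.
move=> mw w0 wi.
pose S x := (\sum_(0 <= i <oo) (w i x)%:E)%E.
have mwe i : measurable_fun setT (fun x => (w i x)%:E) by exact/measurable_EFinP.
have mS : measurable_fun setT S by apply: ge0_emeasurable_sum => // i x _ _; rewrite lee_fin.
have S0 x : (0 <= S x)%E by apply: nneseries_ge0 => i _ _; rewrite lee_fin.
have geo n : \sum_(0 <= i < n) (2^-1 : R) ^+ i <= 2.
  suff -> : \sum_(0 <= i < n) (2^-1 : R) ^+ i = 2 - 2 * (2^-1) ^+ n.
    by rewrite lerBlDr lerDl mulr_ge0// exprn_ge0// invr_ge0.
  elim: n => [|n IH]; first by rewrite big_geq// expr0 mulr1 subrr.
  by rewrite big_nat_recr//= IH exprS; field.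
have Soo : (\int[mu]_x S x <= 2%:E)%E.
  rewrite /S integral_nneseries//; last by move=> i x _; rewrite lee_fin.
  apply: lime_le; first by apply: is_cvg_nneseries => i _ _; apply: integral_ge0 => x _; rewrite lee_fin.
  apply: nearW => n; apply: (@le_trans _ _ (\sum_(0 <= i < n) ((2^-1 : R) ^+ i)%:E)%E).
    by apply: lee_sum => i _.
  by rewrite sumEFin lee_fin.
have iS : mu.-integrable setT S.
  apply/integrableP; split => //.
  rewrite (_ : (\int[mu]_x `|S x|)%E = (\int[mu]_x S x)%E); first exact: le_lt_trans Soo (ltry _).
  by apply: eq_integral => x _; rewrite gee0_abs.
apply: filterS (integrable_ae measurableT iS) => x /(_ I) Sx.
exists (fine (S x)) => i; rewrite -lee_fin fineK//.
apply: le_trans (nneseries_lim_ge i.+1 _); last by move=> j _ _; rewrite lee_fin.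
rewrite big_nat_recr//= leeDr// sume_ge0// => j _; by rewrite lee_fin.
Qed.

Lemma dominated_small (f_ : nat -> T -> R) (g : T -> R) :
  (forall k, measurable_fun setT (f_ k)) -> (forall k x, 0 <= f_ k x <= g x) ->
  (forall x, f_ ^~ x @ \oo --> 0) -> measurable_fun setT g -> (\int[mu]_x (g x)%:E < +oo)%E ->
  forall e, 0 < e -> exists N, forall k, (N <= k)%N -> (\int[mu]_x (f_ k x)%:E <= e%:E)%E.
Proof.
move=> mf fg f_0 mg goo e e0.
have g0 x : 0 <= g x by have /andP[] := fg 0%N x; exact: le_trans.
have mfe k : measurable_fun setT (EFin \o f_ k) by exact/measurable_EFinP.
have mge : measurable_fun setT (EFin \o g) by exact/measurable_EFinP.
have ig : mu.-integrable setT (EFin \o g).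
  apply/integrableP; split => //.
  rewrite (_ : (\int[mu]_x `|(EFin \o g) x|)%E = (\int[mu]_x (g x)%:E)%E)//.
  by apply: eq_integral => x _; rewrite /= ger0_norm.
have m0 : measurable_fun setT (fun _ : T => 0%E : \bar R) by exact: measurable_cst.
have c0 : {ae mu, forall x, setT x -> (fun k => (EFin \o f_ k) x) @ \oo --> (0%E : \bar R)}.
  apply: aeW => x _; apply: cvg_EFin; first by apply: nearW.
  exact: f_0.
have dom : {ae mu, forall x k, setT x -> (`|(EFin \o f_ k) x| <= (EFin \o g) x)%E}.
  apply: aeW => x k _ /=; rewrite lee_fin ger0_norm; by have /andP[] := fg k x.
have [_ _ /=] := @dominated_convergence _ T R mu setT measurableT (fun k => EFin \o f_ k) _ _ mfe m0 c0 ig dom.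
rewrite integral0 => cv.
move: cv => /fine_cvgP[fn cvf].
have [N _ hN] := filterI fn (cvgr_lt _ cvf e e0).
exists N => k Nk; have [fk lk] := hN k Nk.
by rewrite -(fineK fk) lee_fin ltW.
Qed.

Lemma powR_cvg (q : R) (x_ : nat -> R) (x : R) : 0 < q -> (forall k, 0 <= x_ k) ->
  x_ @ \oo --> x -> (fun k => x_ k `^ q) @ \oo --> x `^ q.
Proof.
move=> q0 x_0 cx.
have x0 : 0 <= x.
  by rewrite -(cvg_lim _ cx)//; apply: limr_ge; [apply/cvg_ex; exists x|exact: nearW].
have [xe|xn] := eqVneq x 0; last first.
  have xp : 0 < x by rewrite lt_neqAle eq_sym xn.
  exact: (fun A HA => cx _ (continuous_powR_pos (c := q) xp HA)).
rewrite xe powR0 ?gt_eqF//; rewrite xe in cx; apply/cvgrPdist_lt => e e0.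
have eq0 : 0 < e `^ q^-1 by exact: powR_gt0.
near=> k; rewrite sub0r normrN ger0_norm ?powR_ge0//.
rewrite -[e](powRr1 (ltW e0)) -(mulVf (lt0r_neq0 q0)) powRrM.
apply: gt0_ltr_powR => //; rewrite ?nnegrE ?(ltW eq0)//.
near: k; exact: (cvgr_lt _ cx).
Unshelve. all: by end_near. Qed.

Lemma powR_cvg0 (r : R) (x_ : nat -> R) : 0 < r -> (forall k, 0 <= x_ k) ->
  (exists C, forall i, 2 ^+ i * x_ i `^ r <= C) -> x_ @ \oo --> 0.
Proof.
move=> r0 x0 [C hC].
have geo : (fun i => C * (2^-1) ^+ i) @ \oo --> (0 : R).
  rewrite -(mulr0 C); apply: cvgM; first exact: cvg_cst.
  by apply: cvg_expr; rewrite ger0_norm ?invr_ge0// invf_lt1// ltr1n.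
apply/cvgrPdist_lt => e e0; near=> k; rewrite sub0r normrN ger0_norm//.
rewrite ltNge; apply/negP => ek.
have : e `^ r <= C * 2^-1 ^+ k.
  apply: (@le_trans _ _ (x_ k `^ r)); first by apply: ge0_ler_powR; rewrite ?nnegrE ?(ltW r0) ?(ltW e0).
  by rewrite exprVn ler_pdivlMr ?exprn_gt0// mulrC.
apply/negP; rewrite -ltNge; near: k.
by apply: (cvgr_lt _ geo); exact: powR_gt0.
Unshelve. all: by end_near. Qed.

(** Convergence is stated for the integral of the [r]-th power rather than for the norm, so no root
    has to be taken. Measurability of the limit is included because limits are later selected by
    choice. *)
Definition Lcvg (r : R) (u : nat -> T -> R[i]) (v : T -> R[i]) :=
  cmeasurable v /\ forall e, 0 < e -> exists N, forall j, (N <= j)%N ->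
    (\int[mu]_x (cabs (u j x - v x) `^ r)%:E <= e%:E)%E.

Lemma measurable_cabs_powR (f : T -> R[i]) (r : R) : cmeasurable f ->
  measurable_fun setT (fun x => cabs (f x) `^ r).
Proof. by move=> mf; exact: (measurableT_comp (measurable_powR r) (measurable_cabs mf)). Qed.

Lemma Lcvg_comp r u v (k : nat -> nat) : (forall i, (i <= k i)%N) -> Lcvg r u v ->
  Lcvg r (u \o k) v.
Proof.
move=> ki [mv uv]; split; first exact: mv.
move=> e e0; have [N hN] := uv e e0; exists N => j Nj.
exact: (hN _ (leq_trans Nj (ki j))).
Qed.

Lemma Lcvg_ae r u v : 0 < r -> (forall j, cmeasurable (u j)) -> Lcvg r u v ->
  exists k : nat -> nat, (forall i, (i <= k i)%N) /\
    {ae mu, forall x, (fun i => cabs (u (k i) x - v x)) @ \oo --> 0}.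
Proof.
move=> r0 mu_ [mv uv].
(* One factor [2 ^ (- i)] pays for the weight [2 ^ i] in [w], the other makes the weighted integrals
   summable. The indices need not increase; [i <= k i] is enough for them to tend to infinity. *)
have /(choice (P := fun i k => (i <= k)%N /\
    (\int[mu]_x (cabs (u k x - v x) `^ r)%:E <= ((2^-1 : R) ^+ i * (2^-1) ^+ i)%:E)%E)) [k hk] :
    forall i, exists k, (i <= k)%N /\
    (\int[mu]_x (cabs (u k x - v x) `^ r)%:E <= ((2^-1 : R) ^+ i * (2^-1) ^+ i)%:E)%E.
  move=> i; have [|N hN] := uv ((2^-1) ^+ i * (2^-1) ^+ i).
    by rewrite mulr_gt0// exprn_gt0// invr_gt0.
  by exists (maxn i N); rewrite leq_maxl; split => //; apply: hN; exact: leq_maxr.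
exists k; split; first by move=> i; have [] := hk i.
pose w i x := 2 ^+ i * cabs (u (k i) x - v x) `^ r.
have mB i := measurable_cabs_powR r (cmeasurableB (mu_ (k i)) mv).
have mw i : measurable_fun setT (w i) by exact: measurable_funM.
have w0 i x : 0 <= w i x by rewrite mulr_ge0 ?powR_ge0// exprn_ge0.
have wi i : (\int[mu]_x (w i x)%:E <= ((2^-1) ^+ i)%:E)%E.
  have [_ h] := hk i.
  rewrite /w; under eq_integral => x _ do rewrite EFinM.
  rewrite ge0_integralZlT ?exprn_ge0//.
  - have -> : (2^-1 : R) ^+ i = 2 ^+ i * ((2^-1) ^+ i * (2^-1) ^+ i).
      by rewrite mulrA -exprMn mulfV// expr1n mul1r.
    by rewrite [leRHS]EFinM; apply: lee_wpmul2l => //; rewrite lee_fin exprn_ge0.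
  - exact/measurable_EFinP.
  - by move=> x; rewrite lee_fin powR_ge0.
apply: filterS (ae_bounded_of_summable mw w0 wi) => x [C hC].
apply: (powR_cvg0 r0); first by move=> i; exact: cabs_ge0.
by exists C.
Qed.

Lemma cabs_cvg_unique (u : nat -> R[i]) v w : (fun i => cabs (u i - v)) @ \oo --> 0 ->
  (fun i => cabs (u i - w)) @ \oo --> 0 -> v = w.
Proof.
move=> uv uw; apply/eqP; rewrite -subr_eq0; apply/eqP; apply: cabs_eq0.
apply/eqP; rewrite eq_le cabs_ge0 andbT.
have h : (fun i => cabs (u i - v) + cabs (u i - w)) @ \oo --> 0.
  by rewrite -[X in _ --> X](addr0 0); apply: cvgD.
rewrite -(cvg_lim _ h)//; apply: limr_ge; first by apply/cvg_ex; exists 0.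
apply: nearW => i; rewrite (cabsBC (u i) v) (_ : v - w = (v - u i) + (u i - w)) ?cabsD//.
by rewrite addrA subrK.
Qed.

(** A second extraction inside the first subsequence gives one subsequence converging almost
    everywhere to both limits. *)
Lemma Lcvg_unique r u v w : 0 < r -> (forall j, cmeasurable (u j)) ->
  Lcvg r u v -> Lcvg r u w -> {ae mu, forall x, v x = w x}.
Proof.
move=> r0 mu_ uv uw; have [k [ki kv]] := Lcvg_ae r0 mu_ uv.
have [l [li lw]] := Lcvg_ae r0 (fun j => mu_ (k j)) (Lcvg_comp ki uw).
have linf : l @ \oo --> \oo.
  by apply/cvgnyPge => A; near=> j; apply: leq_trans (li j); near: j; exact: nbhs_infty_ge.
apply: filterS2 kv lw => x kv lw.
exact: (cabs_cvg_unique (cvg_comp _ _ linf kv) lw).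
Unshelve. all: by end_near. Qed.

Lemma Lcvg_pointwise r u v w : 0 < r -> (forall j, cmeasurable (u j)) -> Lcvg r u v ->
  (forall x, (fun j => cabs (u j x - w x)) @ \oo --> 0) -> {ae mu, forall x, v x = w x}.
Proof.
move=> r0 mu_ uv uw; have [k [ki kv]] := Lcvg_ae r0 mu_ uv.
have kinf : k @ \oo --> \oo.
  by apply/cvgnyPge => A; near=> j; apply: leq_trans (ki j); near: j; exact: nbhs_infty_ge.
apply: filterS kv => x kv.
exact: (cabs_cvg_unique kv (cvg_comp _ _ kinf (uw x))).
Unshelve. all: by end_near. Qed.

Lemma cvg_cabs (u : nat -> R[i]) v : (fun i => cabs (u i - v)) @ \oo --> 0 ->
  (fun i => cabs (u i)) @ \oo --> cabs v.
Proof.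
move=> uv; apply/cvgrPdist_lt => e e0; near=> i.
apply: (@le_lt_trans _ _ (cabs (u i - v))); last by near: i; exact: (cvgr_lt _ uv).
rewrite ler_norml lerNl opprB cabsB_ge/= cabsBC.
exact: cabsB_ge.
Unshelve. all: by end_near. Qed.

(** The two exponents are independent: convergence in L^r only serves to obtain an almost everywhere
    convergent subsequence, along which Fatou's lemma transports an L^q bound. *)
Lemma Lcvg_fatou r q u v (c : \bar R) : 0 < r -> 0 < q -> (forall j, cmeasurable (u j)) ->
  Lcvg r u v -> (forall j, (\int[mu]_x (cabs (u j x) `^ q)%:E <= c)%E) ->
  (\int[mu]_x (cabs (v x) `^ q)%:E <= c)%E.
Proof.
move=> r0 q0 mu_ uv uc; have [k [ki kv]] := Lcvg_ae r0 mu_ uv.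
have [mv _] := uv.
apply: (fatou_ae (f_ := fun i x => (cabs (u (k i) x) `^ q)%:E)); last by move=> i; exact: uc.
- by move=> i; apply/measurable_EFinP; exact: measurable_cabs_powR.
- by apply/measurable_EFinP; exact: measurable_cabs_powR.
- by move=> i x; rewrite lee_fin powR_ge0.
- by move=> x; rewrite lee_fin powR_ge0.
apply: filterS kv => x kv; apply: cvg_EFin; first exact: nearW.
by apply: powR_cvg => // [i|]; [exact: cabs_ge0|exact: cvg_cabs].
Qed.

(** Adding twice the current step bound makes the sequence nonincreasing, subtracting it makes it
    nondecreasing. So [y] is monotone and bounded below, and it differs from [x] by a null
    sequence. *)
Lemma cvg_geometric_steps (x : nat -> R) (C : R) : 0 <= C ->
  (forall i, `|x i.+1 - x i| <= C * (2^-1) ^+ i) -> cvgn x.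
Proof.
move=> C0 hx.
have g0 i : 0 <= C * 2^-1 ^+ i by rewrite mulr_ge0// exprn_ge0// invr_ge0.
pose y i := x i + 2 * (C * 2^-1 ^+ i).
pose z i := x i - 2 * (C * 2^-1 ^+ i).
have yS i : y i.+1 <= y i.
  rewrite /y; have := hx i; rewrite ler_norml => /andP[_].
  by rewrite exprS; set g := _ ^+ i; lra.
have zS i : z i <= z i.+1.
  rewrite /z; have := hx i; rewrite ler_norml => /andP[+ _].
  by rewrite exprS; set g := _ ^+ i; lra.
have cy : cvgn y.
  apply: nonincreasing_is_cvgn; first by apply/nonincreasing_seqP.
  exists (z 0%N) => _ [i _ <-]; apply: (@le_trans _ _ (z i)).
    by elim: i => // i; move/le_trans; apply.
  by rewrite /z /y; have := g0 i; lra.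
have -> : x = fun i => y i - 2 * C * 2^-1 ^+ i.
  by apply/funext => i; rewrite /y; ring.
apply: is_cvgB => //; apply: is_cvgM; first exact: is_cvg_cst.
apply/cvg_ex; exists 0; apply: cvg_expr.
by rewrite ger0_norm ?invr_ge0// invf_lt1// ltr1n.
Qed.

(** The upper limit is measurable and defined everywhere, and it is the limit wherever that exists;
    [fine] brings it back to real values. *)
Lemma measurable_limit (x_ : nat -> T -> R) : (forall i, measurable_fun setT (x_ i)) ->
  exists x : T -> R, measurable_fun setT x /\
    forall t, cvgn (x_ ^~ t) -> x_ ^~ t @ \oo --> x t.
Proof.
move=> mx; pose s t := limn_esup (fun i => (x_ i t)%:E).
exists (fun t => fine (s t)); split.
  apply: (measurableT_comp (f := fine) (fine_measurable measurableT)) => //.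
  by apply: measurable_fun_limn_esup => i; exact/measurable_EFinP.
move=> t /cvg_ex[l xl]; suff -> : s t = l%:E by [].
have xle : (fun i => (x_ i t)%:E) @ \oo --> l%:E by apply: cvg_EFin => //; exact: nearW.
by rewrite /s; have [_ ->] := cvg_limn_einf_sup xle.
Qed.

Lemma Lcvg_complete r u : 0 < r -> (forall j, cmeasurable (u j)) ->
  (forall e, 0 < e -> exists N, forall i j, (N <= i)%N -> (N <= j)%N ->
    (\int[mu]_x (cabs (u i x - u j x) `^ r)%:E <= e%:E)%E) -> exists v, Lcvg r u v.
Proof.
move=> r0 mu_ cau.
(* The first factor absorbs [2 ^ i] inside the [r]-th power, so the integral of
   [(2 ^ i * |D i|) ^ r] is at most [2 ^ (- i)]; almost everywhere the steps [D i] are then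
   geometrically small. *)
pose eps i : R := ((2^-1) ^+ i) `^ r * (2^-1) ^+ i.
have /(choice (P := fun i N => forall a b, (N <= a)%N -> (N <= b)%N ->
    (\int[mu]_x (cabs (u a x - u b x) `^ r)%:E <= (eps i)%:E)%E)) [k hk] :
    forall i, exists N, forall a b, (N <= a)%N -> (N <= b)%N ->
    (\int[mu]_x (cabs (u a x - u b x) `^ r)%:E <= (eps i)%:E)%E.
  move=> i; apply: cau; rewrite mulr_gt0// ?powR_gt0 ?exprn_gt0 ?invr_gt0//.
(* A monotone choice of indices: [K i] dominates both [i] and [k i], so the Cauchy estimate with
   [eps i] applies to the pair [K i], [K i.+1]. *)
pose K i := (i + \max_(l < i.+1) k l)%N.
have kK i : (k i <= K i)%N.
  by apply: leq_trans (leq_addl _ _); exact: (leq_bigmax (ord_max : 'I_i.+1)).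
have KS i : (K i <= K i.+1)%N.
  rewrite /K leq_add// [X in (_ <= X)%N]big_ord_recr/=.
  by rewrite leq_max leqnn.
have iK i : (i <= K i)%N by exact: leq_addr.
pose D i x := u (K i.+1) x - u (K i) x.
have mD i : cmeasurable (D i) by apply: cmeasurableB.
pose w i x := (2 ^+ i * cabs (D i x)) `^ r.
have mw i : measurable_fun setT (w i).
  apply: (measurableT_comp (measurable_powR r)); apply: measurable_funM => //.
  exact: measurable_cabs.
have w0 i x : 0 <= w i x by exact: powR_ge0.
have wi i : (\int[mu]_x (w i x)%:E <= ((2^-1) ^+ i)%:E)%E.
  have h := hk i _ _ (leq_trans (kK i) (KS i)) (kK i).
  have E x : (w i x)%:E = (((2 ^+ i) `^ r)%:E * (cabs (D i x) `^ r)%:E)%E.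
    by rewrite /w powRM ?exprn_ge0// cabs_ge0.
  under eq_integral => x _ do rewrite E.
  rewrite ge0_integralZlT ?powR_ge0//.
  - have -> : (2^-1 : R) ^+ i = (2 ^+ i) `^ r * eps i.
      by rewrite /eps mulrA -powRM ?exprn_ge0 ?invr_ge0// -exprMn mulfV// expr1n powR1 mul1r.
    by rewrite [leRHS]EFinM; apply: lee_wpmul2l => //; rewrite lee_fin powR_ge0.
  - by apply/measurable_EFinP; exact: measurable_cabs_powR.
  - by move=> x; rewrite lee_fin powR_ge0.
have steps : {ae mu, forall x, exists C, 0 <= C /\ forall i, cabs (D i x) <= C * (2^-1) ^+ i}.
  apply: filterS (ae_bounded_of_summable mw w0 wi) => x [C hC].
  exists (C `^ r^-1); split; first exact: powR_ge0.
  move=> i; rewrite exprVn ler_pdivlMr ?exprn_gt0// mulrC.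
  have p0 : 0 <= 2 ^+ i * cabs (D i x) by rewrite mulr_ge0 ?cabs_ge0// exprn_ge0.
  have -> : 2 ^+ i * cabs (D i x) = (2 ^+ i * cabs (D i x)) `^ (r * r^-1).
    by rewrite (mulfV (lt0r_neq0 r0)) powRr1.
  rewrite powRrM.
  apply: ge0_ler_powR; rewrite ?invr_ge0 ?(ltW r0) ?nnegrE ?powR_ge0//.
  - exact: le_trans (w0 i x) (hC i).
  - exact: hC.
have [vr [mvr hvr]] := measurable_limit (fun i => (mu_ (K i)).1).
have [vi [mvi hvi]] := measurable_limit (fun i => (mu_ (K i)).2).
pose v x := vr x +i* vi x.
have mv : cmeasurable v by split.
have Kv : {ae mu, forall x, (fun i => cabs (u (K i) x - v x)) @ \oo --> 0}.
  apply: filterS steps => x [C [C0 hC]].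
  have /hvr cr : cvgn (fun i => complex.Re (u (K i) x)).
    apply: (cvg_geometric_steps C0) => i.
    by apply: le_trans (hC i); rewrite -ReN -ReD; exact: normRe_cabs.
  have /hvi ci : cvgn (fun i => complex.Im (u (K i) x)).
    apply: (cvg_geometric_steps C0) => i.
    by apply: le_trans (hC i); rewrite -ImN -ImD; exact: normIm_cabs.
  have s0 : (fun i => `|complex.Re (u (K i) x) - vr x| + `|complex.Im (u (K i) x) - vi x|) @ \oo --> 0.
    rewrite -[X in _ --> X](addr0 0); apply: cvgD.
      by apply/norm_cvg0P; apply/subr_cvg0.
    by apply/norm_cvg0P; apply/subr_cvg0.
  apply: (squeeze_cvgr _ (cvg_cst 0) s0); apply: nearW => i; rewrite cabs_ge0/=.
  apply: le_trans (cabs_ReIm _) _.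
  by rewrite ReD ReN ImD ImN.
exists v; split => // e e0; have [N hN] := cau e e0; exists N => j Nj.
apply: (fatou_ae (f_ := fun i x => (cabs (u j x - u (K (N + i)%N) x) `^ r)%:E)) => //.
- by move=> i; apply/measurable_EFinP; apply: measurable_cabs_powR; exact: cmeasurableB.
- by apply/measurable_EFinP; apply: measurable_cabs_powR; exact: cmeasurableB.
- by move=> i x; rewrite lee_fin powR_ge0.
- by move=> x; rewrite lee_fin powR_ge0.
- apply: filterS Kv => x Kx; apply: cvg_EFin; first exact: nearW.
  apply: powR_cvg => // [i|]; first exact: cabs_ge0.
  apply: cvg_cabs.
  have Kx' : (fun i => cabs (u (K (N + i)%N) x - v x)) @ \oo --> 0.
    move: Kx; rewrite -(cvg_shiftn N); under eq_fun do rewrite addnC; exact.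
  rewrite (_ : (fun i => _) = (fun i => cabs (u (K (N + i)%N) x - v x)))//.
  apply/funext => i; rewrite cabsBC; congr cabs; ring.
- move=> i; apply: hN => //; apply: leq_trans (iK _); exact: leq_addr.
Qed.

End ae_limits.

Section Lcvg_linear.
Context d (T : measurableType d) (R : realType).
Variable mu : {measure set T -> \bar R}.

Lemma powRD_le (r x y : R) : 0 < r -> 0 <= x -> 0 <= y -> (x + y) `^ r <= 2 `^ r * (x `^ r + y `^ r).
Proof.
move=> r0 x0 y0; apply: (@le_trans _ _ ((2 * Num.max x y) `^ r)).
  apply: ge0_ler_powR; rewrite ?nnegrE ?(ltW r0) ?addr_ge0//.
    by rewrite mulr_ge0// le_max x0.
  by rewrite mulr_natl mulr2n lerD// le_max lexx ?orbT.
rewrite powRM// ?le_max ?x0// ler_wpM2l ?powR_ge0//.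
by case: (leP x y) => _; rewrite ?lerDl ?lerDr powR_ge0.
Qed.

Lemma cabs_lin_le (r : R) (a x y : R[i]) : 0 < r ->
  cabs (a * x + y) `^ r <= 2 `^ r * (cabs a `^ r * cabs x `^ r + cabs y `^ r).
Proof.
move=> r0; rewrite -powRM ?cabs_ge0// -cabsM.
apply: le_trans (powRD_le r0 (cabs_ge0 _) (cabs_ge0 _)).
by apply: ge0_ler_powR; rewrite ?nnegrE ?addr_ge0 ?cabs_ge0 ?(ltW r0)// cabsD.
Qed.

Lemma Lr_lin_le (r : R) (a : R[i]) (u v : T -> R[i]) : 0 < r -> cmeasurable u -> cmeasurable v ->
  (\int[mu]_x (cabs (a * u x + v x) `^ r)%:E <=
   (2 `^ r)%:E * ((cabs a `^ r)%:E * \int[mu]_x (cabs (u x) `^ r)%:E + \int[mu]_x (cabs (v x) `^ r)%:E))%E.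
Proof.
move=> r0 mu_ mv.
have m1 : measurable_fun setT (fun x => (cabs (u x) `^ r)%:E) by apply/measurable_EFinP; exact: measurable_cabs_powR.
have m2 : measurable_fun setT (fun x => (cabs (v x) `^ r)%:E) by apply/measurable_EFinP; exact: measurable_cabs_powR.
have p1 x : (0 <= (cabs (u x) `^ r)%:E)%E by rewrite lee_fin powR_ge0.
have p2 x : (0 <= (cabs (v x) `^ r)%:E)%E by rewrite lee_fin powR_ge0.
have m3 : measurable_fun setT (fun x => (cabs a `^ r)%:E * (cabs (u x) `^ r)%:E)%E by exact: emeasurable_funM.
have p3 x : (0 <= (cabs a `^ r)%:E * (cabs (u x) `^ r)%:E)%E by rewrite mule_ge0// lee_fin powR_ge0.
rewrite -(ge0_integralZlT mu m1 p1 (powR_ge0 _ _)).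
rewrite -(ge0_integralD mu measurableT (fun x _ => p3 x) m3 (fun x _ => p2 x) m2).
have m4 : measurable_fun setT (fun x => (cabs a `^ r)%:E * (cabs (u x) `^ r)%:E + (cabs (v x) `^ r)%:E)%E.
  exact: emeasurable_funD.
have p4 x : (0 <= (cabs a `^ r)%:E * (cabs (u x) `^ r)%:E + (cabs (v x) `^ r)%:E)%E by exact: adde_ge0.
rewrite -(ge0_integralZlT mu m4 p4 (powR_ge0 _ _)); apply: ge0_le_integralT.
- apply/measurable_EFinP; apply: measurable_cabs_powR; apply: cmeasurableD => //.
  by apply: cmeasurableM => //; exact: cmeasurable_cst.
- exact: emeasurable_funM.
- by move=> x; rewrite lee_fin powR_ge0.
- by move=> x; rewrite -(EFinM (cabs a `^ r)) -EFinD -EFinM lee_fin; exact: cabs_lin_le.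
Qed.

Lemma Lcvg_lin r (a : R[i]) u v u' v' : 0 < r -> (forall j, cmeasurable (u j)) ->
  (forall j, cmeasurable (u' j)) -> Lcvg mu r u v -> Lcvg mu r u' v' ->
  Lcvg mu r (fun j x => a * u j x + u' j x) (fun x => a * v x + v' x).
Proof.
move=> r0 mu_ mu' [mv uv] [mv' uv']; split.
  by apply: cmeasurableD => //; apply: cmeasurableM => //; exact: cmeasurable_cst.
move=> e e0; pose K := 2 `^ r * (cabs a `^ r + 1).
have K0 : 0 < K by rewrite mulr_gt0 ?powR_gt0// ltr_wpDl ?powR_ge0.
have eK : 0 < e / K by rewrite divr_gt0.
have [N1 h1] := uv _ eK; have [N2 h2] := uv' _ eK.
exists (maxn N1 N2) => j Nj.
have {h1}h1 := h1 j (leq_trans (leq_maxl _ _) Nj).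
have {h2}h2 := h2 j (leq_trans (leq_maxr _ _) Nj).
have -> : (fun x => (cabs (a * u j x + u' j x - (a * v x + v' x)) `^ r)%:E) =
    (fun x => (cabs (a * (u j x - v x) + (u' j x - v' x)) `^ r)%:E).
  by apply/funext => x; congr ((cabs _ `^ r)%:E); ring.
have H := Lr_lin_le a r0 (cmeasurableB (mu_ j) mv) (cmeasurableB (mu' j) mv').
apply: (le_trans H).
apply: (@le_trans _ _ ((2 `^ r)%:E * ((cabs a `^ r)%:E * (e / K)%:E + (e / K)%:E))%E).
  apply: lee_wpmul2l; first by rewrite lee_fin powR_ge0.
  apply: leeD; last exact: h2.
  by apply: lee_wpmul2l; [rewrite lee_fin; exact: powR_ge0|exact: h1].
rewrite -(EFinM (cabs a `^ r)) -EFinD -EFinM lee_fin le_eqVlt; apply/orP; left; apply/eqP.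
rewrite (_ : 2 `^ r * _ = K * (e / K)); last by rewrite /K; ring.
by rewrite mulrC divfK// gt_eqF.
Qed.

Lemma Lr_ae_eq r (u v : T -> R[i]) : cmeasurable u -> cmeasurable v -> {ae mu, forall x, u x = v x} ->
  (\int[mu]_x (cabs (u x) `^ r)%:E = \int[mu]_x (cabs (v x) `^ r)%:E)%E.
Proof.
move=> mu_ mv uv; apply: ge0_ae_eq_integral => //.
- by apply/measurable_EFinP; exact: measurable_cabs_powR.
- by apply/measurable_EFinP; exact: measurable_cabs_powR.
- by move=> x _; rewrite lee_fin powR_ge0.
- by move=> x _; rewrite lee_fin powR_ge0.
- by apply: filterS uv => x -> _.
Qed.

Lemma ae_defect (h f g k e : T -> R[i]) (b : R[i]) :
  {ae mu, forall x, e x = - 1 * h x + k x} -> {ae mu, forall x, k x = b * f x + g x} ->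
  {ae mu, forall x, h x = - 1 * e x + (b * f x + g x)}.
Proof. by move=> e1 e2; apply: filterS2 e1 e2 => x -> ->; ring. Qed.

(** Passes a linear relation to the limit when it holds along the sequence only up to an error [e j]
    tending to [0]. This is needed because clipping a function is not linear. *)
Lemma Lcvg_defect r (b : R[i]) (h f g e : nat -> T -> R[i]) H F G : 0 < r ->
  (forall j, cmeasurable (h j)) -> (forall j, cmeasurable (f j)) -> (forall j, cmeasurable (g j)) ->
  (forall j, cmeasurable (e j)) ->
  Lcvg mu r h H -> Lcvg mu r f F -> Lcvg mu r g G -> Lcvg mu r e (fun=> 0) ->
  (forall j, {ae mu, forall x, h j x = - 1 * e j x + (b * f j x + g j x)}) ->
  {ae mu, forall x, H x = b * F x + G x}.
Proof.
move=> r0 mh mf mg me Lh Lf Lg Le E.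
have mfg j : cmeasurable (fun x => b * f j x + g j x).
  by apply: cmeasurableD => //; apply: cmeasurableM => //; exact: cmeasurable_cst.
have [mL L] := Lcvg_lin (- 1) r0 me mfg Le (Lcvg_lin b r0 mf mg Lf Lg).
have L3 : Lcvg mu r h (fun x => - 1 * 0 + (b * F x + G x)).
  split => // ep ep0; have [N hN] := L ep ep0; exists N => j Nj.
  apply: le_trans (hN j Nj); rewrite le_eqVlt; apply/orP; left; apply/eqP; apply: Lr_ae_eq.
  - exact: cmeasurableB.
  - apply: cmeasurableB => //; apply: cmeasurableD => //.
    by apply: cmeasurableM => //; exact: cmeasurable_cst.
  - by apply: filterS (E j) => x ->.
apply: filterS (Lcvg_unique r0 mh Lh L3) => x ->.
by rewrite mulr0 add0r.
Qed.

End Lcvg_linear.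

(** * Removing the cutoff in L^2, then extending by clipping *)

Section extension.
Context {R : realType} (n : nat).
Local Notation leb := (@lebesgue_measure R).
Local Notation mu := (@lebRn R n.+1).
Local Notation zm := (@Zn_measure R n.+1).

Variables (m : R -> R[i]) (al0 B : R).
Hypothesis mm : cmeasurable (m : measurableTypeR R -> R[i]).
Hypothesis B0 : 0 < B.
Hypothesis mB : forall s, cabs (m s) <= B * `|s| `^ (- al0).
Hypothesis al1 : al0 < 1.
Let a := 1 - al0.
Variables (p q : R).
Hypothesis p1 : 1 < p.
Hypothesis q2 : 2 <= q.
Hypothesis pq : (p - 1) * (q - 1) = 1.
Hypothesis aq : a * (q - 2) = 2 * al0 + n%:R.
Implicit Types f g : Rn R n.+1 -> R[i].

Let a0 : 0 < a. Proof. by rewrite subr_gt0. Qed.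

Let c0 : 0 <= 2 * al0 + n%:R. Proof. by rewrite -aq mulr_ge0 ?(ltW a0)// subr_ge0. Qed.

(** Two regimes: for [q > 2] the real method applies, while [q = 2] forces [p = 2] and a vanishing
    exponent in the weight, so Plancherel suffices. The constant depends neither on [f] nor on the
    cutoff. *)
Lemma freq_op_bound : exists C, 0 <= C /\ forall f M S, cintegrable mu f -> 0 < M -> 0 < S ->
  (\int[mu]_x (cabs (f x) `^ p)%:E <= S%:E)%E ->
  (\int[zm]_z (cabs (freq_op m M (fun=> f) z.1 z.2) `^ q)%:E <= (C * S `^ (q - 1))%:E)%E.
Proof.
move: q2; rewrite le_eqVlt => /orP[/eqP qe|q2']; last first.
  eexists; split; last first.
    by move=> f M S fi M0 S0 fS; exact: (freq_op_Lq mm B0 mB al1 fi M0 p1 q2' pq aq S0 fS).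
  rewrite !mulr_ge0 ?exprn_ge0 ?pi_ge0 ?mulr_ge0 ?pi_ge0 ?(ltW B0) ?powR_ge0 ?invr_ge0 ?subr_ge0//.
  by apply: le_trans q2.
have pe : p = 2 by move: pq; rewrite -qe => h; lra.
have ce : 2 * al0 + n%:R = 0 by rewrite -aq -qe subrr mulr0.
exists (2 * pi * B ^+ 2 * (2 * (2 * pi) ^+ n.+1)); split.
  by rewrite !mulr_ge0 ?exprn_ge0 ?mulr_ge0 ?pi_ge0 ?(ltW B0).
move=> f M S fi M0 S0; rewrite -qe pe => fS.
have E2 d (T : measurableType d) (nu : {measure set T -> \bar R}) (u : T -> R[i]) :
    (\int[nu]_x (cabs (u x) `^ 2)%:E = \int[nu]_x (cabs (u x) ^+ 2)%:E)%E.
  by apply: eq_integralT => x; rewrite -powR_mulrn ?cabs_ge0.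
rewrite E2 in fS; rewrite E2.
have mF : cmeasurable (fun z : measurableTypeR R * Rn R n.+1 => f z.2).
  by apply: (cmeasurable_comp measurable_snd); case: fi.
apply: le_trans (freq_op_L2 mm (ltW B0) mB al1 fi M0 mF (fun _ _ => lexx _) (fun _ => erefl)) _.
have W sg : sg = 1 \/ sg = - 1 ->
    (\int[mu]_xi (freq_weight al0 (fun=> f) sg xi)%:E <= ((2 * pi) ^+ n.+1 * S)%:E)%E.
  move=> sg1; have E xi : (freq_weight al0 (fun=> f) sg xi)%:E = (cabs (fourierRn f (sg *: xi)) ^+ 2)%:E.
    by rewrite /freq_weight ce oppr0 powRr0 mul1r.
  rewrite (eq_integralT _ E); apply: le_trans (plancherel_Rn_sign fi sg1) _.
  by rewrite EFinM; apply: lee_wpmul2l => //; rewrite lee_fin exprn_ge0// mulr_ge0// pi_ge0.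
rewrite (_ : 2 - 1 = 1 :> R); last by ring.
have -> : 2 * pi * B ^+ 2 * (2 * (2 * pi) ^+ n.+1) * S `^ 1 = 2 * pi * B ^+ 2 * (2 * (2 * pi) ^+ n.+1 * S).
  by rewrite (powRr1 (ltW S0)); set X := _ ^+ n.+1; ring.
rewrite [leRHS]EFinM; apply: lee_wpmul2l.
  by rewrite lee_fin !mulr_ge0 ?pi_ge0 ?(ltW B0).
apply: (@le_trans _ _ (((2 * pi) ^+ n.+1 * S)%:E + ((2 * pi) ^+ n.+1 * S)%:E)%E).
  by apply: leeD; apply: W; [left|right].
rewrite -EFinD lee_fin le_eqVlt; apply/orP; left; apply/eqP; set X := _ ^+ _; ring.
Qed.

Let Cq := projT1 (cid freq_op_bound).

Let Cq0 : 0 <= Cq. Proof. by rewrite /Cq; case: cid => C []. Qed.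

Let CqP f M S : cintegrable mu f -> 0 < M -> 0 < S ->
  (\int[mu]_x (cabs (f x) `^ p)%:E <= S%:E)%E ->
  (\int[zm]_z (cabs (freq_op m M (fun=> f) z.1 z.2) `^ q)%:E <= (Cq * S `^ (q - 1))%:E)%E.
Proof. by rewrite /Cq; case: cid => C [C0 H]; exact: H. Qed.

(** The restriction to [|s| > M] is written as a family depending on the frequency, so that the
    difference of two cutoffs is again covered by [freq_op_L2]. *)
Definition cut (M : R) f (s : R) (x : Rn R n.+1) : R[i] := (M < `|s|)%R%:R%:C * f x.

Lemma cabs_cut M f s x : cabs (cut M f s x) <= cabs (f x).
Proof. by rewrite /cut cabsM cabsC normr_nat mulr_bool_le ?cabs_ge0. Qed.

Lemma cmeasurable_cut M f : cmeasurable f ->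
  cmeasurable (fun z : measurableTypeR R * Rn R n.+1 => cut M f z.1 z.2).
Proof.
move=> mf; apply: cmeasurableM; last exact: (cmeasurable_comp measurable_snd).
apply: cmeasurableC; apply: measurable_lt_natr => //.
exact: measurableT_comp.
Qed.

Lemma cintegrable_fourier f xi : cintegrable mu f -> cintegrable mu (fun x => f x * expi (- dot x xi)).
Proof.
move=> fi; apply: (cintegrable_lec (c := 1) (g := f)) => //.
  apply: cmeasurableM; first by case: fi.
  by apply: cmeasurable_expi; apply: measurable_funN; exact: measurable_dot.
by move=> x; rewrite mul1r cabsM cabs_expi mulr1.
Qed.

Lemma fourierRn_cut M f s xi : cintegrable mu f ->
  fourierRn (cut M f s) xi = (M < `|s|)%R%:R%:C * fourierRn f xi.
Proof.
move=> fi; rewrite /fourierRn -(cintegralZ _ (cintegrable_fourier xi fi)).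
by apply: eq_cintegral => x; rewrite /cut mulrA.
Qed.

Lemma cintegrable_freq_op M f th t : cintegrable mu f -> 0 < M ->
  cintegrable leb (fun s : measurableTypeR R => freq_symbol m M (fun=> f) th s * expi (s * t)).
Proof.
move=> fi M0; have mF : cmeasurable (fun z : measurableTypeR R * Rn R n.+1 => f z.2).
  by apply: (cmeasurable_comp measurable_snd); case: fi.
have ci := cintegrable_freq_symbol mm mB al1 fi M0 mF (fun _ _ => lexx _) th.
apply: (cintegrable_lec (c := 1) (g := (freq_symbol m M (fun=> f) th : measurableTypeR R -> R[i])) _ ci).
  by apply: cmeasurableM; [case: ci|apply: cmeasurable_expi; exact: measurable_funM].
by move=> s; rewrite mul1r cabsM cabs_expi mulr1.
Qed.

Lemma freq_op_diff M M' f th t : cintegrable mu f -> 0 < M -> M <= M' ->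
  freq_op m M' (fun=> f) th t - freq_op m M (fun=> f) th t = freq_op m M' (cut M f) th t.
Proof.
move=> fi M0 MM'; rewrite /freq_op /fourierR -cintegralB.
- apply: eq_cintegral => s; rewrite -mulrBl; congr (_ * _).
  rewrite /freq_symbol fourierRn_cut//; case: (leP `|s| M) => sM.
    by rewrite (le_trans sM MM') subrr mul0r mulr0.
  by rewrite !mul0r subr0 mul1r.
- by apply: cintegrable_freq_op => //; exact: lt_le_trans MM'.
- exact: cintegrable_freq_op.
Qed.

Let tail f sg (k : R) (xi : Rn R n.+1) : R := (k < enorm xi)%R%:R * cabs (fourierRn f (sg *: xi)) ^+ 2.

Lemma measurable_fourierRn_scale f sg : cmeasurable f ->
  measurable_fun setT (fun xi : Rn R n.+1 => cabs (fourierRn f (sg *: xi)) ^+ 2).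
Proof.
move=> mf; apply: measurable_funX; apply: measurable_cabs.
apply: (@cmeasurable_fourier_family _ _ _ _ (fun=> f)); last exact: measurable_RnZ.
exact: (cmeasurable_comp measurable_snd).
Qed.

Let measurable_tail f sg k : cmeasurable f -> measurable_fun setT (tail f sg k).
Proof.
move=> mf; apply: measurable_funM; last exact: measurable_fourierRn_scale.
by apply: measurable_lt_natr => //; exact: measurable_enorm.
Qed.

(** Beyond radius [M >= 1] the weight [|xi| ^ (- (2 al0 + n))] is at most [1], because
    [2 al0 + n >= 0]. Only the tail of the transform remains. *)
Lemma freq_op_diff_L2 M M' f : cintegrable mu f -> 1 <= M -> M <= M' ->
  (\int[zm]_z (cabs (freq_op m M' (fun=> f) z.1 z.2 - freq_op m M (fun=> f) z.1 z.2) ^+ 2)%:E <=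
   (2 * pi * B ^+ 2)%:E * (\int[mu]_xi (tail f 1 M xi)%:E + \int[mu]_xi (tail f (- 1) M xi)%:E))%E.
Proof.
move=> fi M1 MM'; have M0 : 0 < M by apply: lt_le_trans M1.
have mf : cmeasurable f by case: fi.
have -> : (fun z : Zn R n.+1 => (cabs (freq_op m M' (fun=> f) z.1 z.2 - freq_op m M (fun=> f) z.1 z.2) ^+ 2)%:E)
   = (fun z => (cabs (freq_op m M' (cut M f) z.1 z.2) ^+ 2)%:E).
  by apply/funext => z; rewrite freq_op_diff.
have M'0 : 0 < M' by apply: lt_le_trans MM'.
have ce s : cut M f (- s) = cut M f s by rewrite /cut normrN.
apply: le_trans (freq_op_L2 mm (ltW B0) mB al1 fi M'0 (cmeasurable_cut M mf) (cabs_cut M f) ce) _.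
apply: lee_wpmul2l; first by rewrite lee_fin !mulr_ge0 ?pi_ge0 ?(ltW B0).
have W sg : (\int[mu]_xi (freq_weight al0 (cut M f) sg xi)%:E <= \int[mu]_xi (tail f sg M xi)%:E)%E.
  apply: ge0_le_integralT.
  - by apply/measurable_EFinP; apply: measurable_freq_weight; exact: cmeasurable_cut.
  - by apply/measurable_EFinP; exact: measurable_tail.
  - by move=> xi; rewrite lee_fin freq_weight_ge0.
  move=> xi; rewrite lee_fin /freq_weight /tail fourierRn_cut//.
  rewrite ger0_norm ?enorm_ge0// cabsM cabsC normr_nat.
  have [Me|] := ltP M (enorm xi); last by rewrite !mul0r expr0n mulr0.
  rewrite !mul1r -[leRHS]mul1r ler_wpM2r ?sqr_ge0// powRN invf_le1.
    apply: (@le_trans _ _ (enorm xi `^ 0)); first by rewrite powRr0.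
    by apply: ler_powR => //; exact: le_trans M1 (ltW Me).
  by rewrite powR_gt0// (lt_trans M0).
by apply: leeD; exact: W.
Qed.

Definition in_L12 f := cintegrable mu f /\ (\int[mu]_x (cabs (f x) ^+ 2)%:E < +oo)%E.

(** The cutoff [j.+1] is at least [1] from the start, the range in which [freq_op_diff_L2] holds. *)
Definition freq_seq f (j : nat) (z : Zn R n.+1) : R[i] := freq_op m j.+1%:R (fun=> f) z.1 z.2.

Lemma cmeasurable_freq_seq f j : cmeasurable f -> cmeasurable (freq_seq f j).
Proof.
by move=> mf; apply: (cmeasurable_freq_op mm _ (F := fun=> f)); exact: (cmeasurable_comp measurable_snd).
Qed.

Lemma powR2E (x : R) : 0 <= x -> x `^ 2 = x ^+ 2.
Proof. by move=> x0; rewrite -powR_mulrn. Qed.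

(** By Plancherel the transform is square integrable, so its tails tend to [0] by dominated
    convergence, and these tails control the differences of two cutoffs. *)
Lemma freq_seq_cauchy f : in_L12 f -> exists v, Lcvg zm 2 (freq_seq f) v.
Proof.
move=> [fi f2]; have mf : cmeasurable f by case: fi.
apply: Lcvg_complete => // [j|e e0]; first exact: cmeasurable_freq_seq.
pose G (xi : Rn R n.+1) := cabs (fourierRn f (1 *: xi)) ^+ 2 + cabs (fourierRn f (- 1 *: xi)) ^+ 2.
pose g_ (k : nat) xi := (k.+1%:R < enorm xi)%R%:R * G xi.
have mG : measurable_fun setT G by apply: measurable_funD; exact: measurable_fourierRn_scale.
have G0 xi : 0 <= G xi by rewrite addr_ge0 ?sqr_ge0.
have mg k : measurable_fun setT (g_ k).
  by apply: measurable_funM => //; apply: measurable_lt_natr => //; exact: measurable_enorm.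
have gG k xi : 0 <= g_ k xi <= G xi by rewrite mulr_bool_le// mulr_ge0.
have g0 xi : g_ ^~ xi @ \oo --> 0.
  apply: cvg_near_cst; near=> k; rewrite /g_ ltNge.
  suff -> : enorm xi <= k.+1%:R by rewrite mul0r.
  apply: (@le_trans _ _ k%:R); last by rewrite ler_nat.
  by near: k; exact: nbhs_infty_ger.
have fs sg : measurable_fun setT (fun xi : Rn R n.+1 => (cabs (fourierRn f (sg *: xi)) ^+ 2)%:E).
  by apply/measurable_EFinP; exact: measurable_fourierRn_scale.
have Goo : (\int[mu]_xi (G xi)%:E < +oo)%E.
  rewrite /G; under eq_integral => xi _ do rewrite EFinD.
  rewrite (ge0_integralD mu measurableT _ (fs 1) _ (fs (- 1))); last 2 first.
  - by move=> xi _; rewrite lee_fin sqr_ge0.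
  - by move=> xi _; rewrite lee_fin sqr_ge0.
  have foo sg : sg = 1 \/ sg = - 1 -> (\int[mu]_xi (cabs (fourierRn f (sg *: xi)) ^+ 2)%:E < +oo)%E.
    move=> sg1; apply: le_lt_trans (plancherel_Rn_sign fi sg1) _.
    by rewrite lte_mul_pinfty// lee_fin exprn_ge0// mulr_ge0// pi_ge0.
  by apply: lte_add_pinfty; apply: foo; [left|right].
pose K := 2 * pi * B ^+ 2; have K0 : 0 < K by rewrite !mulr_gt0 ?pi_gt0 ?exprn_gt0.
have eK : 0 < e / K by rewrite divr_gt0.
have [N hN] := dominated_small mg gG g0 mG Goo eK.
have main i j : (N <= i)%N -> (i <= j)%N ->
    (\int[zm]_z (cabs (freq_seq f j z - freq_seq f i z) `^ 2)%:E <= e%:E)%E.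
  move=> Ni ij; rewrite (eq_integralT zm (g := fun z => (cabs (freq_seq f j z - freq_seq f i z) ^+ 2)%:E)); last first.
    by move=> z; rewrite powR2E ?cabs_ge0.
  have i1 : 1 <= i.+1%:R :> R by rewrite ler1n.
  have ij' : i.+1%:R <= j.+1%:R :> R by rewrite ler_nat.
  apply: le_trans (freq_op_diff_L2 fi i1 ij') _.
  have -> : e = K * (e / K) by rewrite mulrC divfK// gt_eqF.
  rewrite [leRHS]EFinM; apply: lee_wpmul2l; first by rewrite lee_fin ltW.
  apply: le_trans (hN i Ni).
  rewrite -(ge0_integralD mu measurableT); last 4 first.
  - by move=> xi _; rewrite lee_fin mulr_ge0 ?sqr_ge0.
  - by apply/measurable_EFinP; exact: measurable_tail.
  - by move=> xi _; rewrite lee_fin mulr_ge0 ?sqr_ge0.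
  - by apply/measurable_EFinP; exact: measurable_tail.
  rewrite le_eqVlt; apply/orP; left; apply/eqP; apply: eq_integralT => xi.
  by rewrite -EFinD /tail /g_ /G mulrDr.
exists N => i j Ni Nj; have [ij|/ltnW ji] := leqP i j; last exact: main.
rewrite (eq_integralT zm (g := fun z => (cabs (freq_seq f j z - freq_seq f i z) `^ 2)%:E)); last first.
  by move=> z; rewrite cabsBC.
exact: main.
Unshelve. all: by end_near. Qed.

Definition freq_lim f : Zn R n.+1 -> R[i] := xget (fun=> 0) [set v | Lcvg zm 2 (freq_seq f) v].

Lemma freq_limP f : in_L12 f -> Lcvg zm 2 (freq_seq f) (freq_lim f).
Proof. by move=> /freq_seq_cauchy[v hv]; exact: (xgetPex (fun=> 0) (ex_intro _ v hv)). Qed.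

Lemma cmeasurable_freq_lim f : in_L12 f -> cmeasurable (freq_lim f).
Proof. by move=> /freq_limP[]. Qed.

Lemma in_L12_lin (b : R[i]) f g : in_L12 f -> in_L12 g -> in_L12 (fun x => b * f x + g x).
Proof.
move=> [fi f2] [gi g2]; split; first by apply: cintegrableD => //; exact: cintegrableZ.
have E2 (u : Rn R n.+1 -> R[i]) : (\int[mu]_x (cabs (u x) ^+ 2)%:E = \int[mu]_x (cabs (u x) `^ 2)%:E)%E.
  by apply: eq_integralT => x; rewrite powR2E ?cabs_ge0.
rewrite E2; apply: le_lt_trans (Lr_lin_le _ _ _ (proj1 fi) (proj1 gi)) _ => //.
rewrite -!E2; apply: lte_mul_pinfty; rewrite ?lee_fin ?powR_ge0//.
by apply: lte_add_pinfty; [apply: lte_mul_pinfty; rewrite ?lee_fin ?powR_ge0|exact: g2].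
Qed.

Lemma freq_seq_lin (b : R[i]) f g j z : cintegrable mu f -> cintegrable mu g ->
  freq_seq (fun x => b * f x + g x) j z = b * freq_seq f j z + freq_seq g j z.
Proof.
move=> fi gi; have j0 : 0 < j.+1%:R :> R by [].
have cf := cintegrable_freq_op z.1 z.2 fi j0; have cg := cintegrable_freq_op z.1 z.2 gi j0.
rewrite /freq_seq /freq_op /fourierR -(cintegralZ b cf) -(cintegralD (cintegrableZ b cf) cg).
apply: eq_cintegral => s; rewrite /freq_symbol.
have -> : fourierRn (fun x => b * f x + g x) (s *: sval z.1) =
    b * fourierRn f (s *: sval z.1) + fourierRn g (s *: sval z.1).
  have hf := cintegrable_fourier (s *: sval z.1) fi; have hg := cintegrable_fourier (s *: sval z.1) gi.
  rewrite /fourierRn -(cintegralZ b hf) -(cintegralD (cintegrableZ b hf) hg).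
  by apply: eq_cintegral => x; ring.
by ring.
Qed.

Lemma freq_lim_lin (b : R[i]) f g : in_L12 f -> in_L12 g ->
  {ae zm, forall z, freq_lim (fun x => b * f x + g x) z = b * freq_lim f z + freq_lim g z}.
Proof.
move=> fi gi; have mf := proj1 (proj1 fi); have mg := proj1 (proj1 gi).
have h := Lcvg_lin b (ltr0n _ 2 : 0 < 2 :> R) (fun j => cmeasurable_freq_seq j mf)
  (fun j => cmeasurable_freq_seq j mg) (freq_limP fi) (freq_limP gi).
have E : freq_seq (fun x => b * f x + g x) = (fun j z => b * freq_seq f j z + freq_seq g j z).
  by apply/funext => j; apply/funext => z; apply: freq_seq_lin; [case: fi|case: gi].
have := freq_limP (in_L12_lin b fi gi); rewrite E => h'.
have mE j : cmeasurable (freq_seq (fun x => b * f x + g x) j).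
  by apply: cmeasurable_freq_seq; case: (in_L12_lin b fi gi) => -[].
by rewrite E in mE; exact: (Lcvg_unique (ltr0n _ 2 : 0 < 2 :> R) mE h' h).
Qed.

(** The L^q bound is uniform in the cutoff and survives the L^2 limit by Fatou's lemma. *)
Lemma freq_lim_bound f S : in_L12 f -> 0 < S -> (\int[mu]_x (cabs (f x) `^ p)%:E <= S%:E)%E ->
  (\int[zm]_z (cabs (freq_lim f z) `^ q)%:E <= (Cq * S `^ (q - 1))%:E)%E.
Proof.
move=> fi S0 fS; have q0 : 0 < q by apply: lt_le_trans q2.
apply: (Lcvg_fatou (ltr0n _ 2 : 0 < 2 :> R) q0 _ (freq_limP fi)) => j.
  by apply: cmeasurable_freq_seq; case: fi => -[].
by apply: CqP => //; case: fi.
Qed.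

Lemma freq_lim_ae f g : cmeasurable f -> cmeasurable g -> {ae mu, forall x, f x = g x} ->
  freq_lim f = freq_lim g.
Proof.
move=> mf mg fg; suff E : freq_seq f = freq_seq g by rewrite /freq_lim E.
apply/funext => j; apply/funext => z; rewrite /freq_seq /freq_op /fourierR.
apply: eq_cintegral => s; congr (_ * _); rewrite /freq_symbol; congr (_ * _).
have me (u : Rn R n.+1 -> R[i]) xi : cmeasurable u -> cmeasurable (fun x => u x * expi (- dot x xi)).
  move=> mu_; apply: cmeasurableM => //.
  by apply: cmeasurable_expi; apply: measurable_funN; exact: measurable_dot.
apply: ae_eq_cintegral; [exact: me|exact: me|].
by apply: filterS fg => x ->.
Qed.

Lemma freq_lim_pointwise f w : in_L12 f ->
  (forall z, (fun j => cabs (freq_seq f j z - w z)) @ \oo --> 0) ->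
  {ae zm, forall z, freq_lim f z = w z}.
Proof.
move=> fi; apply: (Lcvg_pointwise (ltr0n _ 2 : 0 < 2 :> R)) (freq_limP fi) => j.
by apply: cmeasurable_freq_seq; case: fi => -[].
Qed.

Local Opaque freq_lim.

Let p0 : 0 < p. Proof. by apply: lt_trans p1. Qed.
Let q0 : 0 < q. Proof. by apply: lt_le_trans q2. Qed.
Let q10 : 0 < q - 1. Proof. by rewrite subr_gt0; apply: lt_le_trans q2; rewrite ltr1n. Qed.

Definition in_Lpow f := cmeasurable f /\ (\int[mu]_x (cabs (f x) `^ p)%:E < +oo)%E.

(** Both bounds matter. On the set where [|f| >= 1 / (j + 1)] one has
    [|f| <= (j + 1) ^ (p - 1) * |f| ^ p], so clipping an L^p function gives an integrable one; the
    upper bound then makes it square integrable. *)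
Definition level (j : nat) f (x : Rn R n.+1) : bool := j.+1%:R^-1 <= cabs (f x) <= j.+1%:R.

Definition clip (j : nat) f (x : Rn R n.+1) : R[i] := (level j f x)%:R%:C * f x.

Lemma cmeasurable_clip j f : cmeasurable f -> cmeasurable (clip j f).
Proof.
move=> mf; apply: cmeasurableM => //; apply: cmeasurableC; apply: measurable_bool_natr.
by apply: measurable_and; apply: measurable_fun_ler => //; exact: measurable_cabs.
Qed.

Lemma cabs_clip j f x : cabs (clip j f x) <= cabs (f x).
Proof. by rewrite /clip cabsM cabsC normr_nat mulr_bool_le ?cabs_ge0. Qed.

Lemma clip_eventually f x : \forall j \near \oo, clip j f x = f x.
Proof.
have [f0|f0] := eqVneq (cabs (f x)) 0.
  by apply: nearW => j; rewrite /clip (cabs_eq0 f0) mulr0.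
have fp : 0 < cabs (f x) by rewrite lt_neqAle eq_sym f0 cabs_ge0.
near=> j; rewrite /clip /level.
have j1 : cabs (f x) <= j.+1%:R.
  by apply: (@le_trans _ _ j%:R); [near: j; exact: nbhs_infty_ger|rewrite ler_nat].
have j2 : j.+1%:R^-1 <= cabs (f x).
  rewrite invf_ple ?posrE//; apply: (@le_trans _ _ j%:R); [near: j; exact: nbhs_infty_ger|by rewrite ler_nat].
by rewrite j1 j2 mul1r.
Unshelve. all: by end_near. Qed.

Lemma level_mono i j f x : (i <= j)%N -> level i f x -> level j f x.
Proof.
move=> ij /andP[h1 h2]; apply/andP; split.
  by apply: le_trans h1; rewrite lef_pV2 ?posrE// ler_nat.
by apply: (le_trans h2); rewrite ler_nat.
Qed.

Lemma in_L12_clip j f : in_Lpow f -> in_L12 (clip j f).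
Proof.
move=> [mf foo]; have mc := cmeasurable_clip j mf.
have j0 : 0 < j.+1%:R :> R by [].
have le1 x : cabs (clip j f x) <= j.+1%:R `^ (p - 1) * cabs (f x) `^ p.
  rewrite /clip cabsM cabsC normr_nat; case: (boolP (level j f x)) => [/andP[h1 h2]|_]; last first.
    by rewrite mul0r mulr_ge0 ?powR_ge0.
  have fp : 0 < cabs (f x) by apply: lt_le_trans h1; rewrite invr_gt0.
  rewrite mul1r -(mulr_powRB1 (cabs_ge0 _) p0) mulrCA -[leLHS]mulr1.
  rewrite ler_wpM2l ?cabs_ge0// -powRM ?cabs_ge0//.
  apply: (@le_trans _ _ (1 `^ (p - 1))); first by rewrite powR1.
  apply: ge0_ler_powR; rewrite ?nnegrE ?subr_ge0 ?(ltW p1)//.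
    by rewrite mulr_ge0 ?cabs_ge0.
  by rewrite -(ler_pdivrMl _ _ j0) mulr1.
have mfp : measurable_fun setT (fun x => (cabs (f x) `^ p)%:E).
  by apply/measurable_EFinP; exact: measurable_cabs_powR.
have fp0 x : (0 <= (cabs (f x) `^ p)%:E)%E by rewrite lee_fin powR_ge0.
have fin (c : R) : 0 <= c -> (\int[mu]_x (c * cabs (f x) `^ p)%:E < +oo)%E.
  move=> c0'; rewrite (eq_integralT mu (fun x => EFinM c (cabs (f x) `^ p))) (ge0_integralZlT mu mfp fp0 c0').
  by rewrite lte_mul_pinfty// lee_fin.
have mfc (c : R) : measurable_fun setT (fun x => (c * cabs (f x) `^ p)%:E).
  by apply/measurable_EFinP; apply: measurable_funM => //; exact: measurable_cabs_powR.
split.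
  split => //; apply: le_lt_trans (fin _ (powR_ge0 j.+1%:R (p - 1))).
  apply: ge0_le_integralT => // [|x]; first exact: measurable_ecabs.
  by rewrite lee_fin cabs_ge0.
apply: le_lt_trans (fin (j.+1%:R * j.+1%:R `^ (p - 1)) _); last by rewrite mulr_ge0 ?powR_ge0.
apply: ge0_le_integralT => // [|x|x].
- by apply/measurable_EFinP; apply: measurable_funX; exact: measurable_cabs.
- by rewrite lee_fin sqr_ge0.
rewrite lee_fin expr2 -mulrA; apply: ler_pM; rewrite ?cabs_ge0//.
rewrite /clip cabsM cabsC normr_nat; case: (boolP (level j f x)) => [/andP[h1 h2]|_]; last by rewrite mul0r.
by rewrite mul1r.
Qed.

Lemma in_Lpow_le f g : cmeasurable f -> in_Lpow g -> (forall x, cabs (f x) <= cabs (g x)) -> in_Lpow f.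
Proof.
move=> mf [mg goo] fg; split; first exact: mf.
apply: le_lt_trans goo; apply: ge0_le_integralT.
- by apply/measurable_EFinP; exact: measurable_cabs_powR.
- by apply/measurable_EFinP; exact: measurable_cabs_powR.
- by move=> x; rewrite lee_fin powR_ge0.
- by move=> x; rewrite lee_fin; apply: ge0_ler_powR; rewrite ?nnegrE ?cabs_ge0// ltW.
Qed.

Lemma in_Lpow_lin (b : R[i]) f g : in_Lpow f -> in_Lpow g -> in_Lpow (fun x => b * f x + g x).
Proof.
move=> [mf foo] [mg goo]; split.
  by apply: cmeasurableD => //; apply: cmeasurableM => //; exact: cmeasurable_cst.
apply: le_lt_trans (Lr_lin_le mu b p0 mf mg) _.
apply: lte_mul_pinfty; rewrite ?lee_fin ?powR_ge0//.
by apply: lte_add_pinfty; [apply: lte_mul_pinfty; rewrite ?lee_fin ?powR_ge0|exact: goo].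
Qed.

Definition extend f : Zn R n.+1 -> R[i] :=
  xget (fun=> 0) [set v | Lcvg zm q (fun j => freq_lim (clip j f)) v].

Lemma freq_lim_small e : 0 < e -> exists S, 0 < S /\ forall h, in_L12 h ->
  (\int[mu]_x (cabs (h x) `^ p)%:E <= S%:E)%E -> (\int[zm]_z (cabs (freq_lim h z) `^ q)%:E <= e%:E)%E.
Proof.
move=> e0; have C1 : 0 < Cq + 1 by rewrite ltr_wpDl.
have eC : 0 < e / (Cq + 1) by rewrite divr_gt0.
(* The solution of [(Cq + 1) * S ^ (q - 1) = e]; the [+ 1] covers [Cq = 0]. *)
exists ((e / (Cq + 1)) `^ (q - 1)^-1); split; first exact: powR_gt0.
move=> h hi hS; apply: le_trans (freq_lim_bound hi (powR_gt0 _ eC) hS) _.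
rewrite lee_fin -powRrM mulVf ?gt_eqF// powRr1 ?(ltW eC)//.
apply: (@le_trans _ _ ((Cq + 1) * (e / (Cq + 1)))); last by rewrite mulrC divfK// gt_eqF.
by rewrite ler_wpM2r ?(ltW eC)// lerDl.
Qed.

Lemma dominated_clip (h : nat -> Rn R n.+1 -> R[i]) g : in_Lpow g -> (forall j, cmeasurable (h j)) ->
  (forall j x, cabs (h j x) <= cabs (g x)) -> (forall x, \forall j \near \oo, h j x = 0) ->
  forall e, 0 < e -> exists N, forall j, (N <= j)%N -> (\int[mu]_x (cabs (h j x) `^ p)%:E <= e%:E)%E.
Proof.
move=> [mg goo] mh hg h0 e e0.
apply: (dominated_small (f_ := fun j x => cabs (h j x) `^ p) (g := fun x => cabs (g x) `^ p)) => //.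
- by move=> j; exact: measurable_cabs_powR.
- by move=> j x; rewrite powR_ge0; apply: ge0_ler_powR; rewrite ?nnegrE ?cabs_ge0// ltW.
- move=> x; apply: cvg_near_cst; near=> j.
  have -> : h j x = 0 by near: j; exact: h0.
  by rewrite cabs0 powR0// gt_eqF.
- exact: measurable_cabs_powR.
Unshelve. all: by end_near. Qed.

Lemma extend_cauchy f : in_Lpow f -> exists v, Lcvg zm q (fun j => freq_lim (clip j f)) v.
Proof.
move=> fp; have [mf foo] := fp.
apply: Lcvg_complete; first exact: q0.
  by move=> j; apply: cmeasurable_freq_lim; exact: in_L12_clip.
move=> e e0; have [S [S0 hS]] := freq_lim_small e0.
have mh j : cmeasurable (fun x => f x - clip j f x) by apply: cmeasurableB => //; exact: cmeasurable_clip.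
have hh j x : cabs (f x - clip j f x) <= cabs (f x).
  by rewrite /clip; case: (level j f x); rewrite ?mul1r ?subrr ?mul0r ?subr0// cabs0 cabs_ge0.
have h0 x : \forall j \near \oo, f x - clip j f x = 0.
  by apply: filterS (clip_eventually f x) => j ->; rewrite subrr.
have [N hN] := dominated_clip fp mh hh h0 S0.
exists N => i j Ni Nj; have ci := in_L12_clip i fp; have cj := in_L12_clip j fp.
have E := freq_lim_lin (- 1) cj ci.
have mij : cmeasurable (fun x => - 1 * clip j f x + clip i f x).
  by case: (in_L12_lin (- 1) cj ci) => -[].
pose w := freq_lim (fun x => - 1 * clip j f x + clip i f x).
have mw : cmeasurable w by apply: cmeasurable_freq_lim; exact: in_L12_lin.
have md : cmeasurable (fun z => freq_lim (clip i f) z - freq_lim (clip j f) z).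
  by apply: cmeasurableB; exact: cmeasurable_freq_lim.
have Ew : {ae zm, forall z, freq_lim (clip i f) z - freq_lim (clip j f) z = w z}.
  by apply: filterS E => z Ez; rewrite /w Ez mulN1r addrC.
rewrite (Lr_ae_eq q md mw Ew).
- apply: hS; first exact: in_L12_lin.
  (* Clips at levels [i, j >= N] agree where clip [N] already equals [f], and elsewhere their
     difference is bounded by [|f|]; so the tail at the single level [N] controls all pairs. *)
  apply: le_trans (hN N (leqnn N)); apply: ge0_le_integralT.
  + by apply/measurable_EFinP; exact: measurable_cabs_powR.
  + by apply/measurable_EFinP; exact: measurable_cabs_powR.
  + by move=> x; rewrite lee_fin powR_ge0.
  move=> x; rewrite lee_fin; apply: ge0_ler_powR; rewrite ?nnegrE ?cabs_ge0 ?(ltW p0)//.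
  rewrite mulN1r addrC /clip; case: (boolP (level N f x)) => lN.
    by rewrite (level_mono Ni lN) (level_mono Nj lN) mul1r !subrr.
  rewrite mul0r subr0; case: (level i f x); case: (level j f x);
    by rewrite ?mul1r ?mul0r ?subrr ?subr0 ?sub0r ?cabsN// cabs0 cabs_ge0.
Qed.

Lemma extendP f : in_Lpow f -> Lcvg zm q (fun j => freq_lim (clip j f)) (extend f).
Proof. by move=> /extend_cauchy[v hv]; exact: (xgetPex (fun=> 0) (ex_intro _ v hv)). Qed.

Lemma extend_ae f g : cmeasurable f -> cmeasurable g -> {ae mu, forall x, f x = g x} ->
  extend f = extend g.
Proof.
move=> mf mg fg.
have E : (fun j => freq_lim (clip j f)) = (fun j => freq_lim (clip j g)).
  apply/funext => j; apply: freq_lim_ae; [exact: cmeasurable_clip|exact: cmeasurable_clip|].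
  by apply: filterS fg => x fgx; rewrite /clip /level fgx.
exact: (f_equal (fun u => xget (fun=> 0) [set v | Lcvg zm q u v]) E).
Qed.

(** The defect of linearity of clipping, [r j], vanishes for large [j] at each point and is
    dominated by an L^p function. Hence it tends to [0] in L^p, and its image tends to [0] in L^q by
    [freq_lim_small]. *)
Lemma extend_lin (b : R[i]) f g : in_Lpow f -> in_Lpow g ->
  {ae zm, forall z, extend (fun x => b * f x + g x) z = b * extend f z + extend g z}.
Proof.
move=> fp gp; have hp := in_Lpow_lin b fp gp; set h := (fun x => b * f x + g x) in hp *.
have [mf _] := fp; have [mg _] := gp; have [mh _] := hp.
have cf j := in_L12_clip j fp; have cg j := in_L12_clip j gp; have ch j := in_L12_clip j hp.
pose k j x := b * clip j f x + clip j g x.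
have ck j : in_L12 (k j) by exact: in_L12_lin.
pose r j x := - 1 * clip j h x + k j x.
have cr j : in_L12 (r j) by exact: in_L12_lin.
(* One copy of the sum dominates the clipped combination, the other the combination of the clipped
   functions. *)
pose G x : R[i] := (2 * (cabs b * cabs (f x) + cabs (g x)))%:C.
have Gp : in_Lpow G.
  have absp (u : Rn R n.+1 -> R[i]) : in_Lpow u -> in_Lpow (fun x => (cabs (u x))%:C).
    move=> up; apply: (in_Lpow_le _ up); last by move=> x; rewrite cabsC ger0_norm ?cabs_ge0.
    by apply: cmeasurableC; apply: measurable_cabs; case: up.
  have := in_Lpow_lin (2 * cabs b)%:C (absp _ fp) (in_Lpow_lin 1 (absp _ gp) (absp _ gp)).
  rewrite (_ : (fun x => _) = G)//; apply/funext => x; rewrite /G mul1r.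
  by rewrite -!rmorphM -!rmorphD/=; congr (_%:C); ring.
have rG j x : cabs (r j x) <= cabs (G x).
  have s0 : 0 <= cabs b * cabs (f x) + cabs (g x) by rewrite addr_ge0 ?mulr_ge0 ?cabs_ge0.
  rewrite /G cabsC ger0_norm ?mulr_ge0// /r mulN1r.
  apply: le_trans (cabsD _ _) _; rewrite cabsN mulr_natl mulr2n; apply: lerD.
    by apply: le_trans (cabs_clip _ _ _) _; apply: le_trans (cabsD _ _) _; rewrite cabsM.
  rewrite /k; apply: le_trans (cabsD _ _) _; rewrite cabsM.
  by apply: lerD; [rewrite ler_wpM2l ?cabs_ge0//|]; exact: cabs_clip.
have r0 x : \forall j \near \oo, r j x = 0.
  near=> j; rewrite /r /k.
  have -> : clip j h x = h x by near: j; exact: clip_eventually.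
  have -> : clip j f x = f x by near: j; exact: clip_eventually.
  have -> : clip j g x = g x by near: j; exact: clip_eventually.
  by rewrite mulN1r /h addNr.
have mr j : cmeasurable (r j) by case: (cr j) => -[].
have Lf := extendP fp; have Lg := extendP gp; have Lh := extendP hp.
have mT (u : nat -> Rn R n.+1 -> R[i]) : (forall j, in_L12 (u j)) -> forall j, cmeasurable (freq_lim (u j)).
  by move=> cu j; exact: cmeasurable_freq_lim.
have Lr : Lcvg zm q (fun j => freq_lim (r j)) (fun=> 0).
  split; first exact: cmeasurable_cst.
  move=> e e0; have [S [S0 hS]] := freq_lim_small e0.
  have [N hN] := dominated_clip Gp mr rG r0 S0; exists N => j Nj.
  by under eq_integral do rewrite subr0; apply: hS => //; exact: hN.
apply: (Lcvg_defect q0 (mT _ ch) (mT _ cf) (mT _ cg) (mT _ cr) Lh Lf Lg Lr) => j.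
exact: (ae_defect (freq_lim_lin (- 1) (ch j) (ck j)) (freq_lim_lin b (cf j) (cg j))).
Unshelve. all: by end_near. Qed.

Lemma extend_bound f S : in_Lpow f -> 0 < S -> (\int[mu]_x (cabs (f x) `^ p)%:E <= S%:E)%E ->
  (\int[zm]_z (cabs (extend f z) `^ q)%:E <= (Cq * S `^ (q - 1))%:E)%E.
Proof.
move=> fp S0 fS.
apply: (Lcvg_fatou q0 q0 _ (extendP fp)) => j.
  by apply: cmeasurable_freq_lim; exact: in_L12_clip.
have [mf _] := fp.
apply: (freq_lim_bound (in_L12_clip j fp) S0).
apply: le_trans fS; apply: ge0_le_integralT.
- by apply/measurable_EFinP; apply: measurable_cabs_powR; exact: cmeasurable_clip.
- by apply/measurable_EFinP; exact: measurable_cabs_powR.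
- by move=> x; rewrite lee_fin powR_ge0.
- by move=> x; rewrite lee_fin; apply: ge0_ler_powR; rewrite ?nnegrE ?cabs_ge0 ?cabs_clip// ltW.
Qed.

Lemma extend_freq_lim f : in_Lpow f -> in_L12 f -> {ae zm, forall z, extend f z = freq_lim f z}.
Proof.
move=> fp f2; have [mf _] := fp.
have cf j := in_L12_clip j fp.
have mT j : cmeasurable (freq_lim (clip j f)) by exact: cmeasurable_freq_lim.
apply: (Lcvg_unique q0 mT (extendP fp)); split; first exact: cmeasurable_freq_lim.
move=> e e0; have [S [S0 hS]] := freq_lim_small e0.
pose h j x := - 1 * f x + clip j f x.
have ch j : in_L12 (h j) by exact: in_L12_lin.
have mh j : cmeasurable (h j) by case: (ch j) => -[].
have hh j x : cabs (h j x) <= cabs (f x).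
  by rewrite /h mulN1r /clip; case: (level j f x); rewrite ?mul1r ?addNr ?mul0r ?addr0 ?cabsN// cabs0 cabs_ge0.
have h0 x : \forall j \near \oo, h j x = 0.
  by apply: filterS (clip_eventually f x) => j; rewrite /h => ->; rewrite mulN1r addNr.
have [N hN] := dominated_clip fp mh hh h0 S0; exists N => j Nj.
have md : cmeasurable (fun z => freq_lim (clip j f) z - freq_lim f z).
  by apply: cmeasurableB; [exact: mT|exact: cmeasurable_freq_lim].
have Ew : {ae zm, forall z, freq_lim (clip j f) z - freq_lim f z = freq_lim (h j) z}.
  by apply: filterS (freq_lim_lin (- 1) f2 (cf j)) => z ->; rewrite mulN1r addrC.
rewrite (Lr_ae_eq q md (cmeasurable_freq_lim (ch j)) Ew).
by apply: (hS _ (ch j)); exact: hN.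
Qed.

End extension.

Lemma LpnormE d (T : measurableType d) (R : realType) (mu : {measure set T -> \bar R}) (p : R) (f : T -> R[i]) :
  Lpnorm mu p%:E f = ((\int[mu]_x (cabs (f x) `^ p)%:E) `^ p^-1)%E.
Proof.
have E x : (`|(cabs (f x))%:E| `^ p = (cabs (f x) `^ p)%:E)%E.
  by rewrite gee0_abs ?lee_fin ?cabs_ge0// poweR_EFin.
by rewrite /Lpnorm unlock (eq_integralT mu E).
Qed.

Lemma in_LpE d (T : measurableType d) (R : realType) (mu : {measure set T -> \bar R}) (p : R) (f : T -> R[i]) :
  0 < p -> in_Lp mu p%:E f <-> cmeasurable f /\ (\int[mu]_x (cabs (f x) `^ p)%:E < +oo)%E.
Proof.
move=> p0; rewrite /in_Lp LpnormE; split => -[mf h]; split => //.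
  by apply: lty_poweRy h; rewrite invr_eq0 gt_eqF.
exact: poweR_lty.
Qed.

Section bounded_extension.
Context {R : realType} (n : nat).
Local Notation leb := (@lebesgue_measure R).
Local Notation mu := (@lebRn R n.+1).
Local Notation zm := (@Zn_measure R n.+1).

Variables (m : R -> R[i]) (al0 B : R).
Hypothesis mm : cmeasurable (m : measurableTypeR R -> R[i]).
Hypothesis B0 : 0 < B.
Hypothesis mB : forall s, cabs (m s) <= B * `|s| `^ (- al0).
Hypothesis al1 : al0 < 1.
Variables (p q : R).
Hypothesis p1 : 1 < p.
Hypothesis q2 : 2 <= q.
Hypothesis pq : (p - 1) * (q - 1) = 1.
Hypothesis aq : (1 - al0) * (q - 2) = 2 * al0 + n%:R.

Lemma freq_extension : exists A : (Rn R n.+1 -> R[i]) -> (Zn R n.+1 -> R[i]),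
  bounded_linear_Lp (lebesgue_Rn n.+1) (Zn_measure n.+1) p%:E q%:E A /\
  forall f w, in_Lpow p f -> in_L12 f -> (forall z, (fun j => cabs (freq_seq m f j z - w z)) @ \oo --> 0) ->
    {ae Zn_measure n.+1, forall z, A f z = w z}.
Proof.
have p0 : 0 < p by apply: lt_trans p1.
have q0 : 0 < q by apply: lt_le_trans q2.
have q10 : 0 < q - 1 by rewrite subr_gt0; apply: lt_le_trans q2; rewrite ltr1n.
have inLp (f : Rn R n.+1 -> R[i]) : in_Lp (lebesgue_Rn n.+1) p%:E f -> in_Lpow p f by move=> /(in_LpE _ _ p0).
exists (extend m q); split; last first.
  move=> f w fp f2 fw.
  have e1 := extend_freq_lim mm B0 mB al1 p1 q2 pq aq fp f2.
  have e2 := freq_lim_pointwise mm B0 mB al1 q2 aq f2 fw.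
  by apply: filterS2 e1 e2 => z -> ->.
have [C0 bnd] : exists C, 0 <= C /\ forall f S, in_Lpow p f -> 0 < S ->
    (\int[mu]_x (cabs (f x) `^ p)%:E <= S%:E)%E ->
    (\int[zm]_z (cabs (extend m q f z) `^ q)%:E <= (C * S `^ (q - 1))%:E)%E.
  eexists; split; last first.
    move=> f S; exact: (@extend_bound R n m al0 B mm B0 mB al1 p q p1 q2 pq aq f S).
  by case: cid => C [].
move: bnd => [C00 bnd].
have mE (f : Rn R n.+1 -> R[i]) : in_Lpow p f -> cmeasurable (extend m q f).
  by move=> fp; case: (extendP mm B0 mB al1 p1 q2 pq aq fp).
(* The bound is known for positive [S] only; for functions of norm [0] it follows by letting [S]
   tend to [0]. *)
have sharp (f : Rn R n.+1 -> R[i]) s : in_Lpow p f -> 0 <= s -> (\int[mu]_x (cabs (f x) `^ p)%:E = s%:E)%E ->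
    (\int[zm]_z (cabs (extend m q f z) `^ q)%:E <= (C0 * s `^ (q - 1))%:E)%E.
  move=> fp; rewrite le_eqVlt => /orP[/eqP <- fs|s0 fs]; last by apply: bnd => //; rewrite fs.
  rewrite powR0 ?gt_eqF// mulr0; apply/lee_addgt0Pr => e e0; rewrite add0e.
  have eC : 0 < e / (C0 + 1) by rewrite divr_gt0// ltr_wpDl.
  have S0 : 0 < (e / (C0 + 1)) `^ (q - 1)^-1 by exact: powR_gt0.
  apply: le_trans (bnd f _ fp S0 _) _; first by rewrite fs lee_fin ltW.
  rewrite lee_fin -powRrM mulVf ?gt_eqF// powRr1 ?(ltW eC)//.
  apply: (@le_trans _ _ ((C0 + 1) * (e / (C0 + 1)))).
    by rewrite ler_wpM2r ?(ltW eC)// lerDl.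
  by rewrite mulrC divfK// gt_eqF// ltr_wpDl.
have fins (f : Rn R n.+1 -> R[i]) : in_Lpow p f -> exists2 s, 0 <= s & (\int[mu]_x (cabs (f x) `^ p)%:E = s%:E)%E.
  move=> [mf foo]; exists (fine (\int[mu]_x (cabs (f x) `^ p)%:E)).
    by apply: fine_ge0; apply: integral_ge0 => x _; rewrite lee_fin powR_ge0.
  by rewrite fineK// ge0_fin_numE//; apply: integral_ge0 => x _; rewrite lee_fin powR_ge0.
split.
- move=> f /inLp fp; apply/(in_LpE _ _ q0); split; first exact: mE.
  by have [s s0 fs] := fins f fp; apply: le_lt_trans (sharp f s fp s0 fs) (ltry _).
- move=> f g /inLp[mf _] /inLp[mg _] fg; apply: aeW => z.
  by rewrite (extend_ae m q mf mg fg).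
- move=> b f g /inLp fp /inLp gp.
  exact: (extend_lin mm B0 mB al1 p1 q2 pq aq b fp gp).
- exists (C0 `^ q^-1); split; first exact: powR_ge0.
  move=> f /inLp fp; have [s s0 fs] := fins f fp; have := sharp f s fp s0 fs.
  have -> : Lpnorm (lebesgue_Rn n.+1) p%:E f = (s `^ p^-1)%:E.
    by rewrite LpnormE -poweR_EFin; congr (_ `^ _)%E; exact: fs.
  move=> h; rewrite LpnormE -EFinM.
  (* Conjugacy gives [p * (q - 1) = q], so [(q - 1) / q = 1 / p] and the estimate for integrals
     becomes one for norms. *)
  have -> : C0 `^ q^-1 * s `^ p^-1 = (C0 * s `^ (q - 1)) `^ q^-1.
    rewrite powRM ?powR_ge0// -powRrM; congr (_ * _ `^ _).
    have qp : p * (q - 1) = q by move: pq => h'; lra.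
    by rewrite -[in q^-1]qp; field; rewrite (gt_eqF p0) (gt_eqF q10).
  rewrite -poweR_EFin; apply: gt0_ler_poweR.
  + by rewrite invr_ge0 ltW.
  + by rewrite in_itv/= leey andbT; apply: integral_ge0 => x _; rewrite lee_fin powR_ge0.
  + by rewrite in_itv/= leey andbT lee_fin mulr_ge0 ?powR_ge0.
  + exact: h.
Qed.

End bounded_extension.

(** * Analytic functions on half-planes *)

Section real_derivative.
Context {R : realType}.
Implicit Types (f : R -> R) (s d : R).

Lemma is_derive_eps f s d : (forall e, 0 < e -> exists2 r, 0 < r & forall h, `|h| < r ->
  `|f (s + h) - f s - h * d| <= e * `|h|) -> is_derive s 1 f d.
Proof.
move=> H.
have L : (fun h => h^-1 *: ((f \o shift s) (h *: (1 : R)) - f s)) @ 0^' --> d.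
  apply/cvgrPdist_le => e e0; have [r r0 hr] := H e e0.
  near=> h; have h0 : h != 0 by near: h; exact: nbhs_dnbhs_neq.
  have hlt : `|h| < r by near: h; exact: dnbhs0_lt.
  rewrite /= [h *: 1]mulr1 [h + s]addrC /GRing.scale/=.
  have -> : d - h^-1 * (f (s + h) - f s) = - (h^-1 * (f (s + h) - f s - h * d)) by field.
  by rewrite normrN normrM normfV ler_pdivrMl ?normr_gt0// [leRHS]mulrC; exact: hr.
split; first by apply/cvg_ex; exists d.
exact: cvg_lim L.
Unshelve. all: by end_near. Qed.

Lemma is_derive_epsP f s d : is_derive s 1 f d -> forall e, 0 < e -> exists2 r, 0 < r & forall h, `|h| < r ->
  `|f (s + h) - f s - h * d| <= e * `|h|.
Proof.
move=> [df fd] e e0; have L : (fun h => h^-1 *: ((f \o shift s) (h *: (1 : R)) - f s)) @ 0^' --> d.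
  by rewrite -fd; exact: df.
move/cvgrPdist_le: L => /(_ e e0); rewrite /dnbhs near_withinE => /nbhs_ballP[r /= r0 hr].
exists r => // h hr'; have [->|h0] := eqVneq h 0.
  by rewrite addr0 subrr mul0r subr0 normr0 mulr0.
have := hr h; rewrite /ball/= sub0r normrN => /(_ hr' h0).
rewrite /= [h *: 1]mulr1 [h + s]addrC /GRing.scale/=.
have -> : d - h^-1 * (f (s + h) - f s) = - (h^-1 * (f (s + h) - f s - h * d)) by field.
by rewrite normrN normrM normfV ler_pdivrMl ?normr_gt0// (mulrC e).
Qed.

End real_derivative.

Section complex_derivative.
Context {R : realType}.
Implicit Types (P Q : R -> R[i]) (F G : R[i] -> R[i]) (z d : R[i]).

(** The derivative of a complex path in a real variable, taken on real and imaginary parts as for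
    Schwartz functions. *)
Definition rdiff P (s : R) d := is_derive s (1 : R) (fun x => complex.Re (P x) : R) (complex.Re d) /\
  is_derive s (1 : R) (fun x => complex.Im (P x) : R) (complex.Im d).

Lemma rdiff_eq P s d d' : rdiff P s d -> d = d' -> rdiff P s d'.
Proof. by move=> ? <-. Qed.

Lemma rdiff_unique P s d d' : rdiff P s d -> rdiff P s d' -> d = d'.
Proof.
move=> [D1 D2] [E1 E2]; apply: complex_ext.
- by rewrite -(@derive_val _ _ _ _ _ _ _ D1) -(@derive_val _ _ _ _ _ _ _ E1).
- by rewrite -(@derive_val _ _ _ _ _ _ _ D2) -(@derive_val _ _ _ _ _ _ _ E2).
Qed.

Lemma rdiff_cst z s : rdiff (fun=> z) s 0.
Proof. by split; exact: is_derive_cst. Qed.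

Lemma rdiffD P Q s d d' : rdiff P s d -> rdiff Q s d' -> rdiff (fun x => P x + Q x) s (d + d').
Proof.
move=> [D1 D2] [E1 E2]; split.
- by rewrite ReD; under eq_fun do rewrite ReD; exact: is_deriveD.
- by rewrite ImD; under eq_fun do rewrite ImD; exact: is_deriveD.
Qed.

Lemma rdiffN P s d : rdiff P s d -> rdiff (fun x => - P x) s (- d).
Proof.
move=> [D1 D2]; split.
- by rewrite ReN; under eq_fun do rewrite ReN; exact: is_deriveN.
- by rewrite ImN; under eq_fun do rewrite ImN; exact: is_deriveN.
Qed.

Lemma rdiffB P Q s d d' : rdiff P s d -> rdiff Q s d' -> rdiff (fun x => P x - Q x) s (d - d').
Proof. by move=> D E; apply: rdiffD => //; exact: rdiffN. Qed.

Lemma rdiffM P Q s d d' : rdiff P s d -> rdiff Q s d' ->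
  rdiff (fun x => P x * Q x) s (P s * d' + d * Q s).
Proof.
move=> [D1 D2] [E1 E2]; split.
- under eq_fun do rewrite ReM; apply: is_derive_eq.
  by rewrite ReD !ReM /GRing.scale/=; ring.
- under eq_fun do rewrite ImM; apply: is_derive_eq.
  by rewrite ImD !ImM /GRing.scale/=; ring.
Qed.

Lemma rdiffC (u : R -> R) (s du : R) : is_derive s (1 : R) u du -> rdiff (fun x => (u x)%:C) s du%:C.
Proof. by move=> D; split => //=; exact: is_derive_cst. Qed.

Lemma rdiffZ z P s d : rdiff P s d -> rdiff (fun x => z * P x) s (z * d).
Proof. by move=> D; apply: rdiff_eq (rdiffM (rdiff_cst z s) D) _; rewrite mul0r addr0. Qed.

Lemma rdiff_comp P (u : R -> R) s d du : rdiff P (u s) d -> is_derive s (1 : R) u du ->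
  rdiff (fun x => P (u x)) s (du%:C * d).
Proof.
move=> [D1 D2] U; split.
- by rewrite ReM /= mul0r subr0 mulrC; exact: (is_derive1_comp D1 U).
- by rewrite ImM /= mul0r addr0 mulrC; exact: (is_derive1_comp D2 U).
Qed.

Lemma rdiff_cexp P s d : rdiff P s d -> rdiff (fun x => cexp (P x)) s (d * cexp (P s)).
Proof.
move=> [D1 D2].
have De : rdiff (fun x => (expR (complex.Re (P x)))%:C) s (complex.Re d * expR (complex.Re (P s)))%:C.
  apply: rdiffC; rewrite mulrC; exact: (is_derive1_comp (is_derive_expR _) D1).
have Di : rdiff (fun x => expi (complex.Im (P x))) s ((complex.Im d)%:C * ('i * expi (complex.Im (P s)))).
  split.
    rewrite (_ : complex.Re _ = - sin (complex.Im (P s)) * complex.Im d); last first.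
      by rewrite !ReM !ImM /=; ring.
    exact: (is_derive1_comp (is_derive_cos _) D2).
  rewrite (_ : complex.Im _ = cos (complex.Im (P s)) * complex.Im d); last first.
    by rewrite !ImM !ReM /=; ring.
  exact: (is_derive1_comp (is_derive_sin _) D2).
apply: rdiff_eq (rdiffM De Di) _; rewrite /cexp rmorphM /= {3}(_ : d = (complex.Re d)%:C + 'i * (complex.Im d)%:C).
  by ring.
by apply: complex_ext; rewrite ?ReD ?ImD ?ReM ?ImM /=; ring.
Qed.

Lemma rdiff_affine z w s : rdiff (fun x => z + x%:C * w) s w.
Proof.
have := rdiffD (rdiff_cst z s) (rdiffM (rdiffC (is_derive_id s (1 : R))) (rdiff_cst w s)).
by move=> D; apply: (rdiff_eq D); rewrite mulr0 !add0r mul1r.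
Qed.

Lemma rdiff_continuous P s d : rdiff P s d ->
  {for s, continuous (fun x : R => complex.Re (P x) : R)} /\ {for s, continuous (fun x : R => complex.Im (P x) : R)}.
Proof.
move=> [[D1 _] [D2 _]]; split.
- by apply/differentiable_continuous; rewrite -derivable1_diffP.
- by apply/differentiable_continuous; rewrite -derivable1_diffP.
Qed.

(* Testing the increment against its own conjugate reduces to the real mean value theorem. *)
Lemma rdiff_mvt P (D : R -> R[i]) (M : R) : (forall s, 0 <= s <= 1 -> rdiff P s (D s)) ->
  (forall s, 0 <= s <= 1 -> cabs (D s) <= M) -> cabs (P 1 - P 0) <= M.
Proof.
move=> dP DM; set w := P 1 - P 0.
pose g (s : R) := complex.Re w * complex.Re (P s) + complex.Im w * complex.Im (P s).
pose dg (s : R) := complex.Re w * complex.Re (D s) + complex.Im w * complex.Im (D s).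
have gd (s : R) : 0 <= s <= 1 -> is_derive s (1 : R) g (dg s).
  by move=> /dP[D1 D2]; exact: is_deriveD.
have [c c01 gc] : exists2 c, c \in `]0, 1[%R & g 1 - g 0 = dg c * (1 - 0).
  apply: MVT => // [x|]; first by rewrite in_itv/= => /andP[x0 x1]; apply: gd; rewrite !ltW.
  by apply: derivable_within_continuous => x; rewrite in_itv/= => /gd[].
have c1 : 0 <= c <= 1 by move: c01; rewrite in_itv/= => /andP[? ?]; rewrite !ltW.
have E : cabs w ^+ 2 = dg c.
  rewrite -[RHS]mulr1 -[X in _ * X](subr0 1) -gc sqr_cabs /g.
  rewrite {1 3}/w ReD ImD ReN ImN; ring.
have [w0|wn] := eqVneq (cabs w) 0; first by rewrite w0; apply: le_trans (cabs_ge0 _) (DM c c1).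
have wp : 0 < cabs w by rewrite lt_neqAle eq_sym wn cabs_ge0.
rewrite -(ler_pM2l wp) -expr2 E.
apply: (@le_trans _ _ (cabs w * cabs (D c))); last by rewrite ler_wpM2l ?cabs_ge0// DM.
have -> : dg c = complex.Re (w^* * D c) by rewrite /dg ReM; case: (w) => ? ? /=; ring.
by apply: le_trans (ler_norm _) _; apply: le_trans (normRe_cabs _) _; rewrite cabsM cabs_conj.
Qed.

Lemma rdiff_mvt_ab P (D : R -> R[i]) (a b M : R) : a <= b -> (forall s, a <= s <= b -> rdiff P s (D s)) ->
  (forall s, a <= s <= b -> cabs (D s) <= M) -> cabs (P b - P a) <= M * (b - a).
Proof.
move=> ab dP DM; have ab0 : 0 <= b - a by rewrite subr_ge0.
have in_ab s : 0 <= s <= 1 -> a <= a + s * (b - a) <= b.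
  move=> /andP[s0 s1]; rewrite lerDl mulr_ge0//= -lerBrDl.
  by rewrite ler_piMl.
have dq s : is_derive s (1 : R) (fun x => a + x * (b - a)) (b - a).
  have D1 := is_deriveD (is_derive_cst a s (1 : R)) (is_deriveZ (b - a) (is_derive_id s (1 : R))).
  have -> : (fun x : R => a + x * (b - a)) = (cst a + (b - a) \*: id).
    by apply/funext => x /=; rewrite /GRing.scale/= mulrC.
  by apply: (is_derive_eq D1); rewrite add0r /GRing.scale/= mulr1.
have := @rdiff_mvt (fun x => P (a + x * (b - a))) (fun s => (b - a)%:C * D (a + s * (b - a))) (M * (b - a)).
rewrite mul1r mul0r addr0 (addrC a) subrK; apply.
- by move=> s /in_ab s01; exact: (rdiff_comp (u := fun x => a + x * (b - a)) (dP _ s01) (dq s)).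
- by move=> s /in_ab s01; rewrite cabsM cabsC ger0_norm// mulrC ler_wpM2r// DM.
Qed.

Lemma rdiff_const P (a b : R) : a <= b -> (forall s, a <= s <= b -> rdiff P s 0) -> P b = P a.
Proof.
move=> ab dP; apply/eqP; rewrite -subr_eq0; apply/eqP; apply: cabs_eq0; apply/eqP.
rewrite eq_le cabs_ge0 andbT.
have := rdiff_mvt_ab (M := 0) ab dP; rewrite mul0r; apply => s _.
by rewrite cabs0.
Qed.

(** Complex differentiability with derivative [d], in the form of a first-order remainder with real
    bounds; [cdiff_derivable] and [derivable_cdiff] translate to and from the library notion. *)
Definition cdiff F z d := forall e, 0 < e -> exists2 r, 0 < r & forall h, cabs h < r ->
  cabs (F (z + h) - F z - h * d) <= e * cabs h.

Lemma cdiff_eq F z d d' : cdiff F z d -> d = d' -> cdiff F z d'.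
Proof. by move=> ? <-. Qed.

Lemma cdiff_rdiff F z d w : cdiff F z d -> rdiff (fun x => F (z + x%:C * w)) 0 (w * d).
Proof.
move=> H; pose K := cabs w + 1; have K0 : 0 < K by rewrite ltr_wpDl ?cabs_ge0.
have main e : 0 < e -> exists2 r, 0 < r & forall h : R, `|h| < r ->
    cabs (F (z + h%:C * w) - F z - h%:C * (w * d)) <= e * `|h|.
  move=> e0; have [r r0 hr] := H (e / K) (divr_gt0 e0 K0); exists (r / K); first exact: divr_gt0.
  move=> h hrK; have hw : cabs (h%:C * w) <= `|h| * K.
    by rewrite cabsM cabsC ler_wpM2l// lerDl.
  have lt : cabs (h%:C * w) < r by apply: le_lt_trans hw _; rewrite -ltr_pdivlMr.
  rewrite mulrA; apply: le_trans (hr _ lt) _.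
  apply: (@le_trans _ _ (e / K * (`|h| * K))); first by rewrite ler_wpM2l// ltW// divr_gt0.
  by rewrite mulrCA divfK ?gt_eqF// mulrC.
split; apply: is_derive_eps => e e0; have [r r0 hr] := main e e0; exists r => // h /hr; rewrite add0r mul0r addr0;
  apply: le_trans.
- rewrite (_ : _ - _ = complex.Re (F (z + h%:C * w) - F z - h%:C * (w * d))); first exact: normRe_cabs.
  by rewrite ReD ReN ReD ReN [complex.Re (h%:C * _)]ReM /= mul0r subr0.
- rewrite (_ : _ - _ = complex.Im (F (z + h%:C * w) - F z - h%:C * (w * d))); first exact: normIm_cabs.
  by rewrite ImD ImN ImD ImN [complex.Im (h%:C * _)]ImM /= mul0r addr0.
Qed.

Lemma cdiff_rdiff_at F z w (s : R) d : cdiff F (z + s%:C * w) d -> rdiff (fun x => F (z + x%:C * w)) s (w * d).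
Proof.
move=> /(cdiff_rdiff w) H.
have ds : is_derive s (1 : R) (fun x => x - s) 1.
  by have := is_deriveB (is_derive_id s (1 : R)) (is_derive_cst s s (1 : R)); rewrite subr0.
have := rdiff_comp (u := fun x => x - s) (s := s) (du := 1).
move=> /(_ (fun x => F (z + s%:C * w + x%:C * w)) (w * d)); rewrite subrr => /(_ H ds).
rewrite mul1r; congr rdiff; apply/funext => x; congr F.
by rewrite rmorphB/=; ring.
Qed.

Lemma cdiff_cst c z : cdiff (fun=> c) z 0.
Proof. by move=> e e0; exists 1 => // h _; rewrite subrr mulr0 subr0 cabs0 mulr_ge0 ?cabs_ge0// ltW. Qed.

Lemma cdiff_id z : cdiff id z 1.
Proof.
move=> e e0; exists 1 => // h _.
by rewrite mulr1 (addrC z) addrK subrr cabs0 mulr_ge0 ?cabs_ge0// ltW.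
Qed.

Lemma cdiffD F G z d d' : cdiff F z d -> cdiff G z d' -> cdiff (fun x => F x + G x) z (d + d').
Proof.
move=> HF HG e e0; have e2 : 0 < e / 2 by rewrite divr_gt0.
have [r1 r10 h1] := HF _ e2; have [r2 r20 h2] := HG _ e2.
exists (Num.min r1 r2); first by rewrite lt_min r10 r20.
move=> h; rewrite lt_min => /andP[/h1 A /h2 B].
rewrite (_ : _ - _ = (F (z + h) - F z - h * d) + (G (z + h) - G z - h * d')); last by ring.
apply: le_trans (cabsD _ _) _; apply: le_trans (lerD A B) _.
by rewrite -mulrDl -splitr.
Qed.

Lemma cdiff_continuous F z d : cdiff F z d -> forall e, 0 < e -> exists2 r, 0 < r &
  forall h, cabs h < r -> cabs (F (z + h) - F z) <= e.
Proof.
move=> HF e e0; have [r r0 hr] := HF 1 ltr01.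
have K0 : 0 < 1 + cabs d by rewrite ltr_pwDl ?cabs_ge0.
exists (Num.min r (e / (1 + cabs d))); first by rewrite lt_min r0 divr_gt0.
move=> h; rewrite lt_min => /andP[hr1 hr2].
rewrite -[F (z + h) - F z](subrK (h * d)); apply: le_trans (cabsD _ _) _.
apply: le_trans (lerD (hr _ hr1) (lexx _)) _; rewrite cabsM mulrC -mulrDr.
by rewrite -ler_pdivlMr// ltW.
Qed.

Lemma cdiffM F G z d d' : cdiff F z d -> cdiff G z d' ->
  cdiff (fun x => F x * G x) z (F z * d' + d * G z).
Proof.
move=> HF HG e e0.
pose K := cabs (F z) + 1 + cabs (G z) + cabs d'.
have := cabs_ge0 (F z); have := cabs_ge0 (G z); have := cabs_ge0 d' => d0 g0 f0.
have K0 : 0 < K by rewrite /K; lra.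
pose e' := Num.min 1 (e / (3 * K)).
have e'0 : 0 < e' by rewrite lt_min ltr01 divr_gt0// mulr_gt0.
have [r1 r10 h1] := HF _ e'0; have [r2 r20 h2] := HG _ e'0.
have [r3 r30 h3] := cdiff_continuous HF e'0.
exists (Num.min r1 (Num.min r2 r3)); first by rewrite !lt_min r10 r20.
move=> h; rewrite !lt_min => /and3P[/h1 A /h2 Bd /h3 C].
rewrite (_ : _ - _ = (F (z + h)) * (G (z + h) - G z - h * d') + (F (z + h) - F z - h * d) * G z
  + (F (z + h) - F z) * (h * d')); last by ring.
have e'1 : e' <= 1 by rewrite /e' ge_min lexx.
have e'K : e' * (3 * K) <= e.
  by rewrite -ler_pdivlMr ?mulr_gt0// /e' ge_min lexx orbT.
have Fh : cabs (F (z + h)) <= K.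
  rewrite -[F (z + h)](subrK (F z)); apply: le_trans (cabsD _ _) _.
  by rewrite /K; lra.
have ch0 := cabs_ge0 h.
have t1 : cabs (F (z + h)) * cabs (G (z + h) - G z - h * d') <= K * (e' * cabs h).
  by apply: ler_pM; rewrite ?cabs_ge0.
have t2 : cabs (F (z + h) - F z - h * d) * cabs (G z) <= (e' * cabs h) * K.
  by apply: ler_pM; rewrite ?cabs_ge0// /K; lra.
have t3 : cabs (F (z + h) - F z) * (cabs h * cabs d') <= e' * (cabs h * K).
  apply: ler_pM; rewrite ?cabs_ge0 ?mulr_ge0 ?cabs_ge0//.
  by rewrite ler_wpM2l// /K; lra.
apply: le_trans (cabsD _ _) _; apply: le_trans (lerD (cabsD _ _) (lexx _)) _.
rewrite !cabsM; apply: le_trans (lerD (lerD t1 t2) t3) _.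
rewrite (_ : _ + _ = e' * (3 * K) * cabs h); last by ring.
by rewrite ler_wpM2r.
Qed.

Lemma cdiffN F z d : cdiff F z d -> cdiff (fun x => - F x) z (- d).
Proof.
move=> H; have := cdiffM (cdiff_cst (- 1) z) H; rewrite mul0r addr0 mulN1r.
by rewrite (_ : (fun x => _) = (fun x => - F x)) //; apply/funext => x; rewrite mulN1r.
Qed.

Lemma cdiffB F G z d d' : cdiff F z d -> cdiff G z d' -> cdiff (fun x => F x - G x) z (d - d').
Proof. by move=> HF HG; apply: cdiffD => //; exact: cdiffN. Qed.

Lemma cdiffV F z d : cdiff F z d -> F z != 0 -> cdiff (fun x => (F x)^-1) z (- d / F z ^+ 2).
Proof.
move=> HF F0; have f0 : 0 < cabs (F z).
  by rewrite lt_neqAle cabs_ge0 andbT eq_sym; apply: contra_neq F0 => /cabs_eq0.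
have [r r0 hr] := cdiff_continuous HF (divr_gt0 f0 (ltr0n _ 2 : 0 < 2 :> R)).
(* [K] bounds the inverse of [F (z + h) * F z] once [|F (z + h)|] exceeds half of [|F z|]; [L]
   bounds the factor [d / F z] in the second-order term. *)
move=> e e0; pose K := (cabs (F z) / 2)^-1 * (cabs (F z))^-1.
have K0 : 0 < K by rewrite mulr_gt0 ?invr_gt0// divr_gt0.
pose L := cabs (d / F z) + 1; have L0 : 0 < L by rewrite ltr_wpDl ?cabs_ge0.
have e1 : 0 < e / (2 * K) by rewrite divr_gt0// mulr_gt0.
have e2 : 0 < e / (2 * K * L) by rewrite divr_gt0// mulr_gt0// mulr_gt0.
have [r1 r10 h1] := HF _ e1; have [r2 r20 h2] := cdiff_continuous HF e2.
exists (Num.min r (Num.min r1 r2)); first by rewrite !lt_min r0 r10.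
move=> h; rewrite !lt_min => /and3P[/hr A /h1 B /h2 C].
have fh : cabs (F z) / 2 <= cabs (F (z + h)).
  have := cabsB_ge (F z) (F z - F (z + h)); rewrite opprB addrCA subrr addr0 (cabsBC (F z)) => D.
  by move: A D; lra.
have fh0 : 0 < cabs (F (z + h)) by apply: lt_le_trans fh; rewrite divr_gt0.
have Fh0 : F (z + h) != 0 by apply/eqP => E; move: fh0; rewrite E cabs0 ltxx.
have -> : (F (z + h))^-1 - (F z)^-1 - h * (- d / F z ^+ 2) =
    (- (F (z + h) - F z - h * d) + (F (z + h) - F z) * (h * (d / F z))) * ((F (z + h))^-1 * (F z)^-1).
  by field; rewrite F0 Fh0.
rewrite cabsM.
have k : cabs ((F (z + h))^-1 * (F z)^-1) <= K.
  rewrite cabsM !cabsV ler_pM2r ?invr_gt0//.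
  by rewrite lef_pV2 ?posrE// divr_gt0.
apply: (@le_trans _ _ ((e / (2 * K) * cabs h + e / (2 * K * L) * (cabs h * L)) * K)).
  apply: ler_pM; rewrite ?cabs_ge0//.
  apply: le_trans (cabsD _ _) _; rewrite cabsN; apply: lerD => //.
  rewrite cabsM; apply: ler_pM; rewrite ?cabs_ge0// cabsM ler_wpM2l ?cabs_ge0//.
  by rewrite /L lerDl.
rewrite le_eqVlt; apply/orP; left; apply/eqP.
by field; rewrite (gt_eqF K0) (gt_eqF L0).
Qed.

Lemma cdiff_near F G z d r : 0 < r -> (forall h, cabs h < r -> F (z + h) = G (z + h)) ->
  cdiff F z d -> cdiff G z d.
Proof.
move=> r0 FG HF e e0; have [r1 r10 h1] := HF e e0.
exists (Num.min r r1); first by rewrite lt_min r0.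
move=> h; rewrite lt_min => /andP[hr /h1].
by rewrite (FG h hr) -[in F z](addr0 z) FG ?cabs0// addr0.
Qed.

Lemma cdiff_derivable F z d : cdiff F z d -> derivable (F : R[i]^o -> R[i]^o) z 1.
Proof.
move=> H; apply/cvg_ex; exists d; apply/cvgrPdist_le => e e0.
have er : (complex.Re e)%:C = e.
  by move: e0; case: e => a b; rewrite ltcE /= => /andP[/eqP -> _].
have e0' : 0 < complex.Re e by move: e0; rewrite -er ltcR.
have [r r0 hr] := H _ e0'.
have rC : 0 < r%:C by rewrite ltcR.
near=> h; have h0 : h != 0 by near: h; exact: nbhs_dnbhs_neq.
have hlt : `|h| < r%:C by near: h; exact: dnbhs0_lt.
move: hlt; rewrite normr_cabs ltcR => hlt.
rewrite normr_cabs -er lecR /= [h *: 1]mulr1 [h + z]addrC.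
have -> : d - h^-1 *: (F (z + h) - F z) = - (h^-1 * (F (z + h) - F z - h * d)).
  by rewrite /GRing.scale/=; field.
have ch : 0 < cabs h.
  by rewrite lt_neqAle cabs_ge0 andbT eq_sym; apply: contra_neq h0 => /cabs_eq0.
by rewrite cabsN cabsM cabsV ler_pdivrMl// [leRHS]mulrC; exact: hr.
Unshelve. all: by end_near. Qed.

Lemma derivable_cdiff F z : derivable (F : R[i]^o -> R[i]^o) z 1 -> exists d, cdiff F z d.
Proof.
move=> /cvg_ex[d L]; exists d => e e0.
have eC : 0 < e%:C by rewrite ltcR.
move/cvgrPdist_le: L => /(_ _ eC); rewrite /dnbhs near_withinE => /nbhs_ballP[r /= r0 hr].
have rr : (complex.Re r)%:C = r.
  by move: r0; case: r {hr} => a b; rewrite ltcE /= => /andP[/eqP -> _].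
exists (complex.Re r); first by move: r0; rewrite -rr ltcR.
move=> h hlt; have [->|h0] := eqVneq h 0.
  by rewrite addr0 subrr mul0r subr0 cabs0 mulr0.
have := hr h; rewrite /ball/= sub0r normrN normr_cabs -rr ltcR => /(_ hlt h0).
rewrite normr_cabs lecR [h *: 1]mulr1 [h + z]addrC.
have -> : d - h^-1 *: (F (z + h) - F z) = - (h^-1 * (F (z + h) - F z - h * d)).
  by rewrite /GRing.scale/=; field.
have ch : 0 < cabs h.
  by rewrite lt_neqAle cabs_ge0 andbT eq_sym; apply: contra_neq h0 => /cabs_eq0.
by rewrite cabsN cabsM cabsV ler_pdivrMl// (mulrC e).
Qed.

End complex_derivative.

(** * Goursat's lemma and primitives on a half-plane *)

Section goursat.
Context {R : realType}.
Local Notation leb := (@lebesgue_measure R).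
Implicit Types (F A : R[i] -> R[i]) (a b z : R[i]).

Lemma is_derive_line (c e s : R) : is_derive s (1 : R) (fun x => c + x * e) e.
Proof.
have D1 := is_deriveD (is_derive_cst c s (1 : R)) (is_deriveZ e (is_derive_id s (1 : R))).
have -> : (fun x : R => c + x * e) = (cst c + e \*: id).
  by apply/funext => x /=; rewrite /GRing.scale/= mulrC.
by apply: (is_derive_eq D1); rewrite add0r /GRing.scale/= mulr1.
Qed.

Lemma antiderivative01 (g : R -> R) : continuous g ->
  exists G : R -> R, forall s : R, 0 <= s <= 1 -> is_derive s (1 : R) G (g s).
Proof.
(* Integrating from [-1], inside an interval reaching to [3], makes [0] and [1] interior points, so
   the derivatives there are two-sided. *)
move=> cg; exists (fun x => \int[leb]_(t in `[-1, x]) g t)%R => s /andP[s0 s1].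
have s3 : s < 3 by lra.
have s1' : -1 < s by lra.
have ig : leb.-integrable `[-1, 3] (EFin \o g).
  apply: continuous_compact_integrable; first exact: segment_compact.
  exact: continuous_subspaceT.
have [D E] := continuous_FTC1_closed s3 ig s1' (cg s).
by rewrite derive1E in E; exact: (DeriveDef D E).
Qed.

Definition pt a b (s : R) : R[i] := a + s%:C * (b - a).

Lemma Re_pt a b s : complex.Re (pt a b s) = complex.Re a + s * (complex.Re b - complex.Re a).
Proof. by rewrite /pt ReD ReM ReD ReN /= mul0r subr0. Qed.

Lemma pt_dom (c : R) a b s : 0 <= s <= 1 -> c <= complex.Re a -> c <= complex.Re b -> c <= complex.Re (pt a b s).
Proof.
move=> /andP[s0 s1] ca cb; rewrite Re_pt.
have h1 : 0 <= s * (complex.Re b - c) by rewrite mulr_ge0// subr_ge0.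
have h2 : 0 <= (1 - s) * (complex.Re a - c) by rewrite mulr_ge0// subr_ge0.
by rewrite -subr_ge0 (_ : _ - c = s * (complex.Re b - c) + (1 - s) * (complex.Re a - c)) ?addr_ge0//; ring.
Qed.

Lemma rdiff_pt F a b s d : cdiff F (pt a b s) d -> rdiff (fun x => F (pt a b x)) s ((b - a) * d).
Proof. exact: cdiff_rdiff_at. Qed.

(** The integral of [F] along the segment, encoded as the increment of an antiderivative of the
    pulled-back integrand. Its value is unique because a path with zero derivative is constant, and
    estimates reduce to the mean value inequality. *)
Definition seg F a b : set R[i] := [set I | exists P : R -> R[i],
  (forall s, 0 <= s <= 1 -> rdiff P s ((b - a) * F (pt a b s))) /\ I = P 1 - P 0].

Definition lint F a b : R[i] := xget 0 (seg F a b).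

Variables (F : R[i] -> R[i]) (c : R).
Hypothesis dF : forall z, c < complex.Re z -> exists d, cdiff F z d.
Local Notation "'dom' z" := (c < complex.Re z) (at level 9).

Lemma seg_unique a b I J : seg F a b I -> seg F a b J -> I = J.
Proof.
move=> [P [dP ->]] [Q [dQ ->]].
have := rdiff_const (P := fun s => P s - Q s) (ler01 : 0 <= 1 :> R).
move=> /(_ _) E; suff : P 1 - Q 1 = P 0 - Q 0.
  by move=> h; have -> : P 1 = P 0 - Q 0 + Q 1 by [rewrite -h subrK]; ring.
apply: E => s s01; apply: (rdiff_eq (rdiffB (dP s s01) (dQ s s01))); exact: subrr.
Qed.

Lemma seg_exists a b : dom a -> dom b -> exists I, seg F a b I.
Proof.
(* Clamping the parameter to [[0, 1]] gives an integrand continuous on the whole line, although [F]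
   is controlled only on the half-plane. *)
move=> da db; pose clip (s : R) := Num.max 0 (Num.min 1 s).
have clip01 s : 0 <= clip s <= 1.
  by rewrite /clip le_max lexx/= ge_max ler01 ge_min lexx.
have clipK s : 0 <= s <= 1 -> clip s = s.
  by move=> /andP[s0 s1]; rewrite /clip (min_idPr s1) (max_idPr s0).
have cclip : continuous clip.
  move=> s; apply: continuous_max; first exact: cst_continuous.
  by apply: continuous_min; [exact: cst_continuous|exact: cvg_id].
pose c1 := Num.min (complex.Re a) (complex.Re b).
have c1c : c < c1 by rewrite lt_min da.
have dpt s : 0 <= s <= 1 -> dom (pt a b s).
  by move=> s01; apply: lt_le_trans c1c _; apply: pt_dom => //; rewrite /c1 ge_min lexx ?orbT.
pose g s := (b - a) * F (pt a b (clip s)).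
have cg : continuous (fun s => complex.Re (g s) : R) /\ continuous (fun s => complex.Im (g s) : R).
  have dg s : exists d, rdiff (fun x => (b - a) * F (pt a b x)) (clip s) d.
    have [d hd] := dF (dpt _ (clip01 s)).
    by exists ((b - a) * ((b - a) * d)); apply: rdiffZ; exact: rdiff_pt.
  split => s; have [d /rdiff_continuous[k1 k2]] := dg s.
    by apply: (@continuous_comp _ _ _ clip (fun x => complex.Re ((b - a) * F (pt a b x)) : R)); [exact: cclip|exact: k1].
  by apply: (@continuous_comp _ _ _ clip (fun x => complex.Im ((b - a) * F (pt a b x)) : R)); [exact: cclip|exact: k2].
have [Gr hr] := antiderivative01 cg.1; have [Gi hi] := antiderivative01 cg.2.
exists ((Gr 1 +i* Gi 1) - (Gr 0 +i* Gi 0)); exists (fun s => Gr s +i* Gi s); split => // s s01.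
have := clipK s s01 => E; split => /=.
- by have := hr s s01; rewrite /g E.
- by have := hi s s01; rewrite /g E.
Qed.

Lemma lintP a b : dom a -> dom b -> seg F a b (lint F a b).
Proof. by move=> da db; have [I hI] := seg_exists da db; exact: (xgetPex 0 (ex_intro _ I hI)). Qed.

Lemma lint_eq a b I : dom a -> dom b -> seg F a b I -> lint F a b = I.
Proof. by move=> da db; exact: seg_unique (lintP da db). Qed.

Lemma lint_rev a b : dom a -> dom b -> lint F b a = - lint F a b.
Proof.
move=> da db; have [P [dP E]] := lintP da db; apply: lint_eq => //.
exists (fun s => P (1 - s)); split; last by rewrite subrr subr0 E opprB.
move=> s /andP[s0 s1].
have s01 : 0 <= 1 - s <= 1 by rewrite subr_ge0 s1 gerBl.
have D : is_derive s (1 : R) (fun x => 1 - x) (- 1).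
  by have := is_derive_line 1 (- 1) s; under eq_fun do rewrite mulrN1.
apply: (rdiff_eq (rdiff_comp (u := fun x => 1 - x) (dP _ s01) D)).
have -> : pt a b (1 - s) = pt b a s by rewrite /pt rmorphB rmorph1; ring.
by rewrite rmorphN rmorph1; ring.
Qed.

Definition mid a b : R[i] := (2^-1)%:C * (a + b).

Lemma half2 (z : R[i]) : (2^-1)%:C * z + (2^-1)%:C * z = z.
Proof.
rewrite -mulrDl -rmorphD /= (_ : 2^-1 + 2^-1 = 1) ?rmorph1 ?mul1r//.
by field.
Qed.

Lemma mid_dom (k : R) a b : k <= complex.Re a -> k <= complex.Re b -> k <= complex.Re (mid a b).
Proof. by move=> ka kb; rewrite /mid ReM ReD /= mul0r subr0; lra. Qed.

Lemma mid_dom_lt a b : dom a -> dom b -> dom (mid a b).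
Proof. by move=> ka kb; rewrite /mid ReM ReD /= mul0r subr0; lra. Qed.

Lemma lint_mid a b : dom a -> dom b -> lint F a b = lint F a (mid a b) + lint F (mid a b) b.
Proof.
move=> da db; have dm := mid_dom_lt da db; have [P [dP ->]] := lintP da db.
have e1 : mid a b - a = (2^-1)%:C * (b - a).
  by rewrite -[X in _ - X](half2 a) /mid; ring.
have e2 : b - mid a b = (2^-1)%:C * (b - a).
  by rewrite -[X in X - _](half2 b) /mid; ring.
have -> : lint F a (mid a b) = P 2^-1 - P 0.
  apply: lint_eq => //; exists (fun s => P (0 + s * 2^-1)); split; last by rewrite add0r mul1r add0r mul0r.
  move=> s /andP[s0 s1]; have s01 : 0 <= 0 + s * 2^-1 <= 1 by lra.
  apply: (rdiff_eq (rdiff_comp (u := fun x => 0 + x * 2^-1) (dP _ s01) (is_derive_line 0 2^-1 s))).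
  have -> : pt a b (0 + s * 2^-1) = pt a (mid a b) s by rewrite /pt e1 add0r rmorphM; ring.
  by rewrite e1; ring.
have -> : lint F (mid a b) b = P 1 - P 2^-1.
  apply: lint_eq => //; exists (fun s => P (2^-1 + s * 2^-1)); split.
    move=> s /andP[s0 s1]; have s01 : 0 <= 2^-1 + s * 2^-1 <= 1 by lra.
    apply: (rdiff_eq (rdiff_comp (u := fun x => 2^-1 + x * 2^-1) (dP _ s01) (is_derive_line 2^-1 2^-1 s))).
    have -> : pt a b (2^-1 + s * 2^-1) = pt (mid a b) b s.
      rewrite /pt e2 rmorphD rmorphM /= mulrDl addrA; congr (_ + _); last by ring.
      by rewrite -e1 addrC subrK.
    by rewrite e2; ring.
  by rewrite mul1r mul0r addr0 (_ : 2^-1 + 2^-1 = 1 :> R)//; field.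
by ring.
Qed.

Lemma lint_approx a b (A A' : R[i] -> R[i]) (e : R) : dom a -> dom b -> (forall z, cdiff A z (A' z)) ->
  (forall s, 0 <= s <= 1 -> cabs (F (pt a b s) - A' (pt a b s)) <= e) ->
  cabs (lint F a b - (A b - A a)) <= cabs (b - a) * e.
Proof.
move=> da db dA FA; have [P [dP ->]] := lintP da db.
have p1 : pt a b 1 = b by rewrite /pt mul1r addrC subrK.
have p0 : pt a b 0 = a by rewrite /pt mul0r addr0.
have -> : P 1 - P 0 - (A b - A a) = (P 1 - A (pt a b 1)) - (P 0 - A (pt a b 0)) by rewrite p1 p0; ring.
apply: (rdiff_mvt (P := fun s => P s - A (pt a b s))
  (D := fun s => (b - a) * F (pt a b s) - (b - a) * A' (pt a b s))) => s s01.
  by apply: rdiffB; [exact: dP|apply: rdiff_pt; exact: dA].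
by rewrite -mulrBr cabsM ler_wpM2l ?cabs_ge0// FA.
Qed.

Definition tri a b z : R[i] := lint F a b + lint F b z + lint F z a.

Definition perim a b z : R := cabs (b - a) + cabs (z - b) + cabs (a - z).

Lemma tri_split a b z : dom a -> dom b -> dom z ->
  tri a b z = tri a (mid a b) (mid z a) + tri (mid a b) b (mid b z) + tri (mid z a) (mid b z) z
    + tri (mid a b) (mid b z) (mid z a).
Proof.
move=> da db dz; have d1 := mid_dom_lt da db; have d2 := mid_dom_lt db dz; have d3 := mid_dom_lt dz da.
rewrite /tri (lint_mid da db) (lint_mid db dz) (lint_mid dz da).
rewrite (lint_rev d1 d2) (lint_rev d2 d3) (lint_rev d3 d1); ring.
Qed.

Lemma perim_half a b z : perim a (mid a b) (mid z a) = 2^-1 * perim a b z.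
Proof.
rewrite /perim.
have -> : mid a b - a = (2^-1)%:C * (b - a) by rewrite -[X in _ - X](half2 a) /mid; ring.
have -> : mid z a - mid a b = (2^-1)%:C * (z - b) by rewrite /mid; ring.
have -> : a - mid z a = (2^-1)%:C * (a - z) by rewrite -[X in X - _](half2 a) /mid; ring.
by rewrite !cabsM cabsC ger0_norm ?invr_ge0// -!mulrDr.
Qed.

Lemma perim_rot a b z : perim b z a = perim a b z.
Proof. by rewrite /perim addrC addrA. Qed.

Lemma midC a b : mid a b = mid b a.
Proof. by rewrite /mid addrC. Qed.

Lemma perim_inner a b z : perim (mid a b) (mid b z) (mid z a) = 2^-1 * perim a b z.
Proof.
rewrite /perim.
have -> : mid b z - mid a b = (2^-1)%:C * (z - a) by rewrite /mid; ring.
have -> : mid z a - mid b z = (2^-1)%:C * (a - b) by rewrite /mid; ring.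
have -> : mid a b - mid z a = (2^-1)%:C * (b - z) by rewrite /mid; ring.
rewrite !cabsM cabsC ger0_norm ?invr_ge0// -!mulrDr (cabsBC z a) (cabsBC a b) (cabsBC b z).
by congr (_ * _); ring.
Qed.

Lemma cabs_mid a b : cabs (mid a b - a) <= cabs (b - a).
Proof.
have -> : mid a b - a = (2^-1)%:C * (b - a) by rewrite -[X in _ - X](half2 a) /mid; ring.
rewrite cabsM cabsC ger0_norm ?invr_ge0//; have := cabs_ge0 (b - a); lra.
Qed.

(** The integral is the sum over the four triangles cut out by the midpoints, so one of them carries
    at least a quarter of it. The closed condition [k <= Re] survives the limit of the nested
    triangles; the bound on [a' - a] makes their vertices converge. *)
Lemma goursat_step (k : R) a b z : c < k -> k <= complex.Re a -> k <= complex.Re b -> k <= complex.Re z ->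
  exists a' b' z', [/\ k <= complex.Re a', k <= complex.Re b' & k <= complex.Re z'] /\
    [/\ perim a' b' z' = 2^-1 * perim a b z, cabs (a' - a) <= perim a b z
      & cabs (tri a b z) <= 4 * cabs (tri a' b' z')].
Proof.
move=> ck ka kb kz.
have da := lt_le_trans ck ka; have db := lt_le_trans ck kb; have dz := lt_le_trans ck kz.
have m1 := mid_dom ka kb; have m2 := mid_dom kb kz; have m3 := mid_dom kz ka.
have P0 : 0 <= perim a b z by rewrite !addr_ge0 ?cabs_ge0.
have E1 := perim_half a b z.
have E2 : perim (mid a b) b (mid b z) = 2^-1 * perim a b z.
  by rewrite -(perim_rot a b z) -(perim_half b z a) /perim; rewrite (midC a b); ring.
have E3 : perim (mid z a) (mid b z) z = 2^-1 * perim a b z.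
  by rewrite -(perim_rot a b z) -(perim_rot b z a) -(perim_half z a b) /perim (midC b z); ring.
have E4 := perim_inner a b z.
have ab : cabs (mid a b - a) <= perim a b z.
  apply: le_trans (cabs_mid a b) _; rewrite /perim -addrA lerDl addr_ge0 ?cabs_ge0//.
have az : cabs (mid z a - a) <= perim a b z.
  rewrite midC; apply: le_trans (cabs_mid a z) _; rewrite cabsBC /perim lerDr addr_ge0 ?cabs_ge0//.
have S := tri_split da db dz.
have S4 : cabs (tri a b z) <= cabs (tri a (mid a b) (mid z a)) + cabs (tri (mid a b) b (mid b z)) +
    cabs (tri (mid z a) (mid b z) z) + cabs (tri (mid a b) (mid b z) (mid z a)).
  rewrite S; apply: le_trans (cabsD _ _) _; rewrite lerD2r.
  by apply: le_trans (cabsD _ _) _; rewrite lerD2r; exact: cabsD.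
have [h1|h1] := leP (cabs (tri a b z)) (4 * cabs (tri a (mid a b) (mid z a))).
  exists a, (mid a b), (mid z a); split; split => //; first by rewrite subrr cabs0.
have [h2|h2] := leP (cabs (tri a b z)) (4 * cabs (tri (mid a b) b (mid b z))).
  by exists (mid a b), b, (mid b z); split; split.
have [h3|h3] := leP (cabs (tri a b z)) (4 * cabs (tri (mid z a) (mid b z) z)).
  by exists (mid z a), (mid b z), z; split; split.
exists (mid a b), (mid b z), (mid z a); split; split => //; lra.
Qed.

Lemma geometric_limit (u : nat -> R[i]) (C : R) : 0 <= C ->
  (forall i, cabs (u i.+1 - u i) <= C * (2^-1) ^+ i) ->
  exists l, (fun i => cabs (u i - l)) @ \oo --> 0 /\ forall i, cabs (u i - l) <= 2 * C * (2^-1) ^+ i.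
Proof.
move=> C0 hu.
have cr : cvgn (fun i => complex.Re (u i)).
  apply: (cvg_geometric_steps C0) => i; apply: le_trans (hu i).
  by rewrite -ReN -ReD; exact: normRe_cabs.
have ci : cvgn (fun i => complex.Im (u i)).
  apply: (cvg_geometric_steps C0) => i; apply: le_trans (hu i).
  by rewrite -ImN -ImD; exact: normIm_cabs.
move: cr ci => /cvg_ex[lr cr] /cvg_ex[li ci].
have L : (fun i => cabs (u i - (lr +i* li))) @ \oo --> 0.
  have s0 : (fun i => `|complex.Re (u i) - lr| + `|complex.Im (u i) - li|) @ \oo --> 0.
    rewrite -[X in _ --> X](addr0 0); apply: cvgD.
      by apply/norm_cvg0P; apply/subr_cvg0.
    by apply/norm_cvg0P; apply/subr_cvg0.
  apply: (squeeze_cvgr _ (cvg_cst 0) s0); apply: nearW => i; rewrite cabs_ge0/=.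
  by apply: le_trans (cabs_ReIm _) _; rewrite ReD ReN ImD ImN.
exists (lr +i* li); split => // i.
have step j : cabs (u i - u (i + j)%N) <= 2 * C * (2^-1) ^+ i - 2 * C * (2^-1) ^+ (i + j)%N.
  elim: j => [|j IH]; first by rewrite addn0 !subrr cabs0.
  rewrite addnS -[u i](subrK (u (i + j)%N)) -addrA; apply: le_trans (cabsD _ _) _.
  apply: le_trans (lerD IH (_ : _ <= C * (2^-1) ^+ (i + j))) _; first by rewrite cabsBC.
  by rewrite exprS; set g := _ ^+ (i + j); lra.
have lim : (fun j => cabs (u i - (lr +i* li)) - cabs (u (j + i)%N - (lr +i* li))) @ \oo -->
    cabs (u i - (lr +i* li)) - 0.
  apply: cvgB; first exact: cvg_cst.
  by rewrite (cvg_shiftn i (fun j => cabs (u j - (lr +i* li)))).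
rewrite subr0 in lim; rewrite -(cvg_lim _ lim)//; apply: limr_le.
  by apply/cvg_ex; exists (cabs (u i - (lr +i* li))).
apply: nearW => j; rewrite addnC.
apply: (@le_trans _ _ (cabs (u i - u (i + j)%N))).
  by rewrite lerBlDr -[X in cabs X <= _](subrKA (u (i + j)%N)) cabsD.
apply: le_trans (step j) _; rewrite gerBl; have := C0; rewrite mulr_ge0 ?mulr_ge0 ?exprn_ge0 ?invr_ge0//.
Qed.

(** The affine approximation [A'] of [F] at [z0] has the primitive [A], whose increments around the
    triangle cancel. On the sides [F - A'] is at most [3 * e] times the perimeter, because every
    point there is within three perimeters of [z0]. *)
Lemma tri_approx a b z (z0 d : R[i]) (e r : R) : 0 <= e -> dom a -> dom b -> dom z ->
  (forall h, cabs h < r -> cabs (F (z0 + h) - F z0 - h * d) <= e * cabs h) ->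
  cabs (a - z0) <= 2 * perim a b z -> 3 * perim a b z < r ->
  cabs (tri a b z) <= 3 * e * perim a b z ^+ 2.
Proof.
move=> e0 da db dz Fd az0 pr.
pose A w := F z0 * w + (2^-1)%:C * d * ((w - z0) * (w - z0)).
pose A' w := F z0 + d * (w - z0).
have dA w : cdiff A w (A' w).
  have d1 := cdiffB (cdiff_id w) (cdiff_cst z0 w).
  apply: (cdiff_eq (cdiffD (cdiffM (cdiff_cst (F z0) w) (cdiff_id w))
    (cdiffM (cdiff_cst ((2^-1)%:C * d) w) (cdiffM d1 d1)))).
  rewrite /A' -[in RHS](half2 d); ring.
have b0 := cabs_ge0 (b - a); have b1 := cabs_ge0 (z - b); have b2 := cabs_ge0 (a - z).
have P0 : 0 <= perim a b z by rewrite !addr_ge0 ?cabs_ge0.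
have near w : cabs (w - a) <= perim a b z -> cabs (F w - A' w) <= 3 * e * perim a b z.
  move=> wa; have wz : cabs (w - z0) <= 3 * perim a b z.
    rewrite -(subrKA a); apply: le_trans (cabsD _ _) _; apply: le_trans (lerD wa az0) _; lra.
  have := Fd (w - z0) (le_lt_trans wz pr); rewrite (addrC z0) subrK => H.
  rewrite (_ : F w - A' w = F w - F z0 - (w - z0) * d); last by rewrite /A'; ring.
  apply: le_trans H _; rewrite (_ : 3 * e * _ = e * (3 * perim a b z)); last by ring.
  by rewrite ler_wpM2l.
have ptd u v s : 0 <= s <= 1 -> cabs (pt u v s - u) <= cabs (v - u).
  move=> /andP[s0 s1]; rewrite /pt addrAC subrr add0r cabsM cabsC ger0_norm// ler_piMl ?cabs_ge0//.
have ptd' u v s : 0 <= s <= 1 -> cabs (pt u v s - v) <= cabs (v - u).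
  move=> /andP[s0 s1]; rewrite (_ : _ - v = (1 - s)%:C * (u - v)); last by rewrite /pt rmorphB rmorph1; ring.
  rewrite cabsM cabsC ger0_norm ?subr_ge0// (cabsBC v) ler_piMl ?cabs_ge0// gerBl//.
have H1 : cabs (lint F a b - (A b - A a)) <= cabs (b - a) * (3 * e * perim a b z).
  apply: (lint_approx da db dA) => s s01; apply: near.
  by apply: le_trans (ptd a b s s01) _; rewrite /perim; lra.
have H2 : cabs (lint F b z - (A z - A b)) <= cabs (z - b) * (3 * e * perim a b z).
  apply: (lint_approx db dz dA) => s s01; apply: near.
  rewrite -(subrKA b); apply: le_trans (cabsD _ _) _.
  by apply: le_trans (lerD (ptd b z s s01) (lexx _)) _; rewrite /perim; lra.
have H3 : cabs (lint F z a - (A a - A z)) <= cabs (a - z) * (3 * e * perim a b z).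
  apply: (lint_approx dz da dA) => s s01; apply: near.
  by apply: le_trans (ptd' z a s s01) _; rewrite /perim; lra.
rewrite (_ : tri a b z = (lint F a b - (A b - A a)) + (lint F b z - (A z - A b)) + (lint F z a - (A a - A z))); last first.
  by rewrite /tri; ring.
apply: le_trans (cabsD _ _) _; apply: le_trans (lerD (cabsD _ _) (lexx _)) _.
apply: le_trans (lerD (lerD H1 H2) H3) _.
by rewrite -!mulrDl -/(perim a b z) expr2 le_eqVlt; apply/orP; left; apply/eqP; ring.
Qed.

Lemma goursat a b z : dom a -> dom b -> dom z -> tri a b z = 0.
Proof.
move=> da db dz.
pose k := Num.min (complex.Re a) (Num.min (complex.Re b) (complex.Re z)).
have ck : c < k by rewrite !lt_min da db.
pose st := (R[i] * R[i] * R[i])%type.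
pose good (t : st) := [/\ k <= complex.Re t.1.1, k <= complex.Re t.1.2 & k <= complex.Re t.2].
pose per (t : st) := perim t.1.1 t.1.2 t.2.
pose tr (t : st) := tri t.1.1 t.1.2 t.2.
have /choice[step hstep] : forall t : st, exists t' : st, good t -> good t' /\
    [/\ per t' = 2^-1 * per t, cabs (t'.1.1 - t.1.1) <= per t & cabs (tr t) <= 4 * cabs (tr t')].
  move=> t; have [gt|ngt] := pselect (good t); last by exists t.
  case: (gt) => g1 g2 g3; have [a' [b' [z' [G H]]]] := goursat_step ck g1 g2 g3.
  by exists (a', b', z').
pose tn n := iter n step (a, b, z).
have g0 : good (a, b, z) by split; rewrite /k !ge_min lexx ?orbT.
have gn n : good (tn n) by elim: n => // n IH; have [] := hstep _ IH.
have pn n : per (tn n) = (2^-1) ^+ n * perim a b z.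
  elim: n => [|n IH]; first by rewrite expr0 mul1r.
  by have [_ [-> _ _]] := hstep _ (gn n); rewrite IH exprS mulrA.
have trn n : cabs (tri a b z) <= 4 ^+ n * cabs (tr (tn n)).
  elim: n => [|n IH]; first by rewrite expr0 mul1r.
  apply: le_trans IH _; have [_ [_ _ h]] := hstep _ (gn n).
  by rewrite exprSr -mulrA ler_wpM2l ?exprn_ge0.
pose C := perim a b z.
have C0 : 0 <= C by rewrite !addr_ge0 ?cabs_ge0.
have stepa i : cabs ((tn i.+1).1.1 - (tn i).1.1) <= C * (2^-1) ^+ i.
  by have [_ [_ h _]] := hstep _ (gn i); rewrite mulrC -pn.
have [l [ll hl]] := geometric_limit C0 stepa.
have dl : dom l.
  apply: (lt_le_trans ck); apply/ler_addgt0Pr => e e0.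
  have [i _ hi] := cvgr_lt _ ll e e0; have := hi i (leqnn i) => /= hi'.
  have [g1 _ _] := gn i; rewrite -lerBlDr; apply: le_trans (lerB g1 (ltW hi')) _.
  rewrite lerBlDr -lerBlDl; apply: le_trans (ler_norm _) _.
  by rewrite -ReN -ReD; exact: normRe_cabs.
have [d hd] := dF dl.
apply: cabs_eq0; apply/eqP; rewrite eq_le cabs_ge0 andbT.
apply/ler_addgt0Pr => e e0; rewrite add0r.
(* The growth [4 ^ i] is cancelled by the square of the perimeter [2 ^ (- i) * C]; what remains is
   [3 * C ^ 2] times this number, which is at most [e]. *)
have e1 : 0 < e / (3 * (C ^+ 2 + 1)) by rewrite divr_gt0// mulr_gt0// ltr_wpDl ?sqr_ge0.
have [r r0 hr] := hd _ e1.
have geo : (fun i => 3 * C * (2^-1) ^+ i) @ \oo --> (0 : R).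
  rewrite -(mulr0 (3 * C)); apply: cvgM; first exact: cvg_cst.
  by apply: cvg_expr; rewrite ger0_norm ?invr_ge0// invf_lt1// ltr1n.
have [i _ hi] := cvgr_lt _ geo r r0; have {hi} := hi i (leqnn i) => /= hi.
have [/(lt_le_trans ck) d1 /(lt_le_trans ck) d2 /(lt_le_trans ck) d3] := gn i.
have := tri_approx (ltW e1) d1 d2 d3 hr.
rewrite -/(per (tn i)) -/(tr (tn i)) pn -/C => H.
have {}H := H (_ : _ <= _) (_ : _ < _).
apply: le_trans (trn i) _; apply: (@le_trans _ _ (4 ^+ i * (3 * (e / (3 * (C ^+ 2 + 1))) * ((2^-1) ^+ i * C) ^+ 2))).
  rewrite ler_wpM2l ?exprn_ge0//; apply: H.
    by apply: le_trans (hl i) _; rewrite -mulrA (mulrC C).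
  by rewrite (mulrC _ C) mulrA.
rewrite exprMn -exprM mulnC exprM (_ : (2^-1 : R) ^+ 2 = 4^-1); last by field.
have -> : 4 ^+ i * (3 * (e / (3 * (C ^+ 2 + 1))) * (4^-1 ^+ i * C ^+ 2)) = (4 * 4^-1) ^+ i * (e * (C ^+ 2 / (C ^+ 2 + 1))).
  rewrite exprMn; set x := _ ^+ i; set y := _ ^+ i; field.
  by rewrite gt_eqF// ltr_wpDl ?sqr_ge0.
rewrite mulfV// expr1n mul1r ler_piMr ?(ltW e0)// ler_pdivrMr ?ltr_wpDl ?sqr_ge0//.
by rewrite mul1r lerDl.
Qed.

(** Goursat for the triangle [z0], [z], [z + h] turns the increment into the integral over the short
    side, where [F] is close to [F z]. *)
Lemma primitive z0 z : dom z0 -> dom z -> cdiff (lint F z0) z (F z).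
Proof.
move=> d0 dz e e0; have [d hd] := dF dz.
have [r r0 hr] := cdiff_continuous hd e0.
have rc : 0 < complex.Re z - c by rewrite subr_gt0.
exists (Num.min r (complex.Re z - c)); first by rewrite lt_min r0.
move=> h; rewrite lt_min => /andP[hr1 hr2].
have dzh : dom (z + h).
  rewrite ReD -ltrBlDl -opprB ltrNl; apply: le_lt_trans hr2.
  by apply: le_trans (normRe_cabs h); rewrite -normrN ler_norm.
have := goursat d0 dz dzh; rewrite /tri (lint_rev d0 dzh) => /eqP; rewrite subr_eq0 => /eqP <-.
have -> : lint F z0 z + lint F z (z + h) - lint F z0 z - h * F z = lint F z (z + h) - h * F z by ring.
have dA w : cdiff (fun w => F z * w) w (F z).
  by apply: (cdiff_eq (cdiffM (cdiff_cst (F z) w) (cdiff_id w))); rewrite mul0r addr0 mulr1.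
have zh : z + h - z = h by ring.
have := lint_approx (e := e) dz dzh dA; rewrite -mulrBr zh => H.
rewrite (mulrC h) (mulrC e); apply: H => s /andP[s0 s1].
rewrite /pt zh; apply: hr; apply: le_lt_trans hr1.
by rewrite cabsM cabsC ger0_norm// ler_piMl ?cabs_ge0.
Qed.

End goursat.

(** * Maximum principle and identity theorem *)

Section identity_theorem.
Context {R : realType}.
Implicit Types (F G H : R[i] -> R[i]) (z : R[i]).

Lemma local_max_second (g gam : R -> R) (r d : R) : 0 < r ->
  (forall s : R, `|s| < r -> is_derive s (1 : R) g (gam s)) -> is_derive (0 : R) (1 : R) gam d ->
  (forall s : R, `|s| < r -> g s <= g 0) -> d <= 0.
Proof.
move=> r0 dg dgam gmax; rewrite leNgt; apply/negP => d0.
have in_r (s : R) : s \in `]- r, r[%R -> `|s| < r by rewrite in_itv/= ltr_norml.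
have g00 : gam 0 = 0.
  have z0 : (0 : R) \in `]- r, r[%R by rewrite in_itv/= oppr_lt0 r0.
  have D0 : is_derive (0 : R) (1 : R) g 0.
    apply: (@derive1_at_max _ g (- r) r 0) => //; first by rewrite ge0_cp// ltW.
      by move=> t /in_r /dg[].
    by move=> t /in_r; exact: gmax.
  have D1 : is_derive (0 : R) (1 : R) g (gam 0) by apply: dg; rewrite normr0.
  by rewrite -(@derive_val _ _ _ _ _ _ _ D1) (@derive_val _ _ _ _ _ _ _ D0).
have d2 : 0 < d / 2 by rewrite divr_gt0.
have [r1 r10 h1] := is_derive_epsP dgam d2.
pose s := Num.min r r1 / 2; have s0 : 0 < s by rewrite divr_gt0// lt_min r0.
have mr : Num.min r r1 <= r by rewrite ge_min lexx.
have mr1 : Num.min r r1 <= r1 by rewrite ge_min lexx orbT.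
have sr : s < r by rewrite /s; lra.
have sr1 : s < r1 by rewrite /s; lra.
have [c c0s gc] : exists2 c, c \in `]0, s[%R & g s - g 0 = gam c * (s - 0).
  apply: MVT => // [x|].
    by rewrite in_itv/= => /andP[x0 xs]; apply: dg; rewrite ger0_norm ?(ltW x0)// (lt_trans xs).
  apply: derivable_within_continuous => x; rewrite in_itv/= => /andP[x0 xs].
  by have [] := dg x (_ : `|x| < r); first rewrite ger0_norm// (le_lt_trans xs).
move: c0s; rewrite in_itv/= => /andP[c0 cs].
have cn : `|c| = c by rewrite ger0_norm// ltW.
have := h1 c; rewrite cn add0r g00 subr0 => /(_ (lt_trans cs sr1)).
rewrite ler_norml => /andP[hc _].
have gp : 0 < gam c.
  have : 0 < c * d / 2 by rewrite divr_gt0// mulr_gt0.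
  by move: hc; lra.
have sn : `|s| < r by rewrite ger0_norm// ltW.
by have := gmax _ sn; rewrite -subr_le0 gc subr0 leNgt mulr_gt0.
Qed.

(** At a local maximum the second derivative [d w] in each direction [w] is nonpositive. Adding the
    directions [1] and ['i] cancels the terms with [P2], since the squares of the directions add up
    to [0], and leaves [4 |P1| ^ 2 + 4 e > 0]. The term with [e] is what makes this strict. *)
Lemma no_strict_subharmonic_max (P P1 P2 : R[i] -> R[i]) (p z1 : R[i]) (e r : R) : 0 < r -> 0 < e ->
  (forall h, cabs h < r -> cdiff P (z1 + h) (P1 (z1 + h))) ->
  (forall h, cabs h < r -> cdiff P1 (z1 + h) (P2 (z1 + h))) ->
  (forall h, cabs h < r -> cabs (P (z1 + h)) ^+ 2 + e * cabs (z1 + h - p) ^+ 2 <=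
    cabs (P z1) ^+ 2 + e * cabs (z1 - p) ^+ 2) -> False.
Proof.
move=> r0 e0 dP dP1 Pmax.
pose d w := 2 * (cabs (w * P1 z1) ^+ 2 + complex.Re (conjc (P z1) * (w * (w * P2 z1)))) + 2 * e * cabs w ^+ 2.
have main w : cabs w = 1 -> d w <= 0.
  move=> w1; have small (s : R) : `|s| < r -> cabs (s%:C * w) < r by rewrite cabsM cabsC w1 mulr1.
  have d0 (s : R) : `|s| < r -> rdiff (fun x => P (z1 + x%:C * w)) s (w * P1 (z1 + s%:C * w)).
    by move=> sr; apply: cdiff_rdiff_at; apply: dP; exact: small.
  have d1 (s : R) : `|s| < r -> rdiff (fun x => w * P1 (z1 + x%:C * w)) s (w * (w * P2 (z1 + s%:C * w))).
    by move=> sr; apply: rdiffZ; apply: cdiff_rdiff_at; apply: dP1; exact: small.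
  have dl (s : R) : rdiff (fun x => z1 + x%:C * w - p) s w.
    by apply: (rdiff_eq (rdiffB (rdiff_affine z1 w s) (rdiff_cst p s))); rewrite subr0.
  pose A (x : R) := P (z1 + x%:C * w); pose A1 (x : R) := w * P1 (z1 + x%:C * w).
  pose A2 (x : R) := w * (w * P2 (z1 + x%:C * w)); pose L (x : R) := z1 + x%:C * w - p.
  pose g (x : R) := (complex.Re (A x) ^+ 2 + complex.Im (A x) ^+ 2) +
    e * (complex.Re (L x) ^+ 2 + complex.Im (L x) ^+ 2).
  pose g1 (x : R) := 2 * (complex.Re (A x) * complex.Re (A1 x) + complex.Im (A x) * complex.Im (A1 x)) +
    2 * e * (complex.Re (L x) * complex.Re w + complex.Im (L x) * complex.Im w).
  have z1E : z1 + 0%:C * w = z1 by rewrite mul0r addr0.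
  apply: (@local_max_second g g1 r (d w) r0) => [s sr||s sr].
  - have [D1 D2] := d0 s sr; have [E1 E2] := dl s.
    apply: is_derive_eq; rewrite /g1 /GRing.scale/=; ring.
  - have n0 : `|0 : R| < r by rewrite normr0.
    have [D1 D2] := d0 0 n0; have [E1 E2] := dl 0; have [C1 C2] := d1 0 n0.
    apply: is_derive_eq; rewrite /d /GRing.scale/= !sqr_cabs /A /A1 z1E.
    rewrite [complex.Re (conjc _ * _)]ReM; case: (P z1) => ? ? /=.
    ring.
  - have := Pmax _ (small s sr); rewrite /g /A /L -!sqr_cabs z1E; exact.
have i1 : cabs ('i : R[i]) = 1 by rewrite cabsE /= expr0n/= add0r expr1n sqrtr1.
have := lerD (main 1 (@cabs1 R)) (main 'i i1); rewrite addr0 leNgt => /negP; apply.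
rewrite /d !cabsM cabs1 i1 !mul1r !expr1n !mulr1.
have -> : 'i * ('i * P2 z1) = - P2 z1 by rewrite mulrA -expr2 sqr_i mulN1r.
rewrite mulrN ReN; have := sqr_ge0 (cabs (P1 z1)); lra.
Qed.

Lemma square_max (v : R[i] -> R) (p : R[i]) (rho : R) : 0 < rho ->
  (forall z, `|complex.Re z - complex.Re p| <= rho -> `|complex.Im z - complex.Im p| <= rho ->
    forall e, 0 < e -> exists2 r, 0 < r & forall h, cabs h < r -> `|v (z + h) - v z| <= e) ->
  exists z1, [/\ `|complex.Re z1 - complex.Re p| <= rho, `|complex.Im z1 - complex.Im p| <= rho &
    forall z, `|complex.Re z - complex.Re p| <= rho -> `|complex.Im z - complex.Im p| <= rho -> v z <= v z1].
Proof.
move=> rho0 vc.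
pose a := complex.Re p; pose b := complex.Im p.
pose Q : set (R * R) := `[a - rho, a + rho] `*` `[b - rho, b + rho].
have inQ (x y : R) : Q (x, y) <-> `|x - a| <= rho /\ `|y - b| <= rho.
  by rewrite /Q /= !in_itv/= !ler_distl; split => [[-> ->]|[-> ->]].
pose f (u : R * R) : R := v (u.1 +i* u.2).
have cQ : compact Q by apply: compact_setX; exact: segment_compact.
have Q0 : Q !=set0 by exists (a, b); apply/inQ; rewrite !subrr normr0 (ltW rho0).
have fc : {within Q, continuous f}.
  apply: continuous_in_subspaceT => -[x y] /set_mem /inQ[hx hy].
  apply/cvgrPdist_le => e e0; have [r r0 hr] := vc (x +i* y) hx hy e e0.
  near=> u; rewrite distrC /f.
  have -> : u.1 +i* u.2 = (x +i* y) + ((u.1 - x) +i* (u.2 - y)).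
    by apply: complex_ext; rewrite ?ReD ?ImD /= subrKC.
  apply: hr; apply: le_lt_trans (cabs_ReIm _) _ => /=.
  have [h1 h2] : ball x (r / 2) u.1 /\ ball y (r / 2) u.2.
    near: u; exists (ball x (r / 2), ball y (r / 2)); last by case.
    by split; apply: nbhsx_ballx; rewrite divr_gt0.
  by move: h1 h2; rewrite /ball/= (distrC u.1) (distrC u.2) => h1 h2; lra.
have [[x y] /set_mem/inQ[hx hy] hmax] := compact_EVT_max Q0 cQ fc.
exists (x +i* y); split => // -[s t] /= hs ht.
by apply: (hmax (s, t)); apply/mem_set/inQ.
Unshelve. all: by end_near. Qed.

Lemma cdiff_uniq F z d d' : cdiff F z d -> cdiff F z d' -> d = d'.
Proof.
move=> /(cdiff_rdiff 1) h1 /(cdiff_rdiff 1) h2.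
by have := rdiff_unique h1 h2; rewrite !mul1r.
Qed.

Lemma cdiffX F z d k : cdiff F z d -> cdiff (fun x => F x ^+ k) z (k%:R * F z ^+ k.-1 * d).
Proof.
move=> h; elim: k => [|k IH]; first by rewrite !mul0r; exact: cdiff_cst.
have := cdiffM h IH.
rewrite (_ : (fun x => F x * F x ^+ k) = (fun x => F x ^+ k.+1)); last by apply/funext => x; rewrite exprS.
move/cdiff_eq; apply; case: k {IH} => [|k]; rewrite -?pred_Sn.
  by rewrite mul0r mul0r mulr0 add0r !expr0 !mulr1 mul1r.
by rewrite exprS -[k.+2%:R]natr1; ring.
Qed.

Lemma cabs_dist z w : `|cabs z - cabs w| <= cabs (z - w).
Proof. by rewrite ler_norml cabsB_ge andbT lerNl opprB cabsBC; exact: cabsB_ge. Qed.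

Lemma cdiff_cabs2_continuous F z d : cdiff F z d -> forall e, 0 < e -> exists2 r, 0 < r &
  forall h, cabs h < r -> `|cabs (F (z + h)) ^+ 2 - cabs (F z) ^+ 2| <= e.
Proof.
move=> dF e e0; pose e' := Num.min 1 (e / (2 * cabs (F z) + 1)).
have K0 : 0 < 2 * cabs (F z) + 1 by rewrite ltr_wpDl// mulr_ge0// cabs_ge0.
have e'0 : 0 < e' by rewrite lt_min ltr01 divr_gt0.
have [r r0 hr] := cdiff_continuous dF e'0; exists r => // h /hr H.
have e'1 : e' <= 1 by rewrite ge_min lexx.
have e'e : e' * (2 * cabs (F z) + 1) <= e by rewrite -ler_pdivlMr// ge_min lexx orbT.
rewrite subr_sqr normrM; apply: le_trans e'e.
have D := le_trans (cabs_dist _ _) H.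
apply: ler_pM => //; rewrite ger0_norm ?addr_ge0 ?cabs_ge0//.
by move: D; rewrite ler_distl => /andP[_ D]; lra.
Qed.

Section zero_propagation.
Variables (F : R[i] -> R[i]) (c c' : R).
Hypothesis dF : forall z, c < complex.Re z -> exists d, cdiff F z d.
Hypothesis F0 : forall z, c' < complex.Re z -> F z = 0.
Hypothesis cc' : c <= c'.

Let z0 : R[i] := (c' + 1)%:C.

Let z0c' : c' < complex.Re z0. Proof. by rewrite /= ltrDl. Qed.

Let z0c : c < complex.Re z0. Proof. exact: le_lt_trans z0c'. Qed.

(** The base point [z0] lies in the half-plane where [F] vanishes, and so does the whole segment to
    [z]; the primitive therefore vanishes there too. *)
Lemma lint_zero z : c' < complex.Re z -> lint F z0 z = 0.
Proof.
move=> zc; apply: (lint_eq dF) => //; first exact: le_lt_trans zc.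
exists (fun=> 0); split; last by rewrite subrr.
move=> s s01; rewrite F0 ?mulr0; first exact: rdiff_cst.
pose k := Num.min (complex.Re z0) (complex.Re z).
apply: (@lt_le_trans _ _ k); first by rewrite lt_min z0c'.
by apply: pt_dom => //; rewrite ge_min lexx ?orbT.
Qed.

End zero_propagation.

(* Inverse powers of the distance to a point near which the function vanishes
   play the role of the missing Cauchy estimates: by the maximum principle
   applied to [H2 z / (z - p) ^ k] on a square, the value at distance [r] from
   [p] is at most [K (r / rho) ^ k]. *)
Lemma max_principle_vanish (H2 H F : R[i] -> R[i]) (c c' : R) :
  (forall z, c < complex.Re z -> cdiff H2 z (H z)) -> (forall z, c < complex.Re z -> cdiff H z (F z)) ->
  (forall z, c < complex.Re z -> exists d, cdiff F z d) ->
  (forall z, c' < complex.Re z -> H2 z = 0) -> (forall z, c' < complex.Re z -> H z = 0) ->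
  (forall z, c' < complex.Re z -> F z = 0) ->
  forall z, c < complex.Re z -> H2 z = 0.
Proof.
move=> dH2 dH dF H20 H0 F0 w0 w0c.
(* The pole [p = w0 + R'] is so far to the right that the unit disc about it lies in the zero
   region. The half-side [rho] exceeds [R'], the distance from [p] to [w0], yet the square stays in
   the domain: its left edge is halfway between [c] and [Re w0]. *)
pose R' := Num.max 1 (c' + 2 - complex.Re w0).
have R'1 : 1 <= R' by rewrite le_max lexx.
have R'2 : c' + 2 - complex.Re w0 <= R' by rewrite le_max lexx orbT.
pose p := w0 + R'%:C; pose rho := R' + (complex.Re w0 - c) / 2.
have Rep : complex.Re p = complex.Re w0 + R' by rewrite /p ReD.
have Imp : complex.Im p = complex.Im w0 by rewrite /p ImD addr0.
have rhoR : R' < rho by rewrite /rho; lra.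
have rho0 : 0 < rho by lra.
have Qc z : `|complex.Re z - complex.Re p| <= rho -> c < complex.Re z.
  by rewrite ler_distl Rep /rho => /andP[h _]; lra.
have pn h : cabs h < 1 -> c' < complex.Re (p + h).
  move=> h1; have := normRe_cabs h; rewrite ler_norml ReD Rep => /andP[h2 _]; lra.
(* At [z = p] this is [0] by convention; the products with [V] are analytic there nonetheless, since
   the other factors vanish near [p]. *)
pose V (z : R[i]) := (z - p)^-1.
have dV z : z != p -> cdiff V z (- V z ^+ 2).
  move=> zp; have zp0 : z - p != 0 by rewrite subr_eq0.
  apply: (cdiff_eq (cdiffV (cdiffB (cdiff_id z) (cdiff_cst p z)) zp0)).
  by rewrite subr0 mulN1r exprVn.
have [K K0 HK] : exists2 K, 0 <= K & forall z, `|complex.Re z - complex.Re p| <= rho ->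
    `|complex.Im z - complex.Im p| <= rho -> cabs (H2 z) <= K.
  have [z hz1 hz2|z1 [_ _ hmax]] := @square_max (fun z => cabs (H2 z)) p rho rho0.
    move=> e e0; have [r r0 hr] := cdiff_continuous (dH2 z (Qc z hz1)) e0; exists r => // h /hr; apply: le_trans.
    exact: cabs_dist.
  by exists (cabs (H2 z1)) => //; exact: cabs_ge0.
pose P k z := H2 z * V z ^+ k.
pose P1 k z := H z * V z ^+ k - k%:R * (H2 z * V z ^+ k.+1).
pose P2 k z := F z * V z ^+ k - 2 * k%:R * (H z * V z ^+ k.+1) + k%:R * k.+1%:R * (H2 z * V z ^+ k.+2).
have dVk k z : z != p -> cdiff (fun z => V z ^+ k) z (- k%:R * V z ^+ k.+1).
  move=> zp; apply: (cdiff_eq (cdiffX k (dV z zp))); case: k => [|k]; first by rewrite oppr0 !mul0r.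
  by rewrite /= mulrN -mulrA -exprD addn2 mulNr.
have dP k z : c < complex.Re z -> cdiff (P k) z (P1 k z).
  move=> zc; have [->|zp] := eqVneq z p.
    apply: (@cdiff_near _ (fun=> 0) _ _ _ 1) => //.
      by move=> h /pn h1; rewrite /P H20// mul0r.
    have pc : c' < complex.Re p by have := pn 0; rewrite addr0 cabs0 => /(_ ltr01).
    by rewrite /P1 H0// H20// !mul0r mulr0 subrr; exact: cdiff_cst.
  apply: (cdiff_eq (cdiffM (dH2 z zc) (dVk k z zp))).
  by rewrite /P1; ring.
have dP1 k z : c < complex.Re z -> cdiff (P1 k) z (P2 k z).
  move=> zc; have [->|zp] := eqVneq z p.
    apply: (@cdiff_near _ (fun=> 0) _ _ _ 1) => //.
      by move=> h /pn h1; rewrite /P1 H0// H20// !mul0r mulr0 subrr.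
    have pc : c' < complex.Re p by have := pn 0; rewrite addr0 cabs0 => /(_ ltr01).
    by rewrite /P2 F0// H0// H20// !mul0r !mulr0 subrr addr0; exact: cdiff_cst.
  have D1 := cdiffM (dH z zc) (dVk k z zp).
  have D2 := cdiffM (cdiff_cst k%:R z) (cdiffM (dH2 z zc) (dVk k.+1 z zp)).
  by apply: (cdiff_eq (cdiffB D1 D2)); rewrite /P2; ring.
have bnd k e : 0 < e -> cabs (P k w0) ^+ 2 <= (K / rho ^+ k) ^+ 2 + e.
  (* On the square [|z - p| ^ 2 <= 2 * rho ^ 2], so the strictly subharmonic perturbation costs at
     most [e]. *)
  move=> e0; pose e' := e / (2 * rho ^+ 2).
  have e'0 : 0 < e' by rewrite divr_gt0// mulr_gt0// exprn_gt0.
  pose v z := cabs (P k z) ^+ 2 + e' * cabs (z - p) ^+ 2.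
  have [z hz1 hz2|z1 [hz1 hz2 hmax]] := @square_max v p rho rho0.
    move=> d d0.
    have [r1 r10 h1] := cdiff_cabs2_continuous (dP k z (Qc z hz1)) (divr_gt0 d0 (ltr0n _ 2)).
    have [r2 r20 h2] := cdiff_cabs2_continuous (cdiffB (cdiff_id z) (cdiff_cst p z)) (divr_gt0 d0 (mulr_gt0 (ltr0n _ 2) e'0)).
    exists (Num.min r1 r2); first by rewrite lt_min r10.
    move=> h; rewrite lt_min => /andP[/h1 {}h1 /h2 {}h2].
    rewrite /v (_ : _ - _ = cabs (P k (z + h)) ^+ 2 - cabs (P k z) ^+ 2 +
      e' * (cabs (z + h - p) ^+ 2 - cabs (z - p) ^+ 2)); last by ring.
    apply: le_trans (ler_normD _ _) _; rewrite normrM (ger0_norm (ltW e'0)).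
    apply: le_trans (lerD h1 (ler_wpM2l (ltW e'0) h2)) _.
    by rewrite le_eqVlt; apply/orP; left; apply/eqP; field; rewrite gt_eqF.
  have w0Q : v w0 <= v z1.
    apply: hmax; first by rewrite Rep opprD addrA subrr sub0r normrN ger0_norm; lra.
    by rewrite Imp subrr normr0 ltW.
  have z1c := Qc z1 hz1.
  (* The maximum over the square cannot lie in the open disc of radius [rho] inscribed in it, for
     there it would be a local maximum. Outside this disc each factor [V] has modulus at most
     [1 / rho]. *)
  have z1rho : rho <= cabs (z1 - p).
    rewrite leNgt; apply/negP => z1r.
    pose r := Num.min (complex.Re z1 - c) (rho - cabs (z1 - p)).
    have r0 : 0 < r by rewrite lt_min !subr_gt0 z1c.
    have dom h : cabs h < r -> c < complex.Re (z1 + h).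
      rewrite lt_min => /andP[h1 _]; have := normRe_cabs h; rewrite ler_norml ReD => /andP[h2 _]; lra.
    apply: (@no_strict_subharmonic_max (P k) (P1 k) (P2 k) p z1 e' r) => //.
    - by move=> h /dom /dP.
    - by move=> h /dom /dP1.
    - move=> h; rewrite lt_min => /andP[_ h2].
      have le1 : cabs (z1 + h - p) <= rho.
        by rewrite addrAC; apply: le_trans (cabsD _ _) _; lra.
      apply: hmax; apply: le_trans le1.
      + by rewrite -ReN -ReD; exact: normRe_cabs.
      + by rewrite -ImN -ImD; exact: normIm_cabs.
  have z1up : cabs (z1 - p) ^+ 2 <= 2 * rho ^+ 2.
    rewrite sqr_cabs ReD ReN ImD ImN mulr_natl mulr2n; apply: lerD.
    + by rewrite -[leLHS]real_normK ?num_real// lerXn2r ?nnegrE ?(ltW rho0)//.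
    + by rewrite -[leLHS]real_normK ?num_real// lerXn2r ?nnegrE ?(ltW rho0)//.
  have : cabs (P k w0) ^+ 2 <= v w0 by rewrite /v lerDl mulr_ge0 ?sqr_ge0// ltW.
  move=> /le_trans; apply; apply: le_trans w0Q _; rewrite /v; apply: lerD.
    rewrite lerXn2r ?nnegrE ?cabs_ge0// ?divr_ge0 ?exprn_ge0// ?(ltW rho0)//.
    rewrite /P cabsM cabsX cabsV -exprVn; apply: ler_pM; rewrite ?cabs_ge0 ?exprn_ge0 ?invr_ge0 ?cabs_ge0//.
      exact: HK.
    by rewrite lerXn2r ?nnegrE ?invr_ge0 ?cabs_ge0 ?(ltW rho0)// lef_pV2 ?posrE// (lt_le_trans rho0).
  apply: le_trans (ler_wpM2l (ltW e'0) z1up) _; rewrite /e' divfK// gt_eqF// mulr_gt0// exprn_gt0//.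
(* Since [|w0 - p| = R' < rho], letting [k] grow forces [H2 w0 = 0]. *)
have bnd2 k : cabs (H2 w0) <= K * (R' / rho) ^+ k.
  have R'0 : 0 < R' by lra.
  have h : cabs (P k w0) ^+ 2 <= (K / rho ^+ k) ^+ 2 by apply/ler_addgt0Pr => e /(bnd k).
  move: h; rewrite ler_sqr ?nnegrE ?cabs_ge0// ?divr_ge0 ?exprn_ge0// ?(ltW rho0)//.
  rewrite /P /V cabsM cabsX cabsV (_ : w0 - p = - R'%:C); last by rewrite /p; ring.
  rewrite cabsN cabsC ger0_norm ?(ltW R'0)// exprVn ler_pdivrMr ?exprn_gt0//.
  by rewrite expr_div_n mulrA mulrAC.
apply: cabs_eq0; apply/eqP; rewrite eq_le cabs_ge0 andbT.
have geo : (fun k => K * (R' / rho) ^+ k) @ \oo --> (0 : R).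
  rewrite -(mulr0 K); apply: cvgM; first exact: cvg_cst.
  by apply: cvg_expr; rewrite ger0_norm ?divr_ge0 ?ltr_pdivrMr ?mul1r//; lra.
by rewrite -(cvg_lim _ geo)//; apply: limr_ge; [apply/cvg_ex; exists 0|near=> k; exact: bnd2].
Unshelve. all: by end_near. Qed.

(** The maximum principle needs two derivatives, so it is applied to a second primitive [H2], whose
    derivatives [H] and [F] are known by construction. All three vanish on the smaller half-plane;
    once [H2] is zero everywhere, differentiating twice returns to [F]. *)
Theorem identity_theorem F (c c' : R) : (forall z, c < complex.Re z -> exists d, cdiff F z d) ->
  (forall z, c' < complex.Re z -> F z = 0) -> forall z, c < complex.Re z -> F z = 0.
Proof.
move=> dF F0 z zc; have [cc|/ltW cc] := leP c c'; last by apply: F0; exact: le_lt_trans zc.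
pose z0 : R[i] := (c' + 1)%:C.
have z0c : c < complex.Re z0 by rewrite /=; lra.
pose H := lint F z0.
have dH x : c < complex.Re x -> cdiff H x (F x) by move=> xc; exact: (primitive dF).
have dH' x : c < complex.Re x -> exists d, cdiff H x d by move=> /dH; exists (F x).
pose H2 := lint H z0.
have dH2 x : c < complex.Re x -> cdiff H2 x (H x) by move=> xc; exact: (primitive dH').
have H0 x : c' < complex.Re x -> H x = 0 by exact: (lint_zero dF F0 cc).
have H20 x : c' < complex.Re x -> H2 x = 0 by exact: (lint_zero dH' H0 cc).
have H2z := max_principle_vanish dH2 dH dF H20 H0 F0.
have step (G G1 : R[i] -> R[i]) : (forall x, c < complex.Re x -> cdiff G x (G1 x)) ->
    (forall x, c < complex.Re x -> G x = 0) -> forall x, c < complex.Re x -> G1 x = 0.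
  move=> dG Gz x xc; apply: (cdiff_uniq (dG x xc)).
  apply: (@cdiff_near _ (fun=> 0) _ _ _ (complex.Re x - c)); [by rewrite subr_gt0| |exact: cdiff_cst].
  move=> h hx; rewrite Gz// ReD; have := normRe_cabs h; rewrite ler_norml => /andP[h2 _]; lra.
exact: (step H F dH (step H2 H dH2 H2z)).
Qed.

End identity_theorem.

(** * The Gamma function and the Laplace transform of powers *)

Section cexp_remainder.
Context {R : realType}.
Implicit Types (u z : R[i]).

Lemma rdiff_cexp_line u (s : R) : rdiff (fun x => cexp (x%:C * u)) s (u * cexp (s%:C * u)).
Proof.
have := rdiff_cexp (rdiff_affine 0 u s); rewrite add0r.
by rewrite (_ : (fun x => cexp (0 + _)) = (fun x : R => cexp (x%:C * u)))//; apply/funext => x; rewrite add0r.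
Qed.

Lemma cabs_cexp_le u : cabs (cexp u) <= expR (cabs u).
Proof. by rewrite cabs_cexp ler_expR; apply: le_trans (ler_norm _) (normRe_cabs _). Qed.

Lemma cexp_sub1_le u : cabs (cexp u - 1) <= cabs u * expR (cabs u).
Proof.
have := @rdiff_mvt _ (fun x => cexp (x%:C * u)) (fun s => u * cexp (s%:C * u)) (cabs u * expR (cabs u)).
rewrite mul1r mul0r cexp0; apply => s s01; first exact: rdiff_cexp_line.
rewrite cabsM ler_wpM2l ?cabs_ge0//; apply: le_trans (cabs_cexp_le _) _.
move: s01 => /andP[s0 s1]; rewrite ler_expR cabsM cabsC ger0_norm//.
by rewrite ler_piMl ?cabs_ge0.
Qed.

Lemma cexp_sub1_sub_le u : cabs (cexp u - 1 - u) <= cabs u ^+ 2 * expR (cabs u).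
Proof.
have := @rdiff_mvt _ (fun x => cexp (x%:C * u) - x%:C * u) (fun s => u * (cexp (s%:C * u) - 1))
  (cabs u ^+ 2 * expR (cabs u)).
rewrite mul1r mul0r cexp0 subr0.
rewrite (_ : cexp u - u - 1 = cexp u - 1 - u); last by ring.
apply => s s01.
  have D := rdiffB (rdiff_cexp_line u s) (rdiff_affine 0 u s).
  apply: (rdiff_eq (P := fun x => _) (d := _ - _)); last by rewrite mulrBr mulr1.
  by move: D; congr rdiff; apply/funext => x; rewrite add0r.
move: s01 => /andP[s0 s1]; have us : cabs (s%:C * u) <= cabs u.
  by rewrite cabsM cabsC ger0_norm// ler_piMl ?cabs_ge0.
rewrite cabsM expr2 -mulrA ler_wpM2l ?cabs_ge0//.
apply: le_trans (cexp_sub1_le _) _; apply: ler_pM => //; rewrite ?cabs_ge0 ?expR_ge0//.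
by rewrite ler_expR.
Qed.

Lemma sqr_le_expR (r x : R) : 0 < r -> 0 <= x -> x ^+ 2 <= (2 / r) ^+ 2 * expR (r * x).
Proof.
move=> r0 x0; have h : x <= 2 / r * expR (r / 2 * x).
  have := expR_ge1Dx (r / 2 * x); rewrite -ler_pdivrMl ?divr_gt0// => H.
  apply: le_trans (_ : (2 / r)^-1 * x <= _) => //; apply: le_trans H.
  by rewrite invf_div lerDr.
rewrite (_ : r * x = r / 2 * x + r / 2 * x); last by field.
by rewrite expRD -expr2 -exprMn lerXn2r// nnegrE mulr_ge0 ?expR_ge0// divr_ge0// ltW.
Qed.

End cexp_remainder.

Section parametric_integral.
Context d (T : measurableType d) (R : realType).
Variable mu : {measure set T -> \bar R}.

(** The remainder is governed by [|exp u - 1 - u| <= |u| ^ 2 exp |u|] with [u = - h L]. Half of the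
    room [rho] pays for [exp |u|] when [|h| <= rho / 2], the other half absorbs [|L| ^ 2] at the
    cost of the constant in [sqr_le_expR]. *)
Lemma cdiff_param_integral (w L : T -> R[i]) (z0 : R[i]) (rho : R) : cmeasurable w -> cmeasurable L -> 0 < rho ->
  mu.-integrable setT (fun x => (cabs (w x) * expR (- complex.Re (z0 * L x)) * expR (rho * cabs (L x)))%:E) ->
  cdiff (fun z => cintegral mu setT (fun x => w x * cexp (- (z * L x)))) z0
    (- cintegral mu setT (fun x => w x * L x * cexp (- (z0 * L x)))).
Proof.
move=> mw mL rho0 iG; set G := fun x => _ in iG.
have G0 x : 0 <= cabs (w x) * expR (- complex.Re (z0 * L x)) * expR (rho * cabs (L x)).
  by rewrite !mulr_ge0 ?cabs_ge0 ?expR_ge0.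
pose g x := cabs (w x) * expR (- complex.Re (z0 * L x)) * expR (rho * cabs (L x)).
have gE x : cabs (w x * cexp (- (z0 * L x))) = cabs (w x) * expR (- complex.Re (z0 * L x)).
  by rewrite cabsM cabs_cexp ReN.
have mE z : cmeasurable (fun x => w x * cexp (- (z * L x))).
  by apply: cmeasurableM => //; apply: cmeasurable_cexp; apply: cmeasurableN; apply: cmeasurableM => //; exact: cmeasurable_cst.
have mEL : cmeasurable (fun x => w x * L x * cexp (- (z0 * L x))).
  apply: cmeasurableM; first exact: cmeasurableM.
  by apply: cmeasurable_cexp; apply: cmeasurableN; apply: cmeasurableM => //; exact: cmeasurable_cst.
have r2 : 0 < rho / 2 by rewrite divr_gt0.
have L1 x : cabs (L x) <= (2 / rho) * expR (rho * cabs (L x)).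
  have := expR_ge1Dx (rho / 2 * cabs (L x)) => H.
  apply: (@le_trans _ _ (2 / rho * expR (rho / 2 * cabs (L x)))).
    by rewrite -ler_pdivrMl ?divr_gt0// invf_div; apply: le_trans H; rewrite lerDr.
  rewrite ler_wpM2l ?divr_ge0 ?(ltW rho0)// ler_expR ler_wpM2r ?cabs_ge0//.
  by rewrite ler_pdivrMr// ler_peMr ?ler1n// ltW.
have iEL : cintegrable mu (fun x => w x * L x * cexp (- (z0 * L x))).
  apply: (@cintegrable_le _ _ _ _ _ (fun x => 2 / rho * g x)) => //.
    by under eq_fun do rewrite EFinM; exact: integrableZl.
  move=> x; rewrite mulrAC cabsM gE /g [leRHS]mulrCA.
  by rewrite ler_wpM2l ?mulr_ge0 ?cabs_ge0 ?expR_ge0.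
have main z : cabs (z - z0) <= rho / 2 -> cintegrable mu (fun x => w x * cexp (- (z * L x))).
  move=> zr; apply: (@cintegrable_le _ _ _ _ _ g) => // x.
  have -> : - (z * L x) = - (z0 * L x) + - ((z - z0) * L x) by ring.
  rewrite cexpD mulrA cabsM gE ler_wpM2l ?mulr_ge0 ?cabs_ge0 ?expR_ge0//.
  apply: le_trans (cabs_cexp_le _) _; rewrite ler_expR cabsN cabsM ler_wpM2r ?cabs_ge0//.
  by apply: le_trans zr _; rewrite ler_pdivrMr// ler_peMr ?ler1n// ltW.
pose K := (2 / (rho / 2)) ^+ 2 * \int[mu]_x g x.
have K0 : 0 <= K.
  by apply: mulr_ge0; [exact: sqr_ge0|apply: Rintegral_ge0 => x _; exact: G0].
move=> e e0; exists (Num.min (rho / 2) (e / (K + 1))).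
  by rewrite lt_min r2 divr_gt0// ltr_wpDl.
move=> h; rewrite lt_min => /andP[/ltW hr /ltW]; rewrite ler_pdivlMr ?ltr_wpDl// => he.
have ih : cintegrable mu (fun x => w x * cexp (- ((z0 + h) * L x))).
  by apply: main; rewrite (addrC z0) addrK.
have i0 : cintegrable mu (fun x => w x * cexp (- (z0 * L x))).
  by apply: main; rewrite subrr cabs0 ltW.
rewrite mulrN opprK -(cintegralB ih i0) -(cintegralZ h iEL).
rewrite -(cintegralD (cintegrableB ih i0) (cintegrableZ h iEL)).
have hK : cabs h * (K * cabs h) <= e * cabs h.
  rewrite mulrA ler_wpM2r ?cabs_ge0//; apply: le_trans he.
  by rewrite ler_wpM2l ?cabs_ge0// lerDl.
apply: le_trans hK.
have -> : cabs h * (K * cabs h) = \int[mu]_x (cabs h ^+ 2 * (2 / (rho / 2)) ^+ 2 * g x).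
  rewrite RintegralZl// /K; ring.
apply: cabs_cintegral_le.
- by apply: (cintegrableD (cintegrableB ih i0) (cintegrableZ h iEL)).1.
- by under eq_fun do rewrite EFinM; exact: integrableZl.
move=> x; pose u := - (h * L x).
have -> : w x * cexp (- ((z0 + h) * L x)) - w x * cexp (- (z0 * L x)) + h * (w x * L x * cexp (- (z0 * L x))) =
    w x * cexp (- (z0 * L x)) * (cexp u - 1 - u).
  by rewrite mulrDl opprD cexpD /u; ring.
rewrite cabsM gE /g [leRHS]mulrCA; apply: ler_wpM2l; first by rewrite mulr_ge0 ?cabs_ge0 ?expR_ge0.
apply: le_trans (cexp_sub1_sub_le u) _; rewrite /u cabsN cabsM exprMn -[leLHS]mulrA -[leRHS]mulrA; apply: ler_wpM2l; first exact: sqr_ge0.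
apply: (@le_trans _ _ ((2 / (rho / 2)) ^+ 2 * expR (rho / 2 * cabs (L x)) * expR (rho / 2 * cabs (L x)))).
  apply: ler_pM; rewrite ?sqr_ge0 ?expR_ge0//; first by apply: sqr_le_expR => //; exact: cabs_ge0.
  by rewrite ler_expR ler_wpM2r ?cabs_ge0.
by rewrite -mulrA -expRD -mulrDl -splitr.
Qed.

End parametric_integral.

Section complex_change_of_variables.
Context {R : realType}.
Local Notation leb := (@lebesgue_measure R).

(** Positive and negative parts scale by the nonnegative case; the case analysis shows that a
    positive factor commutes with their extended difference, infinite values included. *)
Lemma integral_affineN (c a : R) (h : R -> R) : c != 0 -> measurable_fun [set: R] h ->
  \int[leb]_x h (c * x + a) = `|c|^-1 * \int[leb]_x h x.
Proof.
move=> c0 mh; have mE : measurable_fun [set: R] (EFin \o h) by exact/measurable_EFinP.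
rewrite /Rintegral (integralE leb setT (fun x => (h (c * x + a))%:E)) (integralE leb setT (fun x => (h x)%:E)).
have pE : (fun x => (h (c * x + a))%:E)^\+%E = (fun x => ((EFin \o h)^\+)%E (c * x + a)) by apply/funext => x; rewrite !funeposE.
have nE : (fun x => (h (c * x + a))%:E)^\-%E = (fun x => ((EFin \o h)^\-)%E (c * x + a)) by apply/funext => x; rewrite !funenegE.
rewrite pE nE.
rewrite (ge0_integral_affineN a c0 (measurable_funepos mE) (fun x => funepos_ge0 _ x)).
rewrite (ge0_integral_affineN a c0 (measurable_funeneg mE) (fun x => funeneg_ge0 _ x)).
have ci : 0 < `|c|^-1 by rewrite invr_gt0 normr_gt0.
set P := (\int[leb]_x ((EFin \o h)^\+ x)%E)%E; set N := (\int[leb]_x ((EFin \o h)^\- x)%E)%E.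
have P0 : (0 <= P)%E by apply: integral_ge0 => x _; exact: funepos_ge0.
have N0 : (0 <= N)%E by apply: integral_ge0 => x _; exact: funeneg_ge0.
have -> : (`|c|^-1%:E * P - `|c|^-1%:E * N = `|c|^-1%:E * (P - N))%E.
  case: P P0 => [p||]//; case: N N0 => [q||]// _ _.
  - by rewrite -!EFinM -!EFinD -mulrBr.
  - by rewrite [(p%:E - +oo)%E]/= gt0_muley ?lte_fin// gt0_muleNy ?lte_fin.
  - by rewrite gt0_muley ?lte_fin.
  - by rewrite [(+oo - +oo)%E]/= gt0_muley ?lte_fin// gt0_muleNy ?lte_fin.
by case: (P - N)%E => [r||]; rewrite -?EFinM//= ?gt0_muley ?gt0_muleNy ?lte_fin//= mulr0.
Qed.

Lemma cintegral_affine (c a : R) (g : R -> R[i]) : c != 0 -> cmeasurable (g : measurableTypeR R -> R[i]) ->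
  cintegral leb setT (fun x : measurableTypeR R => g (c * x + a)) = (`|c|^-1)%:C * cintegral leb setT g.
Proof.
move=> c0 [mr mi]; rewrite /cintegral (integral_affineN a c0 mr) (integral_affineN a c0 mi).
by apply: complex_ext; rewrite ?ReM ?ImM /= mul0r ?subr0 ?addr0.
Qed.

Lemma cintegrable_affine (c a : R) (g : R -> R[i]) : c != 0 -> cintegrable leb g ->
  cintegrable leb (fun x : measurableTypeR R => g (c * x + a)).
Proof.
move=> c0 [mg ig]; split.
  by apply: (cmeasurable_comp (h := fun x : measurableTypeR R => c * x + a : measurableTypeR R)) => //; exact: measurable_affine.
rewrite (ge0_integral_affineN a c0 (measurable_ecabs mg)); last by move=> x; rewrite lee_fin cabs_ge0.
by rewrite lte_mul_pinfty// lee_fin invr_ge0.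
Qed.

End complex_change_of_variables.

(** * The Gamma function and the Laplace transform of powers *)

Section gamma_integral.
Context {R : realType}.
Local Notation leb := (@lebesgue_measure R).
Implicit Types (al z : R[i]) (s e : R).

(** This is [ln x < x] at [x = e s / c], multiplied by [c]. *)
Lemma powR_expR_le (c e s : R) : 0 < c -> 0 < e -> 0 < s ->
  s `^ c * expR (- (e * s)) <= expR (- (c * ln (e / c))).
Proof.
move=> c0 e0 s0; rewrite /powR gt_eqF// -expRD ler_expR.
have ec : 0 < e / c by rewrite divr_gt0.
have := ln_sublinear (mulr_gt0 ec s0); rewrite (@lnM _ (e / c) s) ?posrE// => /ltW H.
have := ler_wpM2l (ltW c0) H; rewrite mulrDr => {}H.
have : c * (e / c * s) = e * s by field; rewrite gt_eqF.
by move=> E; rewrite E in H; lra.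
Qed.

Definition gamma_weight (c e s : R) : R := (0 < s)%R%:R * s `^ (c - 1) * expR (- (e * s)).

Lemma gamma_weight_ge0 c e s : 0 <= gamma_weight c e s.
Proof. by rewrite !mulr_ge0 ?powR_ge0 ?expR_ge0. Qed.

Lemma measurable_gamma_weight c e : measurable_fun [set: R] (gamma_weight c e).
Proof.
apply: measurable_funM.
  apply: measurable_funM; first by apply: measurable_bool_natr; exact: measurable_pos.
  exact: measurable_powR.
apply: (measurableT_comp (@measurable_expR R)); exact: measurableT_comp.
Qed.

(** On []0, 1]] the exponential is at most [1] and the power is integrable. Beyond [1] two powers
    are split off: [s ^ (c + 1) exp (- e s)] is bounded and [s ^ (- 2)] is integrable. *)
Lemma integrable_gamma_weight c e : 0 < c -> 0 < e ->
  leb.-integrable setT (fun s => (gamma_weight c e s)%:E).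
Proof.
move=> c0 e0; have mw := measurable_gamma_weight c e.
have c1 : 0 < c + 1 by rewrite ltr_wpDl// ltW.
pose K := expR (- ((c + 1) * ln (e / (c + 1)))).
apply/integrableP; split; first exact/measurable_EFinP.
under eq_integral do rewrite gee0_abs ?lee_fin ?gamma_weight_ge0//.
have m1 : measurable_fun [set: R] (fun s : R => (`|s| <= 1)%R%:R * `|s| `^ (c - 1)).
  apply: measurable_funM; first by apply: measurable_bool_natr; exact: measurable_abs_le.
  by apply: measurable_powR_comp; exact: normr_measurable.
have m2 : measurable_fun [set: R] (fun s : R => K * ((1 <= s)%R%:R * s `^ (- 1 - 1))).
  apply: measurable_funM => //; apply: measurable_funM; last exact: measurable_powR.
  exact: measurable_le_natr.
have p1 s : 0 <= (`|s| <= 1)%R%:R * `|s| `^ (c - 1) by rewrite mulr_ge0 ?powR_ge0.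
have p2 s : 0 <= K * ((1 <= s)%R%:R * s `^ (- 1 - 1)) by rewrite !mulr_ge0 ?powR_ge0 ?expR_ge0.
apply: (@le_lt_trans _ _ (\int[leb]_s (((`|s| <= 1)%R%:R * `|s| `^ (c - 1))%:E +
    (K * ((1 <= s)%R%:R * s `^ (- 1 - 1)))%:E))%E).
  apply: ge0_le_integralT.
  - exact/measurable_EFinP.
  - by apply: emeasurable_funD; exact/measurable_EFinP.
  - by move=> s; rewrite lee_fin gamma_weight_ge0.
  move=> s; rewrite -EFinD lee_fin /gamma_weight.
  have [s0|s0] := ltP 0 s; last by rewrite !mul0r addr_ge0.
  rewrite mul1r ger0_norm ?(ltW s0)//; have [s1|s1] := leP s 1.
    rewrite mul1r; apply: ler_wpDr; first exact: p2.
    by rewrite ler_piMr ?powR_ge0// -expR0 ler_expR oppr_le0 mulr_ge0 ?ltW.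
  rewrite mul0r add0r (ltW s1) mul1r.
  have -> : c - 1 = (c + 1) + (- 1 - 1) by ring.
  rewrite powRD ?(gt_eqF s0) ?implybT// mulrAC; apply: ler_wpM2r; first exact: powR_ge0.
  exact: powR_expR_le.
rewrite ge0_integralD//; try exact/measurable_EFinP; last by move=> s _; rewrite lee_fin; exact: p2.
apply: lte_add_pinfty; first exact: le_lt_trans (integral_abs_powR_head c0 ltr01) (ltry _).
under eq_integral do rewrite EFinM.
rewrite ge0_integralZlT//.
- by rewrite (integral_powR_tail_ind ltr01 ltr01) -EFinM ltry.
- by apply/measurable_EFinP; apply: measurable_funM; [exact: measurable_le_natr|exact: measurable_powR].
- by move=> s; rewrite lee_fin mulr_ge0 ?powR_ge0.
- exact: expR_ge0.
Qed.

Lemma cabs_pospow (s : R) al : cabs (pospow s al) = (0 < s)%R%:R * s `^ complex.Re al.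
Proof.
case: (ltP 0 s) => s0; last by rewrite /pospow (le_gtF s0) cabs0 mul0r.
rewrite pospowE// cabs_cexp mul1r ReM /= mulr0 subr0 /powR gt_eqF//.
Qed.

Lemma cmeasurable_pospow d (T : measurableType d) (u : T -> R) al : measurable_fun setT u ->
  cmeasurable (fun x => pospow (u x) al).
Proof.
move=> mu; rewrite (_ : (fun x => _) = (fun x => if 0 < u x then cexp (al * (ln (u x))%:C) else 0)).
  apply: cmeasurable_if.
  - by apply: (measurableT_comp (f := fun s : R => 0 < s)) => //; exact: measurable_pos.
  - apply: cmeasurable_cexp; apply: cmeasurableM; first exact: cmeasurable_cst.
    by apply: cmeasurableC; apply: (measurableT_comp (@measurable_ln R)).
  - exact: cmeasurable_cst.
by apply/funext => x; case: ifP => [/pospowE ->//|]; rewrite /pospow => ->.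
Qed.

Lemma pospow_mulr (s : R) al : pospow s al * s%:C = pospow s (al + 1).
Proof.
have [s0|s0] := ltP 0 s; last by rewrite /pospow ltNge s0 /= mul0r.
by rewrite !pospowE// -[in s%:C](lnK (x := s)) ?posrE// -cexpC -cexpD mulrDl mul1r.
Qed.

Lemma pospow_scale (r s : R) al : 0 < r -> pospow (r * s) al = cexp (al * (ln r)%:C) * pospow s al.
Proof.
move=> r0; have [s0|s0] := ltP 0 s.
  by rewrite !pospowE ?mulr_gt0// lnM ?posrE// rmorphD/= mulrDr cexpD.
by rewrite /pospow pmulr_rgt0// ltNge s0 /= mulr0.
Qed.

Definition laplace_pow al z : R[i] :=
  cintegral leb setT (fun s : measurableTypeR R => pospow s (al - 1) * cexp (- (z * s%:C))).

Lemma cabs_laplace_integrand al z s : cabs (pospow s (al - 1) * cexp (- (z * s%:C))) =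
  gamma_weight (complex.Re al) (complex.Re z) s.
Proof. by rewrite cabsM cabs_pospow cabs_cexp ReD !ReN ReM /= mulr0 subr0. Qed.

Lemma cmeasurable_laplace_integrand al z :
  cmeasurable (fun s : measurableTypeR R => pospow s (al - 1) * cexp (- (z * s%:C))).
Proof.
apply: cmeasurableM; first exact: cmeasurable_pospow.
apply: cmeasurable_cexp; apply: cmeasurableN; apply: cmeasurableM; first exact: cmeasurable_cst.
exact: cmeasurableC.
Qed.

Lemma cintegrable_laplace al z : 0 < complex.Re al -> 0 < complex.Re z ->
  cintegrable leb (fun s : measurableTypeR R => pospow s (al - 1) * cexp (- (z * s%:C))).
Proof.
move=> a0 z0; apply: (@cintegrable_le _ (measurableTypeR R) R leb _ (gamma_weight (complex.Re al) (complex.Re z))).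
- exact: cmeasurable_laplace_integrand.
- exact: integrable_gamma_weight.
- by move=> s; rewrite cabs_laplace_integrand.
Qed.

Lemma Gamma_laplace al : Gamma al = laplace_pow al 1.
Proof.
have E (g : R -> R) : (forall s, ~~ (0 < s) -> g s = 0) -> \int[leb]_(s in `]0, +oo[) g s = \int[leb]_s g s.
  move=> g0; rewrite [LHS]Rintegral_mkcond; congr Rintegral; apply/funext => s; rewrite patchE; case: ifPn => //.
  by rewrite notin_setE/= in_itv/= andbT => /negP h; rewrite g0.
have EC s : pospow s (al - 1) * (expR (- s))%:C = pospow s (al - 1) * cexp (- (1 * s%:C)).
  by rewrite mul1r -cexpC rmorphN.
have z0 s : ~~ (0 < s) -> pospow s (al - 1) * (expR (- s))%:C = 0 by rewrite /pospow => /negbTE ->; rewrite mul0r.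
rewrite /Gamma /laplace_pow /cintegral !E.
- by congr (_ +i* _); congr Rintegral; apply/funext => s; rewrite EC.
- by move=> s /z0 ->.
- by move=> s /z0 ->.
Qed.

Lemma laplace_pow_scale al z (r : R) : 0 < r -> 0 < complex.Re al -> 0 < complex.Re z ->
  laplace_pow al (r%:C * z) = cexp (- al * (ln r)%:C) * laplace_pow al z.
Proof.
move=> r0 a0 z0; have := @cintegral_affine R r 0 _ (lt0r_neq0 r0) (cmeasurable_laplace_integrand al z).
rewrite -/(laplace_pow al z) => E.
have -> : laplace_pow al z = r%:C * cintegral leb setT (fun x : measurableTypeR R =>
    pospow (r * x + 0) (al - 1) * cexp (- (z * (r * x + 0)%:C))).
  by rewrite E gtr0_norm// mulrA -rmorphM/= mulfV ?gt_eqF// mul1r.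
have ig : cintegrable leb (fun s : measurableTypeR R => pospow s (al - 1) * cexp (- (r%:C * z * s%:C))).
  by apply: cintegrable_laplace => //; rewrite ReM /= mul0r subr0 mulr_gt0.
under [X in _ = _ * (_ * X)]eq_cintegral => x.
  rewrite addr0 pospow_scale// rmorphM/= -mulrA (_ : z * (r%:C * x%:C) = r%:C * z * x%:C); last by ring.
  over.
have rE : r%:C = cexp (ln r)%:C by rewrite cexpC lnK.
rewrite cintegralZ// -/(laplace_pow al _) 2![RHS]mulrA -[LHS]mul1r; congr (_ * _).
transitivity (cexp (0 : R[i])); first by rewrite cexp0.
by rewrite rE -!cexpD; congr cexp; ring.
Qed.

Lemma cdiff_laplace_pow al z : 0 < complex.Re al -> 0 < complex.Re z ->
  cdiff (laplace_pow al) z (- laplace_pow (al + 1) z).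
Proof.
move=> a0 z0; pose e := complex.Re z / 2; have e0 : 0 < e by rewrite divr_gt0.
have := @cdiff_param_integral _ _ _ leb (fun s : measurableTypeR R => pospow s (al - 1))
  (fun s : measurableTypeR R => s%:C) z e (cmeasurable_pospow (al - 1) (@measurable_id _ (measurableTypeR R) setT)) (cmeasurableC (@measurable_id _ (measurableTypeR R) setT)) e0.
rewrite (_ : cintegral _ _ _ = laplace_pow (al + 1) z); last first.
  by apply: eq_cintegral => s; rewrite pospow_mulr addrAC.
apply; rewrite (_ : (fun x => _) = (fun s => (gamma_weight (complex.Re al) e s)%:E)).
  exact: integrable_gamma_weight.
apply/funext => s; rewrite /gamma_weight cabsC cabs_pospow ReD ReN ReM /= mulr0 subr0.
case: (ltP 0 s) => s0; last by rewrite !mul0r.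
by rewrite -mulrA -expRD ger0_norm ?(ltW s0)//; congr (_ * expR _)%:E; rewrite /e; field.
Qed.

(** The transform is homogeneous of degree [- al] under positive scaling; differentiating along the
    ray through [z] in two ways gives Euler's relation. At [z = 1] it is the functional equation of
    Gamma, so no integration by parts is involved. *)
Lemma laplace_pow_ode al z : 0 < complex.Re al -> 0 < complex.Re z ->
  z * laplace_pow (al + 1) z = al * laplace_pow al z.
Proof.
move=> a0 z0.
have D1 : rdiff (fun x : R => laplace_pow al (0 + x%:C * z)) 1 (z * - laplace_pow (al + 1) z).
  by apply: cdiff_rdiff_at; rewrite mul1r add0r; exact: cdiff_laplace_pow.
have dln : is_derive (1 : R) (1 : R) (@ln R) 1 by have := is_derive1_ln (@ltr01 R); rewrite invr1.
have D2 := rdiffM (rdiff_cexp (rdiffZ (- al) (rdiffC dln))) (rdiff_cst (laplace_pow al z) 1).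
have : rdiff (fun x : R => laplace_pow al (0 + x%:C * z)) 1 (- al * laplace_pow al z).
  have := D2; rewrite ln1 rmorph0 rmorph1 !mulr0 cexp0 !mulr1 add0r => -[H1 H2].
  have N : \forall x \near (1 : R), laplace_pow al (0 + x%:C * z) = cexp (- al * (ln x)%:C) * laplace_pow al z.
    near=> x; rewrite add0r laplace_pow_scale//.
    by near: x; apply: lt_nbhsr.
  split.
  - by apply: near_eq_is_derive H1; apply: filterS N => x ->.
  - by apply: near_eq_is_derive H2; apply: filterS N => x ->.
move=> D; have := rdiff_unique D1 D; rewrite mulrN mulNr => /oppr_inj; exact.
Unshelve. all: by end_near. Qed.

Lemma Gamma_succ al : 0 < complex.Re al -> Gamma (al + 1) = al * Gamma al.
Proof. by move=> a0; rewrite !Gamma_laplace -laplace_pow_ode ?mul1r. Qed.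

(** The principal logarithm of [e + i sg], used for [e > 0], where the arctangent is the
    argument. *)
Definition clog (e sg : R) : R[i] := (ln (e ^+ 2 + sg ^+ 2) / 2) +i* atan (sg / e).

Lemma rdiff_clog e sg : 0 < e -> rdiff (clog e) sg ('i / (e +i* sg)).
Proof.
move=> e0; have p : 0 < e ^+ 2 + sg ^+ 2 by rewrite ltr_wpDr ?sqr_ge0// exprn_gt0.
have dq : is_derive sg (1 : R) (fun x : R => e ^+ 2 + x ^+ 2) (2 * sg).
  by apply: is_derive_eq; rewrite /GRing.scale/=; ring.
have dl := is_derive1_comp (g := fun x : R => e ^+ 2 + x ^+ 2) (is_derive1_ln p) dq.
have -> : 'i / (e +i* sg) = (sg / (e ^+ 2 + sg ^+ 2)) +i* (e / (e ^+ 2 + sg ^+ 2)).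
  have ne : (e +i* sg) != 0 by apply/eqP => -[E _]; rewrite E ltxx in e0.
  apply: (mulIf ne); rewrite divfK//; apply: complex_ext; rewrite ?ReM ?ImM /=; field; exact: lt0r_neq0.
split => /=.
- rewrite (_ : sg / _ = (e ^+ 2 + sg ^+ 2)^-1 * (2 * sg) / 2); last by field; exact: lt0r_neq0.
  rewrite mulrC; have := is_deriveZ (2^-1) dl; rewrite /GRing.scale/=.
  by rewrite (_ : (_ \*: _) = (fun x : R => ln (e ^+ 2 + x ^+ 2) / 2))//; apply/funext => x /=; rewrite mulrC.
- have dv : is_derive sg (1 : R) (fun x : R => x / e) e^-1.
    by have := is_derive_line 0 e^-1 sg; rewrite (_ : (fun x => 0 + _) = (fun x : R => x / e))//; apply/funext => x; rewrite add0r.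
  have := is_derive1_comp (g := fun x : R => x / e) (is_derive1_atan (sg / e)) dv.
  move/is_derive_eq; apply; field.
  by rewrite (gt_eqF e0) (gt_eqF p).
Qed.

(** By Euler's relation the transform times [(e + i s) ^ al] has zero derivative along the vertical
    line. Its value at [s = 0] is [Gamma al], by scaling. *)
Lemma laplace_pow_line al e sg : 0 < complex.Re al -> 0 < e ->
  laplace_pow al (e +i* sg) = Gamma al * cexp (- al * clog e sg).
Proof.
move=> a0 e0; pose P (s : R) := laplace_pow al (e%:C + s%:C * 'i) * cexp (al * clog e s).
have zE (s : R) : e%:C + s%:C * 'i = e +i* s by apply: complex_ext; rewrite ?ReD ?ImD ?ReM ?ImM /=; ring.
have ne (s : R) : (e +i* s) != 0 by apply/eqP => -[E _]; rewrite E ltxx in e0.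
have dP s : rdiff P s 0.
  have D1 : rdiff (fun x : R => laplace_pow al (e%:C + x%:C * 'i)) s ('i * - laplace_pow (al + 1) (e +i* s)).
    by apply: cdiff_rdiff_at; rewrite zE; exact: cdiff_laplace_pow.
  have D2 := rdiff_cexp (rdiffZ al (rdiff_clog s e0)).
  apply: (rdiff_eq (rdiffM D1 D2)); rewrite zE.
  have E : laplace_pow (al + 1) (e +i* s) = al * laplace_pow al (e +i* s) / (e +i* s).
    by rewrite -laplace_pow_ode// mulrAC mulfV// mul1r.
  by rewrite E; ring.
have PE : P sg = P 0.
  have [s0|s0] := leP 0 sg; first exact: (rdiff_const s0).
  by symmetry; apply: (rdiff_const (ltW s0)).
have P0 : P 0 = Gamma al.
  rewrite /P mul0r addr0 -[e%:C]mulr1 laplace_pow_scale// -Gamma_laplace mulrAC -cexpD.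
  rewrite (_ : _ + _ = 0) ?cexp0 ?mul1r// /clog mul0r atan0 expr0n/= addr0 lnXn// mulr2n.
  by rewrite (_ : ((ln e + ln e) / 2 +i* 0) = (ln e)%:C); [ring|apply: complex_ext => //=; field].
rewrite -P0 -PE /P zE -mulrA -cexpD (_ : _ + _ = 0) ?cexp0 ?mulr1//; ring.
Qed.

End gamma_integral.

(** * Fourier inversion by Poisson averages *)

Section fourier_inversion.
Context {R : realType}.
Local Notation leb := (@lebesgue_measure R).

Let dl (j : nat) : R := j.+1%:R^-1.

Let dl0 j : 0 < dl j. Proof. by rewrite invr_gt0. Qed.

Lemma harmonic_cvg0 (y : R) : (fun j : nat => j.+1%:R^-1 * y) @ \oo --> (0 : R).
Proof. by rewrite -(mul0r y); apply: cvgM; [exact: cvg_harmonic|exact: cvg_cst]. Qed.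

Lemma integrable_poisson (e : R) : 0 < e -> leb.-integrable setT (fun s => (poisson e s)%:E).
Proof.
move=> e0; apply/integrableP; split.
  by apply/measurable_EFinP; apply: continuous_measurable_fun; exact: continuous_poisson.
under eq_integral do rewrite gee0_abs ?lee_fin ?poisson_ge0 ?(ltW e0)//.
by rewrite integral_poisson// ltry.
Qed.

Lemma cintegral_poisson (e : R) : 0 < e -> cintegral leb setT (fun s : measurableTypeR R => (poisson e s)%:C) = (2 * pi)%:C.
Proof. by move=> e0; rewrite cintegralC /Rintegral integral_poisson. Qed.

Variables (k : R -> R[i]) (M v : R).
Hypothesis ik : cintegrable leb k.
Hypothesis kM : forall s, cabs (k s) <= M.
Hypothesis kv : forall y, (fun j : nat => cabs (k (v - j.+1%:R^-1 * y) - k v)) @ \oo --> 0.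
Hypothesis ikhat : cintegrable leb (fun sg => fourierR k (- sg)).

Let mk : cmeasurable (k : measurableTypeR R -> R[i]). Proof. by case: ik. Qed.

(** Fubini with the integral over the frequency first turns the damping into the kernel
    [poisson (dl j) (v - y)]. Rescaling [y] about [v] gives a kernel independent of [j], ready for
    dominated convergence. *)
Lemma poisson_smoothing j :
  cintegral leb setT (fun sg : measurableTypeR R => (wexp (dl j) sg)%:C * (fourierR k (- sg) * expi (sg * v))) =
  cintegral leb setT (fun y : measurableTypeR R => k (v - dl j * y) * (poisson 1 y)%:C).
Proof.
have iw : cintegrable leb (fun sg : measurableTypeR R => (wexp (dl j) sg)%:C).
  apply: (@cintegrable_le _ _ _ leb _ (wexp (dl j))).
  - by apply: cmeasurableC; exact: measurable_wexp.
  - exact: integrable_wexp.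
  - by move=> s; rewrite cabsC ger0_norm// wexp_ge0.
pose g (z : measurableTypeR R * measurableTypeR R) : R[i] := (wexp (dl j) z.1)%:C * k z.2 * expi ((v - z.2) * z.1).
have m1 : measurable_fun setT (@fst (measurableTypeR R) (measurableTypeR R)) by exact: measurable_fst.
have m2 : measurable_fun setT (@snd (measurableTypeR R) (measurableTypeR R)) by exact: measurable_snd.
have ig : cintegrable (leb \x leb)%E g.
  apply: (cintegrable_lec (c := 1)) (cintegrable_prod iw ik) _.
    apply: cmeasurableM; first exact: (cintegrable_prod iw ik).1.
    by apply: cmeasurable_expi; apply: measurable_funM => //; exact: measurable_funB.
  by move=> z; rewrite mul1r /g cabsM cabs_expi mulr1.
have := cfubini ig; rewrite /g /= => E.
transitivity (cintegral leb setT (fun x : measurableTypeR R => cintegral leb setT (fun y : measurableTypeR R =>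
    (wexp (dl j) x)%:C * k y * expi ((v - y) * x)))).
  apply: eq_cintegral => sg; rewrite /fourierR.
  have ie : cintegrable leb (fun s : measurableTypeR R => k s * expi (s * - sg)).
    apply: (cintegrable_lec (c := 1)) ik _.
      by apply: cmeasurableM; [exact: mk|apply: cmeasurable_expi; exact: measurable_funM].
    by move=> s; rewrite mul1r cabsM cabs_expi mulr1.
  rewrite mulrCA mulrC -(cintegralZ _ ie).
  apply: eq_cintegral => s.
  have -> : (v - s) * sg = sg * v + s * - sg by ring.
  by rewrite expiD; ring.
rewrite E {E ig}.
transitivity (cintegral leb setT (fun y : measurableTypeR R => k y * (poisson (dl j) (v - y))%:C)).
  apply: eq_cintegral => y; rewrite -(cintegral_wexp _ (dl0 j)) -cintegralZ.
    by apply: eq_cintegral => x; ring.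
  apply: (cintegrable_lec (c := 1)) iw _.
    apply: cmeasurableM; first by apply: cmeasurableC; exact: measurable_wexp.
    by apply: cmeasurable_expi; exact: measurable_funM.
  by move=> s; rewrite mul1r cabsM cabs_expi mulr1.
have mp : cmeasurable (fun y : measurableTypeR R => k y * (poisson (dl j) (v - y))%:C).
  apply: cmeasurableM; [exact: mk|apply: cmeasurableC].
  apply: (measurableT_comp (f := poisson (dl j))); last exact: measurable_funB.
  by apply: continuous_measurable_fun; exact: continuous_poisson.
have nd : - dl j != 0 by rewrite oppr_eq0 gt_eqF.
have := cintegral_affine v nd mp; rewrite normrN (ger0_norm (ltW (dl0 j))) => A.
have -> : cintegral leb setT (fun y : measurableTypeR R => k y * (poisson (dl j) (v - y))%:C) =
    (dl j)%:C * cintegral leb setT (fun x : measurableTypeR R => k (- dl j * x + v) * (poisson (dl j) (v - (- dl j * x + v)))%:C).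
  by rewrite A mulrA -rmorphM/= mulfV ?gt_eqF// mul1r.
have ikp : cintegrable leb (fun y : measurableTypeR R => k y * (poisson (dl j) (v - y))%:C).
  apply: (cintegrable_lec (c := 2 / dl j)) ik _ => // y.
  rewrite cabsM cabsC mulrC ler_wpM2r ?cabs_ge0// ger0_norm ?poisson_ge0 ?(ltW (dl0 j))//.
  have d2 : 0 < dl j ^+ 2 by rewrite exprn_gt0.
  rewrite /poisson ler_pdivrMr ?ltr_wpDr ?sqr_ge0// mulrDr.
  rewrite (_ : 2 / dl j * dl j ^+ 2 = 2 * dl j); last by field; rewrite gt_eqF.
  by rewrite lerDl mulr_ge0 ?sqr_ge0// divr_ge0// ltW.
rewrite -(cintegralZ _ (cintegrable_affine v nd ikp)).
apply: eq_cintegral => y; rewrite mulNr (addrC (- _)) mulrCA -rmorphM /=.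
congr (_ * _%:C); rewrite opprB addrC subrK /poisson.
have y1 : 1 + y ^+ 2 != 0 by rewrite gt_eqF// ltr_wpDr ?sqr_ge0.
have -> : dl j ^+ 2 + (dl j * y) ^+ 2 = dl j ^+ 2 * (1 + y ^+ 2) by ring.
by field; rewrite y1 gt_eqF.
Qed.

(** Both sides of [poisson_smoothing] converge: the left is dominated by the integrable transform,
    the right by [M] times the Poisson kernel, and the kernel has total mass [2 * pi]. *)
Lemma fourier_inversion : cintegral leb setT (fun sg : measurableTypeR R => fourierR k (- sg) * expi (sg * v)) =
  (2 * pi)%:C * k v.
Proof.
have m2 : cmeasurable (fun sg : measurableTypeR R => fourierR k (- sg) * expi (sg * v)).
  by apply: cmeasurableM; [exact: ikhat.1|apply: cmeasurable_expi; exact: measurable_funM].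
have L1 := @cvg_cintegral _ _ _ leb
  (fun j (sg : measurableTypeR R) => (wexp (dl j) sg)%:C * (fourierR k (- sg) * expi (sg * v)))
  (fun sg : measurableTypeR R => fourierR k (- sg) * expi (sg * v)) (fun sg => cabs (fourierR k (- sg))).
have L2 := @cvg_cintegral _ _ _ leb
  (fun j (y : measurableTypeR R) => k (v - dl j * y) * (poisson 1 y)%:C)
  (fun y : measurableTypeR R => k v * (poisson 1 y)%:C) (fun y => M * poisson 1 y).
have ip : cintegrable leb (fun s : measurableTypeR R => (poisson 1 s)%:C).
  apply: (@cintegrable_le _ _ _ leb _ (poisson 1)).
  - by apply: cmeasurableC; apply: continuous_measurable_fun; exact: continuous_poisson.
  - exact: integrable_poisson.
  - by move=> s; rewrite cabsC ger0_norm// poisson_ge0.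
have E : (2 * pi)%:C * k v = cintegral leb setT (fun y : measurableTypeR R => k v * (poisson 1 y)%:C).
  by rewrite cintegralZ// cintegral_poisson// mulrC.
rewrite E; apply: (cabs_cvg_unique (u := fun j => cintegral leb setT (fun y : measurableTypeR R => k (v - dl j * y) * (poisson 1 y)%:C))).
- under eq_fun do rewrite -poisson_smoothing; apply: L1 => //.
  + move=> j; apply: cmeasurableM => //; apply: cmeasurableC; exact: measurable_wexp.
  + move=> sg; rewrite (_ : (fun j => _) = (fun j => expR (- (j.+1%:R^-1 * `|sg|)) * 0 + `|wexp (dl j) sg - 1| * cabs (fourierR k (- sg)))); last first.
      apply/funext => j; rewrite mulr0 add0r -[X in _ - X]mul1r -mulrBl cabsM cabsM cabs_expi mulr1.
      by rewrite -[1]/((1 : R)%:C) -rmorphB cabsC.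
    rewrite -[X in _ --> X](addr0 0); apply: cvgD; first by under eq_fun do rewrite mulr0; exact: cvg_cst.
    rewrite -(mul0r (cabs (fourierR k (- sg)))); apply: cvgM; last exact: cvg_cst.
    have : (fun j => wexp (dl j) sg - 1) @ \oo --> (1 - 1 : R).
      apply: cvgB; last exact: cvg_cst.
      rewrite /wexp -(expR0 R); apply: continuous_cvg; first exact: continuous_expR.
      by under eq_fun do rewrite mulNr; rewrite -oppr0; apply: cvgN; exact: harmonic_cvg0.
    by rewrite subrr => /cvg_norm; rewrite normr0.
  + exact: cintegrable_abs.
  + move=> j sg; rewrite !cabsM cabs_expi mulr1 cabsC ler_piMl ?cabs_ge0// ger0_norm ?wexp_ge0//.
    by rewrite -expR0 ler_expR mulNr oppr_le0 mulr_ge0// ltW.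
- apply: L2 => //.
  + move=> j; apply: cmeasurableM; last exact: ip.1.
    apply: (cmeasurable_comp (h := fun y : measurableTypeR R => v - dl j * y : measurableTypeR R)) => //.
    by apply: measurable_funB => //; exact: measurable_funM.
  + by apply: cmeasurableM; [exact: cmeasurable_cst|exact: ip.1].
  + move=> y; under eq_fun do rewrite -mulrBl cabsM.
    by rewrite -(mul0r (cabs (poisson 1 y)%:C)); apply: cvgM; [exact: kv|exact: cvg_cst].
  + by under eq_fun do rewrite EFinM; apply: integrableZl => //; exact: integrable_poisson.
  + by move=> j y; rewrite cabsM cabsC ger0_norm ?poisson_ge0// ler_wpM2r// poisson_ge0.
Qed.

End fourier_inversion.

(** * Inversion for damped powers *)

Section damped_power.
Context {R : realType}.
Local Notation leb := (@lebesgue_measure R).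
Implicit Types (al : R[i]) (e s sg v : R).

Definition damped_pow al e s : R[i] := pospow s (al - 1) * (expR (- (e * s)))%:C.

Lemma cabs_damped_pow al e s : cabs (damped_pow al e s) = gamma_weight (complex.Re al) e s.
Proof. by rewrite cabsM cabs_pospow ReD ReN cabsC ger0_norm ?expR_ge0. Qed.

Lemma cmeasurable_damped_pow d (T : measurableType d) (u : T -> R) al e : measurable_fun setT u ->
  cmeasurable (fun x => damped_pow al e (u x)).
Proof.
move=> mu; apply: cmeasurableM; first exact: cmeasurable_pospow.
apply: cmeasurableC; apply: (measurableT_comp (@measurable_expR R)); apply: measurableT_comp => //.
exact: measurable_funM.
Qed.

Lemma cintegrable_damped_pow al e : 0 < complex.Re al -> 0 < e -> cintegrable leb (damped_pow al e).
Proof.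
move=> a0 e0; apply: (@cintegrable_le _ (measurableTypeR R) R leb _ (gamma_weight (complex.Re al) e)).
- by apply: (@cmeasurable_damped_pow _ (measurableTypeR R)); exact: measurable_id.
- exact: integrable_gamma_weight.
- by move=> s; rewrite cabs_damped_pow.
Qed.

Lemma damped_pow_bounded al e : 1 < complex.Re al -> 0 < e -> exists M, forall s, cabs (damped_pow al e s) <= M.
Proof.
move=> a1 e0; have c0 : 0 < complex.Re al - 1 by rewrite subr_gt0.
exists (expR (- ((complex.Re al - 1) * ln (e / (complex.Re al - 1))))) => s.
rewrite cabs_damped_pow /gamma_weight; case: (ltP 0 s) => s0; last by rewrite !mul0r expR_ge0.
by rewrite mul1r; exact: powR_expR_le.
Qed.

Lemma fourier_damped_pow al e sg : 0 < complex.Re al -> 0 < e ->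
  fourierR (damped_pow al e) (- sg) = Gamma al * cexp (- al * clog e sg).
Proof.
move=> a0 e0; rewrite -laplace_pow_line//; apply: eq_cintegral => s.
rewrite /damped_pow -mulrA; congr (_ * _); rewrite /cexp.
by congr ((expR _)%:C * expi _); rewrite ?ReN ?ImN ?ReM ?ImM /=; ring.
Qed.

Lemma cvg_abs_sub (a : nat -> R) (l : R) : a @ \oo --> l -> (fun j => `|a j - l|) @ \oo --> 0.
Proof.
move=> al; have h : (fun j => a j - l) @ \oo --> (0 : R) by rewrite -(subrr l); apply: cvgB => //; exact: cvg_cst.
by rewrite -[X in _ --> X](normr0 R); exact: cvg_norm h.
Qed.

Lemma rdiff_cvg (P : R -> R[i]) v d (u : nat -> R) : rdiff P v d -> u @ \oo --> v ->
  (fun j => cabs (P (u j) - P v)) @ \oo --> 0.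
Proof.
move=> /rdiff_continuous[c1 c2] uv.
have h1 : (fun j => complex.Re (P (u j)) : R) @ \oo --> (complex.Re (P v) : R) by exact: (continuous_cvg _ c1 uv).
have h2 : (fun j => complex.Im (P (u j)) : R) @ \oo --> (complex.Im (P v) : R) by exact: (continuous_cvg _ c2 uv).
apply: (@squeeze_cvgr _ _ _ _ (fun=> 0) (fun j => `|complex.Re (P (u j)) - complex.Re (P v)| + `|complex.Im (P (u j)) - complex.Im (P v)|)).
- by near=> j; rewrite cabs_ge0/= -!ReN -ReD -!ImN -ImD cabs_ReIm.
- exact: cvg_cst.
- rewrite -(addr0 0); apply: cvgD.
  + exact: cvg_abs_sub h1.
  + exact: cvg_abs_sub h2.
Unshelve. all: by end_near. Qed.

(** Continuity at [v]: differentiability for [v > 0] and local vanishing for [v < 0]. At [v = 0] the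
    bound by [|u j| ^ (Re al - 1)] tends to [0], which is where [Re al > 1] enters. *)
Lemma damped_pow_cvg al e v (u : nat -> R) : 1 < complex.Re al -> 0 < e -> u @ \oo --> v ->
  (fun j => cabs (damped_pow al e (u j) - damped_pow al e v)) @ \oo --> 0.
Proof.
move=> a1 e0 uv.
have z0 s : s <= 0 -> damped_pow al e s = 0 by move=> s0; rewrite /damped_pow /pospow (le_gtF s0) mul0r.
have [v0|v0|v0] := ltrgt0P v.
- pose P s : R[i] := cexp ((al - 1) * (ln s)%:C) * (expR (- (e * s)))%:C.
  have PE s : 0 < s -> damped_pow al e s = P s by move=> s0; rewrite /damped_pow pospowE.
  have D1 := rdiff_cexp (rdiffZ (al - 1) (rdiffC (is_derive1_ln v0))).
  have dn : is_derive v (1 : R) (fun x => - (e * x)) (- e).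
    by apply: is_derive_eq; rewrite /GRing.scale/=; ring.
  have D2 := rdiffC (is_derive1_comp (g := fun x : R => - (e * x)) (is_derive_expR _) dn).
  have L := rdiff_cvg (rdiffM D1 D2) uv; apply: cvg_trans L; apply: near_eq_cvg.
  have up : \forall j \near \oo, 0 < u j by exact: (cvgr_gt _ uv).
  by apply: filterS up => j uj; rewrite !PE.
- have up : \forall j \near \oo, u j < 0 by exact: (cvgr_lt _ uv).
  apply: cvg_near_cst; apply: filterS up => j uj.
  by rewrite !z0 ?subrr ?cabs0// ltW.
- rewrite v0 (z0 0)//.
  have L : (fun j => `|u j| `^ (complex.Re al - 1)) @ \oo --> (0 : R).
    rewrite -(powR0 (x := complex.Re al - 1)) ?gt_eqF ?subr_gt0//; apply: powR_cvg; rewrite ?subr_gt0//.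
    by rewrite -[X in _ --> X](normr0 R) -v0; exact: cvg_norm.
  apply: squeeze_cvgr (cvg_cst 0) L; near=> j; rewrite cabs_ge0/= subr0 cabs_damped_pow /gamma_weight.
  case: (ltP 0 (u j)) => uj; last by rewrite !mul0r powR_ge0.
  rewrite mul1r ger0_norm ?(ltW uj)// ler_piMr ?powR_ge0// -expR0 ler_expR oppr_le0.
  by rewrite mulr_ge0 ?ltW.
Unshelve. all: by end_near. Qed.

Lemma cabs_cexp_clog al e sg : 0 < e ->
  cabs (cexp (- al * clog e sg)) <= expR (`|complex.Im al| * pi) * expR (- (complex.Re al * (ln (e ^+ 2 + sg ^+ 2) / 2))).
Proof.
move=> e0; rewrite cabs_cexp -expRD ler_expR mulNr ReN ReM /= opprB lerD2r.
apply: le_trans (ler_norm _) _; rewrite normrM ler_wpM2l// ler_norml.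
have := atan_gtNpi2 (sg / e); have := atan_ltpi2 (sg / e); have := pi_gt0 R => h1 h2 h3.
by apply/andP; split; lra.
Qed.

Lemma cmeasurable_clog d (T : measurableType d) (u : T -> R) e : 0 < e -> measurable_fun setT u ->
  cmeasurable (fun x => clog e (u x)).
Proof.
move=> e0 mu; split => /=.
  apply: measurable_funM => //; apply: (measurableT_comp (@measurable_ln R)).
  by apply: measurable_funD => //; exact: measurable_funX.
apply: (measurableT_comp (f := @atan R)); last exact: measurable_funM.
by apply: continuous_measurable_fun => x; exact: continuous_atan.
Qed.

Lemma cintegrable_cexp_clog al e : 2 < complex.Re al -> 0 < e ->
  cintegrable leb (fun sg : measurableTypeR R => cexp (- al * clog e sg)).
Proof.
(* For [Re al > 2] the modulus [(e ^ 2 + s ^ 2) ^ (- Re al / 2)] is at most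
   [e ^ (2 - Re al) / (e ^ 2 + s ^ 2)], a multiple of the Poisson kernel; the first factor bounds
   the contribution of the argument. *)
move=> a2 e0; pose K := expR (`|complex.Im al| * pi) * (expR (- (complex.Re al - 2) * ln e) * (2 * e)^-1).
apply: (@cintegrable_le _ (measurableTypeR R) R leb _ (fun s => K * poisson e s)).
- apply: cmeasurable_cexp; apply: cmeasurableM; first exact: cmeasurable_cst.
  by apply: cmeasurable_clog => //; exact: measurable_id.
- by under eq_fun do rewrite EFinM; apply: integrableZl => //; exact: integrable_poisson.
move=> s; apply: le_trans (cabs_cexp_clog _ _ e0) _; rewrite /K -mulrA ler_wpM2l ?expR_ge0//.
have es : 0 < e ^+ 2 + s ^+ 2 by rewrite ltr_wpDr ?sqr_ge0// exprn_gt0.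
have -> : expR (- (complex.Re al - 2) * ln e) * (2 * e)^-1 * poisson e s =
    expR (- (complex.Re al - 2) * ln e) * expR (- ln (e ^+ 2 + s ^+ 2)).
  by rewrite expRN lnK ?posrE// /poisson; field; rewrite !gt_eqF.
rewrite -expRD ler_expR.
have : ln e * 2 <= ln (e ^+ 2 + s ^+ 2).
  by rewrite mulr_natr -lnXn// ler_ln ?posrE ?exprn_gt0// lerDl sqr_ge0.
have a20 : 0 <= complex.Re al - 2 by rewrite subr_ge0 ltW.
move=> /(ler_wpM2l a20); set l := ln (_ + _); set le := ln e; move: (complex.Re al) => c h; lra.
Qed.

Lemma damped_pow_inversion al e v : 2 < complex.Re al -> 0 < e ->
  cintegral leb setT (fun sg : measurableTypeR R => Gamma al * cexp (- al * clog e sg) * expi (sg * v)) =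
  (2 * pi)%:C * damped_pow al e v.
Proof.
move=> a2 e0; have a1 : 1 < complex.Re al by lra.
have a0 : 0 < complex.Re al by lra.
have [M kM] := damped_pow_bounded a1 e0.
rewrite -(fourier_inversion (cintegrable_damped_pow a0 e0) kM).
- by apply: eq_cintegral => sg; rewrite fourier_damped_pow.
- move=> y; apply: damped_pow_cvg => //; rewrite -[X in _ --> X]subr0.
  by apply: cvgB; [exact: cvg_cst|exact: harmonic_cvg0].
- under eq_fun do rewrite fourier_damped_pow//.
  by apply: cintegrableZ; exact: cintegrable_cexp_clog.
Qed.

(** A zero at [al] would give one at [al + 2], where the inversion formula holds and would make the
    damped power vanish identically; but it is positive at [1]. *)
Lemma Gamma_neq0 al : 0 < complex.Re al -> Gamma al != 0.
Proof.
move=> a0; have Re1 (z : R[i]) : complex.Re (z + 1) = complex.Re z + 1 by rewrite ReD.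
apply/eqP => G0.
have G2 : Gamma (al + 1 + 1) = 0.
  by rewrite !Gamma_succ ?G0 ?mulr0// Re1 ltr_wpDr.
have a2 : 2 < complex.Re (al + 1 + 1) by rewrite !Re1; lra.
have := damped_pow_inversion 1 a2 (@ltr01 R); rewrite G2.
under eq_cintegral do rewrite !mul0r.
rewrite cintegral0 => /esym/eqP; rewrite mulf_eq0 => /orP[/eqP[]|/eqP E].
  by have := pi_gt0 R; lra.
have := cabs_damped_pow (al + 1 + 1) 1 1; rewrite E cabs0 /gamma_weight ltr01 powR1 !mul1r => /esym/eqP.
by rewrite gt_eqF// expR_gt0.
Qed.

End damped_power.

(** * Schwartz functions and their Fourier transform *)

Section continuous_measurable_Rn.
Context {R : realType} (n : nat).

Definition grid (j : nat) (z : 'rV[int]_n) : Rn R n := \row_i ((z ord0 i)%:~R / j.+1%:R).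

Definition grid_index (j : nat) (x : Rn R n) : 'rV[int]_n := \row_i Num.floor (j.+1%:R * x ord0 i).

Lemma measurable_grid_index j z : measurable [set x : Rn R n | grid_index j x = z].
Proof.
have -> : [set x : Rn R n | grid_index j x = z] =
    \bigcap_(i in [set: 'I_n]) [set x : Rn R n | Num.floor (j.+1%:R * coord i x) = z ord0 i].
  apply/seteqP; split => x /=.
  - by move=> <- i _ /=; rewrite mxE.
  - by move=> h; apply/rowP => i; rewrite mxE; exact: (h i I).
apply: fin_bigcap_measurable => // i _.
have -> : [set x : Rn R n | Num.floor (j.+1%:R * coord i x) = z ord0 i] =
    (fun x => j.+1%:R * coord i x) @^-1` `[(z ord0 i)%:~R, (z ord0 i + 1)%:~R[%classic.
  by apply/seteqP; split => x /=; rewrite in_itv/= -floor_eq => /eqP.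
rewrite -[X in measurable X]setTI; apply: measurable_funM => //; exact: measurable_coord.
Qed.

Lemma measurable_grid (g : Rn R n -> R) j : measurable_fun setT (fun x => g (grid j (grid_index j x))).
Proof.
move=> _ Y mY; rewrite setTI.
have -> : (fun x => g (grid j (grid_index j x))) @^-1` Y =
    \bigcup_z ([set x : Rn R n | grid_index j x = z] `&` [set x | Y (g (grid j z))]).
  apply/seteqP; split => x /=; first by move=> h; exists (grid_index j x).
  by move=> [z _ /= [-> //]].
apply: countable_bigcupT_measurable; first exact: countableP.
move=> z; apply: measurableI; first exact: measurable_grid_index.
have [h|h] := pselect (Y (g (grid j z))).
  by rewrite (_ : [set _ | _] = setT) //; apply/seteqP; split.
by rewrite (_ : [set _ | _] = set0) //; apply/seteqP; split.
Qed.

Lemma grid_cvg (x : Rn R n) : (fun j => grid j (grid_index j x)) @ \oo --> x.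
Proof.
apply/cvgrPdist_le => e e0; near=> j.
rewrite /Num.norm/= mx_normrE; apply: bigmax_le => [|[i0 i] _ /=]; first exact: ltW.
rewrite !mxE (ord1 i0).
have j0 : 0 < j.+1%:R :> R by [].
have -> : x ord0 i - (Num.floor (j.+1%:R * x ord0 i))%:~R / j.+1%:R =
    j.+1%:R^-1 * (j.+1%:R * x ord0 i - (Num.floor (j.+1%:R * x ord0 i))%:~R) by field; rewrite gt_eqF.
have /andP[h1 h2] := floor_itv (j.+1%:R * x ord0 i).
rewrite normrM gtr0_norm ?invr_gt0// ger0_norm ?subr_ge0//.
apply: (@le_trans _ _ (j.+1%:R^-1 * 1)).
  by rewrite ler_wpM2l ?invr_ge0// lerBlDl -intrD1 ltW.
rewrite mulr1; near: j.
have := @cvg_harmonic R; move/cvgrPdist_le => /(_ e e0).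
by apply: filterS => k; rewrite sub0r normrN /harmonic ger0_norm// invr_ge0.
Unshelve. all: by end_near. Qed.

(* The sigma-algebra of [Rn] is generated by the coordinates, so continuity is used through rounding to grids. *)
Lemma continuous_measurable_Rn (g : Rn R n -> R) : continuous g -> measurable_fun setT g.
Proof.
move=> cg; apply: (measurable_fun_cvg (h := fun j x => g (grid j (grid_index j x)))).
- by move=> j; exact: measurable_grid.
- by move=> x _; apply: continuous_cvg; [exact: cg|exact: grid_cvg].
Qed.

End continuous_measurable_Rn.

Section peak.
Context {R : realType}.
Local Notation leb := (@lebesgue_measure R).

(** A common integrable majorant, up to constants, for Schwartz functions; as a product its integral
    reduces to the one-dimensional Poisson integral. *)
Definition peak n (x : Rn R n) : R := \prod_i poisson 1 (x ord0 i).

Lemma peak_ge0 n (x : Rn R n) : 0 <= peak x.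
Proof. by apply: prodr_ge0 => i _; exact: poisson_ge0. Qed.

Lemma measurable_peak n : measurable_fun setT (@peak n).
Proof.
apply: measurable_prod => i _; apply: (measurableT_comp (f := poisson 1)); last exact: measurable_coord.
by apply: continuous_measurable_fun; exact: continuous_poisson.
Qed.

Lemma peak_cons n (x : Rn R n) (s : R) : peak (Rn_cons (x, s)) = poisson 1 s * peak x.
Proof.
rewrite /peak big_ord_recl /Rn_cons mxE unlift_none; congr (_ * _).
by apply: eq_bigr => i _; rewrite mxE liftK.
Qed.

Lemma dot_cons n (x : Rn R n) (s : R) (xi : Rn R n.+1) :
  dot (Rn_cons (x, s)) xi = s * xi ord0 ord0 + dot x (Rn_uncons xi).1.
Proof.
rewrite /dot big_ord_recl /Rn_cons mxE unlift_none; congr (_ + _).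
by apply: eq_bigr => i _; rewrite !mxE liftK.
Qed.

Lemma integral_peak n : (\int[lebRn n]_x (peak x)%:E = ((2 * pi) ^+ n)%:E)%E.
Proof.
elim: n => [|n IH].
  rewrite (_ : (fun x => _) = cst (1%:E : \bar R)); last by apply/funext => x; rewrite /peak big_ord0.
  by transitivity (@lebRn R 0 setT); [rewrite integral_cst// mul1e|rewrite expr0; exact: diracT].
rewrite ge0_integral_RnS; last 2 first.
- by apply/measurable_EFinP; exact: measurable_peak.
- by move=> x; rewrite lee_fin peak_ge0.
have inner (x : Rn R n) : (\int[leb]_t (peak (Rn_cons (x, t)))%:E = (2 * pi)%:E * (peak x)%:E)%E.
  under eq_integralT do rewrite peak_cons mulrC EFinM.
  rewrite ge0_integralZlT ?integral_poisson// 1?muleC//.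
  - by apply/measurable_EFinP; apply: continuous_measurable_fun; exact: continuous_poisson.
  - by move=> s; rewrite lee_fin poisson_ge0.
  - exact: peak_ge0.
under eq_integralT do rewrite inner.
rewrite ge0_integralZlT ?IH -?EFinM ?exprS//.
- by apply/measurable_EFinP; exact: measurable_peak.
- by move=> s; rewrite lee_fin peak_ge0.
- by rewrite mulr_ge0// pi_ge0.
Qed.

Lemma integrable_peak n : (lebRn n).-integrable setT (fun x => (peak x)%:E).
Proof.
apply/integrableP; split; first by apply/measurable_EFinP; exact: measurable_peak.
under eq_integralT do rewrite gee0_abs ?lee_fin ?peak_ge0//.
by rewrite integral_peak ltry.
Qed.

Lemma poisson_le2 (s : R) : poisson 1 s <= 2.
Proof.
have s2 := sqr_ge0 s.
by rewrite /poisson ler_pdivrMr; [lra|rewrite expr1n ltr_pwDl].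
Qed.

(* One direction with [xi i != 0] is integrated against Lebesgue measure, the others against the peak. *)
Lemma ridge_le n (xi : Rn R n) : xi != 0 -> exists2 C : R, 0 <= C & forall (g : R -> R) u,
  measurable_fun [set: R] g -> (forall s, 0 <= g s) ->
  (\int[lebRn n]_x (peak x * g (u - dot x xi))%:E <= C%:E * \int[leb]_s (g s)%:E)%E.
Proof.
elim: n xi => [xi|n IH xi xi0]; first by rewrite thinmx0 eqxx.
have mint m (g : R -> R) (u : R) (eta : Rn R m) : measurable_fun [set: R] g ->
    measurable_fun setT (fun x : Rn R m => (peak x * g (u - dot x eta))%:E).
  move=> mg; apply/measurable_EFinP; apply: measurable_funM; first exact: measurable_peak.
  apply: (measurableT_comp (f := g)) => //; apply: measurable_funB => //.
  exact: (measurable_dot (u := fun x => x) (v := fun=> eta)).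
have gint0 m (g : R -> R) (u : R) (eta x : Rn R m) : (forall s, 0 <= g s) ->
    (0 <= (peak x * g (u - dot x eta))%:E)%E.
  by move=> g0; rewrite lee_fin mulr_ge0// peak_ge0.
have [e0|e0] := eqVneq (xi ord0 ord0) 0.
(* The first coordinate of [xi] is [0], so the ridge does not depend on that variable, which is
   integrated out before induction. *)
- have eta0 : (Rn_uncons xi).1 != 0.
    apply: contra_neq xi0 => E; apply/rowP => i; rewrite mxE.
    case: (unliftP ord0 i) => [j ->|-> //].
    by have := congr1 (fun v : Rn R n => v ord0 j) E; rewrite /= !mxE.
  have [C C0 HC] := IH _ eta0; exists (2 * pi * C); first by rewrite !mulr_ge0// pi_ge0.
  move=> g u mg g0; rewrite ge0_integral_RnS2; [|exact: mint|by move=> x; exact: gint0].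
  set I := (\int[leb]_s (g s)%:E)%E.
  have I0 : (0 <= C%:E * I)%E by rewrite mule_ge0// integral_ge0// => s _; rewrite lee_fin.
  apply: (@le_trans _ _ (\int[leb]_t ((poisson 1 t)%:E * (C%:E * I)))%E); last first.
    rewrite ge0_integralZr//; last 2 first.
    - by apply/measurable_EFinP; apply: continuous_measurable_fun; exact: continuous_poisson.
    - by move=> s _; rewrite lee_fin poisson_ge0.
    by rewrite integral_poisson// muleA EFinM.
  apply: ge0_le_integralT.
  - apply: (measurable_integral_snd (lebRn n) (f := fun t x => (peak (Rn_cons (x, t)) * g (u - dot (Rn_cons (x, t)) xi))%:E)).
      apply: (measurableT_comp (mint n.+1 g u xi mg)); apply: (measurableT_comp (@measurable_Rn_cons R n)).
      exact: measurable_fun_pair.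
    by move=> t x; exact: gint0.
  - apply: emeasurable_funM => //.
    by apply/measurable_EFinP; apply: continuous_measurable_fun; exact: continuous_poisson.
  - by move=> t; apply: integral_ge0 => x _; exact: gint0.
  move=> t; under eq_integralT => x do rewrite peak_cons dot_cons e0 mulr0 add0r -mulrA EFinM.
  rewrite ge0_integralZlT ?poisson_ge0//; [|exact: mint|by move=> x; exact: gint0].
  by apply: lee_wpmul2l; [rewrite lee_fin poisson_ge0|exact: HC].
(* The Poisson factor in the first variable is bounded by [2], and the ridge variable becomes an
   affine function of it with slope [- xi ord0 ord0]. *)
- pose K := 2 * `|xi ord0 ord0|^-1; have K0 : 0 <= K by rewrite mulr_ge0 ?invr_ge0.
  exists ((2 * pi) ^+ n * K); first by rewrite mulr_ge0// exprn_ge0// mulr_ge0// pi_ge0.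
  move=> g u mg g0; rewrite ge0_integral_RnS; [|exact: mint|by move=> x; exact: gint0].
  set I := (\int[leb]_s (g s)%:E)%E.
  have I0 : (0 <= K%:E * I)%E by rewrite mule_ge0// integral_ge0// => s _; rewrite lee_fin.
  apply: (@le_trans _ _ (\int[lebRn n]_x ((peak x)%:E * (K%:E * I)))%E); last first.
    rewrite ge0_integralZr//; last 2 first.
    - by apply/measurable_EFinP; exact: measurable_peak.
    - by move=> s _; rewrite lee_fin peak_ge0.
    by rewrite integral_peak muleA EFinM.
  apply: ge0_le_integralT.
  - apply: (measurable_integral_snd leb (f := fun x t => (peak (Rn_cons (x, t)) * g (u - dot (Rn_cons (x, t)) xi))%:E)).
      apply: (measurableT_comp (mint n.+1 g u xi mg)); exact: measurable_Rn_cons.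
    by move=> t x; exact: gint0.
  - apply: emeasurable_funM => //.
    by apply/measurable_EFinP; exact: measurable_peak.
  - by move=> x; apply: integral_ge0 => t _; exact: gint0.
  move=> x; have nx : - xi ord0 ord0 != 0 by rewrite oppr_eq0.
  pose b := u - dot x (Rn_uncons xi).1.
  have mE : measurable_fun [set: R] (fun s => (g s)%:E) by exact/measurable_EFinP.
  have := ge0_integral_affineN b nx mE (fun s => ltac:(by rewrite lee_fin)); rewrite normrN -/I => A.
  rewrite /K EFinM -(muleA 2%:E) -A muleA -EFinM -ge0_integralZlT; last 3 first.
  - by apply: (measurableT_comp mE); exact: measurable_affine.
  - by move=> s; rewrite lee_fin.
  - by rewrite mulr_ge0// peak_ge0.
  apply: ge0_le_integralT.
  - apply/measurable_EFinP; apply: measurable_funM.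
      apply: (measurableT_comp (@measurable_peak n.+1)); apply: (measurableT_comp (@measurable_Rn_cons R n)).
      exact: measurable_fun_pair.
    apply: (measurableT_comp mg); apply: measurable_funB => //.
    under eq_fun do rewrite dot_cons; apply: measurable_funD => //; exact: measurable_funM.
  - by apply: measurable_funeM; apply: (measurableT_comp mE); exact: measurable_affine.
  - by move=> t; exact: gint0.
  move=> t; rewrite -EFinM lee_fin peak_cons dot_cons.
  have -> : u - (t * xi ord0 ord0 + dot x (Rn_uncons xi).1) = - xi ord0 ord0 * t + b by rewrite /b; ring.
  apply: ler_wpM2r; first exact: g0.
  by rewrite mulrC ler_wpM2l ?peak_ge0// poisson_le2.
Qed.

(** Each factor [2 / (1 + x_i ^ 2)] is at least [(1 + |x|) ^ (- 2)]; so [2 * n] extra powers of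
    Schwartz decay suffice for domination by the peak. *)
Lemma peak_enorm n (x : Rn R n) : (1 + enorm x) ^- (2 * n) <= peak x.
Proof.
have e0 : 0 <= enorm x by exact: enorm_ge0.
have p : 0 < 1 + enorm x by rewrite ltr_pwDl.
have -> : (1 + enorm x) ^- (2 * n) = \prod_(i < n) (1 + enorm x) ^- 2.
  by rewrite prodr_const card_ord exprM exprVn.
apply: ler_prod => i _; rewrite invr_ge0 exprn_ge0 ?(ltW p)//= /poisson mulr1 expr1n.
have xi := normr_coord_enorm x i.
have q : 0 < 1 + x ord0 i ^+ 2 by rewrite ltr_pwDl// sqr_ge0.
rewrite ler_pdivlMr// ler_pdivrMl ?exprn_gt0//.
have : x ord0 i ^+ 2 <= enorm x ^+ 2 by rewrite -real_normK ?num_real// lerXn2r ?nnegrE.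
have := sqr_ge0 (enorm x); rewrite sqrrD expr1n mul1r; move: e0.
by set E := enorm x ^+ 2; set X := x ord0 i ^+ 2; rewrite mulr2n => *; lra.
Qed.

End peak.

Section schwartz_decay.
Context {R : realType} (n : nat).
Implicit Types f : Rn R n -> R[i].

Lemma schwartz_peak f K : schwartz f -> exists2 C : R, 0 <= C & forall x, cabs (f x) * (1 + enorm x) ^+ K <= C * peak x.
Proof.
move=> [_ _ /(_ [::] (K + 2 * n)%N)[C1 h1] /(_ [::] (K + 2 * n)%N)[C2 h2]].
have CC : 0 <= C1 + C2.
  apply: (@le_trans _ _ ((1 + enorm 0) ^+ (K + 2 * n) * `|partials [::] (fun x => complex.Re (f x)) 0| +
    (1 + enorm 0) ^+ (K + 2 * n) * `|partials [::] (fun x => complex.Im (f x)) 0|)).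
    by rewrite addr_ge0// mulr_ge0// exprn_ge0// addr_ge0// enorm_ge0.
  exact: lerD.
exists (C1 + C2) => // x; have e0 : 0 <= enorm x by exact: enorm_ge0.
have p : 0 < 1 + enorm x by rewrite ltr_pwDl.
apply: (@le_trans _ _ ((C1 + C2) * (1 + enorm x) ^- (2 * n))); last by rewrite ler_wpM2l// peak_enorm.
rewrite ler_pdivlMr ?exprn_gt0// -mulrA -exprD.
apply: le_trans (ler_wpM2r _ (cabs_ReIm _)) _; first by rewrite exprn_ge0// ltW.
by rewrite mulrDl mulrC [X in _ + X]mulrC; exact: lerD (h1 x) (h2 x).
Qed.

Lemma cmeasurable_schwartz f : schwartz f -> cmeasurable f.
Proof.
move=> [s1 s2 _ _]; split; apply: continuous_measurable_Rn.
- exact: (s1 [::]).1.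
- exact: (s2 [::]).1.
Qed.

Lemma schwartz_le_peak f : schwartz f -> exists2 C : R, 0 <= C & forall x, cabs (f x) <= C * peak x.
Proof. by move=> /(schwartz_peak 0)[C C0 h]; exists C => // x; rewrite -[cabs _]mulr1 -(expr0 (1 + enorm x)). Qed.

Lemma cintegrable_schwartz f : schwartz f -> cintegrable (lebRn n) f.
Proof.
move=> sf; have [C C0 h] := schwartz_le_peak sf.
apply: (@cintegrable_le _ _ _ (lebRn n) _ (fun x => C * peak x)) => //; first exact: cmeasurable_schwartz.
by under eq_fun do rewrite EFinM; apply: integrableZl => //; exact: integrable_peak.
Qed.

Lemma schwartz_bounded f : schwartz f -> exists2 C : R, 0 <= C & forall x, cabs (f x) <= C.
Proof.
move=> sf; have [C C0 h] := schwartz_le_peak sf; exists (C * 2 ^+ n); first by rewrite mulr_ge0 ?exprn_ge0.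
move=> x; apply: le_trans (h x) _; rewrite ler_wpM2l// /peak.
rewrite -[leRHS](_ : \prod_(i < n) (2 : R) = _); last by rewrite prodr_const card_ord.
by apply: ler_prod => i _; rewrite poisson_ge0//= poisson_le2.
Qed.

Lemma schwartz_powR f (p : R) : 1 <= p -> schwartz f -> (\int[lebRn n]_x (cabs (f x) `^ p)%:E < +oo)%E.
Proof.
move=> p1 sf; have [C C0 h] := schwartz_bounded sf; have [mf fi] := cintegrable_schwartz sf.
have p0 : 0 <= p - 1 by rewrite subr_ge0.
apply: (@le_lt_trans _ _ (\int[lebRn n]_x ((C `^ (p - 1))%:E * (cabs (f x))%:E))%E).
  apply: ge0_le_integralT.
  - by apply/measurable_EFinP; exact: measurable_cabs_powR.
  - by apply: measurable_funeM; exact: measurable_ecabs.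
  - by move=> x; rewrite lee_fin powR_ge0.
  move=> x; rewrite -EFinM lee_fin.
  have [->|n0] := eqVneq (cabs (f x)) 0; first by rewrite mulr0 powR0// gt_eqF// (lt_le_trans ltr01).
  have -> : p = (p - 1) + 1 by ring.
  rewrite powRD ?n0 ?implybT// powRr1 ?cabs_ge0// addrK ler_wpM2r ?cabs_ge0//.
  by apply: ge0_ler_powR; rewrite ?nnegrE ?cabs_ge0.
rewrite ge0_integralZlT ?powR_ge0//.
- by rewrite lte_mul_pinfty// lee_fin powR_ge0.
- exact: measurable_ecabs.
- by move=> x; rewrite lee_fin cabs_ge0.
Qed.

End schwartz_decay.

Section translation.
Context {R : realType} (n : nat).

Lemma lebRn_translate (v : Rn R n) (A : set (Rn R n)) : measurable A ->
  lebRn n A = lebRn n ((fun x : Rn R n => x + v : Rn R n) @^-1` A).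
Proof.
move=> mA; have mv := measurable_RnD v.
have mA' : measurable ((fun x : Rn R n => x + v : Rn R n) @^-1` A).
  by rewrite -[X in measurable X]setTI; exact: mv.
transitivity (\int[lebRn n]_x (\1_A x)%:E)%E; first by rewrite integral_indic// setIT.
rewrite -(ge0_integral_RnD v (g := fun x => (\1_A x)%:E)).
- transitivity (\int[lebRn n]_x (\1_((fun x : Rn R n => x + v : Rn R n) @^-1` A) x)%:E)%E; last by rewrite integral_indic// setIT.
  by apply: eq_integral.
- by apply/measurable_EFinP; exact: measurable_indic.
- by move=> x; rewrite lee_fin.
Qed.

Lemma cintegral_translate (v : Rn R n) (g : Rn R n -> R[i]) : cintegrable (lebRn n) (fun x => g (x + v)) ->
  cmeasurable g -> cintegral (lebRn n) setT (fun x => g (x + v)) = cintegral (lebRn n) setT g.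
Proof.
move=> ig mg; have [_ ->//] := cintegrable_push (mu := lebRn n) (nu := lebRn n) (measurable_RnD v) (lebRn_translate v) mg ig.
Qed.

Lemma cintegrable_translate (v : Rn R n) (g : Rn R n -> R[i]) : cintegrable (lebRn n) g ->
  cintegrable (lebRn n) (fun x => g (x + v)).
Proof.
move=> [mg ig]; split; first exact: cmeasurable_comp (measurable_RnD v) mg.
rewrite (ge0_integral_RnD v (measurable_ecabs mg))// => x; by rewrite lee_fin cabs_ge0.
Qed.

(** From [a ^ 2 <= 2 (a + b) ^ 2 + 2 b ^ 2] and [|b| <= 1] one gets
    [1 + a ^ 2 <= 3 (1 + (a + b) ^ 2)] in each coordinate. It dominates difference quotients with
    steps at most [1]. *)
Lemma peak_translate (v x : Rn R n) : (forall i, `|v ord0 i| <= 1) -> peak (x + v) <= 3 ^+ n * peak x.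
Proof.
move=> v1; rewrite /peak -[in 3 ^+ n](card_ord n) -prodr_const -big_split/=.
apply: ler_prod => i _; rewrite poisson_ge0//= !mxE.
set a := x ord0 i; set b := v ord0 i.
have b1 : b ^+ 2 <= 1 by rewrite -[leLHS]real_normK ?num_real// exprn_ile1// v1.
have sa := sqr_ge0 a; have sab := sqr_ge0 (a + b).
have p1 : 0 < 1 ^+ 2 + (a + b) ^+ 2 :> R by rewrite expr1n ltr_pwDl.
have p2 : 0 < 1 ^+ 2 + a ^+ 2 :> R by rewrite expr1n ltr_pwDl.
have : a ^+ 2 <= 2 * (a + b) ^+ 2 + 2 * b ^+ 2.
  rewrite -subr_ge0 (_ : _ - _ = (a + 2 * b) ^+ 2); first exact: sqr_ge0.
  by ring.
move: p1 p2; rewrite expr1n => p1 p2 h; rewrite -subr_ge0 /poisson expr1n mulr1.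
have -> : 3 * (2 / (1 + a ^+ 2)) - 2 / (1 + (a + b) ^+ 2) =
    2 * (3 * (1 + (a + b) ^+ 2) - (1 + a ^+ 2)) / ((1 + a ^+ 2) * (1 + (a + b) ^+ 2)).
  by field; rewrite (gt_eqF p1) (gt_eqF p2).
by rewrite divr_ge0 ?mulr_ge0 ?(ltW p1) ?(ltW p2)//; lra.
Qed.

End translation.

(** * Decay of the Fourier transform along a ray *)

Section fourier_derivative.
Context {R : realType} (n : nat).
Implicit Types f : Rn R n -> R[i].

Definition cpartial (i : 'I_n) f (x : Rn R n) : R[i] :=
  partial i (fun y => complex.Re (f y)) x +i* partial i (fun y => complex.Im (f y)) x.

Lemma partials_rcons (g : Rn R n -> R) i s : partials s (partial i g) = partials (rcons s i) g.
Proof. by rewrite /partials -cats1 foldr_cat. Qed.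

Lemma schwartz_partial f i : schwartz f -> schwartz (cpartial i f).
Proof.
move=> [s1 s2 r1 r2]; split.
- by move=> s; rewrite (partials_rcons (fun y => complex.Re (f y))); exact: s1.
- by move=> s; rewrite (partials_rcons (fun y => complex.Im (f y))); exact: s2.
- by move=> s k; rewrite (partials_rcons (fun y => complex.Re (f y))); exact: r1.
- by move=> s k; rewrite (partials_rcons (fun y => complex.Im (f y))); exact: r2.
Qed.

Let e_ (i : 'I_n) : Rn R n := delta_mx ord0 i.

Lemma is_derive_direction (g : Rn R n -> R) (x v : Rn R n) (s : R) : derivable g (x + s *: v) v ->
  is_derive s (1 : R) (fun t => g (x + t *: v)) ('D_v g (x + s *: v)).
Proof.
move=> dg.
have E : (fun h : R => h^-1 *: (((fun t => g (x + t *: v)) \o shift s) (h *: (1 : R)) - g (x + s *: v))) =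
    (fun h : R => h^-1 *: ((g \o shift (x + s *: v)) (h *: v) - g (x + s *: v))).
  apply/funext => h /=; congr (_ *: (g _ - _)).
  by rewrite [h *: 1]mulr1 scalerDl addrCA.
split; first by rewrite /derivable E; exact: dg.
by rewrite /derive E.
Qed.

Lemma rdiff_direction f x i s : schwartz f -> rdiff (fun t => f (x + t *: e_ i)) s (cpartial i f (x + s *: e_ i)).
Proof.
move=> [s1 s2 _ _]; split.
- exact: (@is_derive_direction (fun y => complex.Re (f y)) x (e_ i) s ((s1 [::]).2 i _)).
- exact: (@is_derive_direction (fun y => complex.Im (f y)) x (e_ i) s ((s2 [::]).2 i _)).
Qed.

Lemma rdiff_quotient (P : R -> R[i]) (d : R[i]) : rdiff P 0 d ->
  (fun j : nat => cabs (j.+1%:R%:C * (P j.+1%:R^-1 - P 0) - d)) @ \oo --> 0.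
Proof.
move=> [D1 D2].
have real_quotient (g : R -> R) (c : R) : is_derive (0 : R) (1 : R) g c ->
    (fun j : nat => `|j.+1%:R * (g j.+1%:R^-1 - g 0) - c|) @ \oo --> 0.
  move=> D; apply/cvgrPdist_le => e e0; have [r r0 hr] := is_derive_epsP D e0.
  near=> j; rewrite sub0r normrN normr_id.
  have j0 : 0 < j.+1%:R :> R by [].
  have := hr j.+1%:R^-1; rewrite add0r (gtr0_norm (x := j.+1%:R^-1)) ?invr_gt0//.
  have jr : j.+1%:R^-1 < r.
    near: j; have := @cvg_harmonic R; move/cvgrPdist_lt => /(_ r r0).
    by apply: filterS => k; rewrite sub0r normrN /harmonic ger0_norm// invr_ge0.
  move=> /(_ jr) H.
  have -> : j.+1%:R * (g j.+1%:R^-1 - g 0) - c = j.+1%:R * (g j.+1%:R^-1 - g 0 - j.+1%:R^-1 * c).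
    by field; rewrite gt_eqF.
  by rewrite normrM (gtr0_norm j0) -ler_pdivlMl// [leRHS]mulrC.
have h : (fun j : nat => `|j.+1%:R * (complex.Re (P j.+1%:R^-1) - complex.Re (P 0)) - complex.Re d| +
    `|j.+1%:R * (complex.Im (P j.+1%:R^-1) - complex.Im (P 0)) - complex.Im d|) @ \oo --> (0 : R).
  by rewrite -[X in _ --> X](addr0 0); exact: (cvgD (real_quotient _ _ D1) (real_quotient _ _ D2)).
apply: squeeze_cvgr (cvg_cst 0) h; near=> j; rewrite cabs_ge0/=.
apply: le_trans (cabs_ReIm _) _.
have RC (r : R) (w : R[i]) : complex.Re (r%:C * w) = r * complex.Re w by rewrite ReM /= mul0r subr0.
have IC (r : R) (w : R[i]) : complex.Im (r%:C * w) = r * complex.Im w by rewrite ImM /= mul0r addr0.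
by rewrite ReD ImD ReN ImN RC IC ReD ImD ReN ImN.
Unshelve. all: by end_near. Qed.

Lemma cintegrable_wave f xi : cintegrable (lebRn n) f -> cintegrable (lebRn n) (fun x => f x * expi (- dot x xi)).
Proof.
move=> fi; apply: (cintegrable_lec (c := 1) _ fi).
  apply: cmeasurableM; first by case: fi.
  apply: cmeasurable_expi; apply: measurableT_comp => //.
  exact: (measurable_dot (u := fun x => x) (v := fun=> xi)).
by move=> x; rewrite mul1r cabsM cabs_expi mulr1.
Qed.

Lemma dotDl (x y xi : Rn R n) : dot (x + y) xi = dot x xi + dot y xi.
Proof. by rewrite /dot -big_split/=; apply: eq_bigr => i _; rewrite mxE mulrDl. Qed.

Lemma dot_delta (h : R) i (xi : Rn R n) : dot (h *: e_ i) xi = h * xi ord0 i.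
Proof.
rewrite /dot (bigD1 i)//= !mxE !eqxx mulr1 big1 ?addr0// => j ji.
by rewrite !mxE eqxx (negbTE ji) mulr0 mul0r.
Qed.

Lemma fourierRn_translate f (v xi : Rn R n) : cintegrable (lebRn n) f ->
  fourierRn (fun x => f (x + v)) xi = expi (dot v xi) * fourierRn f xi.
Proof.
move=> fi; rewrite /fourierRn -(cintegralZ _ (cintegrable_wave xi fi)).
rewrite -(@cintegral_translate _ _ v (fun x => expi (dot v xi) * (f x * expi (- dot x xi)))); last 2 first.
- by apply: (@cintegrable_translate _ _ v (fun x => expi (dot v xi) * (f x * expi (- dot x xi)))); apply: cintegrableZ; exact: cintegrable_wave.
- by apply: (cintegrableZ _ (cintegrable_wave xi fi)).1.
apply: eq_cintegral => x; rewrite mulrCA -expiD dotDl; congr (_ * expi _); ring.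
Qed.

(** Difference quotients replace integration by parts. Their transforms are explicit because a
    translation becomes a phase factor, and they converge to the transform of the derivative by
    domination with a multiple of the peak. *)
Lemma fourierRn_partial f i xi : schwartz f -> fourierRn (cpartial i f) xi = 'i * (xi ord0 i)%:C * fourierRn f xi.
Proof.
move=> sf; have fi := cintegrable_schwartz sf; have sp := schwartz_partial i sf.
have [C C0 hC] := schwartz_le_peak sp.
pose q (j : nat) (x : Rn R n) : R[i] := j.+1%:R%:C * (f (x + j.+1%:R^-1 *: e_ i) - f x).
have qi j : cintegrable (lebRn n) (q j) by apply: cintegrableZ; apply: cintegrableB => //; exact: cintegrable_translate.
have small (s : R) : 0 <= s <= 1 -> forall k, `|(s *: e_ i) ord0 k| <= 1.
  move=> /andP[s0 s1] k; rewrite !mxE normrM (ger0_norm s0) mulr_ile1//.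
  by case: (_ && _); rewrite ?normr1 ?normr0.
have qle j x : cabs (q j x) <= C * 3 ^+ n * peak x.
  have j0 : 0 < j.+1%:R :> R by [].
  have := @rdiff_mvt_ab _ (fun t => f (x + t *: e_ i)) (fun s => cpartial i f (x + s *: e_ i)) 0 j.+1%:R^-1 (C * 3 ^+ n * peak x).
  rewrite scale0r addr0 subr0 invr_ge0 => H.
  rewrite /q cabsM cabsC gtr0_norm// -ler_pdivlMl// [leRHS]mulrC; apply: H => // s; first by move=> _; exact: rdiff_direction.
  move=> /andP[s0 s1]; apply: le_trans (hC _) _; rewrite -mulrA ler_wpM2l//.
  by apply: peak_translate; apply: small; rewrite s0 (le_trans s1)// invf_le1// ler1n.
have L : (fun j => cabs (fourierRn (q j) xi - fourierRn (cpartial i f) xi)) @ \oo --> 0.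
  apply: (@cvg_cintegral _ _ _ (lebRn n) _ _ (fun x => C * 3 ^+ n * peak x)).
  - by move=> j; case: (cintegrable_wave xi (qi j)).
  - by case: (cintegrable_wave xi (cintegrable_schwartz sp)).
  - move=> x; under eq_fun do rewrite -mulrBl cabsM cabs_expi mulr1.
    have := rdiff_quotient (rdiff_direction x i 0 sf); rewrite scale0r addr0; exact.
  - by under eq_fun do rewrite EFinM; apply: integrableZl => //; exact: integrable_peak.
  - by move=> j x; rewrite cabsM cabs_expi mulr1.
apply: (cabs_cvg_unique L).
have qE j : fourierRn (q j) xi = j.+1%:R%:C * (cexp (j.+1%:R^-1%:C * ('i * (xi ord0 i)%:C)) - 1) * fourierRn f xi.
  have E1 := fourierRn_translate (j.+1%:R^-1 *: e_ i) xi fi.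
  have E2 : expi (dot (j.+1%:R^-1 *: e_ i) xi) = cexp (j.+1%:R^-1%:C * ('i * (xi ord0 i)%:C)).
    rewrite dot_delta (_ : _ * ('i * _) = 0 +i* (j.+1%:R^-1 * xi ord0 i)); first by rewrite /cexp [complex.Re _]/= expR0 mul1r.
    by apply: complex_ext; rewrite ?ReM ?ImM /=; ring.
  rewrite -mulrA mulrBl mul1r -E2 -E1.
  have ft := cintegrable_translate (j.+1%:R^-1 *: e_ i) fi.
  rewrite /fourierRn -(cintegralB (cintegrable_wave xi ft) (cintegrable_wave xi fi)).
  rewrite -cintegralZ; first by apply: eq_cintegral => x; rewrite /q; ring.
  by apply: cintegrableB; exact: cintegrable_wave.
have := rdiff_quotient (rdiff_cexp_line ('i * (xi ord0 i)%:C) 0); rewrite mul0r cexp0 mulr1 => L2.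
under eq_fun do rewrite qE -mulrBl cabsM.
by rewrite -(mul0r (cabs (fourierRn f xi))); apply: cvgM; [exact: L2|exact: cvg_cst].
Qed.

(** Along the ray of [th] a single coordinate with [th_i != 0] is enough: each derivative in
    direction [i] gains a factor [|s th_i|]. *)
Lemma fourierRn_decay f (th : Rn R n) m : th != 0 -> schwartz f ->
  exists2 C : R, 0 <= C & forall s : R, cabs (fourierRn f (s *: th)) * `|s| ^+ m <= C.
Proof.
move=> th0; have [i thi] : exists i, th ord0 i != 0.
  apply/existsP; apply: contraNT th0 => /existsPn h; apply/eqP/rowP => i; rewrite mxE.
  by apply/eqP; have := h i; rewrite negbK.
elim: m f => [|m IH] f sf.
  have fi := cintegrable_schwartz sf.
  exists (\int[lebRn n]_x cabs (f x)); first by apply: Rintegral_ge0 => x _; exact: cabs_ge0.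
  move=> s; rewrite mulr1; apply: cabs_cintegral_le.
  - by case: (cintegrable_wave (s *: th) fi).
  - exact: cintegrable_abs.
  - by move=> x; rewrite cabsM cabs_expi mulr1.
have [C C0 h] := IH _ (schwartz_partial i sf).
exists (C / `|th ord0 i|); first by rewrite divr_ge0.
move=> s; have := h s; rewrite fourierRn_partial// mxE !cabsM cabsC normrM.
have -> : cabs ('i : R[i]) = 1 by rewrite cabsE /= expr0n/= add0r expr1n sqrtr1.
rewrite ler_pdivlMr ?normr_gt0// exprS; apply: le_trans.
by rewrite le_eqVlt; apply/orP; left; apply/eqP; ring.
Qed.

Lemma integrable_fourier_weight f (th : Rn R n) (c : R) : th != 0 -> schwartz f -> c < 1 ->
  (@lebesgue_measure R).-integrable setT (fun s => (cabs (fourierRn f (s *: th)) * `|s| `^ (- c))%:E).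
Proof.
(* An integer at least [2 - c], so that beyond [|s| = 1] the decay of order [m] leaves
   [|s| ^ (- 2)]. Near [0] the power is integrable since [c < 1]. *)
move=> th0 sf c1; pose m := Num.trunc (`|2 - c| + 1).
have mc : 2 - c <= m%:R.
  apply: le_trans (ler_norm _) _; rewrite -(lerD2r 1); apply: ltW; rewrite natr1; exact: truncnS_gt.
have [C1 C10 h1] := fourierRn_decay 0 th0 sf; have [C2 C20 h2] := fourierRn_decay m th0 sf.
have fi := cintegrable_schwartz sf.
have mF : measurable_fun setT (fun s : measurableTypeR R => cabs (fourierRn f (s *: th)) * `|s| `^ (- c)).
  apply: measurable_funM.
    apply: measurable_cabs; apply: (cmeasurable_cintegral (lebRn n) (f := fun z : measurableTypeR R * Rn R n => f z.2 * expi (- dot z.2 (z.1 *: th)))).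
    apply: cmeasurableM.
      by apply: cmeasurable_comp (measurable_snd) fi.1.
    apply: cmeasurable_expi; apply: measurableT_comp => //; apply: measurable_dot; first exact: measurable_snd.
    by apply: measurable_scale_Rn; [exact: measurable_fst|exact: measurable_cst].
  by apply: measurable_powR_comp; exact: normr_measurable.
have F0 s : 0 <= cabs (fourierRn f (s *: th)) * `|s| `^ (- c) by rewrite mulr_ge0 ?cabs_ge0 ?powR_ge0.
apply/integrableP; split; first exact/measurable_EFinP.
under eq_integralT do rewrite gee0_abs ?lee_fin//.
have m1 : measurable_fun [set: R] (fun s : R => (`|s| <= 1)%R%:R * `|s| `^ (- c)).
  apply: measurable_funM; first by apply: measurable_bool_natr; exact: measurable_abs_le.
  by apply: measurable_powR_comp; exact: normr_measurable.
have p1 (s : R) : 0 <= (`|s| <= 1)%R%:R * `|s| `^ (- c) by rewrite mulr_ge0 ?powR_ge0.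
have m2 : measurable_fun [set: R] (poisson (1 : R)) by apply: continuous_measurable_fun; exact: continuous_poisson.
apply: (@le_lt_trans _ _ (\int[@lebesgue_measure R]_s (C1%:E * ((`|s| <= 1)%R%:R * `|s| `^ (- c))%:E + C2%:E * (poisson 1 s)%:E))%E).
  apply: ge0_le_integralT.
  - exact/measurable_EFinP.
  - by apply: emeasurable_funD; apply: measurable_funeM; exact/measurable_EFinP.
  - by move=> s; rewrite lee_fin.
  move=> s; rewrite -!EFinM -EFinD lee_fin.
  have [s1|s1] := leP `|s| 1.
    rewrite mul1r; apply: ler_wpDr; first by rewrite mulr_ge0 ?poisson_ge0.
    by apply: ler_wpM2r; [exact: powR_ge0|have := h1 s; rewrite mulr1].
  rewrite mul0r mulr0 add0r; have s0 : 0 < `|s| by apply: lt_trans s1.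
  apply: (@le_trans _ _ (C2 * `|s| `^ (- 2))).
    apply: (@le_trans _ _ (cabs (fourierRn f (s *: th)) * `|s| ^+ m * `|s| `^ (- 2))); last first.
      by apply: ler_wpM2r; [exact: powR_ge0|exact: h2].
    rewrite -mulrA; apply: ler_wpM2l; first exact: cabs_ge0.
    rewrite -powR_mulrn// -powRD ?(gt_eqF s0) ?implybT//.
    by rewrite ler_powR ?(ltW s1)//; move: mc; lra.
  apply: ler_wpM2l => //; rewrite powRN powR_mulrn// real_normK ?num_real// /poisson mulr1 expr1n.
  have s2 : 1 < s ^+ 2 by rewrite -real_normK ?num_real// expr_gt1.
  by rewrite ler_pdivlMr ?ltr_wpDr ?sqr_ge0// ler_pdivrMl ?(lt_trans ltr01)//; lra.
rewrite ge0_integralD//; last 4 first.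
- by move=> s _; rewrite -EFinM lee_fin mulr_ge0.
- by apply: measurable_funeM; exact/measurable_EFinP.
- by move=> s _; rewrite -EFinM lee_fin mulr_ge0 ?poisson_ge0.
- by apply: measurable_funeM; exact/measurable_EFinP.
rewrite !ge0_integralZlT//.
- apply: lte_add_pinfty; last by rewrite integral_poisson// -EFinM ltry.
  apply: (@le_lt_trans _ _ (C1%:E * (2 * (1 `^ (1 - c) / (1 - c)))%:E)%E); last by rewrite -EFinM ltry.
  apply: lee_wpmul2l; first by rewrite lee_fin.
  have c0 : 0 < 1 - c by rewrite subr_gt0.
  by have := integral_abs_powR_head c0 (@ltr01 R); rewrite addrAC subrr add0r.
- exact/measurable_EFinP.
- by move=> s; rewrite lee_fin poisson_ge0.
- exact/measurable_EFinP.
Qed.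

End fourier_derivative.

(** * The multiplier formula *)

Section analytic_families.
Context d (T : measurableType d) (R : realType).
Variable mu : {measure set T -> \bar R}.

(** With [Im L] bounded, [exp (rho |L|)] costs only a constant times [exp (rho |Re L|)]. According
    to the sign of [Re L] this shifts the exponent [Re al] down or up by [rho], so the sum of the
    two hypotheses is a majorant. *)
Lemma cdiff_exp_family (g L : T -> R[i]) (B rho : R) (al : R[i]) : cmeasurable g -> cmeasurable L -> 0 < rho ->
  (forall x, `|complex.Im (L x)| <= B) ->
  mu.-integrable setT (fun x => (cabs (g x) * expR (- ((complex.Re al - rho) * complex.Re (L x))))%:E) ->
  mu.-integrable setT (fun x => (cabs (g x) * expR (- ((complex.Re al + rho) * complex.Re (L x))))%:E) ->
  exists d, cdiff (fun z => cintegral mu setT (fun x => g x * cexp (- (z * L x)))) al d.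
Proof.
move=> mg mL rho0 LB i1 i2; eexists; apply: (@cdiff_param_integral _ _ _ mu g L al rho) => //.
have mG c : cmeasurable (fun x => g x * cexp (- (c * L x))).
  by apply: cmeasurableM => //; apply: cmeasurable_cexp; apply: cmeasurableN; apply: cmeasurableM => //; exact: cmeasurable_cst.
pose K := expR (`|complex.Im al| * B + rho * B).
pose h x := K * (cabs (g x) * expR (- ((complex.Re al - rho) * complex.Re (L x))) +
  cabs (g x) * expR (- ((complex.Re al + rho) * complex.Re (L x)))).
have ih : mu.-integrable setT (fun x => (h x)%:E).
  under eq_fun do rewrite EFinM EFinD; apply: integrableZl => //; exact: integrableD.
apply: (le_integrable measurableT _ _ ih).
  apply/measurable_EFinP; apply: measurable_funM.
    have := measurable_cabs (mG al); rewrite (_ : (fun x => cabs _) = (fun x => cabs (g x) * expR (- complex.Re (al * L x))))//.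
    by apply/funext => x; rewrite cabsM cabs_cexp ReN.
  apply: (measurableT_comp (@measurable_expR R)); apply: measurable_funM => //; exact: measurable_cabs.
move=> x _; rewrite /= lee_fin.
have p0 (c : R) : 0 <= cabs (g x) * expR c by rewrite mulr_ge0 ?cabs_ge0 ?expR_ge0.
have h0 : 0 <= h x by rewrite /h mulr_ge0 ?expR_ge0// addr_ge0.
rewrite (ger0_norm h0) ger0_norm; last by rewrite mulr_ge0// expR_ge0.
rewrite /h -mulrDr mulrCA -mulrA; apply: ler_wpM2l; first exact: cabs_ge0.
rewrite -expRD /K mulrDr -!expRD.
set r := complex.Re (L x); set i := complex.Im (L x).
have B0 : 0 <= B by apply: le_trans (LB x); exact: normr_ge0.
have LL : cabs (L x) <= `|r| + B by apply: le_trans (cabs_ReIm _) _; rewrite lerD2l.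
have h1 : complex.Im al * i <= `|complex.Im al| * B.
  by apply: le_trans (ler_norm _) _; rewrite normrM; apply: ler_wpM2l => //; exact: LB.
have h2 : rho * cabs (L x) <= rho * (`|r| + B) by rewrite ler_wpM2l// ltW.
have E : - complex.Re (al * L x) = - (complex.Re al * r) + complex.Im al * i by rewrite ReM opprB addrC.
rewrite E; have [r0|r0] := leP 0 r.
- apply: ler_wpDr; first exact: expR_ge0.
  by rewrite ler_expR; move: h2; rewrite (ger0_norm r0) mulrBl; lra.
- apply: ler_wpDl; first exact: expR_ge0.
  by rewrite ler_expR; move: h2; rewrite (ltr0_norm r0) mulrDl; lra.
Qed.

(** Here [L = - ln u] is real, and the shifts by half of [Re al] stay in the range of positive
    exponents covered by the hypothesis. *)
Lemma cdiff_pospow_family (u : T -> R) (h : T -> R[i]) : measurable_fun setT u -> cmeasurable h ->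
  (forall c, 0 < c -> mu.-integrable setT (fun x => ((0 < u x)%R%:R * u x `^ (c - 1) * cabs (h x))%:E)) ->
  forall al, 0 < complex.Re al -> exists d, cdiff (fun z => cintegral mu setT (fun x => pospow (u x) (z - 1) * h x)) al d.
Proof.
move=> mu_ mh ih al a0.
pose g x := pospow (u x) (- 1) * h x; pose L x : R[i] := (- ln (u x))%:C.
have r0 : 0 < complex.Re al / 2 by rewrite divr_gt0.
have E z x : pospow (u x) (z - 1) * h x = g x * cexp (- (z * L x)).
  rewrite /g /L; case: (ltP 0 (u x)) => ux; last by rewrite /pospow (le_gtF ux) !mul0r.
  rewrite !pospowE// [RHS]mulrAC -cexpD; congr (cexp _ * _).
  by rewrite rmorphN/=; ring.
have W (c : R) x : cabs (g x) * expR (- (c * complex.Re (L x))) = (0 < u x)%R%:R * u x `^ (c - 1) * cabs (h x).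
  rewrite /g cabsM cabs_pospow ReN /= mulrAC; congr (_ * _).
  case: (ltP 0 (u x)) => ux; last by rewrite !mul0r.
  by rewrite !mul1r /powR gt_eqF// -expRD; congr expR; ring.
have mg : cmeasurable g by apply: cmeasurableM => //; exact: cmeasurable_pospow.
have mL : cmeasurable L.
  by apply: cmeasurableC; apply: measurableT_comp => //; exact: (measurableT_comp (@measurable_ln R)).
have L0 x : `|complex.Im (L x)| <= 0 by rewrite /= normr0.
have iW c : 0 < c -> mu.-integrable setT (fun x => (cabs (g x) * expR (- (c * complex.Re (L x))))%:E).
  by move=> c0; under eq_fun do rewrite W; exact: ih.
have c1 : 0 < complex.Re al - complex.Re al / 2 by lra.
have c2 : 0 < complex.Re al + complex.Re al / 2 by lra.
have [dd D] := cdiff_exp_family mg mL r0 L0 (iW _ c1) (iW _ c2).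
have -> : (fun z => cintegral mu setT (fun x => pospow (u x) (z - 1) * h x)) =
    (fun z => cintegral mu setT (fun x => g x * cexp (- (z * L x)))).
  by apply/funext => z; apply: eq_cintegral => x; exact: E.
by exists dd.
Qed.

End analytic_families.

Section gamma_analytic.
Context {R : realType}.

Lemma cdiff_Gamma (al : R[i]) : 0 < complex.Re al -> exists d, cdiff (@Gamma R) al d.
Proof.
move=> a0; have := @cdiff_pospow_family _ (measurableTypeR R) R (@lebesgue_measure R) id (fun s => cexp (- (1 * s%:C))).
rewrite (_ : (fun z => cintegral _ _ _) = @Gamma R); last by apply/funext => z; rewrite Gamma_laplace.
apply => //.
- by apply: cmeasurable_cexp; apply: cmeasurableN; under eq_fun do rewrite mul1r; exact: cmeasurableC.
- move=> c c0; rewrite (_ : (fun x => _) = (fun s => (gamma_weight c 1 s)%:E)); first exact: integrable_gamma_weight.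
  apply/funext => s; rewrite cabs_cexp /gamma_weight; congr (_ * expR _)%:E.
  by rewrite !mul1r ReN.
Qed.

End gamma_analytic.

(** * Equality of the damped kernel and multiplier formulas *)

Section ridge_identity.
Context {R : realType} (n : nat).
Local Notation leb := (@lebesgue_measure R).
Variables (f : Rn R n -> R[i]) (th : Rn R n) (t : R).
Hypotheses (sf : schwartz f) (th0 : th != 0).
Implicit Types (al : R[i]) (e : R).

Let fi : cintegrable (lebRn n) f. Proof. exact: cintegrable_schwartz. Qed.

Let mdot : measurable_fun setT (fun x : Rn R n => t - dot x th).
Proof. by apply: measurable_funB => //; exact: (measurable_dot (u := fun x => x) (v := fun=> th)). Qed.

(** Where [0 < t - dot x th <= 1] the possible singularity on the hyperplane is controlled by
    [ridge_le]. Where it exceeds [1] the power grows at most like [(1 + |x|) ^ m], with [D] the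
    constant of linear growth, and Schwartz decay absorbs it. *)
Lemma integrable_ridge_weight (c : R) : 0 < c ->
  (lebRn n).-integrable setT (fun x => ((0 < t - dot x th)%R%:R * (t - dot x th) `^ (c - 1) * cabs (f x))%:E).
Proof.
move=> c0; pose m := Num.trunc (`|c - 1| + 1).
have mc : c - 1 <= m%:R.
  apply: le_trans (ler_norm _) _; rewrite -(lerD2r 1); apply: ltW; rewrite natr1; exact: truncnS_gt.
have [C C0 hC] := schwartz_peak m sf; have [C' C'0 hC'] := schwartz_le_peak sf.
have [A A0 hA] := ridge_le th0.
pose D := `|t| + \sum_i `|th ord0 i|.
have D0 : 0 <= D by rewrite addr_ge0// sumr_ge0.
have sD x : t - dot x th <= D * (1 + enorm x).
  have e0 := enorm_ge0 x.
  apply: le_trans (ler_norm _) _; apply: le_trans (ler_normB _ _) _; rewrite mulrDr mulr1.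
  have : `|dot x th| <= (\sum_i `|th ord0 i|) * enorm x.
    rewrite /dot mulr_suml; apply: le_trans (ler_norm_sum _ _ _) _; apply: ler_sum => i _.
    by rewrite normrM mulrC ler_wpM2l// normr_coord_enorm.
  have : 0 <= \sum_i `|th ord0 i| by rewrite sumr_ge0.
  have : 0 <= `|t| * enorm x by rewrite mulr_ge0.
  by rewrite /D mulrDl; lra.
pose g (s : R) := (`|s| <= 1)%R%:R * `|s| `^ (c - 1).
have mg : measurable_fun [set: R] g.
  apply: measurable_funM; first by apply: measurable_bool_natr; exact: measurable_abs_le.
  by apply: measurable_powR_comp; exact: normr_measurable.
have g0 s : 0 <= g s by rewrite mulr_ge0 ?powR_ge0.
have mW : measurable_fun setT (fun x => (0 < t - dot x th)%R%:R * (t - dot x th) `^ (c - 1) * cabs (f x)).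
  apply: measurable_funM; last by apply: measurable_cabs; case: fi.
  apply: measurable_funM; last exact: measurable_powR_comp.
  by apply: measurable_bool_natr; apply: (measurableT_comp (f := fun s : R => 0 < s)) => //; exact: measurable_pos.
have W0 x : 0 <= (0 < t - dot x th)%R%:R * (t - dot x th) `^ (c - 1) * cabs (f x).
  by rewrite !mulr_ge0 ?powR_ge0 ?cabs_ge0.
apply/integrableP; split; first exact/measurable_EFinP.
under eq_integralT do rewrite gee0_abs ?lee_fin//.
apply: (@le_lt_trans _ _ (\int[lebRn n]_x (C'%:E * (peak x * g (t - dot x th))%:E + (D ^+ m * C)%:E * (peak x)%:E))%E).
  have mpk := @measurable_peak R n.
  have mpg : measurable_fun setT (fun x : Rn R n => peak x * g (t - dot x th)).
    by apply: measurable_funM => //; exact: (measurableT_comp mg mdot).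
  apply: ge0_le_integralT.
  - exact/measurable_EFinP.
  - by apply: emeasurable_funD; apply: measurable_funeM; exact/measurable_EFinP.
  - by move=> x; rewrite lee_fin.
  move=> x; rewrite -!EFinM -EFinD lee_fin; set s := t - dot x th.
  have P0 := peak_ge0 x.
  have t1 : 0 <= C' * (peak x * g s) by rewrite !mulr_ge0.
  have t2 : 0 <= D ^+ m * C * peak x by rewrite !mulr_ge0// exprn_ge0.
  have [s0|s0] := ltP 0 s; last by rewrite !mul0r addr_ge0.
  rewrite mul1r; have [s1|s1] := leP s 1.
    apply: ler_wpDr => //; rewrite /g ger0_norm ?(ltW s0)// s1 mul1r mulrC mulrA.
    by apply: ler_wpM2r; [exact: powR_ge0|exact: hC'].
  apply: ler_wpDl => //; have e1 : 0 <= 1 + enorm x by rewrite addr_ge0// enorm_ge0.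
  apply: (@le_trans _ _ ((D * (1 + enorm x)) ^+ m * cabs (f x))).
    apply: ler_wpM2r; first exact: cabs_ge0.
    apply: (@le_trans _ _ (s ^+ m)); last by rewrite lerXn2r ?nnegrE ?mulr_ge0// ?(ltW s0)//; exact: sD.
    by rewrite -powR_mulrn ?(ltW s0)// ler_powR// ltW.
  rewrite exprMn -mulrA -mulrA; apply: ler_wpM2l; first exact: exprn_ge0.
  by rewrite mulrC; exact: hC.
have mpk := @measurable_peak R n.
have mpg : measurable_fun setT (fun x : Rn R n => peak x * g (t - dot x th)).
  by apply: measurable_funM => //; exact: (measurableT_comp mg mdot).
rewrite ge0_integralD//; last 4 first.
- by move=> x _; rewrite -EFinM lee_fin !mulr_ge0// peak_ge0.
- by apply: measurable_funeM; exact/measurable_EFinP.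
- by move=> x _; rewrite -EFinM lee_fin !mulr_ge0 ?exprn_ge0// peak_ge0.
- by apply: measurable_funeM; exact/measurable_EFinP.
have -> : (\int[lebRn n]_x (C'%:E * (peak x * g (t - dot x th))%:E) =
    C'%:E * \int[lebRn n]_x (peak x * g (t - dot x th))%:E)%E.
  apply: ge0_integralZlT => //; first exact/measurable_EFinP.
  by move=> x; rewrite lee_fin mulr_ge0// peak_ge0.
have -> : (\int[lebRn n]_x ((D ^+ m * C)%:E * (peak x)%:E) = (D ^+ m * C)%:E * \int[lebRn n]_x (peak x)%:E)%E.
  apply: ge0_integralZlT; first exact/measurable_EFinP.
    by move=> x; rewrite lee_fin peak_ge0.
  by rewrite mulr_ge0// exprn_ge0.
apply: lte_add_pinfty; last by rewrite integral_peak -EFinM ltry.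
apply: lte_mul_pinfty => //; apply: le_lt_trans (hA g t mg g0) _.
apply: lte_mul_pinfty => //; exact: le_lt_trans (integral_abs_powR_head c0 ltr01) (ltry _).
Qed.

(** The kernel side, without the Gamma factor; [e = 0] is the integral that defines the operator for
    [Re al > 0]. *)
Definition ridge_V e al : R[i] := cintegral (lebRn n) setT (fun x => damped_pow al e (t - dot x th) * f x).

Let mVint e al : cmeasurable (fun x => damped_pow al e (t - dot x th) * f x).
Proof. by apply: cmeasurableM; [exact: cmeasurable_damped_pow|case: fi]. Qed.

Lemma cabs_damped_pow_le e al s : 0 <= e -> cabs (damped_pow al e s) <= (0 < s)%R%:R * s `^ (complex.Re al - 1).
Proof.
move=> e0; rewrite cabs_damped_pow /gamma_weight; have [s0|s0] := ltP 0 s; last by rewrite !mul0r.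
by rewrite ler_piMr ?mulr_ge0 ?powR_ge0// -expR0 ler_expR oppr_le0 mulr_ge0// ltW.
Qed.

Lemma cdiff_ridge_V e al : 0 <= e -> 0 < complex.Re al -> exists d, cdiff (ridge_V e) al d.
Proof.
move=> e0 a0.
have := @cdiff_pospow_family _ _ _ (lebRn n) (fun x => t - dot x th) (fun x => (expR (- (e * (t - dot x th))))%:C * f x) mdot.
rewrite (_ : (fun z => cintegral _ _ _) = ridge_V e); last first.
  by apply/funext => z; apply: eq_cintegral => x; rewrite mulrA.
have mh : cmeasurable (fun x : Rn R n => (expR (- (e * (t - dot x th))))%:C * f x).
  apply: cmeasurableM; last by case: fi.
  apply: cmeasurableC; apply: (measurableT_comp (@measurable_expR R)); apply: measurableT_comp => //.
  exact: measurable_funM.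
apply => // c c0; apply: (le_integrable measurableT _ _ (integrable_ridge_weight c0)).
  apply/measurable_EFinP; apply: measurable_funM; last exact: measurable_cabs.
  apply: measurable_funM; last exact: measurable_powR_comp.
  by apply: measurable_bool_natr; apply: (measurableT_comp (f := fun s : R => 0 < s)) => //; exact: measurable_pos.
move=> x _; rewrite /= lee_fin !ger0_norm ?mulr_ge0 ?powR_ge0 ?cabs_ge0//.
have [s0|s0] := ltP 0 (t - dot x th); last by rewrite !mul0r.
rewrite cabsM cabsC ger0_norm ?expR_ge0// ler_wpM2l ?mulr_ge0 ?powR_ge0//.
by rewrite ler_piMl ?cabs_ge0// -expR0 ler_expR oppr_le0 mulr_ge0// ltW.
Qed.

Definition ridge_phi (s : R) : R[i] := expi (s * t) * fourierRn f (s *: th).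

Lemma cabs_ridge_phi s : cabs (ridge_phi s) = cabs (fourierRn f (s *: th)).
Proof. by rewrite cabsM cabs_expi mul1r. Qed.

Lemma cmeasurable_ridge_phi : cmeasurable (ridge_phi : measurableTypeR R -> R[i]).
Proof.
apply: cmeasurableM; first by apply: cmeasurable_expi; exact: measurable_funM.
apply: (cmeasurable_cintegral (lebRn n) (f := fun z : measurableTypeR R * Rn R n => f z.2 * expi (- dot z.2 (z.1 *: th)))).
apply: cmeasurableM; first exact: (cmeasurable_comp (@measurable_snd _ _ _ _) fi.1).
apply: cmeasurable_expi; apply: measurableT_comp => //; apply: measurable_dot; first exact: measurable_snd.
by apply: measurable_scale_Rn; [exact: measurable_fst|exact: measurable_cst].
Qed.

Lemma integrable_ridge_phi (c : R) : c < 1 -> leb.-integrable setT (fun s => (cabs (ridge_phi s) * `|s| `^ (- c))%:E).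
Proof. by move=> c1; under eq_fun do rewrite cabs_ridge_phi; exact: integrable_fourier_weight. Qed.

Lemma cintegrable_ridge_phi : cintegrable leb ridge_phi.
Proof.
apply: (@cintegrable_le _ (measurableTypeR R) R leb _ (fun s => cabs (ridge_phi s) * `|s| `^ (- 0))).
- exact: cmeasurable_ridge_phi.
- by apply: integrable_ridge_phi.
- by move=> s; rewrite oppr0 powRr0 mulr1.
Qed.

(** The multiplier side: the exponential is [(e + i s) ^ (- al)]. For [e > 0] it is bounded at
    [s = 0] when [Re al > 0], which makes the integral analytic there. *)
Definition ridge_U e al : R[i] := ((2 * pi)^-1)%:C *
  cintegral leb setT (fun s : measurableTypeR R => ridge_phi s * cexp (- (al * clog e s))).

Lemma cdiffZ (z : R[i]) (F : R[i] -> R[i]) w : (exists d, cdiff F w d) -> exists d, cdiff (fun x => z * F x) w d.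
Proof. by move=> [d D]; eexists; apply: cdiffM; [exact: cdiff_cst|exact: D]. Qed.

Lemma cdiff_ridge_U e al : 0 < e -> 0 < complex.Re al -> exists d, cdiff (ridge_U e) al d.
Proof.
move=> e0 a0; apply: cdiffZ.
have r0 : 0 < complex.Re al / 2 by rewrite divr_gt0.
have mL : cmeasurable (clog e : measurableTypeR R -> R[i]) by apply: (@cmeasurable_clog _ _ (measurableTypeR R) id) => //; exact: measurable_id.
have iW (c : R) : 0 <= c -> leb.-integrable setT (fun s => (cabs (ridge_phi s) * expR (- (c * complex.Re (clog e s))))%:E).
  move=> c0; have ih : leb.-integrable setT (fun s => (expR (- (c * ln e)) * cabs (ridge_phi s))%:E).
    by under eq_fun do rewrite EFinM; apply: integrableZl => //; apply: cintegrable_abs; exact: cintegrable_ridge_phi.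
  apply: (le_integrable measurableT _ _ ih).
    apply/measurable_EFinP; apply: measurable_funM; first by apply: measurable_cabs; exact: cmeasurable_ridge_phi.
    apply: (measurableT_comp (@measurable_expR R)); apply: measurableT_comp => //; apply: measurable_funM => //; exact: mL.1.
  move=> s _; rewrite /= lee_fin !ger0_norm ?mulr_ge0 ?cabs_ge0 ?expR_ge0//.
  rewrite mulrC ler_wpM2r ?cabs_ge0// ler_expR lerN2 ler_wpM2l//.
  have : ln e * 2 <= ln (e ^+ 2 + s ^+ 2).
    rewrite mulr_natr -lnXn// ler_ln ?posrE ?exprn_gt0//; first by rewrite lerDl sqr_ge0.
    by rewrite ltr_wpDr ?sqr_ge0// exprn_gt0.
  by rewrite ler_pdivlMr.
apply: (@cdiff_exp_family _ _ _ leb ridge_phi (clog e) pi (complex.Re al / 2) al cmeasurable_ridge_phi mL r0).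
- move=> s; rewrite /= ler_norml; have := atan_gtNpi2 (s / e); have := atan_ltpi2 (s / e); have := pi_gt0 R => h1 h2 h3.
  by apply/andP; split; lra.
- by apply: iW; lra.
- by apply: iW; lra.
Qed.

Lemma dotZr (s : R) (x y : Rn R n) : dot x (s *: y) = s * dot x y.
Proof. by rewrite /dot mulr_sumr; apply: eq_bigr => i _; rewrite mxE mulrCA. Qed.

(* [2 < Re al] makes the symbol comparable with the Poisson kernel, hence integrable. *)
Lemma ridge_V_U_large e al : 0 < e -> 2 < complex.Re al -> ridge_V e al = Gamma al * ridge_U e al.
Proof.
move=> e0 a2; have ik := cintegrableZ (Gamma al) (cintegrable_cexp_clog a2 e0).
pose G (z : measurableTypeR R * Rn R n) : R[i] := Gamma al * cexp (- al * clog e z.1) * f z.2 * expi (z.1 * (t - dot z.2 th)).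
have m1 : measurable_fun setT (@fst (measurableTypeR R) (Rn R n)) by exact: measurable_fst.
have m2 : measurable_fun setT (@snd (measurableTypeR R) (Rn R n)) by exact: measurable_snd.
have iG : cintegrable (leb \x lebRn n)%E G.
  apply: (cintegrable_lec (c := 1) _ (cintegrable_prod ik fi)).
    apply: cmeasurableM; first exact: (cintegrable_prod ik fi).1.
    by apply: cmeasurable_expi; apply: measurable_funM => //; exact: (measurableT_comp mdot m2).
  by move=> z; rewrite mul1r /G cabsM cabs_expi mulr1.
have := cfubini iG; rewrite /G /= => {iG} E.
have pi2 : (2 * pi)%:C != 0 :> R[i] by apply/eqP => -[]; have := pi_gt0 R; lra.
have piV : ((2 * pi)^-1)%:C * (2 * pi)%:C = 1 :> R[i].
  by rewrite -rmorphM/= mulVf//; have := pi_gt0 R => h; rewrite gt_eqF// mulr_gt0.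
have iw x : cintegrable leb (fun s : measurableTypeR R => Gamma al * cexp (- al * clog e s) * expi (s * (t - dot x th))).
  apply: (cintegrable_lec (c := 1) _ ik).
    by apply: cmeasurableM; [exact: ik.1|apply: cmeasurable_expi; exact: measurable_funM].
  by move=> s; rewrite mul1r cabsM cabs_expi mulr1.
have E1 x : cintegral leb setT (fun s : measurableTypeR R => Gamma al * cexp (- al * clog e s) * f x * expi (s * (t - dot x th))) =
    (2 * pi)%:C * (damped_pow al e (t - dot x th) * f x).
  rewrite mulrA -(damped_pow_inversion _ a2 e0) mulrC -(cintegralZ _ (iw x)).
  by apply: eq_cintegral => s; ring.
have E2 s : cintegral (lebRn n) setT (fun x => Gamma al * cexp (- al * clog e s) * f x * expi (s * (t - dot x th))) =
    Gamma al * (ridge_phi s * cexp (- (al * clog e s))).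
  rewrite /ridge_phi /fourierRn mulNr.
  rewrite [RHS](_ : _ = Gamma al * cexp (- (al * clog e s)) * expi (s * t) * cintegral (lebRn n) setT (fun x => f x * expi (- dot x (s *: th)))); last by ring.
  rewrite -cintegralZ; last exact: cintegrable_wave.
  apply: eq_cintegral => x; rewrite (_ : s * (t - dot x th) = s * t + - dot x (s *: th)); last by rewrite dotZr; ring.
  by rewrite expiD; ring.
have iV : cintegrable (lebRn n) (fun x => damped_pow al e (t - dot x th) * f x).
  have a0 : 0 < complex.Re al by lra.
  apply: (@cintegrable_le _ _ _ (lebRn n) _ _ (mVint e al) (integrable_ridge_weight a0)) => x.
  by rewrite cabsM; apply: ler_wpM2r; [exact: cabs_ge0|apply: cabs_damped_pow_le; exact: ltW].
have iU : cintegrable leb (fun s : measurableTypeR R => ridge_phi s * cexp (- (al * clog e s))).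
  have [M hM] : exists M, forall s, cabs (fourierRn f (s *: th)) <= M.
    by have [C C0 h] := fourierRn_decay 0 th0 sf; exists C => s; have := h s; rewrite mulr1.
  apply: (cintegrable_lec (c := M) _ (cintegrable_cexp_clog a2 e0)).
    apply: cmeasurableM; first exact: cmeasurable_ridge_phi.
    by have := (cintegrable_cexp_clog a2 e0).1; under eq_fun do rewrite mulNr.
  by move=> s; rewrite cabsM cabs_ridge_phi mulNr; apply: ler_wpM2r; [exact: cabs_ge0|exact: hM].
rewrite /ridge_U mulrCA -(cintegralZ _ iU).
have -> : cintegral leb setT (fun s : measurableTypeR R => Gamma al * (ridge_phi s * cexp (- (al * clog e s)))) =
    (2 * pi)%:C * ridge_V e al.
  rewrite /ridge_V -(cintegralZ _ iV).
  transitivity (cintegral leb setT (fun s : measurableTypeR R => cintegral (lebRn n) setT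
      (fun x => Gamma al * cexp (- al * clog e s) * f x * expi (s * (t - dot x th))))).
    by apply: eq_cintegral => s; rewrite E2.
  by rewrite E; apply: eq_cintegral => x; rewrite E1.
by rewrite mulrA piV mul1r.
Qed.

Lemma ridge_V_U e al : 0 < e -> 0 < complex.Re al -> ridge_V e al = Gamma al * ridge_U e al.
Proof.
move=> e0 a0; apply/eqP; rewrite -subr_eq0; apply/eqP.
apply: (@identity_theorem _ (fun z => ridge_V e z - Gamma z * ridge_U e z) 0 2) => // z z0.
- have [d1 D1] := cdiff_ridge_V (ltW e0) z0; have [d2 D2] := cdiff_Gamma z0; have [d3 D3] := cdiff_ridge_U e0 z0.
  by eexists; apply: cdiffB; [exact: D1|exact: (cdiffM D2 D3)].
- by rewrite ridge_V_U_large// subrr.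
Qed.

End ridge_identity.

(** * Boundary values as the damping tends to zero *)

Section limit_kernel.
Context {R : realType}.
Local Notation leb := (@lebesgue_measure R).
Implicit Types (al z : R[i]) (s : R).

Lemma integrable_ler d (T : measurableType d) (mu : {measure set T -> \bar R}) (g h : T -> R) :
  measurable_fun setT g -> mu.-integrable setT (fun x => (h x)%:E) -> (forall x, 0 <= g x <= h x) ->
  mu.-integrable setT (fun x => (g x)%:E).
Proof.
move=> mg ih gh; apply: (le_integrable measurableT _ _ ih); first exact/measurable_EFinP.
move=> x _; have /andP[g0 gle] := gh x.
by rewrite !gee0_abs ?lee_fin// (le_trans g0).
Qed.

Lemma cexp_cvg (u : nat -> R[i]) z : (fun j => cabs (u j - z)) @ \oo --> 0 ->
  (fun j => cabs (cexp (u j) - cexp z)) @ \oo --> 0.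
Proof.
move=> h.
have h2 : (fun j => cabs (cexp z) * (cabs (u j - z) * expR (cabs (u j - z)))) @ \oo --> (0 : R).
  rewrite -(mulr0 (cabs (cexp z))); apply: cvgM; first exact: cvg_cst.
  rewrite -(mul0r (expR (0 : R))); apply: cvgM => //.
  by apply: continuous_cvg => //; exact: continuous_expR.
apply: squeeze_cvgr (cvg_cst 0) h2; near=> j; rewrite cabs_ge0 andTb.
have -> : cexp (u j) - cexp z = cexp z * (cexp (u j - z) - 1).
  by rewrite mulrBr mulr1 -cexpD (addrC z) subrK.
by rewrite cabsM ler_wpM2l ?cabs_ge0// cexp_sub1_le.
Unshelve. all: by end_near. Qed.

(** For [s != 0] this is the logarithm of [i s], the limit of [clog e s] as [e] decreases to [0]. *)
Definition clog0 s : R[i] := ln `|s| +i* (Num.sg s * (pi / 2)).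

(* The value at [s = 0] is set to [0]; it is irrelevant but makes the bound by a power of [`|s|] hold everywhere. *)
Definition radon_symbol al s : R[i] := (s != 0)%R%:R%:C * cexp (- (al * clog0 s)).

Lemma measurable_neq0 : measurable_fun [set: R] (fun s : R => s != 0).
Proof.
have -> : (fun s : R => s != 0) = (fun s => (0 < s) || (s < 0)).
  by apply/funext => s; rewrite neq_lt orbC.
by apply: measurable_or; [exact: measurable_pos|exact: measurable_fun_ltr].
Qed.

Lemma cmeasurable_clog0 : cmeasurable (clog0 : measurableTypeR R -> R[i]).
Proof.
split => /=.
  by apply: (measurableT_comp (@measurable_ln R)); exact: normr_measurable.
apply: measurable_funM => //.
have -> : Num.sg = (fun s : R => (0 < s)%R%:R - (s < 0)%R%:R).
  apply/funext => s; have [s0|s0|->] := ltrgt0P s.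
  - by rewrite gtr0_sg// subr0.
  - by rewrite ltr0_sg// sub0r.
  - by rewrite sgr0 subr0.
by apply: measurable_funB; apply: measurable_bool_natr; [exact: measurable_pos|exact: measurable_fun_ltr].
Qed.

Lemma cmeasurable_radon_symbol al : cmeasurable (radon_symbol al : measurableTypeR R -> R[i]).
Proof.
apply: cmeasurableM; first by apply: cmeasurableC; apply: measurable_bool_natr; exact: measurable_neq0.
by apply: cmeasurable_cexp; apply: cmeasurableN; apply: cmeasurableM; [exact: cmeasurable_cst|exact: cmeasurable_clog0].
Qed.

Lemma cabs_sg_le s : `|Num.sg s * (pi / 2)| <= pi :> R.
Proof.
have p := pi_gt0 R; rewrite normrM (@ger0_norm _ (pi / 2)) ?divr_ge0 ?(ltW p)// normr_sg.
by case: (s != 0); rewrite ?mul1r ?mul0r; lra.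
Qed.

Lemma cabs_radon_symbol al s : cabs (radon_symbol al s) <= expR (`|complex.Im al| * pi) * `|s| `^ (- complex.Re al).
Proof.
rewrite cabsM cabsC; have [s0|s0] := eqVneq s 0.
  by rewrite normr0 mul0r mulr_ge0 ?expR_ge0 ?powR_ge0.
rewrite normr1 mul1r cabs_cexp ReN ReM /= /powR normr_eq0 (negbTE s0) -expRD ler_expR.
have : complex.Im al * (Num.sg s * (pi / 2)) <= `|complex.Im al| * pi.
  by apply: le_trans (ler_norm _) _; rewrite normrM; apply: ler_wpM2l => //; exact: cabs_sg_le.
lra.
Qed.

Lemma clog_cvg s : s != 0 -> (fun j : nat => cabs (clog j.+1%:R^-1 s - clog0 s)) @ \oo --> 0.
Proof.
move=> s0; have s2 : 0 < s ^+ 2 by rewrite lt_neqAle sqr_ge0 eq_sym expf_neq0.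
have L1 : (fun j : nat => ln (j.+1%:R^-1 ^+ 2 + s ^+ 2) / 2) @ \oo --> ln `|s|.
  have -> : ln `|s| = ln (0 ^+ 2 + s ^+ 2) / 2.
    by rewrite expr0n/= add0r -real_normK ?num_real// lnXn ?normr_gt0// mulr2n; field.
  apply: cvgM; last exact: cvg_cst.
  have c : {for 0 ^+ 2 + s ^+ 2, continuous (@ln R)} by apply: continuous_ln; rewrite expr0n/= add0r.
  apply: (continuous_cvg _ c); apply: cvgD; last exact: cvg_cst.
  by rewrite expr2; under eq_fun do rewrite expr2; apply: cvgM; exact: cvg_harmonic.
have L2 : (fun j : nat => atan (s / j.+1%:R^-1)) @ \oo --> Num.sg s * (pi / 2).
  have main (c : R) : 0 < c -> (fun j : nat => atan (c / j.+1%:R^-1)) @ \oo --> pi / 2.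
    move=> c0; have I : (fun j : nat => c / j.+1%:R^-1) @ \oo --> +oo.
      apply/cvgryPge => A; near=> j; rewrite invrK mulrC -ler_pdivrMr//.
      by apply: (@le_trans _ _ j%:R); [near: j; exact: nbhs_infty_ger|rewrite ler_nat].
    exact: (cvg_comp _ _ I (@cvgy_atan R)).
  have [sp|sn|E] := ltrgt0P s; last by rewrite E eqxx in s0.
    by rewrite gtr0_sg// mul1r; exact: main.
  rewrite ltr0_sg// mulN1r; have -> : (fun j : nat => atan (s / j.+1%:R^-1)) = (fun j : nat => - atan (- s / j.+1%:R^-1)).
    by apply/funext => j; rewrite mulNr atanN opprK.
  by apply: cvgN; apply: main; rewrite oppr_gt0.
have h : (fun j : nat => `|ln (j.+1%:R^-1 ^+ 2 + s ^+ 2) / 2 - ln `|s| | + `|atan (s / j.+1%:R^-1) - Num.sg s * (pi / 2)|) @ \oo --> (0 : R).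
  by rewrite -(addr0 0); apply: cvgD; exact: cvg_abs_sub.
apply: squeeze_cvgr (cvg_cst 0) h; near=> j; rewrite cabs_ge0 andTb.
by apply: le_trans (cabs_ReIm _) _; rewrite ReD ReN ImD ImN.
Unshelve. all: by end_near. Qed.

End limit_kernel.

Section ridge_limit.
Context {R : realType} (n : nat).
Local Notation leb := (@lebesgue_measure R).
Variables (f : Rn R n -> R[i]) (th : Rn R n) (t : R).
Hypotheses (sf : schwartz f) (th0 : th != 0).
Implicit Types (al : R[i]).
Local Notation V := (ridge_V f th t).
Local Notation U := (ridge_U f th t).
Local Notation phi := (ridge_phi f th t).

Definition ridge_U0 al : R[i] := ((2 * pi)^-1)%:C *
  cintegral leb setT (fun s : measurableTypeR R => phi s * radon_symbol al s).

Let mphi : cmeasurable (phi : measurableTypeR R -> R[i]). Proof. exact: cmeasurable_ridge_phi. Qed.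

Lemma integrable_phi_symbol al : complex.Re al < 1 ->
  leb.-integrable setT (fun s => (expR (`|complex.Im al| * pi) * (cabs (phi s) * `|s| `^ (- complex.Re al)))%:E).
Proof. by move=> a1; under eq_fun do rewrite EFinM; apply: integrableZl => //; exact: integrable_ridge_phi. Qed.

Lemma cdiff_ridge_U0 al : complex.Re al < 1 -> exists d, cdiff ridge_U0 al d.
Proof.
move=> a1; apply: cdiffZ.
pose g (s : R) : R[i] := phi s * (s != 0)%R%:R%:C.
have -> : (fun z => cintegral leb setT (fun s : measurableTypeR R => phi s * radon_symbol z s)) =
    (fun z => cintegral leb setT (fun s : measurableTypeR R => g s * cexp (- (z * clog0 s)))).
  by apply/funext => z; apply: eq_cintegral => s; rewrite /radon_symbol mulrA.
pose rho := (1 - complex.Re al) / 2.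
have r0 : 0 < rho by rewrite /rho; lra.
have mg : cmeasurable (g : measurableTypeR R -> R[i]).
  by apply: cmeasurableM => //; apply: cmeasurableC; apply: measurable_bool_natr; exact: measurable_neq0.
have iW (c : R) : c < 1 -> leb.-integrable setT (fun s => (cabs (g s) * expR (- (c * complex.Re (clog0 s))))%:E).
  move=> c1; apply: (integrable_ler _ (integrable_ridge_phi t sf th0 c1)).
    apply: measurable_funM; first exact: measurable_cabs.
    apply: (measurableT_comp (@measurable_expR R)); apply: measurableT_comp => //; apply: measurable_funM => //; exact: cmeasurable_clog0.1.
  move=> s; rewrite mulr_ge0 ?cabs_ge0 ?expR_ge0// andTb.
  rewrite /g cabsM cabsC; have [->|s0] := eqVneq s 0.
    by rewrite normr0 mulr0 mul0r mulr_ge0 ?cabs_ge0 ?powR_ge0.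
  by rewrite normr1 mulr1 /powR normr_eq0 (negbTE s0) mulNr.
apply: (@cdiff_exp_family _ _ _ leb g clog0 pi rho al mg cmeasurable_clog0 r0).
- by move=> s; exact: cabs_sg_le.
- by apply: iW; rewrite /rho; lra.
- by apply: iW; rewrite /rho; lra.
Qed.

Lemma ridge_V_limit al : 0 < complex.Re al ->
  (fun j : nat => cabs (V j.+1%:R^-1 al - V 0 al)) @ \oo --> 0.
Proof.
move=> a0.
have mV e : cmeasurable (fun x => damped_pow al e (t - dot x th) * f x).
  apply: cmeasurableM; last exact: cmeasurable_schwartz.
  apply: cmeasurable_damped_pow; apply: measurable_funB => //.
  exact: (measurable_dot (u := fun x => x) (v := fun=> th)).
apply: (@cvg_cintegral _ _ _ (lebRn n) _ _ _ _ (mV 0) _ (integrable_ridge_weight t sf th0 a0)).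
- by move=> j; exact: mV.
- move=> x; set s := t - dot x th.
  have L : (fun j : nat => cabs ((expR (- (j.+1%:R^-1 * s)))%:C - 1)) @ \oo --> (0 : R).
    have : (fun j : nat => expR (- (j.+1%:R^-1 * s))) @ \oo --> (1 : R).
      rewrite -[X in _ --> X](expR0 R); apply: continuous_cvg; first exact: continuous_expR.
      by rewrite -oppr0; apply: cvgN; exact: harmonic_cvg0.
    move/cvg_abs_sub; rewrite (_ : (fun j => `|_|) = (fun j : nat => cabs ((expR (- (j.+1%:R^-1 * s)))%:C - 1)))//.
    by apply/funext => j; rewrite -cabsC rmorphB rmorph1.
  rewrite (_ : (fun j => _) = (fun j : nat => cabs ((expR (- (j.+1%:R^-1 * s)))%:C - 1) * cabs (pospow s (al - 1) * f x))).
    by rewrite -(mul0r (cabs (pospow s (al - 1) * f x))); apply: cvgM => //; exact: cvg_cst.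
  apply/funext => j; rewrite /damped_pow -cabsM mul0r oppr0 expR0 mulr1; congr cabs; ring.
- move=> j x; rewrite cabsM; apply: ler_wpM2r; first exact: cabs_ge0.
  exact: cabs_damped_pow_le.
Qed.

(** The strip is forced from both sides: [Re al > 0] gives the majorant [|s| ^ (- Re al)] uniformly
    in the damping, because [e ^ 2 + s ^ 2 >= s ^ 2], and [Re al < 1] makes it integrable at [0]. *)
Lemma ridge_U_limit al : 0 < complex.Re al < 1 ->
  (fun j : nat => cabs (U j.+1%:R^-1 al - ridge_U0 al)) @ \oo --> 0.
Proof.
move=> /andP[a0 a1].
pose h (j : nat) : measurableTypeR R -> R[i] := fun s : R => phi s * ((s != 0)%R%:R%:C * cexp (- (al * clog j.+1%:R^-1 s))).
have mc j : cmeasurable (fun s : measurableTypeR R => cexp (- (al * clog j.+1%:R^-1 s))).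
  apply: cmeasurable_cexp; apply: cmeasurableN; apply: cmeasurableM; first exact: cmeasurable_cst.
  by apply: cmeasurable_clog => //; exact: measurable_id.
have mn0 : cmeasurable (fun s : measurableTypeR R => ((s != 0)%R%:R : R)%:C).
  by apply: cmeasurableC; apply: measurable_bool_natr; exact: measurable_neq0.
have mh j : cmeasurable (h j) by do 2 apply: cmeasurableM => //.
(* The factor [s != 0] changes the integrand at one point only. There the majorant is [0] by
   convention, so without it domination would fail at that point. *)
have UE j : U j.+1%:R^-1 al = ((2 * pi)^-1)%:C * cintegral leb setT (h j).
  congr (_ * _); apply: ae_eq_cintegral => //; first exact: cmeasurableM.
  exists [set (0 : R)]; split; [exact: measurable_set1|exact: lebesgue_measure_set1|].
  move=> s; have [//|s0] := eqVneq (s : R) 0.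
  have E : phi s * cexp (- (al * clog j.+1%:R^-1 s)) = h j s by rewrite /h s0 mul1r.
  by move=> /(_ E).
have L : (fun j => cabs (cintegral leb setT (h j) - cintegral leb setT (fun s : measurableTypeR R => phi s * radon_symbol al s))) @ \oo --> 0.
  apply: (@cvg_cintegral _ _ _ leb _ _ _ mh _ _ (integrable_phi_symbol a1)).
  - by apply: cmeasurableM => //; exact: cmeasurable_radon_symbol.
  - move=> s; have [s0|s0] := eqVneq s 0.
      by rewrite /h /radon_symbol s0 eqxx; under eq_fun do rewrite !mul0r mulr0 subrr cabs0; exact: cvg_cst.
    rewrite (_ : (fun j => _) = (fun j : nat => cabs (phi s) * cabs (cexp (- (al * clog j.+1%:R^-1 s)) - cexp (- (al * clog0 s))))).
      rewrite -(mulr0 (cabs (phi s))); apply: cvgM; first exact: cvg_cst.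
      apply: cexp_cvg; rewrite (_ : (fun j => _) = (fun j : nat => cabs al * cabs (clog j.+1%:R^-1 s - clog0 s))).
        by rewrite -(mulr0 (cabs al)); apply: cvgM; [exact: cvg_cst|exact: clog_cvg].
      by apply/funext => j; rewrite -cabsM -[LHS]cabsN; congr cabs; ring.
    by apply/funext => j; rewrite /h /radon_symbol s0 !mul1r -mulrBr cabsM.
  - move=> j s; rewrite /h cabsM [leRHS]mulrCA; apply: ler_wpM2l; first exact: cabs_ge0.
    rewrite cabsM cabsC; have [s0|s0] := eqVneq s 0.
      by rewrite normr0 mul0r mulr_ge0 ?expR_ge0 ?powR_ge0.
    have j0 : 0 < j.+1%:R^-1 :> R by [].
    rewrite normr1 mul1r -mulNr; apply: le_trans (cabs_cexp_clog _ _ j0) _.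
    apply: ler_wpM2l; first exact: expR_ge0.
    rewrite /powR normr_eq0 (negbTE s0) mulNr ler_expR lerN2; apply: ler_wpM2l; first exact: ltW.
    have s2 : 0 < s ^+ 2 by rewrite lt_neqAle sqr_ge0 eq_sym expf_neq0.
    have : ln `|s| * 2 <= ln (j.+1%:R^-1 ^+ 2 + s ^+ 2).
      rewrite mulr_natr -lnXn ?normr_gt0// real_normK ?num_real// ler_ln ?posrE//; first by rewrite lerDr sqr_ge0.
      by rewrite ltr_wpDl ?sqr_ge0.
    by rewrite ler_pdivlMr.
under eq_fun do rewrite UE -mulrBr cabsM.
by rewrite -(mulr0 (cabs ((2 * pi)^-1)%:C)); apply: cvgM; [exact: cvg_cst|exact: L].
Qed.

Lemma ridge_V0_U0 al : 0 < complex.Re al < 1 -> V 0 al = Gamma al * ridge_U0 al.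
Proof.
move=> /andP[a0 a1]; apply: (cabs_cvg_unique (ridge_V_limit a0)).
have L : (fun j : nat => cabs (U j.+1%:R^-1 al - ridge_U0 al)) @ \oo --> 0 by apply: ridge_U_limit; rewrite a0.
have E j : V j.+1%:R^-1 al = Gamma al * U j.+1%:R^-1 al by apply: ridge_V_U.
under eq_fun do rewrite E -mulrBr cabsM.
by rewrite -(mulr0 (cabs (Gamma al))); apply: cvgM; [exact: cvg_cst|exact: L].
Qed.

(** The two formulas agree on the strip [0 < Re al < 1]. This overlap is what makes the glued
    function differentiable on the line [Re al = 1] as well. *)
Definition ridge_ext al : R[i] := if complex.Re al < 1 then ridge_U0 al else (Gamma al)^-1 * V 0 al.

Lemma ridge_ext_large al : 0 < complex.Re al -> ridge_ext al = (Gamma al)^-1 * V 0 al.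
Proof.
move=> a0; rewrite /ridge_ext; case: ifP => // a1.
by rewrite ridge_V0_U0 ?a0// mulrA mulVf ?Gamma_neq0// mul1r.
Qed.

Lemma cdiff_ridge_ext al : exists d, cdiff ridge_ext al d.
Proof.
have near_Re (h : R[i]) (r : R) : cabs h < r -> `|complex.Re h| < r by apply: le_lt_trans; exact: normRe_cabs.
have [a1|a1] := ltP (complex.Re al) 1.
  have [d D] := cdiff_ridge_U0 a1; exists d; apply: (@cdiff_near _ (ridge_U0) _ _ _ (1 - complex.Re al)) D; first by rewrite subr_gt0.
  move=> h /near_Re; rewrite ltr_norml => /andP[_ h1]; rewrite /ridge_ext ReD ifT//; lra.
have a0 : 0 < complex.Re al by lra.
have [d1 D1] := cdiff_Gamma a0; have [d2 D2] := cdiff_ridge_V t sf th0 (lexx 0) a0.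
eexists; apply: (@cdiff_near _ (fun z => (Gamma z)^-1 * V 0 z) _ _ _ _ a0); last first.
  by apply: cdiffM; [apply: (cdiffV D1); exact: Gamma_neq0|exact: D2].
by move=> h /near_Re; rewrite ltr_norml => /andP[h1 _]; rewrite ridge_ext_large// ReD; lra.
Qed.

End ridge_limit.

(** * Identification with the analytic continuation *)

Section analytic_continuation.
Context {R : realType} (n : nat).
Variables (f : Rn R n.+1 -> R[i]) (th : @sphere R n.+1) (t : R).
Hypothesis sf : schwartz f.

Lemma sphere_neq0 : sval th != 0 :> Rn R n.+1.
Proof.
apply/eqP => E; have := enorm_sphere th; rewrite E /enorm /dot big1 ?sqrtr0; first by move/eqP; rewrite eq_sym oner_eq0.
by move=> i _; rewrite mxE mul0r.
Qed.

Lemma radon_plus_intE al : radon_plus_int f th t al = (Gamma al)^-1 * ridge_V f (sval th) t 0 al.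
Proof.
by congr (_ * _); apply: eq_cintegral => x; rewrite /damped_pow mul0r oppr0 expR0 mulr1.
Qed.

(** [ridge_ext] shows that an entire extension exists, so the choice operator returns one. It agrees
    with [ridge_ext] where [Re > 0], and the identity theorem, used on a half-plane containing [al],
    extends the equality. *)
Lemma radon_plusE al : radon_plus al f th t = ridge_ext f (sval th) t al.
Proof.
have th0 := sphere_neq0.
have H : entire_extension f th t (ridge_ext f (sval th) t).
  split; first by move=> z; have [d D] := cdiff_ridge_ext t sf th0 z; exact: cdiff_derivable D.
  by move=> z z0; rewrite radon_plus_intE ridge_ext_large.
rewrite /radon_plus; case: xgetP => [G _ [Gent GE]|/(_ _ H)//].
apply/eqP; rewrite -subr_eq0; apply/eqP.
apply: (@identity_theorem _ (fun z => G z - ridge_ext f (sval th) t z) (complex.Re al - 1) 0) => [z _|z z0|].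
- have [d1 D1] := derivable_cdiff (Gent z); have [d2 D2] := cdiff_ridge_ext t sf th0 z.
  by eexists; exact: cdiffB D1 D2.
- by rewrite GE// radon_plus_intE ridge_ext_large// subrr.
- by rewrite ltrBlDr ltrDl.
Qed.

Lemma radon_plus_U0 al : complex.Re al < 1 -> radon_plus al f th t = ridge_U0 f (sval th) t al.
Proof. by move=> a1; rewrite radon_plusE /ridge_ext a1. Qed.

Lemma radon_plus_pos al : 0 < complex.Re al -> radon_plus al f th t = radon_plus_int f th t al.
Proof. by move=> a0; rewrite radon_plusE radon_plus_intE ridge_ext_large//; exact: sphere_neq0. Qed.

End analytic_continuation.

Lemma Lpnorm_infty_le d (T : measurableType d) (R : realType) (mu : {measure set T -> \bar R}) (f : T -> R[i]) (M : R) :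
  0 <= M -> (forall x, cabs (f x) <= M) -> (Lpnorm mu +oo%E f <= M%:E)%E.
Proof.
move=> M0 h; rewrite /Lpnorm unlock; case: ifP => _; last by rewrite lee_fin.
apply/ess_sup_inf.ess_supP; apply: aeW => x /=.
by rewrite lee_fin ger0_norm ?cabs_ge0.
Qed.

Lemma Lpnorm1 d (T : measurableType d) (R : realType) (mu : {measure set T -> \bar R}) (f : T -> R[i]) :
  Lpnorm mu 1%:E f = (\int[mu]_x (cabs (f x))%:E)%E.
Proof.
rewrite /Lpnorm Lnorm1; apply: eq_integralT => x.
by rewrite gee0_abs// lee_fin cabs_ge0.
Qed.

Section endpoint.
Context {R : realType} (n : nat).
Variable al : R[i].
Hypothesis al1 : complex.Re al = 1.
Local Notation mu := (@lebRn R n).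

Let A (f : Rn R n -> R[i]) (z : Zn R n) : R[i] := radon_plus_int f z.1 z.2 al.

Let K (z : Zn R n) (x : Rn R n) : R[i] := pospow (z.2 - dot x (sval z.1)) (al - 1).

Let K1 z x : cabs (K z x) <= 1.
Proof.
rewrite cabs_pospow ReD ReN al1 subrr powRr0 mulr1.
by case: (0 < _); rewrite ?ler01.
Qed.

Let mK : cmeasurable (fun w : Zn R n * Rn R n => K w.1 w.2).
Proof.
apply: cmeasurable_pospow; apply: measurable_funB; first exact: measurableT_comp.
apply: measurable_dot; first exact: measurable_snd.
by apply: measurableT_comp; [exact: measurable_sval|exact: measurableT_comp].
Qed.

Let mKz z : cmeasurable (K z).
Proof. exact: (cmeasurable_comp (h := fun x : Rn R n => (z, x)) (pair1_measurable z) mK). Qed.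

Let iK f z : cintegrable mu f -> cintegrable mu (fun x => K z x * f x).
Proof.
move=> fi; apply: (cintegrable_lec (c := 1) _ fi).
  by apply: cmeasurableM; [exact: mKz|case: fi].
by move=> x; rewrite mul1r cabsM ler_piMl ?cabs_ge0.
Qed.

Let AE f z : A f z = (Gamma al)^-1 * cintegral mu setT (fun x => K z x * f x).
Proof. by []. Qed.

(** For [Re al = 1] the kernel has modulus at most [1], so the defining integral converges for every
    integrable [f] and is bounded by its L^1 norm divided by [|Gamma al|]. *)
Lemma endpoint_bounded : bounded_linear_Lp (lebesgue_Rn n) (Zn_measure n) 1%:E +oo%E A.
Proof.
have L1 (f : Rn R n -> R[i]) : in_Lp (lebesgue_Rn n) 1%:E f -> cintegrable mu f.
  by move=> [mf]; rewrite Lpnorm1 => fi; split.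
have bnd (f : Rn R n -> R[i]) z : cintegrable mu f -> cabs (A f z) <= cabs (Gamma al)^-1 * \int[mu]_x cabs (f x).
  move=> fi; rewrite AE cabsM; apply: ler_wpM2l; first exact: cabs_ge0.
  apply: cabs_cintegral_le; first exact: (iK z fi).1.
  - exact: cintegrable_abs.
  - by move=> x; rewrite cabsM ler_piMl ?cabs_ge0.
have bnd0 (f : Rn R n -> R[i]) : 0 <= cabs (Gamma al)^-1 * \int[mu]_x cabs (f x).
  by apply: mulr_ge0; [exact: cabs_ge0|apply: Rintegral_ge0 => x _; exact: cabs_ge0].
split.
- move=> f /L1 fi; split.
    apply: cmeasurableM; first exact: cmeasurable_cst.
    apply: (cmeasurable_cintegral mu (f := fun w : Zn R n * Rn R n => K w.1 w.2 * f w.2)).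
    by apply: cmeasurableM => //; exact: (cmeasurable_comp (@measurable_snd _ _ _ _) fi.1).
  exact: le_lt_trans (Lpnorm_infty_le _ (bnd0 f) (fun z => bnd f z fi)) (ltry _).
- move=> f g /L1 fi /L1 gi fg; apply: aeW => z; rewrite !AE; congr (_ * _).
  apply: ae_eq_cintegral; [exact: (iK z fi).1|exact: (iK z gi).1|].
  by apply: filterS fg => x ->.
- move=> b f g /L1 fi /L1 gi; apply: aeW => z; rewrite !AE.
  have E : cintegral mu setT (fun x => K z x * (b * f x + g x)) = b * cintegral mu setT (fun x => K z x * f x) + cintegral mu setT (fun x => K z x * g x).
    rewrite -(cintegralZ b (iK z fi)) -(cintegralD (cintegrableZ b (iK z fi)) (iK z gi)).
    by apply: eq_cintegral => x; ring.
  by rewrite E; ring.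
- exists (cabs (Gamma al)^-1); split; first exact: cabs_ge0.
  move=> f /L1 fi; apply: le_trans (Lpnorm_infty_le _ (bnd0 f) (fun z => bnd f z fi)) _.
  rewrite EFinM; apply: lee_wpmul2l; first by rewrite lee_fin cabs_ge0.
  rewrite Lpnorm1 /Rintegral fineK//.
  rewrite ge0_fin_numE; first by case: fi.
  by apply: integral_ge0 => x _; rewrite lee_fin cabs_ge0.
Qed.

End endpoint.

Section frequency_limit.
Context {R : realType} (n : nat).
Local Notation leb := (@lebesgue_measure R).
Variable al : R[i].
Hypothesis al1 : complex.Re al < 1.

Definition radon_multiplier (s : R) : R[i] := ((2 * pi)^-1)%:C * radon_symbol al s.

Let c0 : 0 < (2 * pi)^-1 :> R. Proof. by rewrite invr_gt0 mulr_gt0// pi_gt0. Qed.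

Lemma cmeasurable_radon_multiplier : cmeasurable (radon_multiplier : measurableTypeR R -> R[i]).
Proof. by apply: cmeasurableM; [exact: cmeasurable_cst|exact: cmeasurable_radon_symbol]. Qed.

Lemma cabs_radon_multiplier s : cabs (radon_multiplier s) <= (2 * pi)^-1 * expR (`|complex.Im al| * pi) * `|s| `^ (- complex.Re al).
Proof.
rewrite cabsM cabsC gtr0_norm// -mulrA; apply: ler_wpM2l; first exact: ltW.
exact: cabs_radon_symbol.
Qed.

(** For Schwartz [f] the full frequency integral converges absolutely, so the cutoffs converge at
    every point of [Zn]. This identifies the abstract L^2 limit with the explicit formula. *)
Lemma freq_seq_cvg (f : Rn R n.+1 -> R[i]) (z : Zn R n.+1) : schwartz f ->
  (fun j => cabs (freq_seq radon_multiplier f j z - ridge_U0 f (sval z.1) z.2 al)) @ \oo --> 0.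
Proof.
move=> sf; case: z => th t; have th0 := sphere_neq0 th.
pose h (j : nat) (s : measurableTypeR R) : R[i] := ridge_phi f (sval th) t s * ((`|s| <= j.+1%:R)%R%:R%:C * radon_symbol al s).
have mphi := cmeasurable_ridge_phi (sval th) t sf.
have msym := cmeasurable_radon_symbol al.
have mh j : cmeasurable (h j).
  apply: cmeasurableM; first exact: mphi.
  apply: cmeasurableM; last exact: msym.
  by apply: cmeasurableC; apply: measurable_bool_natr; exact: measurable_abs_le.
have bh j s : cabs (h j s) <= expR (`|complex.Im al| * pi) * (cabs (ridge_phi f (sval th) t s) * `|s| `^ (- complex.Re al)).
  rewrite /h cabsM [leRHS]mulrCA; apply: ler_wpM2l; first exact: cabs_ge0.
  rewrite cabsM cabsC normr_nat; apply: le_trans (mulr_bool_le _ (cabs_ge0 _)) _.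
  exact: cabs_radon_symbol.
have iW := integrable_phi_symbol t sf th0 al1.
have ih j : cintegrable leb (h j) by apply: (@cintegrable_le _ (measurableTypeR R) R leb _ _ (mh j) iW).
have E j : freq_seq radon_multiplier f j (th, t) = ((2 * pi)^-1)%:C * cintegral leb setT (h j).
  rewrite -(cintegralZ _ (ih j)); apply: eq_cintegral => s.
  rewrite /freq_symbol /h /radon_multiplier /ridge_phi /=; ring.
have L : (fun j => cabs (cintegral leb setT (h j) - cintegral leb setT (fun s : measurableTypeR R => ridge_phi f (sval th) t s * radon_symbol al s))) @ \oo --> 0.
  apply: (@cvg_cintegral _ _ _ leb _ _ _ mh _ _ iW bh).
    by apply: cmeasurableM; [exact: mphi|exact: msym].
  move=> s; apply: cvg_near_cst; near=> j.
  have sj : `|s| <= j.+1%:R.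
    by apply: (@le_trans _ _ j%:R); [near: j; exact: nbhs_infty_ger|rewrite ler_nat].
  by rewrite /h sj mul1r subrr cabs0.
have -> : (fun j => cabs (freq_seq radon_multiplier f j (th, t) - ridge_U0 f (sval th) t al)) =
    (fun j => cabs ((2 * pi)^-1)%:C * cabs (cintegral leb setT (h j) -
      cintegral leb setT (fun s : measurableTypeR R => ridge_phi f (sval th) t s * radon_symbol al s))).
  by apply/funext => j; rewrite E -cabsM mulrBr.
by rewrite -(mulr0 (cabs ((2 * pi)^-1)%:C)); apply: cvgM; [exact: cvg_cst|exact: L].
Unshelve. all: by end_near. Qed.

End frequency_limit.

Theorem theorem6p1 (R : realType) (n : nat) (p q : \bar R) (alpha : R[i]) :
  (2 <= n)%N -> (1 <= p)%E -> (1 <= q)%E ->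
  (1 - n%:R) / 2 <= complex.Re alpha <= 1 ->
  p = ((n%:R + 1)%:E / (n%:R + complex.Re alpha)%:E)%E ->
  q = ((n%:R + 1)%:E / (1 - complex.Re alpha)%:E)%E ->
  exists A : (Rn R n -> R[i]) -> (Zn R n -> R[i]),
    bounded_linear_Lp (lebesgue_Rn n) (Zn_measure n) p q A /\
    forall f : Rn R n -> R[i], schwartz f ->
      {ae Zn_measure n, forall z, A f z = radon_plus alpha f z.1 z.2}.
Proof.
case: n => [//|n] _ _ _; set a0 := complex.Re alpha => /andP[a_lo a_hi].
have nS : n.+1%:R = n%:R + 1 :> R by rewrite natr1.
have n0 : 0 <= n%:R :> R by [].
have dp : 0 < n.+1%:R + a0 by move: a_lo; rewrite nS; lra.
rewrite inver (gt_eqF dp) -EFinM => ->.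
move: a_hi; rewrite le_eqVlt => /orP[/eqP a1|a1].
(* The inverse of [0] in the extended reals is [+oo], so here [q] is infinite and [p] reduces to
   [1]. *)
- rewrite a1 subrr inver eqxx gt0_muley ?lte_fin; last by rewrite nS; lra.
  move=> ->; rewrite divff; last by rewrite gt_eqF// nS; lra.
  exists (fun f z => radon_plus_int f z.1 z.2 alpha); split; first exact: endpoint_bounded.
  by move=> f sf; apply: aeW => z; rewrite radon_plus_pos// -/a0 a1.
have dq : 0 < 1 - a0 by rewrite subr_gt0.
rewrite inver (gt_eqF dq) -EFinM => ->.
set P := (n.+1%:R + 1) / (n.+1%:R + a0); set Q := (n.+1%:R + 1) / (1 - a0).
have P1 : 1 < P by rewrite /P ltr_pdivlMr// mul1r ltrD2l.
(* [Q >= 2] is equivalent to the lower bound on [a0]; equality there is the pure Plancherel case. *)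
have Q2 : 2 <= Q by rewrite /Q ler_pdivlMr//; move: a_lo; rewrite nS; lra.
have PQ : (P - 1) * (Q - 1) = 1.
  have dp' : 0 < n%:R + 1 + a0 by rewrite -nS.
  by rewrite /P /Q nS; field; rewrite (gt_eqF dp') (gt_eqF dq).
have AQ : (1 - a0) * (Q - 2) = 2 * a0 + n%:R.
  by rewrite /Q nS; field; rewrite (gt_eqF dq).
have B0 : 0 < (2 * pi)^-1 * expR (`|complex.Im alpha| * pi) :> R.
  by rewrite mulr_gt0 ?expR_gt0// invr_gt0 mulr_gt0// pi_gt0.
have [A [bA hA]] := freq_extension (cmeasurable_radon_multiplier alpha) B0 (@cabs_radon_multiplier R alpha) a1 P1 Q2 PQ AQ.
exists A; split => // f sf.
have fP : in_Lpow P f by split; [exact: cmeasurable_schwartz|apply: schwartz_powR => //; exact: ltW].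
have f2 : in_L12 f.
  split; first exact: cintegrable_schwartz.
  under eq_integralT do rewrite -powR2E ?cabs_ge0//.
  by apply: schwartz_powR => //; rewrite ler1n.
have := hA f (fun z => ridge_U0 f (sval z.1) z.2 alpha) fP f2 (fun z => freq_seq_cvg a1 z sf).
by apply: filterS => z ->; rewrite radon_plus_U0.
Qed.
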